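(* Let $T^*=\max(a,l)$ and let $T>2T^*$. Let $(\phi_1,\phi_2)\in \mathcal H^1_0\times\mathcal H$. Then there exist controls $\mathbf f=(f_1,f_2,f_3)\in L^2(0,T)\times H^1_0(0,T)\times H^1_0(0,T)$ such that the solution $u^{\mathbf f}$ of the initial boundary value problem (Problem 2) satisfies $$u^{\mathbf f}(\cdot,T)=\phi_1,\qquad u^{\mathbf f}_t(\cdot,T)=\phi_2,$$ and $$\|f_1\|_{L^2(0,T)}+\|f_2\|_{H^1(0,T)}+\|f_3\|_{H^1(0,T)}\le C\left(\|\phi_1\|_{\mathcal H^1}+\|\phi_2\|_{\mathcal H}\right),$$ where $C$ is a constant that depends only on $q,a,l,T$.
   Context: Let $a,l>0$. The lasso graph $\Omega$ consists of a ring with one attached edge. The attached edge $e_1$ is identified with $(0,l)$: $x=l$ is the boundary vertex and $x=0$ is the interior vertex where the ring is attached. The ring, of length $2a$, is split at its midpoint (an artificial vertex) into two edges $e_2,e_3$, each identified with $(0,a)$, with $x=0$ the common interior vertex of $e_1,e_2,e_3$ and $x=a$ the midpoint of the ring. Alternatively the whole ring is one edge $e_r=(0,2a)$ starting and ending at the interior vertex: a function $\phi$ on the ring is $\phi_r(x)=\phi_2(x)$ for $0<x<a$ and $\phi_r(x)=\phi_3(2a-x)$ for $a<x<2a$. The restriction of a function $u$ to $e_j$ is $u_j$. At a vertex, $\partial u_j$ denotes the derivative of $u$ along the incident edge $e_j$ in the direction pointing outward from the vertex. The potential $q$ is real valued with $q_j=q|_{e_j}\in L^1(e_j)$, $j=1,2,3$.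 Spaces: $\mathcal H=L^2(\Omega)$; $\mathcal H^1=\{\phi\in\mathcal H:\ \phi_1\in H^1(e_1),\ \phi_r\in H^1(e_r)\}$ with $\|\phi\|_{\mathcal H^1}^2=\|\phi'\|^2_{L^2(e_1)}+\|\phi'\|^2_{L^2(e_r)}+\|\phi\|^2_{\mathcal H}$; $\mathcal H^1_0=\{\phi\in\mathcal H^1:\ \phi_1(0)=\phi_r(0)=\phi_r(2a)\}$. $H^1_0(0,T)$ is the set of $f\in H^1(0,T)$ with $f(0)=f(T)=0$. Problem 2: $u_{tt}-u_{xx}+q(x)u=0$ for $t>0$, $x\in e_1\cup e_2\cup e_3$; $u_2(a,t)=u_3(a,t)$, $\partial u_2(a,t)+\partial u_3(a,t)=0$ for $t>0$; $u(x,0)=u_t(x,0)=0$ for $x\in\Omega$; $\partial u_1(l,t)=0$ for $t>0$; $u_3(0,t)-u_1(0,t)=f_3(t)$, $u_2(0,t)-u_1(0,t)=f_2(t)$, $\sum_{j=1}^3\partial u_j(0,t)=f_1(t)$ for $t>0$. Solutions are understood in the generalized sense: let $D$ be the set of $\varphi\in\mathcal H$ with $\varphi_j,\varphi_j'$ absolutely continuous on each closed edge, $A\varphi:=-\varphi''+q\varphi\in\mathcal H$, $\varphi_1'(l)=0$, $\varphi_2(a)=\varphi_3(a)$, $\partial\varphi_2(a)+\partial\varphi_3(a)=0$, $\varphi_1(0)=\varphi_2(0)=\varphi_3(0)$, $\sum_{j=1}^3\partial\varphi_j(0)=0$. Then $u\in C([0,T];\mathcal H)$ is the solution if for every $\varphi\in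 D$ the function $m_\varphi(t)=\langle u(\cdot,t),\varphi\rangle_{\mathcal H}$ is in $H^2(0,T)$, $m_\varphi(0)=m_\varphi'(0)=0$, and $m_\varphi''(t)+\langle u(\cdot,t),A\varphi\rangle_{\mathcal H}=-f_1(t)\varphi_1(0)+f_2(t)\,\partial\varphi_2(0)+f_3(t)\,\partial\varphi_3(0)$ for a.e. $t$. The equality $u_t(\cdot,T)=\psi$ with $\psi\in\mathcal H$ means $m_\varphi'(T)=\langle\psi,\varphi\rangle_{\mathcal H}$ for all $\varphi\in D$. *)

(* Defs.v *)
(* MathComp-Analysis.  A function on the lasso graph is a family of real
   functions, one per edge; only the values on the (closed) edges matter. *)
From HB Require Import structures.
From mathcomp Require Import all_boot all_order all_algebra.
From mathcomp Require Import all_classical all_reals all_analysis.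
Set Implicit Arguments.
Unset Strict Implicit.
Unset Printing Implicit Defensive.
Import Order.TTheory GRing.Theory Num.Theory.
Import numFieldNormedType.Exports.
Local Open Scope classical_set_scope.
Local Open Scope ring_scope.

Section Interval.
Context {R : realType}.
Local Notation mu := (@lebesgue_measure R).
Implicit Types (p : \bar R) (b T : R) (f g : R -> R).

(* f is only looked at on (0, b): it is extended by 0 before the library's
   L^p notions on the whole line are applied. *)
Definition in_Lp p b f := f \_ `]0, b[ \in Lfun mu p.

Definition L2norm b f : R := fine 'N[mu]_2%:E[EFin \o (f \_ `]0, b[)].

(* f is absolutely continuous on the closed interval [0, b], and g is its
   almost everywhere derivative. *)
Definition AC_deriv b f g :=
  in_Lp 1 b g /\
  forall x, x \in `[0, b] -> f x = f 0 + \int[mu]_(t in `]0, x[) g t.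

(* Membership in H^1(0, b) is asserted of the continuous representative on
   [0, b], so that the boundary values f 0 and f b are the traces. *)
Definition in_H1 b f := exists2 g, AC_deriv b f g & in_Lp 2%:E b g.

Definition in_H1_0 b f := [/\ in_H1 b f, f 0 = 0 & f b = 0].

(* A version of the derivative; two versions are equal almost everywhere. *)
Definition weak_deriv b f : R -> R := get [set g | AC_deriv b f g].

Definition H1norm b f : R :=
  Num.sqrt (L2norm b (weak_deriv b f) ^+ 2 + L2norm b f ^+ 2).

(* m belongs to H^2(0, T), m1 is the absolutely continuous representative of
   its derivative on [0, T], and m2 is its second derivative. *)
Definition H2_derivs T (m m1 m2 : R -> R) :=
  [/\ AC_deriv T m m1, AC_deriv T m1 m2 & in_Lp 2%:E T m2].

End Interval.

Definition edge1 : 'I_3 := @Ordinal 3 0 isT.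
Definition edge2 : 'I_3 := @Ordinal 3 1 isT.
Definition edge3 : 'I_3 := @Ordinal 3 2 isT.

Section Lasso.
Context {R : realType}.
Local Notation mu := (@lebesgue_measure R).

Definition lasso_fun := 'I_3 -> R -> R.

Variables a l : R.
Implicit Types (u v phi psi dphi d2phi q : lasso_fun).

Definition edge_length (j : 'I_3) : R := if j == edge1 then l else a.

Definition in_L2 phi := forall j, in_Lp 2%:E (edge_length j) (phi j).

Definition inner phi psi : R :=
  \sum_(j < 3) \int[mu]_(x in `]0, edge_length j[) (phi j x * psi j x).

Definition Hnorm phi : R :=
  Num.sqrt (\sum_(j < 3) L2norm (edge_length j) (phi j) ^+ 2).

Definition H_eq phi psi := forall j,
  {ae mu, forall x, x \in `]0, edge_length j[ -> phi j x = psi j x}.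

(* The part of phi on the ring, as a function on the single edge [0, 2a]. *)
Definition ring_part phi (x : R) : R :=
  if x < a then phi edge2 x else phi edge3 (2 * a - x).

Definition in_calH1 phi :=
  [/\ in_L2 phi, in_H1 l (phi edge1) & in_H1 (2 * a) (ring_part phi)].

Definition calH1norm phi : R :=
  Num.sqrt (L2norm l (weak_deriv l (phi edge1)) ^+ 2
          + L2norm (2 * a) (weak_deriv (2 * a) (ring_part phi)) ^+ 2
          + Hnorm phi ^+ 2).

Definition in_calH1_0 phi :=
  [/\ in_calH1 phi, phi edge1 0 = ring_part phi 0
    & ring_part phi 0 = ring_part phi (2 * a)].

(* Derivatives along the incident edge j, pointing away from the vertex x = 0
   and from the vertex at the other end respectively; dphi is the derivative
   with respect to the coordinate x of the edge. *)
Definition outward_start dphi j : R := dphi j 0.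
Definition outward_end dphi j : R := - dphi j (edge_length j).

Definition opA q phi d2phi : lasso_fun :=
  fun j x => - d2phi j x + q j x * phi j x.

(* phi belongs to the domain D, with first derivative dphi (its continuous
   version on the closed edges) and second derivative d2phi. *)
Definition in_domain q phi dphi d2phi :=
  [/\ in_L2 phi,
      forall j, AC_deriv (edge_length j) (phi j) (dphi j) /\
                AC_deriv (edge_length j) (dphi j) (d2phi j),
      in_L2 (opA q phi d2phi),
      [/\ dphi edge1 l = 0,
          phi edge2 a = phi edge3 a
        & outward_end dphi edge2 + outward_end dphi edge3 = 0]
    & [/\ phi edge1 0 = phi edge2 0,
          phi edge2 0 = phi edge3 0
        & \sum_(j < 3) outward_start dphi j = 0]].

Definition continuous_in_H (T : R) (u : R -> lasso_fun) :=
  (forall t, t \in `[0, T] -> in_L2 (u t)) /\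
  (forall t, t \in `[0, T] ->
    Hnorm (fun j x => u s j x - u t j x) @[s --> within `[0, T] (nbhs t)]
      --> (0 : R)).

Definition is_solution q (T : R) (f1 f2 f3 : R -> R) (u : R -> lasso_fun) :=
  continuous_in_H T u /\
  forall phi dphi d2phi, in_domain q phi dphi d2phi ->
    exists m1 m2 : R -> R,
      [/\ H2_derivs T (fun t => inner (u t) phi) m1 m2,
          inner (u 0) phi = 0,
          m1 0 = 0
        & {ae mu, forall t, t \in `]0, T[ ->
            m2 t + inner (u t) (opA q phi d2phi) =
            - f1 t * phi edge1 0 + f2 t * outward_start dphi edge2
                                 + f3 t * outward_start dphi edge3}].

(* u_t(., T) = psi, tested against D. *)
Definition final_velocity q (T : R) (u : R -> lasso_fun) psi :=
  forall phi dphi d2phi, in_domain q phi dphi d2phi ->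
    exists m1 m2 : R -> R,
      H2_derivs T (fun t => inner (u t) phi) m1 m2 /\ m1 T = inner psi phi.

End Lasso.

Arguments lasso_fun : clear implicits.

(* Main.v *)
(* On each edge use the coordinate y measured from the far end (y = 0 at x = l,
   resp. at the midpoint of the ring).  All three conditions at the interior
   vertex are controlled, so the edges decouple: any solution of the wave
   equation on e1 with v_y(0, t) = 0, and any solution on the ring that is
   regular at its midpoint, is a solution of Problem 2 for the controls read
   off from its traces at y = L.  Such solutions are obtained sideways, as
   Cauchy problems in y:
     v(y, t) = al(t + y) + be(t - y) + (1/2) int_0^y q(z) int_{|s-t|<y-z} v(z, s) ds dz,
   with al = be on e1, and with al and be exchanged between e2 and e3.  If al
   and be vanish on t <= L then so does v at t = 0.  At time T, prescribing
   v and v_t determines al and be on [T - L, T + L] through a fixed-point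
   equation of Volterra type in |t - T|; since T > 2L this interval is disjoint
   from t <= L, and the data can be joined to 0 in between.

   The end state must be reached by every solution, so uniqueness is needed.
   For a homogeneous trajectory w with zero initial state, let K = (A + c)^-1
   and F(s, t) = <w(t), K w(s)>.  K is symmetric, so F_ss = F_tt (in an
   integrated form), and characteristics give <w(s), w(t)> = 0 for s + t < T.
   Hence w = 0 on [0, T/2], then on [0, 3T/4], and so on up to T. *)
Require Import Defs.
From mathcomp Require Import all_boot all_order all_algebra.
From mathcomp Require Import all_classical all_reals all_analysis.
From mathcomp Require Import measurable_realfun ring lra.
Set Implicit Arguments.
Unset Strict Implicit.
Unset Printing Implicit Defensive.
Import Order.TTheory GRing.Theory Num.Theory.
Import numFieldNormedType.Exports.
Local Open Scope classical_set_scope.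
Local Open Scope ring_scope.

(** * Lebesgue integrals on intervals *)

(** The potential is only integrable, [f1] only in L^2, [f2] and [f3] only in H^1, so classical
    solutions are out of reach. Derivative identities are therefore proved for primitives in time:
    everything is at rest at time 0, so integrating once or twice in time creates no extra terms,
    and the integrated identities are what the weak formulation asks for.

    Solving sideways, estimating in a cone and fixing the data near time T are all Volterra problems
    with an integrable kernel. A weight, namely a truncated exponential of a primitive of the
    kernel, turns each of them into a contraction by 1/2, without any smallness of q or of the
    lengths.

    The bond al = be on e1 is not imposed on the fixed point: e1 is treated as a coupled pair with
    equal potentials and equal targets, and the two densities found are averaged.

    For uniqueness, the weak equation may be tested only with elements of D, while w(s) merely lies
    in H. This is the origin of K: it moves w(s) into D and keeps the pairing symmetric in s and t,
    and by that symmetry the one equation in t also yields the equation in s. *)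

Section Integral.
Context {R : realType}.
Local Notation mu := (@lebesgue_measure R).
Local Notation MR := (measurableTypeR R).
Implicit Types (D A : set R) (f g h : R -> R) (a b c x y M : R).

(* A Variant, because the library's predicate unfolds to a boolean equation
   between integrals that conversion tries to compute. *)
Variant intg D f : Prop := Intg of mu.-integrable D (EFin \o f).

Lemma intgP D f : intg D f <-> mu.-integrable D (EFin \o f).
Proof. by split=> [[]|]. Qed.

Lemma intg_meas D f : intg D f -> measurable_fun D f.
Proof. by case=> /measurable_int /measurable_EFinP. Qed.

Lemma intgD D f g : measurable D -> intg D f -> intg D g ->
  intg D (fun x => f x + g x).
Proof. by move=> mD [hf] [hg]; split; exact: (@integrableD _ _ _ mu _ mD _ _ hf hg). Qed.

Lemma intgB D f g : measurable D -> intg D f -> intg D g ->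
  intg D (fun x => f x - g x).
Proof. by move=> mD [hf] [hg]; split; exact: (@integrableB _ _ _ mu _ mD _ _ hf hg). Qed.

Lemma intgZ D k f : measurable D -> intg D f -> intg D (fun x => k * f x).
Proof. by move=> mD [hf]; split; exact: (@integrableZl _ _ _ mu _ mD k _ hf). Qed.

Lemma intgN D f : measurable D -> intg D f -> intg D (fun x => - f x).
Proof. by move=> mD [hf]; split; exact: (integrableN hf). Qed.

Lemma intg0 D : intg D (fun=> 0).
Proof. by split; exact: (@integrable0 _ _ _ mu). Qed.

Lemma intg_norm D f : measurable D -> intg D f -> intg D (fun x => `|f x|).
Proof. by move=> mD [hf]; split; exact: integrable_norm. Qed.

Lemma eq_intg D f g : measurable D -> (forall x, D x -> f x = g x) ->
  intg D f -> intg D g.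
Proof.
move=> mD fg [hf]; split.
apply: (@eq_integrable _ _ _ mu _ mD) hf => x; rewrite inE => Dx /=.
by rewrite fg.
Qed.

Lemma intg_le D f g : measurable D -> measurable_fun D f ->
  (forall x, D x -> `|f x| <= g x) -> intg D g -> intg D f.
Proof.
move=> mD mf fg [hg]; split; apply: (@le_integrable _ _ _ mu _ mD _ _ _ _ hg).
  exact/measurable_EFinP.
by move=> x Dx /=; rewrite lee_fin (le_trans (fg x Dx))// ler_norm.
Qed.

Lemma intg_mulb D f h M : measurable D -> intg D f -> measurable_fun D h ->
  (forall x, D x -> `|h x| <= M) -> intg D (fun x => f x * h x).
Proof.
move=> mD hf mh hM.
apply: (@intg_le _ _ (fun x => M * `|f x|)) => //.
- by apply: measurable_funM => //; exact: intg_meas.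
- by move=> x Dx; rewrite normrM mulrC ler_wpM2r// hM.
- by apply: intgZ => //; exact: intg_norm.
Qed.

Lemma intgS A D f : measurable A -> measurable D -> A `<=` D -> intg D f ->
  intg A f.
Proof. by move=> mA mD AD [hf]; split; exact: integrableS hf. Qed.

Lemma intg_restrict D f : measurable D -> intg D f <-> intg setT (f \_ D).
Proof.
by move=> mD; rewrite !intgP -restrict_EFin; exact: (@integrable_mkcond _ _ _ mu).
Qed.

Lemma mu_oo_lty a b : (mu `]a, b[%classic < +oo)%E.
Proof. by rewrite lebesgue_measure_itv/=; case: ifP; rewrite ?ltry. Qed.

Lemma intg_cst_oo a b M : intg `]a, b[ (fun=> M).
Proof.
split; apply: (@measurable_bounded_integrable _ _ _ mu) => //; first exact: mu_oo_lty.
by exists `|M|; split => // N MN x _ /=; exact: ltW.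
Qed.

Lemma intg_bnd a b f M : measurable_fun `]a, b[%classic f ->
  (forall x, a < x < b -> `|f x| <= M) -> intg `]a, b[ f.
Proof.
move=> mf hM; apply: (@intg_le _ _ (fun=> M)) => //; last exact: intg_cst_oo.
Qed.

Lemma Rint_cst a b M : a <= b -> \int[mu]_(x in `]a, b[) M = M * (b - a).
Proof.
move=> ab; rewrite Rintegral_cst//= lebesgue_measure_itv/= lte_fin.
case: ltP => //= ba; have -> : b = a by apply/le_anti; rewrite ab ba.
by rewrite subrr.
Qed.

Lemma Rint_zero D : \int[mu]_(x in D) 0 = 0.
Proof. by rewrite /Rintegral integral0. Qed.

Lemma Rint_le D f g : measurable D -> intg D f -> intg D g ->
  (forall x, D x -> f x <= g x) ->
  \int[mu]_(x in D) f x <= \int[mu]_(x in D) g x.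
Proof. by move=> mD [hf] [hg] fg; exact: (@le_Rintegral _ _ _ mu). Qed.

Lemma Rint_D D f g : measurable D -> intg D f -> intg D g ->
  \int[mu]_(x in D) (f x + g x) =
  \int[mu]_(x in D) f x + \int[mu]_(x in D) g x.
Proof. by move=> mD [hf] [hg]; exact: (@RintegralD _ _ _ mu). Qed.

Lemma Rint_B D f g : measurable D -> intg D f -> intg D g ->
  \int[mu]_(x in D) (f x - g x) =
  \int[mu]_(x in D) f x - \int[mu]_(x in D) g x.
Proof. by move=> mD [hf] [hg]; exact: (@RintegralB _ _ _ mu). Qed.

Lemma Rint_Zl D k f : measurable D -> intg D f ->
  \int[mu]_(x in D) (k * f x) = k * \int[mu]_(x in D) f x.
Proof. by move=> mD [hf]; exact: (@RintegralZl _ _ _ mu). Qed.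

Lemma Rint_Zr D k f : measurable D -> intg D f ->
  \int[mu]_(x in D) (f x * k) = (\int[mu]_(x in D) f x) * k.
Proof. by move=> mD [hf]; exact: (@RintegralZr _ _ _ mu). Qed.

Lemma Rint_lin D k m f g : measurable D -> intg D f -> intg D g ->
  \int[mu]_(x in D) (k * f x + m * g x) =
  k * \int[mu]_(x in D) f x + m * \int[mu]_(x in D) g x.
Proof.
by move=> mD hf hg; rewrite Rint_D ?Rint_Zl//; exact: intgZ.
Qed.

Lemma Rint_norm D f : measurable D -> intg D f ->
  `|\int[mu]_(x in D) f x| <= \int[mu]_(x in D) `|f x|.
Proof. by move=> mD [hf]; exact: (@le_normr_Rintegral _ _ _ mu). Qed.

Lemma Rint_norm_le D f g : measurable D -> intg D f -> intg D g ->
  (forall x, D x -> `|f x| <= g x) ->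
  `|\int[mu]_(x in D) f x| <= \int[mu]_(x in D) g x.
Proof.
move=> mD hf hg fg; apply: (le_trans (Rint_norm mD hf)).
by apply: Rint_le => //; exact: intg_norm.
Qed.

Lemma Rint_bnd a b f M : a <= b -> intg `]a, b[ f ->
  (forall x, a < x < b -> `|f x| <= M) ->
  `|\int[mu]_(x in `]a, b[) f x| <= M * (b - a).
Proof.
move=> ab hf hM; rewrite -Rint_cst//; apply: Rint_norm_le => //; first exact: intg_cst_oo.
Qed.

Lemma Rint_empty a b f : b <= a -> \int[mu]_(x in `]a, b[) f x = 0.
Proof. by move=> ba; rewrite set_itv_ge ?Rintegral_set0// bnd_simp -leNgt. Qed.

Lemma oo_setU a b c : a < b -> b < c ->
  `]a, c[%classic = `]a, b] `|` `]b, c[ :> set R.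
Proof.
by move=> ab bc; apply: itv_bndbnd_setU; rewrite bnd_simp// ltW.
Qed.

Lemma intgS_oo a b c d f : a <= c -> d <= b -> intg `]a, b[ f -> intg `]c, d[ f.
Proof.
move=> ac db; apply: intgS => // x /=; rewrite !in_itv/= => /andP[h1 h2].
by rewrite (le_lt_trans ac h1) (lt_le_trans h2 db).
Qed.

Lemma Rint_split a b c f : a <= b -> b <= c -> intg `]a, c[ f ->
  \int[mu]_(x in `]a, c[) f x =
  \int[mu]_(x in `]a, b[) f x + \int[mu]_(x in `]b, c[) f x.
Proof.
rewrite [a <= b]le_eqVlt => /predU1P[-> _ _|ab].
  by rewrite [X in _ = X + _]Rint_empty ?add0r.
rewrite le_eqVlt => /predU1P[<- _|bc hf].
  by rewrite [X in _ = _ + X]Rint_empty ?addr0.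
have e := oo_setU ab bc.
rewrite e Rintegral_setU//=; first last.
- apply/disj_setPS => x /= []; rewrite !in_itv/= => /andP[_ h1] /andP[h2 _].
  by move: (lt_le_trans h2 h1); rewrite ltxx.
- by rewrite -e; case: hf.
congr (_ + _); apply/esym/Rintegral_itv_bndo_bndc.
by have [] := intgS_oo (lexx a) (ltW bc) hf.
Qed.

Lemma RintegralE D f : \int[mu]_(x in D) f x = fine (\int[mu]_(x in D) (f x)%:E)%E.
Proof. by []. Qed.

Lemma Rint_mkcond D f : \int[mu]_(x in D) f x = \int[mu]_x (f \_ D) x.
Proof. exact: Rintegral_mkcond. Qed.

Lemma eq_Rint D f g : (forall x, D x -> f x = g x) ->
  \int[mu]_(x in D) f x = \int[mu]_(x in D) g x.
Proof. by move=> h; apply: eq_Rintegral => x; rewrite inE => /h. Qed.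

Lemma Rint_subset A D f : A `<=` D -> (forall x, D x -> ~ A x -> f x = 0) ->
  \int[mu]_(x in D) f x = \int[mu]_(x in A) f x.
Proof.
move=> AD f0; rewrite Rint_mkcond [RHS]Rint_mkcond; apply: eq_Rintegral => x _.
rewrite !patchE; case: ifPn; case: ifPn; rewrite ?inE ?notin_setE// => h1 h2.
- exact: f0.
- by case: h2; exact: AD.
Qed.

Lemma continuous_intg a b f : continuous f -> intg `]a, b[ f.
Proof.
move=> cf; apply: (@intgS _ `[a, b]) => //.
  by move=> x /=; rewrite !in_itv/= => /andP[/ltW -> /ltW ->].
by split; apply: continuous_compact_integrable; [exact: segment_compact|
  exact: continuous_subspaceT].
Qed.

Lemma ae_eq_Rint D f g : measurable D -> measurable_fun D f ->
  measurable_fun D g -> {ae mu, forall x, D x -> f x = g x} ->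
  \int[mu]_(x in D) f x = \int[mu]_(x in D) g x.
Proof.
move=> mD mf mg fg; rewrite /Rintegral; congr fine.
apply: ae_eq_integral => //; [exact/measurable_EFinP|exact/measurable_EFinP|].
by apply: (@filterS _ _ (ae_filter_ringOfSetsType mu)) fg => x fg /fg ->.
Qed.

End Integral.

(** * Invariance of the integral under translations and reflections *)

Section Translation.
Context {R : realType}.
Local Notation mu := (@lebesgue_measure R).
Local Notation MR := (measurableTypeR R).

(** Lebesgue measure is determined by its values on half-open intervals, so only the preimage of
    such an interval has to be measured. *)
Lemma pushforward_shift (c : R) (A : set R) : measurable A ->
  mu A = pushforward mu (fun x : R => x + c) A.
Proof.
have mf : measurable_fun [set: MR] (fun x : MR => (x + c) : MR) by exact: measurable_funD.
pose m := @measure_function_pushforward__canonical__measure_function_Measure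
  _ _ _ _ _ mu _ mf.
apply: (@lebesgue_measure_unique R m) => X [[a b] _ <-] /=.
rewrite /m/= /pushforward/=.
have -> : (fun x : R => x + c) @^-1` `]a, b] = `]a - c, b - c]%classic.
  by apply/seteqP; split => x /=; rewrite !in_itv/= ltrBlDr lerBrDr.
by rewrite !lebesgue_measure_itv/= !lte_fin ltrD2r; case: ifP => // _;
  rewrite -!EFinD; congr (_%:E); ring.
Qed.

Lemma pushforward_refl (c : R) (A : set R) : measurable A ->
  mu A = pushforward mu (fun x : R => c - x) A.
Proof.
have mf : measurable_fun [set: MR] (fun x : MR => (c - x) : MR) by exact: measurable_funB.
pose m := @measure_function_pushforward__canonical__measure_function_Measure
  _ _ _ _ _ mu _ mf.
apply: (@lebesgue_measure_unique R m) => X [[a b] _ <-] /=.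
rewrite /m/= /pushforward/=.
have -> : (fun x : R => c - x) @^-1` `]a, b] = `[c - b, c - a[%classic.
  apply/seteqP; split => x /=; rewrite !in_itv/= => /andP[h1 h2].
    by rewrite lerBlDr ltrBrDl; lra.
  by lra.
rewrite !lebesgue_measure_itv/= !lte_fin ltrD2l ltrN2; case: ifP => // _.
by rewrite -!EFinD; congr (_%:E); ring.
Qed.

(** Stated for an arbitrary measure-preserving map so that translations and reflections share one
    proof. *)
Lemma Rint_preserving (phi : R -> R) (f : R -> R) :
  measurable_fun [set: MR] (phi : MR -> MR) ->
  (forall A : set R, measurable A -> mu A = pushforward mu phi A) ->
  intg setT f ->
  intg setT (f \o phi) /\ \int[mu]_x f (phi x) = \int[mu]_x f x.
Proof.
move=> mphi pres hf.
pose m := @measure_function_pushforward__canonical__measure_function_Measure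
  _ _ _ _ _ mu _ mphi.
have mf := intg_meas hf.
have mEf : measurable_fun [set: MR] (EFin \o f) by exact/measurable_EFinP.
have eqm (g : MR -> \bar R) : (\int[m]_x g x = \int[mu]_x g x)%E.
  by apply: eq_measure_integral => A mA _ /=; first [exact: pres|exact/esym/pres].
have [hf'] := hf.
have hphi : mu.-integrable setT (EFin \o (f \o phi)).
  apply/integrableP; split.
    by apply/measurable_EFinP; exact: measurableT_comp.
  have := hf' => /integrableP[_]; rewrite -eqm.
  by rewrite ge0_integral_pushforward//; exact: measurableT_comp.
split; first exact/intgP.
rewrite /Rintegral; congr fine.
have := eqm (EFin \o f).
by rewrite (@integral_pushforward _ _ MR MR R phi mphi mu).
Qed.

Lemma Rint_shift (f : R -> R) c : intg setT f ->
  intg setT (fun x => f (x + c)) /\ \int[mu]_x f (x + c) = \int[mu]_x f x.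
Proof.
by apply: (@Rint_preserving (fun x => x + c)) => [|A]; [exact: measurable_funD|
  exact: pushforward_shift].
Qed.

Lemma Rint_refl (f : R -> R) c : intg setT f ->
  intg setT (fun x => f (c - x)) /\ \int[mu]_x f (c - x) = \int[mu]_x f x.
Proof.
by apply: (@Rint_preserving (fun x => c - x)) => [|A]; [exact: measurable_funB|
  exact: pushforward_refl].
Qed.

Lemma restrict_shift (f : R -> R) a b c x :
  (f \_ `]a + c, b + c[) (x + c) = ((fun x => f (x + c)) \_ `]a, b[) x.
Proof.
rewrite !patchE; congr (if _ then _ else _).
by apply/idP/idP; rewrite !inE /= !in_itv/= !ltrD2r.
Qed.

Lemma Rint_shift_oo (f : R -> R) a b c : intg `]a + c, b + c[ f ->
  intg `]a, b[ (fun x => f (x + c)) /\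
  \int[mu]_(x in `]a, b[) f (x + c) = \int[mu]_(x in `]a + c, b + c[) f x.
Proof.
move=> /intg_restrict /= /(_ _ )/Rint_shift-/(_ c) [//|h1 h2].
split.
  apply/intg_restrict => //; apply: eq_intg h1 => // x _.
  exact: restrict_shift.
rewrite Rint_mkcond [RHS]Rint_mkcond -h2; apply: eq_Rint => x _.
by rewrite restrict_shift.
Qed.

Lemma restrict_refl (f : R -> R) a b c x :
  (f \_ `]c - b, c - a[) (c - x) = ((fun x => f (c - x)) \_ `]a, b[) x.
Proof.
rewrite !patchE; congr (if _ then _ else _).
by apply/idP/idP; rewrite !inE /= !in_itv/=; lra.
Qed.

Lemma Rint_refl_oo (f : R -> R) a b c : intg `]c - b, c - a[ f ->
  intg `]a, b[ (fun x => f (c - x)) /\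
  \int[mu]_(x in `]a, b[) f (c - x) = \int[mu]_(x in `]c - b, c - a[) f x.
Proof.
move=> /intg_restrict /= /(_ _ )/Rint_refl-/(_ c) [//|h1 h2].
split.
  apply/intg_restrict => //; apply: eq_intg h1 => // x _.
  exact: restrict_refl.
rewrite Rint_mkcond [RHS]Rint_mkcond -h2; apply: eq_Rint => x _.
by rewrite restrict_refl.
Qed.

End Translation.

(** * Fubini's theorem for real-valued integrals, and joint measurability *)

Section Fubini.
Context {R : realType}.
Local Notation mu := (@lebesgue_measure R).
Local Notation MR := (measurableTypeR R).

(** The bound [c] makes the double integral of the absolute value finite, whence integrability on
    the product by Tonelli. Sections are integrable at every point, so that no inner real integral
    takes the default value of [fine]. *)
Lemma FubiniR (f : R -> R -> R) (c : R -> R) :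
  measurable_fun setT (fun p : R * R => f p.1 p.2) ->
  (forall x, intg setT (f x)) -> (forall y, intg setT (f^~ y)) ->
  intg setT c -> (forall x, \int[mu]_y `|f x y| <= c x) ->
  [/\ intg setT (fun x => \int[mu]_y f x y),
      intg setT (fun y => \int[mu]_x f x y) &
      \int[mu]_x \int[mu]_y f x y = \int[mu]_y \int[mu]_x f x y].
Proof.
move=> mf fx fy hc hle.
pose F (p : MR * MR) := (f p.1 p.2)%:E.
have mF : measurable_fun [set: MR * MR] F by exact/measurable_EFinP.
have iF : (mu \x mu)%E.-integrable setT F.
  apply/(integrable12ltyP mu mu mF).
  apply: (@le_lt_trans _ _ (\int[mu]_x `|(c x)%:E|)%E); last first.
    by move: hc => [/integrableP[]].
  apply: ge0_le_integral => //.
  - by move=> x _; exact: integral_ge0.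
  - apply: (@measurable_fun_fubini_tonelli_F _ _ MR MR R mu (fun p => `|F p|%E)) => //.
    exact: measurableT_comp.
  - apply: measurableT_comp => //.
    by move: hc => [/integrableP[]].
  move=> x _ /=; apply: (@le_trans _ _ (c x)%:E); last first.
    by rewrite lee_fin ler_norm.
  have := hle x; rewrite -lee_fin /Rintegral fineK//.
  by case: (intg_norm measurableT (fx x)) => j; exact: integrable_fin_num j.
have EF x : fubini_F mu F x = (\int[mu]_y f x y)%:E.
  by rewrite /Rintegral fineK//; case: (fx x) => j; exact: integrable_fin_num j.
have EG y : fubini_G mu F y = (\int[mu]_x f x y)%:E.
  by rewrite /Rintegral fineK//; case: (fy y) => j; exact: integrable_fin_num j.
have iFF := integrable_fubini_F iF.
have := Fubini iF.
split.
- by split; apply: eq_integrable iFF => // x _; rewrite EF.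
- have mFs : measurable_fun [set: MR * MR] (fun p => F (p.2, p.1)).
    apply: measurableT_comp => //.
    by apply: measurable_fun_pair; [exact: measurable_snd|exact: measurable_fst].
  have iFs : (mu \x mu)%E.-integrable setT (fun p => F (p.2, p.1)).
    by apply/(integrable12ltyP mu mu mFs)/(integrable21ltyP mu mu mF).1.
  split; apply: eq_integrable (integrable_fubini_F iFs) => // x _.
  exact: EG.
- rewrite /Rintegral; congr fine.
  under eq_integral do rewrite -EF.
  under [RHS]eq_integral do rewrite -EG.
  exact: Fubini.
Qed.

Lemma FubiniR_prod (f : R -> R -> R) (g h : R -> R) :
  measurable_fun setT (fun p : R * R => f p.1 p.2) ->
  intg setT g -> intg setT h -> (forall x y, `|f x y| <= g x * h y) ->
  [/\ intg setT (fun x => \int[mu]_y f x y),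
      intg setT (fun y => \int[mu]_x f x y) &
      \int[mu]_x \int[mu]_y f x y = \int[mu]_y \int[mu]_x f x y].
Proof.
move=> mf hg hh hle.
have mfx x : measurable_fun setT (f x).
  by have := measurable_fun_pair2 x mf.
have mfy y : measurable_fun setT (f^~ y).
  by have := measurable_fun_pair1 y mf.
have fx x : intg setT (f x).
  apply: (@intg_le _ _ _ (fun y => g x * h y)) => //.
  exact: intgZ.
apply: (@FubiniR _ (fun x => g x * \int[mu]_y h y)) => //.
- move=> y; apply: (@intg_le _ _ _ (fun x => h y * g x)) => //.
    by move=> x _; rewrite mulrC.
  exact: intgZ.
- apply: (@eq_intg _ _ (fun x => (\int[mu]_y h y) * g x)) => //.
    by move=> x _; rewrite mulrC.
  exact: intgZ.
- move=> x; rewrite -Rint_Zl//.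
  apply: Rint_le => //; first exact: intg_norm.
  exact: intgZ.
Qed.

(** Rounding the first coordinate down to a multiple of 1/(n+1) gives functions whose preimages are
    countable unions of measurable rectangles, one per grid cell. They converge pointwise by
    continuity. *)
Lemma continuous_measurable2 (f : R * R -> R) : continuous f ->
  measurable_fun setT f.
Proof.
move=> cf.
pose fn (n : nat) (p : R * R) :=
  f ((Num.floor (n.+1%:R * p.1))%:~R / n.+1%:R, p.2).
apply: (@measurable_fun_cvg _ _ _ _ fn) => //.
- move=> n _ /= Y mY; rewrite setTI.
  have -> : fn n @^-1` Y = \bigcup_(k : int)
     ([set p : R * R | (Num.floor (n.+1%:R * p.1)) = k] `&`
      [set p : R * R | Y (f (k%:~R / n.+1%:R, p.2))]).
    apply/seteqP; split => p /=; first by move=> h; exists (Num.floor (n.+1%:R * p.1)).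
    by move=> [k _ [<-]].
  apply: countable_bigcupT_measurable; first exact: countableP.
  move=> k; apply: measurableI.
    have -> : [set p : R * R | Num.floor (n.+1%:R * p.1) = k] =
       fst @^-1` `[k%:~R / n.+1%:R, (k + 1)%:~R / n.+1%:R[%classic.
      apply/seteqP; split => p /=; rewrite in_itv/= ler_pdivrMr// ltr_pdivlMr//
        [p.1 * _]mulrC.
        by move=> <-; rewrite floor_le floorD1_gt.
      by move/floor_def.
    by rewrite -[X in measurable X]setTI; apply: measurable_fst.
  have -> : [set p : R * R | Y (f (k%:~R / n.+1%:R, p.2))] =
      snd @^-1` ((fun y => f (k%:~R / n.+1%:R, y)) @^-1` Y) by [].
  rewrite -[X in measurable X]setTI; apply: measurable_snd => //.
  rewrite -[X in measurable X]setTI.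
  have : measurable_fun setT (fun y => f (k%:~R / n.+1%:R, y)).
    apply: continuous_measurable_fun => y.
    have h : (k%:~R / n.+1%:R, z) @[z --> y] --> (k%:~R / n.+1%:R : R, y).
      by apply: (@cvg_pair _ _ _ _ (nbhs _) (nbhs _)); [exact: cvg_cst|exact: cvg_id].
    by apply: (cvg_comp _ _ h); exact: cf.
  by apply.
- move=> [x y] _ /=.
  have : (fun n => ((Num.floor (n.+1%:R * x))%:~R / n.+1%:R, y)) @ \oo --> (x, y).
    apply: (@cvg_pair _ _ _ _ (nbhs _) (nbhs _)); last exact: cvg_cst.
    apply/cvgrPdist_le => e e0; near=> n.
    have n0 : 0 < n.+1%:R :> R by [].
    have h1 : (Num.floor (n.+1%:R * x))%:~R <= n.+1%:R * x by exact: floor_le.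
    have h2 : n.+1%:R * x < (Num.floor (n.+1%:R * x) + 1)%:~R by exact: floorD1_gt.
    have h3 : e^-1 <= n.+1%:R.
      near: n; exists (Num.truncn e^-1) => // m /= hm.
      apply/ltW/(lt_le_trans (truncnS_gt _)).
      by rewrite ler_nat ltnS.
    rewrite intrD in h2.
    have -> : x - (Num.floor (n.+1%:R * x))%:~R / n.+1%:R =
      (n.+1%:R * x - (Num.floor (n.+1%:R * x))%:~R) / n.+1%:R.
      by rewrite mulrBl mulrAC divff ?mul1r// gt_eqF.
    rewrite ger0_norm ?divr_ge0 ?subr_ge0// ler_pdivrMr//.
    have : 1 <= e * n.+1%:R by rewrite -ler_pdivrMl// mulr1.
    by move: h1 h2; lra.
  by move=> h; apply: (cvg_comp _ _ h); exact: cf.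
Unshelve. all: by end_near. Qed.

End Fubini.

Local Opaque Rintegral.

(** * Absolutely continuous functions *)

Section AbsolutelyContinuous.
Context {R : realType}.
Local Notation mu := (@lebesgue_measure R).
Implicit Types (f g h : R -> R) (a b c x y M : R).

Lemma in_Lp1P b f : in_Lp 1 b f <-> intg `]0, b[ f.
Proof.
have mD : measurable `]0, b[%classic by exact: measurable_itv.
split=> [/Lfun1_integrable h|h].
  by apply/intg_restrict => //; split.
by have [/Lfun1_integrable] := (intg_restrict _ mD).1 h.
Qed.

(** The interval is empty for x <= 0, so a primitive is 0 there: this is the extension by rest to
    negative times. *)
Definition prim f x : R := \int[mu]_(t in `]0, x[) f t.

Lemma prim0 f : prim f 0 = 0.
Proof. by rewrite /prim Rint_empty. Qed.

Lemma primB f b x y : intg `]0, b[ f -> 0 <= x -> x <= y -> y <= b ->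
  prim f y - prim f x = \int[mu]_(t in `]x, y[) f t.
Proof.
move=> hf x0 xy yb; rewrite /prim (@Rint_split _ 0 x y)//.
  by rewrite addrAC subrr add0r.
exact: (intgS_oo (lexx _) yb hf).
Qed.

Lemma intgT_oo f a b : intg setT f -> intg `]a, b[ f.
Proof. by move=> hf; apply: intgS hf. Qed.

Lemma eq_prim f g b x : (forall t, 0 < t < b -> f t = g t) -> x <= b ->
  prim f x = prim g x.
Proof.
move=> fg xb; apply: eq_Rint => t /=; rewrite in_itv/= => /andP[t0 tx].
by apply: fg; rewrite t0 (lt_le_trans tx xb).
Qed.

Lemma restr_if f a b x : (f \_ `]a, b[) x = if a < x < b then f x else 0.
Proof. by rewrite patchE; congr (if _ then _ else _); apply/idP/idP; rewrite inE/= in_itv. Qed.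

Lemma intg_if f a b : intg `]a, b[ f <-> intg setT (fun x => if a < x < b then f x else 0).
Proof.
rewrite intg_restrict; last exact: measurable_itv.
by split; apply: eq_intg => // x _; rewrite restr_if.
Qed.

Lemma Rint_if f a b : \int[mu]_(x in `]a, b[) f x =
  \int[mu]_x (if a < x < b then f x else 0).
Proof. by rewrite Rint_mkcond; apply: eq_Rint => x _; rewrite restr_if. Qed.

(* Fubini on the triangle 0 < t < s < x. *)
Lemma prim_parts f g x : 0 <= x -> intg `]0, x[ f -> intg `]0, x[ g ->
  [/\ intg `]0, x[ (fun s => f s * prim g s),
      intg `]0, x[ (fun s => prim f s * g s) &
  prim f x * prim g x =
    \int[mu]_(s in `]0, x[) (f s * prim g s) +
    \int[mu]_(s in `]0, x[) (prim f s * g s)].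
Proof.
move=> x0 hf hg.
pose F := f \_ `]0, x[; pose G := g \_ `]0, x[.
have iF : intg setT F by exact: (intg_restrict _ _).1.
have iG : intg setT G by exact: (intg_restrict _ _).1.
pose h s t := if t < s then F s * G t else 0.
have mh : measurable_fun setT (fun p : R * R => h p.1 p.2).
  apply: measurable_fun_ifT => //.
    by apply: measurable_fun_ltr; [exact: measurable_snd|exact: measurable_fst].
  apply: measurable_funM.
    by apply: measurableT_comp; [exact: intg_meas|exact: measurable_fst].
  by apply: measurableT_comp; [exact: intg_meas|exact: measurable_snd].
have hle s t : `|h s t| <= `|F s| * `|G t|.
  by rewrite /h; case: ifP => _; rewrite ?normrM// normr0 mulr_ge0.
have FF := FubiniR_prod mh (intg_norm measurableT iF)
  (intg_norm measurableT iG) hle.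
have [i1 i2 _] := FF.
have E1 s : \int[mu]_t h s t = ((fun s => f s * prim g s) \_ `]0, x[) s.
  rewrite restr_if; case: ifPn => [/andP[s0 sx]|sx]; last first.
    under eq_Rintegral do rewrite /h /F restr_if (negbTE sx) mul0r if_same.
    exact: Rint_zero.
  rewrite /prim -Rint_Zl//; last exact: (intgS_oo (lexx _) (ltW sx) hg).
  rewrite [RHS]Rint_mkcond; apply: eq_Rint => t _.
  rewrite restr_if /h /F /G !restr_if s0 sx/=.
  case: (ltP t s) => [ts|st]; last by rewrite andbF.
  by rewrite (lt_trans ts sx) !andbT; case: ifP; rewrite ?mulr0.
have E2 t : \int[mu]_s h s t =
    ((fun t => prim f x * g t - prim f t * g t) \_ `]0, x[) t.
  rewrite restr_if; case: ifPn => [/andP[t0 tx]|tx]; last first.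
    under eq_Rintegral do rewrite /h /G restr_if (negbTE tx) mulr0 if_same.
    exact: Rint_zero.
  rewrite -mulrBl (primB hf (ltW t0) (ltW tx))//.
  rewrite -Rint_Zr//; last exact: (intgS_oo (ltW t0) (lexx _) hf).
  rewrite [RHS]Rint_mkcond; apply: eq_Rint => s _.
  rewrite restr_if /h /F /G !restr_if t0 tx/=.
  case: (ltP t s) => [ts|st] //=.
  by rewrite (lt_trans t0 ts)/=; case: ifP; rewrite ?mul0r.
have j1 : intg `]0, x[ (fun s => f s * prim g s).
  by apply/intg_restrict => //; apply: eq_intg i1.
have j2 : intg `]0, x[ (fun t => prim f x * g t - prim f t * g t).
  by apply/intg_restrict => //; apply: eq_intg i2.
have j3 : intg `]0, x[ (fun t => prim f x * g t) by exact: intgZ.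
have j4 : intg `]0, x[ (fun t => prim f t * g t).
  apply: eq_intg (intgB _ j3 j2) => //; first by move=> t _; rewrite opprB addrC subrK.
split=> //.
case: FF => _ _; under eq_Rintegral do rewrite E1.
under [in RHS]eq_Rintegral do rewrite E2.
rewrite -!Rint_mkcond Rint_B// Rint_Zl// => ->.
by rewrite subrK.
Qed.

Lemma prim_bnd f b : intg `]0, b[ f -> forall x, x <= b ->
  `|prim f x| <= prim (fun t => `|f t|) b.
Proof.
move=> hf x xb; have [x0|x0] := leP x 0.
  by rewrite {1}/prim Rint_empty// normr0; exact: Rintegral_ge0.
apply: (le_trans (@Rint_norm_le _ _ _ (fun t => `|f t|) _ _ _ _)) => //.
- exact: (intgS_oo (lexx _) xb hf).
- by apply: intg_norm => //; exact: (intgS_oo (lexx _) xb hf).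
rewrite -subr_ge0 (primB (intg_norm _ hf) (ltW x0) xb)//.
exact: Rintegral_ge0.
Qed.

Lemma AC_derivP b f g : AC_deriv b f g <->
  intg `]0, b[ g /\ forall x, 0 <= x <= b -> f x = f 0 + prim g x.
Proof.
rewrite /AC_deriv -in_Lp1P; split=> -[h1 h2]; split=> // x hx; exact: h2.
Qed.

Lemma AC_bnd b f g : AC_deriv b f g -> exists M, forall x, 0 <= x <= b -> `|f x| <= M.
Proof.
move=> /AC_derivP[hg hf]; exists (`|f 0| + prim (fun t => `|g t|) b) => x hx.
rewrite hf//; apply: (le_trans (ler_normD _ _)); rewrite lerD2l.
by apply: prim_bnd => //; case/andP: hx.
Qed.

(** With both factors written as value at 0 plus primitive, only the product of the two primitives
    is nontrivial, and that is [prim_parts]. *)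
Lemma AC_mul b f f' g g' : 0 <= b -> AC_deriv b f f' -> AC_deriv b g g' ->
  AC_deriv b (fun x => f x * g x) (fun x => f' x * g x + f x * g' x).
Proof.
move=> b0 /AC_derivP[if' ef] /AC_derivP[ig' eg].
have part x : 0 <= x <= b ->
    intg `]0, x[ (fun x => f' x * g x + f x * g' x) /\
    f x * g x = f 0 * g 0 + prim (fun x => f' x * g x + f x * g' x) x.
  move=> /andP[x0 xb].
  have jf := intgS_oo (lexx 0) xb if'.
  have jg := intgS_oo (lexx 0) xb ig'.
  have PP := prim_parts x0 jf jg.
  have [h1 h2 _] := PP.
  have k1 : intg `]0, x[ (fun s => g 0 * f' s) by exact: intgZ.
  have k2 : intg `]0, x[ (fun s => f 0 * g' s) by exact: intgZ.
  have e1 s : 0 < s < x -> g 0 * f' s + f' s * prim g' s = f' s * g s.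
    by move=> /andP[s0 sx]; rewrite (eg s) ?(ltW s0) ?(le_trans (ltW sx))//; ring.
  have e2 s : 0 < s < x -> f 0 * g' s + prim f' s * g' s = f s * g' s.
    by move=> /andP[s0 sx]; rewrite (ef s) ?(ltW s0) ?(le_trans (ltW sx))//; ring.
  have l1 : intg `]0, x[ (fun s => f' s * g s).
    by apply: eq_intg (intgD _ k1 h1) => // s; rewrite /= in_itv/= => /e1.
  have l2 : intg `]0, x[ (fun s => f s * g' s).
    by apply: eq_intg (intgD _ k2 h2) => // s; rewrite /= in_itv/= => /e2.
  split; first exact: intgD.
  rewrite {1}/prim Rint_D//.
  have E1 : \int[mu]_(s in `]0, x[) (f' s * g s) =
      \int[mu]_(s in `]0, x[) (g 0 * f' s + f' s * prim g' s).
    by apply: eq_Rint => s; rewrite /= in_itv/= => /e1.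
  have E2 : \int[mu]_(s in `]0, x[) (f s * g' s) =
      \int[mu]_(s in `]0, x[) (f 0 * g' s + prim f' s * g' s).
    by apply: eq_Rint => s; rewrite /= in_itv/= => /e2.
  rewrite E1 E2.
  rewrite !Rint_D// !Rint_Zl// -/(prim f' x) -/(prim g' x).
  rewrite (ef x) ?x0// (eg x) ?x0//; by case: PP => _ _; lra.
apply/AC_derivP; split; last by move=> x /part[].
by have [|] := part b; rewrite ?b0 ?lexx.
Qed.

Lemma AC_eq b f f' g g' : 0 <= b -> (forall x, 0 <= x <= b -> f x = g x) ->
  (forall x, 0 < x < b -> f' x = g' x) -> AC_deriv b f f' -> AC_deriv b g g'.
Proof.
move=> b0 efg efg' /AC_derivP[i e]; apply/AC_derivP; split.
  by apply: eq_intg i => // x; rewrite /= in_itv/= => /efg'.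
move=> x hx; rewrite -!efg ?lexx ?b0// e//; congr (_ + _).
by apply: (eq_prim efg'); case/andP: hx.
Qed.

Lemma AC_lin b f f' g g' k m : AC_deriv b f f' -> AC_deriv b g g' ->
  AC_deriv b (fun x => k * f x + m * g x) (fun x => k * f' x + m * g' x).
Proof.
move=> /AC_derivP[if' ef] /AC_derivP[ig' eg]; apply/AC_derivP; split.
  by apply: intgD => //; exact: intgZ.
move=> x hx; have /andP[x0 xb] := hx.
have h1 := intgS_oo (lexx 0) xb if'; have h2 := intgS_oo (lexx 0) xb ig'.
rewrite ef// (eg x)// /prim Rint_D// ?Rint_Zl//; last 2 first.
- exact: intgZ.
- exact: intgZ.
by ring.
Qed.

Lemma AC_cst b k : AC_deriv b (fun=> k) (fun=> 0).
Proof. by apply/AC_derivP; split=> [|x _]; [exact: intg0|rewrite /prim Rint_zero addr0]. Qed.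

Lemma AC_id b : AC_deriv b (fun x => x) (fun=> 1).
Proof.
apply/AC_derivP; split=> [|x /andP[x0 _]]; first exact: intg_cst_oo.
by rewrite /prim Rint_cst// mul1r subr0 add0r.
Qed.

Lemma AC_by_parts b f f' g g' : 0 <= b -> AC_deriv b f f' -> AC_deriv b g g' ->
  [/\ intg `]0, b[ (fun x => f' x * g x), intg `]0, b[ (fun x => f x * g' x) &
   \int[mu]_(x in `]0, b[) (f' x * g x) =
   f b * g b - f 0 * g 0 - \int[mu]_(x in `]0, b[) (f x * g' x)].
Proof.
move=> b0 hf hg.
have /AC_derivP[if' ef] := hf; have /AC_derivP[ig' eg] := hg.
(* [prim_parts] against the constant 1 already makes a primitive integrable, hence measurable. *)
have meas h h' : AC_deriv b h h' -> measurable_fun `]0, b[%classic h.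
  move=> /AC_derivP[ih eh].
  have [_ i2 _] := prim_parts b0 ih (intg_cst_oo 0 b 1).
  have := intg_meas (intgD _ (intg_cst_oo 0 b (h 0)) i2).
  move=> /(_ (measurable_itv _)); apply: eq_measurable_fun => x.
  rewrite inE /= in_itv/= => /andP[x0 xb].
  by rewrite mulr1 (eh x)// !ltW.
have bnd := AC_bnd.
have j1 : intg `]0, b[ (fun x => f' x * g x).
  have [M hM] := AC_bnd hg; apply: (@intg_mulb _ _ _ _ M) => //.
    exact: meas hg.
  by move=> x; rewrite /= in_itv/= => /andP[x0 xb]; apply: hM; rewrite !ltW.
have j2 : intg `]0, b[ (fun x => f x * g' x).
  have [M hM] := AC_bnd hf.
  apply: (@eq_intg _ _ (fun x => g' x * f x)) => //.
    by move=> x _; rewrite mulrC.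
  apply: (@intg_mulb _ _ _ _ M) => //; first exact: meas hf.
  by move=> x; rewrite /= in_itv/= => /andP[x0 xb]; apply: hM; rewrite !ltW.
split=> //.
have /AC_derivP[_ /(_ b)] := AC_mul b0 hf hg.
rewrite b0 lexx => /(_ isT) ->.
by rewrite /prim Rint_D//; ring.
Qed.

Lemma AC_meas b f f' : 0 <= b -> AC_deriv b f f' -> measurable_fun `]0, b[%classic f.
Proof.
move=> b0 hf.
have [_ i _] := AC_by_parts b0 hf (AC_id b).
by apply: eq_measurable_fun (intg_meas i) => x _; rewrite mulr1.
Qed.

(** Fubini on the triangle 0 < z < s < y. Read in y: a kernel that equals k0(z) on the diagonal and
    has y-derivative k1(z, y) yields, after integration against q, a function of y with derivative q
    k0 plus the integral of q k1. No continuity of q enters. *)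
Lemma leibniz (q k0 : R -> R) (k1 : R -> R -> R) M y : intg setT q ->
  measurable_fun setT k0 -> (forall z, 0 < z < y -> `|k0 z| <= M) ->
  measurable_fun setT (fun p : R * R => k1 p.1 p.2) ->
  (forall z s, 0 < z -> z < s -> s < y -> `|k1 z s| <= M) -> 0 <= M -> 0 <= y ->
  [/\ intg `]0, y[ (fun z => q z * k0 z),
     intg `]0, y[ (fun s => \int[mu]_(z in `]0, s[) (q z * k1 z s)) &
  \int[mu]_(z in `]0, y[) (q z * (k0 z + \int[mu]_(s in `]z, y[) k1 z s)) =
  \int[mu]_(z in `]0, y[) (q z * k0 z) +
  \int[mu]_(s in `]0, y[) \int[mu]_(z in `]0, s[) (q z * k1 z s)].
Proof.
move=> iq mk0 bk0 mk1 bk1 M0 y0.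
pose D := `]0, y[%classic : set R.
pose h z s := if z < s then (q \_ D) z * (k1 z s * \1_D s) else 0.
have mD : measurable D by exact: measurable_itv.
have iQ : intg setT (q \_ D) by exact: (intg_restrict _ mD).1 (intgT_oo _ _ iq).
have iD : intg setT (fun s => M * \1_D s).
  have j := (intg_restrict _ mD).1 (intg_cst_oo 0 y 1).
  apply: intgZ => //; apply: eq_intg j => // s _.
  by rewrite patchE indicE; case: (_ \in _).
have mh : measurable_fun setT (fun p : R * R => h p.1 p.2).
  apply: measurable_fun_ifT => //.
    by apply: measurable_fun_ltr; [exact: measurable_fst|exact: measurable_snd].
  apply: measurable_funM.
    by apply: measurableT_comp; [exact: intg_meas|exact: measurable_fst].
  apply: measurable_funM => //.
  by apply: measurableT_comp; [exact: measurable_indic|exact: measurable_snd].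
have hle z s : `|h z s| <= `|(q \_ D) z| * (M * \1_D s).
  rewrite /h restr_if indicE /D mem_setE in_itv/=.
  case: (ltP z s) => zs; last by rewrite normr0 !mulr_ge0.
  case: ifP => [/andP[z0 _]|_]; last by rewrite mul0r normr0 mul0r.
  rewrite normrM ler_wpM2l//; case: ltP => [s0|_]; last by rewrite !mulr0 normr0.
  case: ltP => [sy|_]; last by rewrite !mulr0 normr0.
  by rewrite !mulr1; exact: bk1.
have FF := FubiniR_prod mh (intg_norm measurableT iQ) iD hle.
have [i1 i2 _] := FF.
have ik1 z : 0 < z -> intg `]z, y[ (k1 z).
  move=> z0; apply: (@intg_bnd _ _ _ _ M); last first.
    by move=> s /andP[zs sy]; exact: bk1.
  by apply: measurable_funTS; have := measurable_fun_pair2 z mk1.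
have E1 z : \int[mu]_s h z s =
    ((fun z => q z * \int[mu]_(s in `]z, y[) k1 z s) \_ D) z.
  rewrite restr_if; case: ifPn => [/andP[z0 zy]|zy]; last first.
    under eq_Rintegral do rewrite /h restr_if (negbTE zy) mul0r if_same.
    exact: Rint_zero.
  rewrite -(Rint_Zl _ _ (ik1 z z0))// [RHS]Rint_mkcond; apply: eq_Rint => s _.
  rewrite restr_if /h restr_if z0 zy/= indicE /D mem_setE in_itv/=.
  case: (ltP z s) => //= zs; rewrite (lt_trans z0 zs)/=.
  by case: ifP => _; rewrite ?mulr1// !mulr0.
have E2 s : \int[mu]_z h z s =
    ((fun s => \int[mu]_(z in `]0, s[) (q z * k1 z s)) \_ D) s.
  rewrite restr_if; case: ifPn => [/andP[s0 sy]|sy]; last first.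
    under eq_Rintegral do
      rewrite /h indicE /D mem_setE in_itv/= (negbTE sy) !mulr0 if_same.
    exact: Rint_zero.
  rewrite [RHS]Rint_mkcond; apply: eq_Rint => z _.
  rewrite restr_if /h restr_if indicE /D mem_setE in_itv/= s0 sy/= mulr1.
  case: (ltP z s) => [zs|] /=; last by rewrite andbF.
  by rewrite (lt_trans zs sy) !andbT; case: ifP => _ //; rewrite mul0r.
have j1 : intg `]0, y[ (fun z => q z * k0 z).
  apply: (@intg_mulb _ _ _ _ M) => //; first exact: intgT_oo.
  exact: measurable_funTS.
have j2 : intg `]0, y[ (fun z => q z * \int[mu]_(s in `]z, y[) k1 z s).
  by apply/intg_restrict => //; apply: eq_intg i1 => // z _; exact: E1.
split=> //.
  by apply/intg_restrict => //; apply: eq_intg i2 => // z _; exact: E2.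
under eq_Rintegral do rewrite mulrDr.
rewrite Rint_D//; congr (_ + _).
case: FF => _ _ e; rewrite Rint_mkcond [RHS]Rint_mkcond.
under eq_Rintegral do rewrite -E1.
by under [RHS]eq_Rintegral do rewrite -E2.
Qed.

(** The bound on [k] is local so that continuous but unbounded functions, such as iterated time
    primitives, are covered. *)
Lemma fubini_rect (q : R -> R) (k : R -> R -> R) M y t : intg `]0, y[ q ->
  measurable_fun setT (fun p : R * R => k p.1 p.2) ->
  (forall z s, 0 < z < y -> 0 < s < t -> `|k z s| <= M) -> 0 <= M ->
  [/\ forall s, 0 < s < t -> intg `]0, y[ (fun z => q z * k z s),
     intg `]0, t[ (fun s => \int[mu]_(z in `]0, y[) (q z * k z s)),
     intg `]0, y[ (fun z => q z * \int[mu]_(s in `]0, t[) k z s) &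
  \int[mu]_(s in `]0, t[) \int[mu]_(z in `]0, y[) (q z * k z s) =
  \int[mu]_(z in `]0, y[) (q z * \int[mu]_(s in `]0, t[) k z s)].
Proof.
move=> iq mk bk M0.
pose Q z := if 0 < z < y then q z else 0.
pose g s : R := if 0 < s < t then M else 0.
pose h z s := if (0 < s) && (s < t) then Q z * k z s else 0.
have iQ : intg setT Q by apply/intg_if.
have ig : intg setT g by apply/intg_if; exact: intg_cst_oo.
have mh : measurable_fun setT (fun p : R * R => h p.1 p.2).
  apply: measurable_fun_ifT => //.
    apply: measurable_and.
      by apply: measurable_fun_ltr; [exact: measurable_cst|exact: measurable_snd].
    by apply: measurable_fun_ltr; [exact: measurable_snd|exact: measurable_cst].
  apply: measurable_funM => //.
  by apply: measurableT_comp; [exact: intg_meas|exact: measurable_fst].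
have hle z s : `|h z s| <= `|Q z| * g s.
  rewrite /h /g /Q; case: ifP => hs; last by rewrite normr0 mulr0.
  case: ifP => hz; last by rewrite mul0r normr0 mul0r.
  by rewrite normrM ler_wpM2l//; exact: bk.
have FF := FubiniR_prod mh (intg_norm measurableT iQ) ig hle.
have [i1 i2 _] := FF.
have mks z : measurable_fun setT (k z) by have := measurable_fun_pair2 z mk.
have mkz s : measurable_fun setT (k^~ s) by have := measurable_fun_pair1 s mk.
have ik z : 0 < z < y -> intg `]0, t[ (k z).
  move=> hz; apply: (@intg_bnd _ _ _ _ M); last by move=> s; exact: bk.
  exact: measurable_funTS.
have jk s : 0 < s < t -> intg `]0, y[ (fun z => q z * k z s).
  move=> hs; apply: (@intg_mulb _ _ _ _ M) => //; first exact: measurable_funTS.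
  by move=> z; rewrite /= in_itv/= => hz; exact: bk.
have E1 z : \int[mu]_s h z s =
    if 0 < z < y then q z * \int[mu]_(s in `]0, t[) k z s else 0.
  case: ifPn => hz; last first.
    under eq_Rintegral do rewrite /h /Q (negbTE hz) mul0r if_same.
    exact: Rint_zero.
  rewrite -(Rint_Zl _ _ (ik z hz))// Rint_if; apply: eq_Rint => s _.
  by rewrite /h /Q hz.
have E2 s : \int[mu]_z h z s =
    if 0 < s < t then \int[mu]_(z in `]0, y[) (q z * k z s) else 0.
  case: ifPn => hs; last first.
    under eq_Rintegral do rewrite /h (negbTE hs).
    exact: Rint_zero.
  rewrite Rint_if; apply: eq_Rint => z _.
  by rewrite /h hs /Q; case: ifP => _; rewrite ?mul0r.
split=> //.
- by apply/intg_if; apply: eq_intg i2 => // s _; exact: E2.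
- by apply/intg_if; apply: eq_intg i1 => // s _; exact: E1.
rewrite Rint_if [RHS]Rint_if; case: FF => _ _ e.
refine (etrans _ (etrans (esym e) _)); apply: eq_Rint => x _; exact/esym.
Qed.

Lemma prim_nd (k : R -> R) x y : intg setT k -> (forall z, 0 <= k z) -> x <= y ->
  prim k x <= prim k y.
Proof.
move=> ik k0 xy; have [x0|/ltW x0] := leP x 0.
  by rewrite /prim Rint_empty//; exact: Rintegral_ge0.
by rewrite -subr_ge0 (primB (intgT_oo 0 y ik))//; exact: Rintegral_ge0.
Qed.

Lemma prim_ge0 (k : R -> R) x : (forall z, 0 <= k z) -> 0 <= prim k x.
Proof. by move=> k0; exact: Rintegral_ge0. Qed.

Lemma AC_prim (b : R) (k : R -> R) : intg `]0, b[ k -> AC_deriv b (prim k) k.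
Proof.
by move=> ik; apply/AC_derivP; split=> // x _; rewrite prim0 add0r.
Qed.

Lemma AC_exp (b c : R) f f' n : 0 <= b -> AC_deriv b f f' ->
  AC_deriv b (fun x => f x ^+ n.+1) (fun x => n.+1%:R * f x ^+ n * f' x).
Proof.
move=> b0 hf; elim: n => [|n IH].
  by apply: AC_eq hf => // x _; rewrite ?expr1 ?expr0 ?mul1r.
apply: AC_eq (AC_mul b0 hf IH) => // x _;
rewrite -[n.+2]addn1 natrD !exprS; ring.
Qed.

(* w is a truncated exponential of twice the primitive of k. *)
Lemma volterra_weight (b : R) (k : R -> R) : 0 <= b -> intg setT k ->
  (forall z, 0 <= k z) ->
  exists (w : R -> R) (M : R), [/\ forall x, 1 <= w x <= M,
    {homo w : x y / x <= y}, measurable_fun setT w &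
    forall x, 0 <= x <= b -> prim (fun z => k z * w z) x <= w x / 2].
Proof.
move=> b0 ik k0.
pose K := prim k b.
have K0 : 0 <= K by exact: prim_ge0.
(* Integrating k w shifts the series by one index: the constant term 1 disappears and the term of
   order n + 1 appears. The series is cut where that new term is at most 1. *)
have [n hn] : exists n, (2 * K) ^+ n.+1 / n.+1`!%:R <= 1.
  have := is_cvg_series_exp_coeff (2 * K) => /cvg_series_cvg_0.
  move=> /cvgrPdist_le /(_ 1 ltr01)[N _ hN].
  exists N; have := hN N.+1 (leqnSn N).
  by rewrite sub0r normrN /exp_coeff/= ger0_norm// divr_ge0// exprn_ge0// mulr_ge0.
(* Stopping the primitive at b keeps w bounded on the whole line. *)
pose clp x := prim k (Num.min x b).
have clp0 x : 0 <= clp x by exact: prim_ge0.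
have clpn x y : x <= y -> clp x <= clp y.
  by move=> xy; apply: prim_nd => //; rewrite le_min !ge_min xy lexx orbT.
pose w x := \sum_(i < n.+1) (2 * clp x) ^+ i / i`!%:R.
have whomo : {homo w : x y / x <= y}.
  move=> x y xy; apply: ler_sum => i _; rewrite ler_wpM2r ?invr_ge0//.
  by rewrite lerXn2r ?nnegrE ?mulr_ge0// ler_wpM2l// clpn.
exists w, (w b); split=> //.
- move=> x; apply/andP; split.
    rewrite /w big_ord_recl expr0 divr1 lerDl; apply: sumr_ge0 => i _.
    by rewrite divr_ge0// exprn_ge0// mulr_ge0.
  have [xb|/ltW bx] := leP x b; first exact: whomo.
  by rewrite /w /clp (min_r bx) minxx.
- by apply: nondecreasing_measurable => // x y _ _; exact: whomo.
move=> x /andP[x0 xb].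
have clpE z : 0 < z < x -> clp z = prim k z.
  by move=> /andP[_ zx]; rewrite /clp min_l// ltW// (lt_le_trans zx xb).
have iT (i : nat) : intg `]0, x[ (fun z => (2 * clp z) ^+ i / i`!%:R * k z) /\
    \int[mu]_(z in `]0, x[) ((2 * clp z) ^+ i / i`!%:R * k z) =
    (2 * clp x) ^+ i.+1 / i.+1`!%:R / 2.
  pose c : R := 2 ^+ i / i.+1`!%:R.
  have ikx := intgT_oo 0 x ik.
  have /AC_derivP[h1 h2] := @AC_exp x 0 _ _ i x0 (AC_prim ikx).
  have eE z : 0 < z < x -> c * (i.+1%:R * prim k z ^+ i * k z) =
      (2 * clp z) ^+ i / i`!%:R * k z.
    move=> hz; rewrite (clpE _ hz) exprMn /c factS natrM.
    have : i`!%:R != 0 :> R by rewrite pnatr_eq0 -lt0n fact_gt0.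
    have : i.+1%:R != 0 :> R by [].
    move: (i`!%:R) (i.+1%:R) => A B A0 B0; field.
    by rewrite A0 B0.
  split.
    apply: eq_intg (intgZ c _ h1) => // z; rewrite /= in_itv/=; exact: eE.
  have := h2 x; rewrite x0 lexx => /(_ isT).
  rewrite prim0 expr0n/= add0r => e.
  transitivity (c * prim (fun z => i.+1%:R * prim k z ^+ i * k z) x).
    rewrite /prim -Rint_Zl//; apply: eq_Rint => z; rewrite /= in_itv/= => hz.
    exact/esym/eE.
  rewrite -e /c /clp min_l// exprMn.
  have : (i.+1)`!%:R != 0 :> R by rewrite pnatr_eq0 -lt0n fact_gt0.
  by rewrite [2 ^+ i.+1]exprS; move: ((i.+1)`!%:R) => A A0; field.
have -> : prim (fun z => k z * w z) x =
    \sum_(i < n.+1) (2 * clp x) ^+ i.+1 / i.+1`!%:R / 2.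
  under eq_bigr => i _ do rewrite -(iT i).2.
  have : forall m, intg `]0, x[ (fun z => \sum_(i < m) (2 * clp z) ^+ i / i`!%:R * k z) /\
     \int[mu]_(z in `]0, x[) (\sum_(i < m) (2 * clp z) ^+ i / i`!%:R * k z) =
     \sum_(i < m) \int[mu]_(z in `]0, x[) ((2 * clp z) ^+ i / i`!%:R * k z).
    elim=> [|m [IH1 IH2]].
      rewrite big_ord0; under eq_Rintegral do rewrite big_ord0.
      split; last exact: Rint_zero.
      by apply: eq_intg (intg0 _) => // z _; rewrite big_ord0.
    have [j1 _] := iT m; split.
      by apply: eq_intg (intgD _ IH1 j1) => // z _; rewrite big_ord_recr.
    rewrite big_ord_recr/= -IH2 -Rint_D//.
    by apply: eq_Rint => z _; rewrite big_ord_recr.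
  move=> /(_ n.+1)[_ <-]; apply: eq_Rint => z _.
  by rewrite mulrC /w mulr_suml.
rewrite -mulr_suml ler_wpM2r// big_ord_recr/=.
rewrite /w big_ord_recl/= expr0 divr1 addrC; apply: lerD => //.
apply: le_trans hn; rewrite ler_wpM2r ?invr_ge0//.
by rewrite lerXn2r ?nnegrE ?mulr_ge0// ler_wpM2l// /clp /K min_l// prim_nd.
Qed.

End AbsolutelyContinuous.

(** * Volterra equations *)

Section GeometricFixpoint.
Context {R : realType}.

(** Stands in for the passage to the limit in the geometric estimates below; it rests on n < 2^n. *)
Lemma half_pow_le0 (x M : R) : (forall n, x <= M / 2 ^+ n) -> x <= 0.
Proof.
move=> h; rewrite leNgt; apply/negP => x0.
have := h (Num.truncn (M / x)).
have p : 0 < 2 ^+ Num.truncn (M / x) :> R by rewrite exprn_gt0.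
rewrite ler_pdivlMr// => hM.
have := truncnS_gt (M / x); rewrite ltr_pdivrMr// => h2.
have : (Num.truncn (M / x)).+1%:R <= 2 ^+ Num.truncn (M / x) :> R.
  by rewrite -natrX ler_nat ltn_expl.
rewrite -(ler_pM2r x0) => h3; move: hM; rewrite mulrC => h4.
by have := lt_le_trans h2 (le_trans h3 h4); rewrite ltxx.
Qed.

(* The limit is the supremum of the lower ends of nested intervals. *)
Lemma half_cauchy (u : nat -> R) (C : R) : 0 <= C ->
  (forall n, `|u n.+1 - u n| <= C / 2 ^+ n.+1) ->
  exists l, forall n, `|u n - l| <= C / 2 ^+ n.
Proof.
move=> C0 hu.
have hC n : C / 2 ^+ n = C / 2 ^+ n.+1 + C / 2 ^+ n.+1.
  have p : 2 ^+ n != 0 :> R by rewrite expf_neq0.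
  by rewrite exprS; field.
have up n m : u (n + m)%N + C / 2 ^+ (n + m) <= u n + C / 2 ^+ n.
  elim: m => [|m IH]; first by rewrite addn0.
  apply: le_trans IH; rewrite addnS (hC (n + m)%N).
  by have := hu (n + m)%N; rewrite ler_norml => /andP[_]; lra.
have dn n m : u n - C / 2 ^+ n <= u (n + m)%N - C / 2 ^+ (n + m).
  elim: m => [|m IH]; first by rewrite addn0.
  apply: le_trans IH _; rewrite addnS (hC (n + m)%N).
  by have := hu (n + m)%N; rewrite ler_norml => /andP[+ _]; lra.
have nest m n : u m - C / 2 ^+ m <= u n + C / 2 ^+ n.
  have p k : 0 <= C / 2 ^+ k by rewrite divr_ge0// exprn_ge0.
  have := dn m n; have := up n m; rewrite addnC => h1 h2.
  by have := p (m + n)%N; lra.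
pose A := [set x | exists n, x = u n - C / 2 ^+ n].
exists (sup A) => n; rewrite ler_norml.
have h1 : u n - C / 2 ^+ n <= sup A.
  apply: ub_le_sup; last by exists n.
  by exists (u 0%N + C / 2 ^+ 0) => _ [m ->].
have h2 : sup A <= u n + C / 2 ^+ n.
  by apply: ge_sup; [exists (u 0%N - C / 2 ^+ 0), 0%N|move=> _ [m ->]].
by apply/andP; split; lra.
Qed.

Variables (S : Type) (w : S -> R) (Cl : set (S -> R)) (Op : (S -> R) -> S -> R).
Implicit Types (f g : S -> R).
Hypothesis Cl_lin : forall k m f g, Cl f -> Cl g -> Cl (fun p => k * f p + m * g p).
Hypothesis Op_lin : forall k m f g, Cl f -> Cl g ->
  forall p, Op (fun p => k * f p + m * g p) p = k * Op f p + m * Op g p.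
Hypothesis Op_cl : forall f, Cl f -> Cl (Op f).
Hypothesis Op_half : forall f M, Cl f -> (forall p, `|f p| <= M * w p) ->
  forall p, `|Op f p| <= M / 2 * w p.
Hypothesis Cl_lim : forall (u : nat -> S -> R) f M, (forall n, Cl (u n)) ->
  (forall n p, `|u n p - f p| <= M / 2 ^+ n * w p) -> Cl f.

(** Picard iteration in the sup norm weighted by [w]. The class [Cl] carries linearity and
    completeness, so no normed space has to be built. The factor 2 is the sum of the geometric
    series. *)
Lemma fixpoint_exists f0 M : Cl f0 -> (forall p, `|f0 p| <= M * w p) ->
  exists g, [/\ Cl g, forall p, g p = f0 p + Op g p &
                forall p, `|g p| <= 2 * M * w p].
Proof.
move=> cf0 hf0.
pose u n := iter n (fun g p => f0 p + Op g p) f0.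
have Cl_add f g : Cl f -> Cl g -> Cl (fun p => f p + g p).
  move=> cf cg; have := Cl_lin 1 1 cf cg.
  by congr (Cl _); apply/funext => p; rewrite !mul1r.
have Cl_sub f g : Cl f -> Cl g -> Cl (fun p => f p - g p).
  move=> cf cg; have := Cl_lin 1 (-1) cf cg.
  by congr (Cl _); apply/funext => p; rewrite mul1r mulN1r.
have Op_sub f g : Cl f -> Cl g -> forall p, Op (fun p => f p - g p) p = Op f p - Op g p.
  move=> cf cg p; have := Op_lin 1 (-1) cf cg p.
  rewrite mul1r mulN1r => <-; congr (Op _ p).
  by apply/funext => x; rewrite mul1r mulN1r.
have cu n : Cl (u n).
  by elim: n => //= n IH; apply: Cl_add => //; exact: Op_cl.
have du n p : `|u n.+1 p - u n p| <= M / 2 ^+ n.+1 * w p.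
  elim: n p => [|n IH] p.
    by rewrite /u/= addrAC subrr add0r expr1; exact: Op_half.
  have -> : u n.+2 p - u n.+1 p = Op (fun p => u n.+1 p - u n p) p.
    by rewrite Op_sub// /u/=; ring.
  have := Op_half (Cl_sub _ _ (cu n.+1) (cu n)) IH p.
  rewrite [2 ^+ n.+2]exprSr invfM => h; apply: le_trans h _.
  by rewrite mulrA.
have hlim p : exists l, forall n, `|u n p - l| <= M * w p / 2 ^+ n.
  apply: half_cauchy; first exact: le_trans (hf0 p).
  by move=> n; apply: le_trans (du n p) _; rewrite mulrAC.
have [g hg] := choice hlim.
have cg : Cl g.
  apply: (@Cl_lim u g M) => // n p.
  by apply: le_trans (hg p n) _; rewrite mulrAC.
exists g; split=> // p.
- apply/eqP; rewrite -subr_eq0 -normr_le0; apply: (@half_pow_le0 _ (2 * (M * w p))).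
  move=> n.
  have -> : g p - (f0 p + Op g p) =
      (Op (fun p => u n p - g p) p) - (u n.+1 p - g p).
    by rewrite Op_sub// /u/=; ring.
  apply: le_trans (ler_normB _ _) _.
  have h1 : forall p, `|u n p - g p| <= M / 2 ^+ n * w p.
    by move=> x; apply: le_trans (hg x n) _; rewrite mulrAC.
  have h2 := Op_half (Cl_sub _ _ (cu n) cg) h1 p.
  have h3 := hg p n.+1.
  have Mw : 0 <= M * w p by exact: le_trans (hf0 p).
  apply: le_trans (lerD h2 h3) _.
  have p2 : 2 ^+ n != 0 :> R by rewrite expf_neq0.
  rewrite exprS; have -> : M / 2 ^+ n / 2 * w p + M * w p / (2 * 2 ^+ n) =
    M * w p / 2 ^+ n by field.
  by rewrite ler_wpM2r ?invr_ge0 ?exprn_ge0//; lra.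
- have := hg p 0%N; rewrite expr0 divr1 /u/= => h; have := hf0 p.
  by move: h; rewrite !ler_norml => /andP[h1 h2] /andP[h3 h4]; apply/andP; split; lra.
Qed.

Lemma fixpoint_unique g M : Cl g -> (forall p, `|g p| <= M * w p) ->
  (forall p, g p = Op g p) -> forall p, g p = 0.
Proof.
move=> cg hg eg p; apply/eqP; rewrite -normr_le0.
apply: (@half_pow_le0 _ (M * w p)) => n.
have -> : M * w p / 2 ^+ n = M / 2 ^+ n * w p by rewrite mulrAC.
elim: n p => [|n IH] p; first by rewrite expr0 divr1.
have := Op_half cg IH p; rewrite -eg [2 ^+ n.+1]exprSr invfM => h.
by apply: le_trans h _; rewrite mulrA.
Qed.

End GeometricFixpoint.

(** * Gronwall's inequality with the Volterra weight *)

Section Gronwall.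
Context {R : realType}.
Local Notation mu := (@lebesgue_measure R).

(** If n <= C w, inserting this into the integral inequality gives n <= (A + C / 2) w, so the excess
    of C over 2 A is halved at each step. *)
Lemma gronwall (b A M Mw : R) (k w n : R -> R) : 0 <= A ->
  (forall x, 1 <= w x <= Mw) -> measurable_fun setT w -> (forall z, 0 <= k z) ->
  intg `]0, b[ k -> intg `]0, b[ (fun z => k z * n z) ->
  (forall x, 0 <= x <= b -> prim (fun z => k z * w z) x <= w x / 2) ->
  (forall z, 0 <= z <= b -> n z <= M) ->
  (forall z, 0 <= z <= b -> n z <= A + prim (fun z => k z * n z) z) ->
  forall z, 0 <= z <= b -> n z <= 2 * A * w z.
Proof.
move=> A0 hw mw k0 ik ikn hkw hM hn.
have w1 x : 1 <= w x by have /andP[] := hw x.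
have M0 z : 0 <= z <= b -> n z <= (2 * A + `|M| / 2 ^+ 0) * w z.
  move=> hz; apply: le_trans (hM z hz) _; rewrite expr0 divr1.
  apply: le_trans (ler_norm M) _; apply: (@le_trans _ _ ((2 * A + `|M|) * 1)).
    by rewrite mulr1 lerDr mulr_ge0.
  by rewrite ler_wpM2l// addr_ge0// mulr_ge0.
have step m z : 0 <= z <= b -> n z <= (2 * A + `|M| / 2 ^+ m) * w z.
  elim: m z => [|m IH] z hz; first exact: M0.
  have /andP[z0 zb] := hz.
  apply: le_trans (hn z hz) _.
  have ikw : intg `]0, z[ (fun z => k z * w z).
    apply: (@intg_mulb _ _ _ _ Mw) => //.
    - exact: (intgS_oo (lexx _) zb ik).
    - exact: measurable_funTS.
    - move=> x _; have /andP[h1 h2] := hw x.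
      by rewrite ger0_norm// (le_trans ler01 h1).
  set c := 2 * A + `|M| / 2 ^+ m.
  have : prim (fun z => k z * n z) z <= c * (w z / 2).
    apply: (@le_trans _ _ (c * prim (fun z => k z * w z) z)).
      rewrite /prim -Rint_Zl//; apply: Rint_le => //.
      - exact: (intgS_oo (lexx _) zb ikn).
      - exact: intgZ.
      move=> x; rewrite /= in_itv/= => /andP[x0 xz].
      rewrite [c * _]mulrCA ler_wpM2l//; apply: IH.
      by rewrite (ltW x0) (le_trans (ltW xz) zb).
    by rewrite ler_wpM2l ?hkw// addr_ge0 ?divr_ge0 ?mulr_ge0// exprn_ge0.
  have -> : c * (w z / 2) = (A + `|M| / 2 ^+ m.+1) * w z.
    have p2 : 2 ^+ m != 0 :> R by rewrite expf_neq0.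
    by rewrite /c exprS; field.
  have : A <= A * w z by rewrite ler_peMr.
  by lra.
move=> z hz; rewrite -subr_le0; apply: (@half_pow_le0 _ _ (`|M| * w z)) => m.
have := step m z hz; rewrite mulrDl lerBlDl => h; apply: le_trans h _.
by rewrite [_ * w z / _]mulrAC.
Qed.

End Gronwall.

(** * Sideways solutions of the wave equation *)

Section Sideways.
Context {R : realType}.
Local Notation mu := (@lebesgue_measure R).
Implicit Types (u v : R -> R -> R) (f : R -> R) (x y z t r s a b c k m : R).
Implicit Types (L M K : R).

Definition bcont v := continuous (fun p : R * R => v p.1 p.2) /\
  exists M, forall y t, `|v y t| <= M.

Lemma pair_cvg (T : Type) (F : set_system T) (f g : T -> R) (x y : R) :
  Filter F -> f @ F --> x -> g @ F --> y -> (fun e => (f e, g e)) @ F --> (x, y).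
Proof. by move=> FF hf hg; exact: (@cvg_pair _ _ _ _ (nbhs _) (nbhs _)). Qed.

Lemma bcont_comp v (f g : R -> R -> R) : bcont v ->
  continuous (fun p : R * R => f p.1 p.2) -> continuous (fun p : R * R => g p.1 p.2) ->
  bcont (fun y t => v (f y t) (g y t)).
Proof.
move=> [cv [M hM]] cf cg; split; last by exists M.
move=> p; have h := pair_cvg (nbhs_filter p) (cf p) (cg p).
exact: (cvg_comp _ _ h (cv (f p.1 p.2, g p.1 p.2))).
Qed.

Lemma bcont_meas v : bcont v -> measurable_fun setT (fun p : R * R => v p.1 p.2).
Proof. by move=> [cv _]; exact: continuous_measurable2. Qed.

Lemma bcont_sec v z : bcont v -> continuous (v z).
Proof.
move=> [cv _] t.
have h : (fun s : R => (z, s)) @ nbhs t --> (z, t).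
  by apply: pair_cvg; [exact: cvg_cst|exact: cvg_id].
exact: (cvg_comp _ _ h (cv (z, t))).
Qed.

Lemma bcont_sec2 v t : bcont v -> continuous (v^~ t).
Proof.
move=> [cv _] z.
have h : (fun s : R => (s, t)) @ nbhs z --> (z, t).
  by apply: pair_cvg; [exact: cvg_id|exact: cvg_cst].
exact: (cvg_comp _ _ h (cv (z, t))).
Qed.

Lemma bcont_intg v z a b : bcont v -> intg `]a, b[ (v z).
Proof. by move=> /bcont_sec h; exact: (continuous_intg _ _ (h z)). Qed.

Lemma bcont_lin k m u v : bcont u -> bcont v ->
  bcont (fun y t => k * u y t + m * v y t).
Proof.
move=> [cu [M hM]] [cv [N hN]]; split.
  move=> p; apply: cvgD.
    by apply: cvgM; [exact: cvg_cst|exact: cu].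
  by apply: cvgM; [exact: cvg_cst|exact: cv].
exists (`|k| * M + `|m| * N) => y t.
by apply: le_trans (ler_normD _ _) _; rewrite !normrM lerD// ler_wpM2l.
Qed.

Lemma lipschitz_cont2 v K : (forall y t y' t',
  `|v y t - v y' t'| <= K * (`|y - y'| + `|t - t'|)) ->
  continuous (fun p : R * R => v p.1 p.2).
Proof.
move=> h [y t]; apply/cvgrPdist_le => e e0 /=.
have K1 : 0 < `|K| + 1 by rewrite ltr_wpDl.
have d0 : 0 < e / (2 * (`|K| + 1)) by rewrite divr_gt0// mulr_gt0.
exists (ball y (e / (2 * (`|K| + 1))), ball t (e / (2 * (`|K| + 1)))).
  by split; exact: nbhsx_ballx.
move=> [y' t'] /= [hy ht].
apply: le_trans (h _ _ _ _) _.
apply: (@le_trans _ _ ((`|K| + 1) * (`|y - y'| + `|t - t'|))).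
  by rewrite ler_wpM2r ?addr_ge0// (le_trans (ler_norm K))// lerDl.
rewrite mulrC -ler_pdivlMr//.
move: hy ht; rewrite /ball/= => hy ht.
have -> : e / (`|K| + 1) = e / (2 * (`|K| + 1)) + e / (2 * (`|K| + 1)).
  by field; rewrite gt_eqF.
by rewrite lerD// ltW.
Qed.

Lemma bcont_lim (u : nat -> R -> R -> R) v M : (forall n, bcont (u n)) ->
  (forall n y t, `|u n y t - v y t| <= M / 2 ^+ n) -> bcont v.
Proof.
move=> cu huv; split; last first.
  have [_ [N hN]] := cu 0%N; exists (N + M) => y t.
  have := huv 0%N y t; rewrite expr0 divr1 distrC => h.
  have -> : v y t = u 0%N y t + (v y t - u 0%N y t) by ring.
  by apply: le_trans (ler_normD _ _) _; rewrite lerD.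
move=> p; apply/cvgrPdist_le => e e0.
have [n hn] : exists n, M / 2 ^+ n <= e / 3.
  apply: contrapT => /forallNP hN.
  suff : e / 3 <= 0 by rewrite leNgt divr_gt0.
  apply: (@half_pow_le0 _ _ M) => n.
  by have /negP := hN n; rewrite -ltNge => /ltW.
have [cn _] := cu n.
have e3 : 0 < e / 3 by rewrite divr_gt0.
have /cvgrPdist_le /(_ _ e3) := cn p.
apply: filterS => p' h.
have h1 := huv n p.1 p.2; have h2 := huv n p'.1 p'.2.
have -> : v p.1 p.2 - v p'.1 p'.2 = - (u n p.1 p.2 - v p.1 p.2) +
  ((u n p.1 p.2 - u n p'.1 p'.2) + (u n p'.1 p'.2 - v p'.1 p'.2)) by ring.
apply: le_trans (ler_normD _ _) _; rewrite normrN.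
have : e = e / 3 + (e / 3 + e / 3) by field.
move=> ->; rewrite lerD ?(le_trans h1)//.
by apply: le_trans (ler_normD _ _) _; rewrite lerD// (le_trans h2).
Qed.

Lemma Rint_lip f M c x y : (forall a b, intg `]a, b[ f) -> (forall s, `|f s| <= M) ->
  c <= x -> c <= y ->
  `|\int[mu]_(s in `]c, x[) f s - \int[mu]_(s in `]c, y[) f s| <= M * `|x - y|.
Proof.
move=> hf hM; wlog xy : x y / x <= y.
  move=> wl cx cy; have [xy|/ltW yx] := leP x y; first exact: wl.
  by rewrite distrC [`|x - y|]distrC wl.
move=> cx cy; rewrite (Rint_split cx xy)// opprD addNKr.
by rewrite normrN distrC (ger0_norm (_ : 0 <= y - x)) ?subr_ge0// Rint_bnd.
Qed.

Lemma Rint_itv_lip f M a b a' b' : (forall a b, intg `]a, b[ f) ->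
  (forall s, `|f s| <= M) -> a <= b -> a' <= b' ->
  `|\int[mu]_(s in `]a, b[) f s - \int[mu]_(s in `]a', b'[) f s| <=
    M * (`|a - a'| + `|b - b'|).
Proof.
move=> hf hM ab ab'; pose c := Num.min a a'.
have ca : c <= a by rewrite ge_min lexx.
have ca' : c <= a' by rewrite ge_min lexx orbT.
have e1 : \int[mu]_(s in `]a, b[) f s =
    \int[mu]_(s in `]c, b[) f s - \int[mu]_(s in `]c, a[) f s.
  by rewrite (Rint_split ca ab)// addrAC subrr add0r.
have e2 : \int[mu]_(s in `]a', b'[) f s =
    \int[mu]_(s in `]c, b'[) f s - \int[mu]_(s in `]c, a'[) f s.
  by rewrite (Rint_split ca' ab')// addrAC subrr add0r.
rewrite e1 e2 mulrDr; clear e1 e2.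
have -> : forall A B C D : R, A - B - (C - D) = (A - C) - (B - D).
  by move=> *; ring.
apply: le_trans (ler_normB _ _) _; rewrite addrC lerD//.
  by apply: Rint_lip.
by apply: Rint_lip => //; [exact: le_trans ab|exact: le_trans ab'].
Qed.

(** The fundamental solution of the one-dimensional wave equation, with y as the evolution variable
    and t as the transverse one. *)
Definition avg v z t r := (\int[mu]_(s in `]t - r, t + r[) v z s) / 2.

Lemma avg_bnd v M z t r : bcont v -> 0 <= r ->
  (forall s, t - r < s < t + r -> `|v z s| <= M) -> `|avg v z t r| <= M * r.
Proof.
move=> cv r0 hM; rewrite /avg normrM (ger0_norm (_ : 0 <= 2^-1))// ler_pdivrMr//.
have h : t - r <= t + r by lra.
apply: le_trans (Rint_bnd h (bcont_intg _ _ _ cv) hM) _.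
by rewrite le_eqVlt; apply/orP; left; apply/eqP; ring.
Qed.

Lemma avg_lip v M z t r t' r' : bcont v -> 0 <= r -> 0 <= r' ->
  (forall s, `|v z s| <= M) ->
  `|avg v z t r - avg v z t' r'| <= M * (`|t - t'| + `|r - r'|).
Proof.
move=> cv r0 r0' hM.
have M0 : 0 <= M by exact: le_trans (hM 0).
rewrite /avg -mulrBl normrM (ger0_norm (_ : 0 <= 2^-1))// ler_pdivrMr//.
have h : t - r <= t + r by lra.
have h' : t' - r' <= t' + r' by lra.
apply: le_trans (Rint_itv_lip (fun a b => bcont_intg _ _ _ cv) hM h h') _.
rewrite -mulrA ler_wpM2l//.
have -> : t - r - (t' - r') = (t - t') + (r' - r) by ring.
have -> : t + r - (t' + r') = (t - t') + (r - r') by ring.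
have h1 := ler_normD (t - t') (r - r').
have h2 := ler_normD (t - t') (r' - r).
by rewrite [`|r' - r|]distrC in h2; lra.
Qed.

Definition clamp (L y : R) := Num.max 0 (Num.min y L).

Lemma clampP L y : 0 <= L -> 0 <= clamp L y <= L.
Proof. by move=> L0; rewrite /clamp le_max lexx/= ge_max L0 ge_min lexx orbT. Qed.

Lemma clamp_id L y : 0 <= y <= L -> clamp L y = y.
Proof. by move=> /andP[y0 yL]; rewrite /clamp min_l// max_r. Qed.

Lemma max_lip x y c : `|Num.max x c - Num.max y c| <= `|x - y|.
Proof.
have h3 := ler_norm (x - y); have h4 := ler_norm (y - x).
rewrite distrC in h4.
by case: (leP x c) => h1; case: (leP y c) => h2; rewrite ler_norml;
  apply/andP; split; lra.
Qed.

Lemma min_lip x y c : `|Num.min x c - Num.min y c| <= `|x - y|.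
Proof.
have h3 := ler_norm (x - y); have h4 := ler_norm (y - x).
rewrite distrC in h4.
by case: (leP x c) => h1; case: (leP y c) => h2; rewrite ler_norml;
  apply/andP; split; lra.
Qed.

Lemma clamp_lip L y y' : `|clamp L y - clamp L y'| <= `|y - y'|.
Proof.
by rewrite /clamp !(maxC 0); apply: le_trans (max_lip _ _ _) _; exact: min_lip.
Qed.

(** Half-width at depth z of the characteristic triangle with apex at depth y; it is 0 beyond the
    apex. *)
Definition crad L y z := Num.max (clamp L y - z) 0.

Lemma crad_ge0 L y z : 0 <= crad L y z.
Proof. by rewrite /crad le_max lexx orbT. Qed.

Lemma crad_lip L y y' z : `|crad L y z - crad L y' z| <= `|y - y'|.
Proof.
apply: le_trans (max_lip _ _ _) _.
have -> : clamp L y - z - (clamp L y' - z) = clamp L y - clamp L y' by ring.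
exact: clamp_lip.
Qed.

Lemma crad_le L y z : 0 <= L -> 0 <= z -> crad L y z <= L.
Proof.
move=> L0 z0; rewrite /crad ge_max L0 andbT.
by have /andP[_ h] := clampP y L0; rewrite lerBlDr (le_trans h)// lerDl.
Qed.

(* The term (1/2) int_0^y q(z) int_{|s - t| < y - z} v(z, s) ds dz, with y clamped
   to [0, L] so that the integral equation makes sense for all y. *)
Definition wave_int (q : R -> R) L v y t :=
  \int[mu]_z (q z * avg v z t (crad L y z)).

Variables (q : R -> R) (L : R).
Hypothesis L0 : 0 <= L.
Hypothesis iq : intg setT q.
Hypothesis q0 : forall z, ~~ (0 < z < L) -> q z = 0.

(** Measurability in z is the delicate point. It comes from Fubini applied to q v / 2 restricted to
    the characteristic triangle. *)
Lemma avg_intg v y t : bcont v -> intg setT (fun z => q z * avg v z t (crad L y z)).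
Proof.
move=> cv; have [_ [M hM]] := cv.
have M0 : 0 <= M by exact: le_trans (hM 0 0).
pose h z s := if (t - crad L y z < s) && (s < t + crad L y z) then
  q z * (v z s / 2) else 0.
have mcrad : measurable_fun setT (fun p : R * R => crad L y p.1).
  by apply: measurable_maxr => //; exact: measurable_funB.
have mh : measurable_fun setT (fun p : R * R => h p.1 p.2).
  apply: measurable_fun_ifT => //.
    apply: measurable_and.
      apply: measurable_fun_ltr; last exact: measurable_snd.
      exact: measurable_funB.
    apply: measurable_fun_ltr; first exact: measurable_snd.
    exact: measurable_funD.
  apply: measurable_funM.
    by apply: measurableT_comp; [exact: intg_meas|exact: measurable_fst].
  by apply: measurable_funM => //; exact: bcont_meas.
pose g s : R := if t - L < s < t + L then M else 0.
have ig : intg setT g by apply/intg_if; exact: intg_cst_oo.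
have hle z s : `|h z s| <= `|q z| * g s.
  have g0 : 0 <= g s.
    by rewrite /g; case: ifP.
  rewrite /h; case: ifPn => [/andP[h1 h2]|_]; last by rewrite normr0 mulr_ge0.
  have [z0|z0] := boolP (0 < z < L); last by rewrite (q0 z0) mul0r normr0 mul0r.
  rewrite normrM ler_wpM2l// /g.
  have hr := crad_le y L0 (ltW (proj1 (andP z0))).
  have -> : t - L < s < t + L by apply/andP; split; lra.
  by rewrite normrM (ger0_norm (_ : 0 <= 2^-1))// ler_pdivrMr//;
    have := hM z s; lra.
have [i1 _ _] := FubiniR_prod mh (intg_norm measurableT iq) ig hle.
apply: eq_intg i1 => // z _.
rewrite /avg -Rint_Zr; [|exact: measurable_itv|exact: bcont_intg].
rewrite -Rint_Zl; [|exact: measurable_itv|].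
  by rewrite [RHS]Rint_mkcond; apply: eq_Rint => s _; rewrite restr_if.
apply: (@eq_intg _ _ (fun s => 2^-1 * v z s)); first exact: measurable_itv.
  by move=> s _; rewrite mulrC.
by apply: intgZ; [exact: measurable_itv|exact: bcont_intg].
Qed.

Lemma wave_int_lin k m u v y t : bcont u -> bcont v ->
  wave_int q L (fun y t => k * u y t + m * v y t) y t =
  k * wave_int q L u y t + m * wave_int q L v y t.
Proof.
move=> cu cv; rewrite /wave_int -Rint_lin//; [|exact: avg_intg|exact: avg_intg].
apply: eq_Rint => z _; rewrite /avg Rint_lin//; [ring|exact: bcont_intg..].
Qed.

(** Moving (y, t) only moves the ends of the inner integrals, at unit speed, so the L^1 norm of q
    suffices. *)
Lemma wave_int_lip v M y t y' t' : bcont v -> (forall y t, `|v y t| <= M) ->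
  `|wave_int q L v y t - wave_int q L v y' t'| <=
  (M * \int[mu]_z `|q z|) * (`|y - y'| + `|t - t'|).
Proof.
move=> cv hM.
have M0 : 0 <= M by exact: le_trans (hM 0 0).
rewrite /wave_int -Rint_B//; [|exact: avg_intg|exact: avg_intg].
have iqn := intg_norm measurableT iq.
have -> : M * (\int[mu]_z `|q z|) * (`|y - y'| + `|t - t'|) =
    \int[mu]_z ((M * (`|y - y'| + `|t - t'|)) * `|q z|).
  by rewrite Rint_Zl//; ring.
apply: Rint_norm_le => //.
- by apply: intgB => //; exact: avg_intg.
- exact: intgZ.
move=> z _; rewrite -mulrBr normrM mulrC ler_wpM2r//.
apply: le_trans (avg_lip _ _ cv (crad_ge0 _ _ _) (crad_ge0 _ _ _) (hM z)) _.
by rewrite ler_wpM2l// addrC lerD// crad_lip.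
Qed.

Lemma wave_int_bnd v M y t : bcont v -> (forall y t, `|v y t| <= M) ->
  `|wave_int q L v y t| <= M * L * \int[mu]_z `|q z|.
Proof.
move=> cv hM.
have M0 : 0 <= M by exact: le_trans (hM 0 0).
have iqn := intg_norm measurableT iq.
rewrite -Rint_Zl//; apply: Rint_norm_le => //; [exact: avg_intg|exact: intgZ|].
move=> z _; have [z0|z0] := boolP (0 < z < L); last by rewrite (q0 z0) mul0r normr0 mulr0.
rewrite normrM mulrC ler_wpM2r//.
apply: le_trans (avg_bnd cv (crad_ge0 _ _ _) (fun s _ => hM z s)) _.
by rewrite ler_wpM2l// crad_le// ltW//; case/andP: z0.
Qed.

Lemma wave_int_bcont v : bcont v -> bcont (wave_int q L v).
Proof.
move=> cv; have [_ [M hM]] := cv; split.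
  apply: lipschitz_cont2 => y t y' t'; exact: (wave_int_lip _ _ _ _ cv hM).
by exists (M * L * \int[mu]_z `|q z|) => y t; exact: wave_int_bnd.
Qed.

(** The triangle has half-width at most L, so the operator is dominated by the Volterra operator
    with kernel L |q|, for which [w] is made. *)
Lemma wave_int_half (w : R -> R) Mw v M : measurable_fun setT w ->
  (forall x, 1 <= w x <= Mw) ->
  (forall x, 0 <= x <= L -> prim (fun z => (L * `|q z|) * w z) x <= w x / 2) ->
  bcont v -> (forall y t, `|v y t| <= M * w (clamp L y)) ->
  forall y t, `|wave_int q L v y t| <= M / 2 * w (clamp L y).
Proof.
move=> mw hw hqw cv hM y t.
have M0 : 0 <= M.
  have := le_trans (normr_ge0 _) (hM 0 0); rewrite pmulr_lge0//.
  by have /andP[h _] := hw (clamp L 0); exact: lt_le_trans h.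
have iqn := intg_norm measurableT iq.
have hy := clampP y L0.
have -> : M / 2 * w (clamp L y) = M * (w (clamp L y) / 2) by ring.
apply: (@le_trans _ _ (M * prim (fun z => (L * `|q z|) * w z) (clamp L y))); last first.
  by rewrite ler_wpM2l// hqw.
have ikw : intg `]0, clamp L y[ (fun z => (L * `|q z|) * w z).
  apply: (@intg_mulb _ _ _ _ Mw); first exact: measurable_itv.
  - by apply: intgT_oo; exact: intgZ.
  - exact: measurable_funTS.
  - move=> z _; have /andP[h1 h2] := hw z.
    by rewrite ger0_norm// (le_trans ler01 h1).
rewrite -Rint_Zl; [|exact: measurable_itv|exact: ikw].
rewrite /wave_int (@Rint_subset _ `]0, clamp L y[)//; last first.
  move=> z _; rewrite /= in_itv/= => /negP h.
  have [z0|z0] := boolP (0 < z < L); last by rewrite (q0 z0) mul0r.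
  move: h; case/andP: (z0) => -> _ /=; rewrite -leNgt => h.
  rewrite /crad max_r ?subr_le0// /avg Rint_empty ?mul0r ?mulr0//.
  by rewrite subr0 addr0.
apply: Rint_norm_le; first exact: measurable_itv.
- by apply: intgT_oo; exact: avg_intg.
- by apply: intgZ; [exact: measurable_itv|exact: ikw].
move=> z; rewrite /= in_itv/= => /andP[z0 zy].
have zL : 0 <= z <= L by rewrite ltW//= (le_trans (ltW zy))//; case/andP: hy.
have hz s : `|v z s| <= M * w z by have := hM z s; rewrite clamp_id.
rewrite normrM.
apply: (@le_trans _ _ (`|q z| * (M * w z * L))); last first.
  by rewrite le_eqVlt; apply/orP; left; apply/eqP; ring.
rewrite ler_wpM2l//.
apply: le_trans (avg_bnd cv (crad_ge0 _ _ _) (fun s _ => hz s)) _.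
by rewrite ler_wpM2l ?crad_le// ?(le_trans _ (hz 0))// ltW.
Qed.

End Sideways.

Section SidewaysSolution.
Context {R : realType}.
Local Notation mu := (@lebesgue_measure R).
Implicit Types (u v : R -> R -> R) (f q al be : R -> R).
Implicit Types (x y z t r s a b c k m L M K : R).

Definition potential q L := [/\ 0 <= L, intg setT q &
  forall z, ~~ (0 < z < L) -> q z = 0].

Lemma sideways_weight q L : potential q L -> exists (w : R -> R) Mw,
  [/\ forall x, 1 <= w x <= Mw, measurable_fun setT w &
   forall x, 0 <= x <= L -> prim (fun z => (L * `|q z|) * w z) x <= w x / 2].
Proof.
move=> [L0 iq q0].
have ik : intg setT (fun z => L * `|q z|) by apply: intgZ => //; exact: intg_norm.
have k0 z : 0 <= L * `|q z| by rewrite mulr_ge0.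
by have [w [Mw [h1 _ h2 h3]]] := volterra_weight L0 ik k0; exists w, Mw.
Qed.

Lemma sideways_exists q L : potential q L -> exists2 C, 0 <= C &
  forall v0 M, bcont v0 -> (forall y t, `|v0 y t| <= M) ->
  exists v, [/\ bcont v, forall y t, v y t = v0 y t + wave_int q L v y t &
    forall y t, `|v y t| <= C * M].
Proof.
move=> pq; have [w [Mw [hw mw hqw]]] := sideways_weight pq.
have [L0 iq q0] := pq.
have w1 x : 1 <= w x by case/andP: (hw x).
have wM x : w x <= Mw by case/andP: (hw x).
exists (2 * Mw); first by rewrite mulr_ge0// (le_trans ler01)// (le_trans (w1 0)).
move=> v0 M cv0 hv0.
have M0 : 0 <= M by exact: le_trans (hv0 0 0).
pose Cl (f : R * R -> R) := bcont (fun y t => f (y, t)).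
pose Op (f : R * R -> R) (p : R * R) := wave_int q L (fun y t => f (y, t)) p.1 p.2.
pose W (p : R * R) := w (clamp L p.1).
have [|||||||g [cg eg hg]] := @fixpoint_exists R (R * R)%type W Cl Op _ _ _ _ _
    (fun p => v0 p.1 p.2) M.
- by move=> k m f g; exact: bcont_lin.
- by move=> k m f g cf cg p; rewrite /Op wave_int_lin.
- by move=> f cf; rewrite /Cl/=; exact: wave_int_bcont.
- move=> f N cf hf [y t].
  exact: (wave_int_half L0 iq q0 mw hw hqw cf (fun y t => hf (y, t))).
- move=> u f N cu huf; apply: (@bcont_lim _ (fun n y t => u n (y, t)) _ (`|N| * Mw)) => //.
  move=> n y t; apply: le_trans (huf n (y, t)) _.
  rewrite [leRHS]mulrAC; apply: ler_pM => //; last exact: wM.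
    by rewrite divr_ge0 ?exprn_ge0// -(pmulr_lge0 _ (lt_le_trans ltr01 (w1 (clamp L y)))) //;
      have := le_trans (normr_ge0 _) (huf 0%N (y, t)); rewrite expr0 divr1.
    exact: le_trans (w1 _).
  by rewrite ler_wpM2r ?invr_ge0 ?exprn_ge0// ler_norm.
- exact: cv0.
- move=> p; apply: le_trans (hv0 _ _) _.
  by rewrite ler_peMr//; exact: w1.
exists (fun y t => g (y, t)); split=> // y t.
apply: le_trans (hg (y, t)) _.
by rewrite mulrAC ler_wpM2r// ler_wpM2l ?mulr_ge0// wM.
Qed.

Lemma sideways_unique q L u v v0 : potential q L -> bcont u -> bcont v ->
  (forall y t, u y t = v0 y t + wave_int q L u y t) ->
  (forall y t, v y t = v0 y t + wave_int q L v y t) -> forall y t, u y t = v y t.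
Proof.
move=> pq cu cv eu ev y t; have [w [Mw [hw mw hqw]]] := sideways_weight pq.
have [L0 iq q0] := pq.
have w1 x : 1 <= w x by case/andP: (hw x).
pose g (p : R * R) := 1 * u p.1 p.2 + (-1) * v p.1 p.2.
suff : g (y, t) = 0 by rewrite /g/= mul1r mulN1r => /eqP; rewrite subr_eq0 => /eqP.
pose Cl (f : R * R -> R) := bcont (fun y t => f (y, t)).
pose Op (f : R * R -> R) (p : R * R) := wave_int q L (fun y t => f (y, t)) p.1 p.2.
pose W (p : R * R) := w (clamp L p.1).
have cg : Cl g by exact: bcont_lin.
have [_ [M hM]] := cg.
apply: (@fixpoint_unique R (R * R)%type W Cl Op _ g M) => //.
- move=> f N cf hf [y' t'].
  exact: (wave_int_half L0 iq q0 mw hw hqw cf (fun y t => hf (y, t))).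
- move=> [y' t']; apply: le_trans (hM y' t') _; rewrite ler_peMr//; last exact: w1.
  exact: le_trans (hM 0 0).
- by move=> [y' t']; rewrite /Op /g/= wave_int_lin// {1}eu {1}ev; ring.
Qed.

Definition wsol q L v0 : R -> R -> R :=
  get [set v | bcont v /\ forall y t, v y t = v0 y t + wave_int q L v y t].

Lemma wsolP q L v0 : potential q L -> bcont v0 ->
  bcont (wsol q L v0) /\
  forall y t, wsol q L v0 y t = v0 y t + wave_int q L (wsol q L v0) y t.
Proof.
move=> pq cv0; have [C C0 hC] := sideways_exists pq.
have [_ [M hM]] := cv0; have [v [cv ev _]] := hC v0 M cv0 hM.
by rewrite /wsol; case: xgetP => [u _ //|/(_ v)]; case.
Qed.

Lemma wsol_eq q L v0 v : potential q L -> bcont v0 -> bcont v ->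
  (forall y t, v y t = v0 y t + wave_int q L v y t) ->
  forall y t, wsol q L v0 y t = v y t.
Proof.
move=> pq cv0 cv ev; have [cs es] := wsolP pq cv0.
exact: (sideways_unique pq cs cv es ev).
Qed.

Lemma wsol_lin q L k m v0 v1 : potential q L -> bcont v0 -> bcont v1 ->
  forall y t, wsol q L (fun y t => k * v0 y t + m * v1 y t) y t =
  k * wsol q L v0 y t + m * wsol q L v1 y t.
Proof.
move=> pq c0 c1; have [cs es] := wsolP pq c0; have [cs' es'] := wsolP pq c1.
have [L0 iq q0] := pq.
apply: wsol_eq; [exact: pq|exact: bcont_lin|exact: bcont_lin|].
move=> y t; rewrite (wave_int_lin L0 iq q0 k m y t cs cs').
have -> := es y t; have -> := es' y t.
move: (wave_int _ _ _ _ _) (wave_int _ _ _ _ _) => A B; ring.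
Qed.

Lemma wsol_bnd q L : potential q L -> exists2 C, 0 <= C & forall v0 M, bcont v0 ->
  (forall y t, `|v0 y t| <= M) -> forall y t, `|wsol q L v0 y t| <= C * M.
Proof.
move=> pq; have [C C0 hC] := sideways_exists pq; exists C => // v0 M cv0 hM y t.
have [v [cv ev hv]] := hC v0 M cv0 hM.
by rewrite (wsol_eq pq cv0 cv ev).
Qed.

Lemma Rint_mono_set (A D : set R) f : measurable A -> measurable D -> A `<=` D ->
  intg D f -> (forall x, 0 <= f x) ->
  \int[mu]_(x in A) f x <= \int[mu]_(x in D) f x.
Proof.
move=> mA mD AD hf f0; rewrite Rint_mkcond [leRHS]Rint_mkcond.
apply: Rint_le => //.
- by apply/(intg_restrict _ mA); exact: intgS hf.
- exact/(intg_restrict _ mD).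
move=> x _; rewrite !patchE; case: ifPn => [/set_mem/AD/mem_set->//|_].
by case: ifP.
Qed.

Lemma Rint_mono_oo a b a' b' f : a' <= a -> b <= b' -> intg `]a', b'[ f ->
  (forall x, 0 <= f x) ->
  \int[mu]_(x in `]a, b[) f x <= \int[mu]_(x in `]a', b'[) f x.
Proof.
move=> ha hb; apply: Rint_mono_set; [exact: measurable_itv..|].
move=> x /=; rewrite !in_itv/= => /andP[h1 h2].
by rewrite (le_lt_trans ha h1) (lt_le_trans h2 hb).
Qed.

Lemma bcont_norm v : bcont v -> bcont (fun y t => `|v y t|).
Proof.
move=> [cv [M hM]]; split; last by exists M => y t; rewrite normr_id.
by move=> p; apply: (cvg_comp _ _ (cv p)); exact: norm_continuous.
Qed.

Lemma potential_norm q L : potential q L -> potential (fun z => `|q z|) L.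
Proof.
move=> [L0 iq q0]; split=> //; first exact: intg_norm.
by move=> z /q0 ->; rewrite normr0.
Qed.

Lemma wave_int_oo q L v y t : potential q L -> bcont v -> 0 <= y <= L ->
  wave_int q L v y t = \int[mu]_(z in `]0, y[) (q z * avg v z t (y - z)).
Proof.
move=> [L0 iq q0] cv hy.
transitivity (\int[mu]_(z in `]0, y[) (q z * avg v z t (crad L y z))).
  apply: Rint_subset; first by [].
  move=> z _; rewrite /= in_itv/= => /negP h.
  have [z0|z0] := boolP (0 < z < L); last by rewrite (q0 _ z0) mul0r.
  move: h; case/andP: (z0) => -> _ /=; rewrite -leNgt => h.
  rewrite /crad clamp_id// max_r ?subr_le0// /avg Rint_empty ?mul0r ?mulr0//.
  by rewrite subr0 addr0.
apply: eq_Rint => z; rewrite /= in_itv/= => /andP[z0 zy].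
rewrite /crad clamp_id// max_l; first by [].
by rewrite subr_ge0 ltW.
Qed.

(** Domain of dependence: inside the triangle with base (t0 - r, t0 + r), only the data on that base
    count. Besides bounds, this yields causality and the agreement of solutions whose data agree on
    the base. *)
Lemma cone_bound q L : potential q L -> exists2 C, 0 <= C &
  forall al be v, continuous al -> continuous be -> bcont v ->
  (forall y t, v y t = al (t + clamp L y) + be (t - clamp L y) + wave_int q L v y t) ->
  forall t0 r, 0 <= r <= L -> forall z s, 0 <= z -> z + `|s - t0| <= r ->
  `|v z s| <= `|al (s + z)| + `|be (s - z)| +
     C * (\int[mu]_(x in `]t0 - r, t0 + r[) `|al x| +
          \int[mu]_(x in `]t0 - r, t0 + r[) `|be x|).
Proof.
move=> pq; have [w [Mw [hw mw hqw]]] := sideways_weight pq.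
have [L0 iq q0] := pq.
have iqn := intg_norm measurableT iq.
have Mw1 : 1 <= Mw by case/andP: (hw 0); exact: le_trans.
have Iq0 : 0 <= \int[mu]_z `|q z| by exact: Rintegral_ge0.
exists (Mw * \int[mu]_z `|q z|); first by rewrite mulr_ge0// (le_trans ler01).
move=> al be v cal cbe cv ev t0 r hr.
have /andP[r0 rL] := hr.
have cvn := bcont_norm cv.
have pqn := potential_norm pq.
have [_ iq' q0'] := pqn.
set A := _ + _.
have na : continuous (fun x => `|al x|).
  by move=> x; apply: (cvg_comp _ _ (cal x)); exact: norm_continuous.
have nb : continuous (fun x => `|be x|).
  by move=> x; apply: (cvg_comp _ _ (cbe x)); exact: norm_continuous.
have A0 : 0 <= A by rewrite addr_ge0//; exact: Rintegral_ge0.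
(* Integrating |v| over the section of the triangle at depth z leaves an inequality in z alone, to
   which Gronwall applies. *)
pose n z := avg (fun y t => `|v y t|) z t0 (crad L r z).
have n0 z : 0 <= n z by rewrite /n /avg divr_ge0//; exact: Rintegral_ge0.
have iqnn : intg setT (fun z => `|q z| * n z) by exact: avg_intg.
pose P := prim (fun z => `|q z| * n z).
have vP z s : 0 <= z -> z + `|s - t0| <= r ->
    `|v z s| <= `|al (s + z)| + `|be (s - z)| + P z.
  move=> z0 hzs.
  have zr : z <= r by apply: le_trans hzs; rewrite lerDl.
  have hz : 0 <= z <= L by rewrite z0 (le_trans zr).
  rewrite {1}ev (clamp_id hz); apply: le_trans (ler_normD _ _) _.
  rewrite lerD ?ler_normD// (wave_int_oo _ pq cv hz) /P /prim.
  apply: Rint_norm_le; first exact: measurable_itv.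
  - apply: (@eq_intg _ _ (fun z' => q z' * avg v z' s (crad L z z'))).
    + exact: measurable_itv.
    + move=> z'; rewrite /= in_itv/= => /andP[z0' zz'].
      by rewrite /crad clamp_id// max_l// subr_ge0 ltW.
    + by apply: intgT_oo; exact: avg_intg.
  - exact: intgT_oo.
  move=> z'; rewrite /= in_itv/= => /andP[z0' zz'].
  rewrite normrM ler_wpM2l// /n /crad (clamp_id hr) max_l; last first.
    by rewrite subr_ge0 ltW// (lt_le_trans zz').
  rewrite /avg normrM (ger0_norm (_ : 0 <= 2^-1))// ler_wpM2r//.
  apply: le_trans (Rint_norm (measurable_itv _) (bcont_intg _ _ _ cv)) _.
  have h1 := ler_norm (s - t0); have h2 := ler_norm (t0 - s).
  rewrite distrC in h2.
  by apply: Rint_mono_oo => //; [lra|lra|exact: (bcont_intg _ _ _ cvn)].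
have nP z : 0 <= z <= r -> n z <= A / 2 + prim (fun z => (L * `|q z|) * n z) z.
  move=> /andP[z0 zr].
  have -> : prim (fun z => (L * `|q z|) * n z) z = L * P z.
    rewrite /P /prim -Rint_Zl; [|exact: measurable_itv|exact: intgT_oo].
    by apply: eq_Rint => x _; rewrite -mulrA.
  rewrite /n /crad (clamp_id hr) max_l ?subr_ge0//.
  rewrite /avg ler_pdivrMr// mulrDl divfK//.
  have P0 : 0 <= P z by apply: Rintegral_ge0 => x _; rewrite mulr_ge0.
  pose I : set R := `]t0 - (r - z), t0 + (r - z)[%classic.
  have mI : measurable I by exact: measurable_itv.
  have ja : intg I (fun s => `|al (s + z)|).
    by have [] := @Rint_shift_oo _ (fun x => `|al x|) (t0 - (r - z)) (t0 + (r - z)) z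
      (continuous_intg _ _ na).
  have jb : intg I (fun s => `|be (s - z)|).
    by have [] := @Rint_shift_oo _ (fun x => `|be x|) (t0 - (r - z)) (t0 + (r - z)) (- z)
      (continuous_intg _ _ nb).
  have jP : intg I (fun=> P z) by exact: intg_cst_oo.
  apply: (@le_trans _ _ (\int[mu]_(s in I) (`|al (s + z)| + `|be (s - z)| + P z))).
    apply: Rint_le => //.
    - exact: (bcont_intg _ _ _ cvn).
    - by apply: intgD => //; exact: intgD.
    move=> s; rewrite /I /= in_itv/= => /andP[s1 s2]; apply: vP => //.
    by rewrite -lerBrDl ler_norml; apply/andP; split; lra.
  rewrite Rint_D//; last exact: intgD.
  rewrite Rint_D// /I Rint_cst; last by lra.
  have -> : t0 + (r - z) - (t0 - (r - z)) = 2 * (r - z) by ring.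
  apply: lerD.
    rewrite /A; apply: lerD.
      have [_ ->] := @Rint_shift_oo _ (fun x => `|al x|) (t0 - (r - z)) (t0 + (r - z)) z
        (continuous_intg _ _ na).
      by apply: Rint_mono_oo => //; [lra|lra|exact: continuous_intg].
    have [_ ->] := @Rint_shift_oo _ (fun x => `|be x|) (t0 - (r - z)) (t0 + (r - z)) (- z)
        (continuous_intg _ _ nb).
    by apply: Rint_mono_oo => //; [lra|lra|exact: continuous_intg].
  have -> : P z * (2 * (r - z)) = (2 * P z) * (r - z) by ring.
  have -> : L * P z * 2 = (2 * P z) * L by ring.
  by rewrite ler_wpM2l ?mulr_ge0//; lra.
have [_ [Mv hMv]] := cv.
have Mv0 : 0 <= Mv by exact: le_trans (hMv 0 0).
have nA z : 0 <= z <= r -> n z <= 2 * (A / 2) * w z.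
  apply: (@gronwall _ r (A / 2) (Mv * L) Mw (fun z => L * `|q z|) w n) => //.
  - by rewrite divr_ge0.
  - by move=> x; rewrite mulr_ge0.
  - by apply: intgT_oo; exact: intgZ.
  - apply: intgT_oo; apply: (@eq_intg _ _ (fun z => L * (`|q z| * n z))) => //.
      by move=> x _; rewrite mulrA.
    exact: intgZ.
  - by move=> x /andP[x0 xr]; apply: hqw; rewrite x0 (le_trans xr).
  - move=> x /andP[x0 xr]; apply: le_trans (ler_norm _) _.
    apply: le_trans (avg_bnd (M := Mv) cvn (crad_ge0 _ _ _) _) _.
      by move=> s _; rewrite normr_id.
    by rewrite ler_wpM2l// crad_le.
move=> z s z0 hzs; apply: le_trans (vP _ _ z0 hzs) _; rewrite lerD2l.
have zr : z <= r by apply: le_trans hzs; rewrite lerDl.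
have mz : measurable `]0, z[%classic by exact: measurable_itv.
have iqz : intg `]0, z[ (fun z => `|q z|) by exact: intgT_oo.
have -> : Mw * (\int[mu]_z `|q z|) * A = (A * Mw) * \int[mu]_z `|q z| by ring.
apply: (@le_trans _ _ (\int[mu]_(x in `]0, z[) (A * Mw * `|q x|))).
  apply: Rint_le => //; [exact: intgT_oo|exact: intgZ|].
  move=> x; rewrite /= in_itv/= => /andP[x0 xz]; rewrite mulrC ler_wpM2r//.
  apply: le_trans (nA x _) _; first by rewrite !ltW// (lt_le_trans xz).
  have -> : 2 * (A / 2) = A by field.
  by rewrite ler_wpM2l//; case/andP: (hw x).
rewrite Rint_Zl// ler_wpM2l//; first by rewrite mulr_ge0// (le_trans ler01).
by apply: Rint_mono_set.
Qed.

End SidewaysSolution.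

(** * Square-integrable functions *)

Section SquareIntegrable.
Context {R : realType}.
Local Notation mu := (@lebesgue_measure R).
Implicit Types (f g h : R -> R) (b c x y k m M : R).

Variant sqi b f : Prop := Sqi of
  measurable_fun `]0, b[%classic f & intg `]0, b[ (fun x => f x ^+ 2).

Lemma sqr_poweR (x : R) : (`|x%:E| `^ 2)%E = (x ^+ 2)%:E.
Proof. by rewrite /= powR_mulrn// real_normK// num_real. Qed.

Lemma restr_sqr b f x : (f \_ `]0, b[) x ^+ 2 = ((fun x => f x ^+ 2) \_ `]0, b[) x.
Proof. by rewrite !restr_if; case: ifP => _; rewrite ?expr0n. Qed.

Lemma in_Lp2P b f : in_Lp 2%:E b f <-> sqi b f.
Proof.
have mD : measurable `]0, b[%classic by exact: measurable_itv.
split=> [h|[mf hf]].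
  have hm : measurable_fun setT (f \_ `]0, b[).
    by move: h => /andP[+ _]; rewrite inE.
  have [hi] : intg setT (fun x => (f \_ `]0, b[) x ^+ 2).
    by split; exact: Lfun2_integrable_sqr h.
  split; first by apply/measurable_restrictT.
  apply/(intg_restrict _ mD); split.
  by apply: eq_integrable hi => // x _ /=; rewrite restr_sqr.
have mF : measurable_fun setT (f \_ `]0, b[) := (measurable_restrictT f mD).1 mf.
apply/andP; split; rewrite inE//= /finite_norm unlock poweR_lty//.
have E x : (`|(EFin \o (f \_ `]0%R, b[)) x| `^ 2 =
    (((fun x => f x ^+ 2) \_ `]0%R, b[) x)%:E)%E.
  by rewrite -restr_sqr; exact: sqr_poweR.
under eq_integral => x _ do rewrite E.
have [/integrableP[_]] := (intg_restrict _ mD).1 hf.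
apply: le_lt_trans; rewrite le_eqVlt; apply/orP; left; apply/eqP.
apply: eq_integral => x _ /=.
by rewrite ger0_norm// -restr_sqr sqr_ge0.
Qed.

Lemma L2norm_ge0 b f : 0 <= L2norm b f.
Proof. by rewrite /L2norm fine_ge0// Lnorm_ge0. Qed.

Lemma L2norm_sqr b f : sqi b f ->
  L2norm b f ^+ 2 = \int[mu]_(x in `]0, b[) f x ^+ 2.
Proof.
move=> hf; have /in_Lp2P := hf => /andP[_]; rewrite inE/= /finite_norm => fin.
pose F := f \_ `]0, b[.
have e : ('N[mu]_2%:E[EFin \o F] `^ 2 = \int[mu]_x (F x ^+ 2)%:E)%E.
  by rewrite poweR_Lnorm//; apply: eq_integral => x _; exact: sqr_poweR.
rewrite Rint_mkcond.
have -> : \int[mu]_x ((fun x => f x ^+ 2) \_ `]0, b[) x =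
    \int[mu]_x (F x ^+ 2).
  by apply: eq_Rint => x _; rewrite restr_sqr.
rewrite RintegralE -e /L2norm -/F; move: fin (Lnorm_ge0 mu 2%:E (EFin \o F)).
rewrite -/F.
case: (Lnorm mu 2%:E (EFin \o F)) => [c _ c0|//|//].
by rewrite /= powR_mulrn// -lee_fin.
Qed.

Lemma L2norm_sqrt b f : sqi b f ->
  L2norm b f = Num.sqrt (\int[mu]_(x in `]0, b[) f x ^+ 2).
Proof.
by move=> hf; rewrite -L2norm_sqr// sqrtr_sqr ger0_norm// L2norm_ge0.
Qed.

Lemma sqi_mul b f g : sqi b f -> sqi b g -> intg `]0, b[ (fun x => f x * g x).
Proof.
move=> [mf hf] [mg hg].
have mD : measurable `]0, b[%classic by exact: measurable_itv.
apply: (@intg_le _ _ _ (fun x => f x ^+ 2 + g x ^+ 2)) => //.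
- exact: measurable_funM.
- move=> x _; rewrite normrM -(real_normK (num_real (f x))) -(real_normK (num_real (g x))).
  by have := sqr_ge0 (`|f x| - `|g x|); have := normr_ge0 (f x);
    have := normr_ge0 (g x); nra.
- exact: intgD.
Qed.

Lemma sqi_lin b k m f g : sqi b f -> sqi b g -> sqi b (fun x => k * f x + m * g x).
Proof.
move=> hf hg; have hfg := sqi_mul hf hg; case: hf hg => mf hf [mg hg].
have mD : measurable `]0, b[%classic by exact: measurable_itv.
split; first by apply: measurable_funD; apply: measurable_funM.
apply: (@eq_intg _ _ (fun x => k ^+ 2 * f x ^+ 2 +
   (2 * k * m * (f x * g x) + m ^+ 2 * g x ^+ 2))) => //.
  by move=> x _; ring.
by apply: intgD => //; [exact: intgZ|apply: intgD => //; exact: intgZ].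
Qed.

Lemma eq_sqi b f g : (forall x, 0 < x < b -> f x = g x) -> sqi b f -> sqi b g.
Proof.
move=> fg [mf hf]; split.
  apply: eq_measurable_fun mf => x; rewrite inE/= in_itv/=; exact: fg.
apply: eq_intg hf; first exact: measurable_itv.
by move=> x; rewrite /= in_itv/= => /fg ->.
Qed.

Lemma sqiD b f g : sqi b f -> sqi b g -> sqi b (fun x => f x + g x).
Proof.
move=> hf hg; apply: eq_sqi (sqi_lin 1 1 hf hg) => x _; by rewrite !mul1r.
Qed.

Lemma sqiB b f g : sqi b f -> sqi b g -> sqi b (fun x => f x - g x).
Proof.
move=> hf hg; apply: eq_sqi (sqi_lin 1 (-1) hf hg) => x _; by rewrite mul1r mulN1r.
Qed.

Lemma sqiZ b k f : sqi b f -> sqi b (fun x => k * f x).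
Proof.
move=> hf; apply: eq_sqi (sqi_lin k 0 hf hf) => x _; by rewrite mul0r addr0.
Qed.

Lemma sqi_bnd b f M : measurable_fun `]0, b[%classic f ->
  (forall x, 0 < x < b -> `|f x| <= M) -> sqi b f.
Proof.
move=> mf hM; split=> //; apply: (@intg_bnd _ _ _ _ (M ^+ 2)).
  exact: measurable_funX.
move=> x hx; rewrite normrX lerXn2r ?nnegrE// ?hM//.
exact: le_trans (hM x hx).
Qed.

Lemma sqi_cst b k : sqi b (fun=> k).
Proof. by apply: (@sqi_bnd _ _ `|k|) => //; exact: measurable_cst. Qed.

Lemma continuous_sqi b f : continuous f -> sqi b f.
Proof.
move=> cf; split.
  by apply: measurable_funTS; exact: continuous_measurable_fun.
apply: continuous_intg => x; rewrite /GRing.exp/=.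
by apply: cvgM; exact: cf.
Qed.

Lemma sqi_intg b f : sqi b f -> intg `]0, b[ f.
Proof.
move=> hf; apply: eq_intg (sqi_mul hf (sqi_cst b 1)); first exact: measurable_itv.
by move=> x _; rewrite mulr1.
Qed.

Lemma sqi_sub b c f : c <= b -> sqi b f -> sqi c f.
Proof.
move=> cb [mf hf]; split.
  apply: measurable_funS mf; first exact: measurable_itv.
  by move=> x /=; rewrite !in_itv/= => /andP[-> h]; rewrite (lt_le_trans h).
exact: (intgS_oo (lexx _) cb hf).
Qed.

(* The discriminant of the nonnegative quadratic k |-> |f - k g|^2. *)
Lemma cauchy_schwarz b f g : sqi b f -> sqi b g ->
  `|\int[mu]_(x in `]0, b[) (f x * g x)| <= L2norm b f * L2norm b g.
Proof.
move=> hf hg; have hfg := sqi_mul hf hg.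
have mD : measurable `]0, b[%classic by exact: measurable_itv.
pose A := \int[mu]_(x in `]0, b[) f x ^+ 2.
pose B := \int[mu]_(x in `]0, b[) (f x * g x).
pose C := \int[mu]_(x in `]0, b[) g x ^+ 2.
have quad k : 0 <= A - 2 * k * B + k ^+ 2 * C.
  have [mf jf] := hf; have [mg jg] := hg.
  have -> : A - 2 * k * B + k ^+ 2 * C = \int[mu]_(x in `]0, b[)
     (1 * (1 * f x ^+ 2 + (- (2 * k)) * (f x * g x)) + k ^+ 2 * g x ^+ 2).
    rewrite (@Rint_lin _ _ _ _ (fun x => 1 * f x ^+ 2 + _ * (f x * g x)) (fun x => g x ^+ 2))//.
      by rewrite (@Rint_lin _ _ _ _ (fun x => f x ^+ 2) (fun x => f x * g x))// -/A -/B -/C; ring.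
    by apply: intgD => //; exact: intgZ.
  apply: Rintegral_ge0 => x _.
  have -> : 1 * (1 * f x ^+ 2 + - (2 * k) * (f x * g x)) + k ^+ 2 * g x ^+ 2 =
    (f x - k * g x) ^+ 2 by ring.
  exact: sqr_ge0.
have A0 : 0 <= A by apply: Rintegral_ge0 => x _; exact: sqr_ge0.
have C0 : 0 <= C by apply: Rintegral_ge0 => x _; exact: sqr_ge0.
have BAC : B ^+ 2 <= A * C.
  have [C1|C1] := leP C 0.
    have C00 : C = 0 by apply/le_anti; rewrite C1 C0.
    have [->|B0] := eqVneq B 0; first by rewrite expr0n/= mulr_ge0.
    have := quad ((A + 1) / B); rewrite C00 mulr0 addr0.
    have -> : 2 * ((A + 1) / B) * B = 2 * (A + 1) by field.
    by lra.
  have := quad (B / C).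
  have -> : A - 2 * (B / C) * B + (B / C) ^+ 2 * C = (A * C - B ^+ 2) / C.
    by field; rewrite gt_eqF.
  by rewrite pmulr_lge0 ?invr_gt0// subr_ge0.
rewrite -/B -(@ler_pXn2r _ 2%N)// ?nnegrE ?mulr_ge0 ?L2norm_ge0//.
by rewrite exprMn !L2norm_sqr// real_normK// num_real.
Qed.

Lemma L2norm_ler b f M : sqi b f -> 0 <= M ->
  \int[mu]_(x in `]0, b[) f x ^+ 2 <= M ^+ 2 -> L2norm b f <= M.
Proof.
by move=> hf M0; rewrite -L2norm_sqr// ler_pXn2r// nnegrE// L2norm_ge0.
Qed.

Lemma L2normD b f g : sqi b f -> sqi b g ->
  L2norm b (fun x => f x + g x) <= L2norm b f + L2norm b g.
Proof.
move=> hf hg; have hfg := sqi_mul hf hg.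
have [mf jf] := hf; have [mg jg] := hg.
have mD : measurable `]0, b[%classic by exact: measurable_itv.
apply: L2norm_ler; [exact: sqiD|by rewrite addr_ge0 ?L2norm_ge0|].
have CS := cauchy_schwarz hf hg.
apply: (@le_trans _ _ (\int[mu]_(x in `]0, b[)
   (1 * (1 * f x ^+ 2 + 2 * (f x * g x)) + 1 * g x ^+ 2))).
  apply: Rint_le => //.
  - by have [] := sqiD hf hg.
  - by apply: intgD => //; apply: intgZ => //; apply: intgD => //; exact: intgZ.
  by move=> x _; rewrite le_eqVlt; apply/orP; left; apply/eqP; ring.
rewrite (@Rint_lin _ _ _ _ (fun x => 1 * f x ^+ 2 + _ * (f x * g x)) (fun x => g x ^+ 2))//; last first.
  by apply: intgD => //; exact: intgZ.
rewrite (@Rint_lin _ _ _ _ (fun x => f x ^+ 2) (fun x => f x * g x))// -!L2norm_sqr//.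
have := ler_norm (\int[mu]_(x in `]0, b[) (f x * g x)); lra.
Qed.

Lemma L2normZ b k f : sqi b f -> L2norm b (fun x => k * f x) = `|k| * L2norm b f.
Proof.
move=> hf; have [mf jf] := hf.
rewrite !L2norm_sqrt//; last exact: sqiZ.
have -> : \int[mu]_(x in `]0, b[) (k * f x) ^+ 2 =
    k ^+ 2 * \int[mu]_(x in `]0, b[) f x ^+ 2.
  rewrite -Rint_Zl//.
  by apply: eq_Rint => x _; rewrite exprMn.
by rewrite sqrtrM ?sqr_ge0// sqrtr_sqr.
Qed.

Lemma eq_L2norm b f g : (forall x, 0 < x < b -> f x = g x) -> L2norm b f = L2norm b g.
Proof.
move=> fg; rewrite /L2norm; congr (fine _); apply: eq_Lnorm => x /=.
by rewrite !restr_if; case: ifP => // /fg ->.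
Qed.

Lemma L2norm_bnd b f M : 0 <= b -> 0 <= M -> measurable_fun `]0, b[%classic f ->
  (forall x, 0 < x < b -> `|f x| <= M) -> L2norm b f <= M * Num.sqrt b.
Proof.
move=> b0 M0 mf hM; have hf := sqi_bnd mf hM.
apply: L2norm_ler => //; first by rewrite mulr_ge0// sqrtr_ge0.
rewrite exprMn sqr_sqrtr//; have [_ jf] := hf.
have -> : M ^+ 2 * b = \int[mu]_(x in `]0, b[) (M ^+ 2) by rewrite Rint_cst// subr0.
apply: Rint_le => //; first exact: intg_cst_oo.
move=> x; rewrite /= in_itv/= => hx.
by rewrite -(real_normK (num_real (f x))) lerXn2r ?nnegrE// hM.
Qed.

Lemma L1_le_L2 b f : 0 <= b -> sqi b f ->
  \int[mu]_(x in `]0, b[) `|f x| <= Num.sqrt b * L2norm b f.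
Proof.
move=> b0 hf; have [mf jf] := hf.
have hn : sqi b (fun x => `|f x|).
  split; first exact: measurableT_comp.
  apply: eq_intg jf; first exact: measurable_itv.
  by move=> x _; rewrite real_normK// num_real.
have -> : \int[mu]_(x in `]0, b[) `|f x| = \int[mu]_(x in `]0, b[) (1 * `|f x|).
  by apply: eq_Rint => x _; rewrite mul1r.
have := cauchy_schwarz (sqi_cst b 1) hn.
rewrite (L2norm_sqrt (sqi_cst b 1)) (L2norm_sqrt hn) (L2norm_sqrt hf).
have -> : \int[mu]_(x in `]0, b[) (1 ^+ 2 : R) = b.
  by rewrite expr1n Rint_cst// subr0 mul1r.
have -> : \int[mu]_(x in `]0, b[) (`|f x| ^+ 2) = \int[mu]_(x in `]0, b[) f x ^+ 2.
  by apply: eq_Rint => x _; rewrite real_normK// num_real.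
by apply: le_trans; exact: ler_norm.
Qed.

Lemma holder_half b f x y : sqi b f -> 0 <= x -> x <= y -> y <= b ->
  \int[mu]_(s in `]x, y[) `|f s| <= Num.sqrt (y - x) * L2norm b f.
Proof.
move=> hf x0 xy yb; have [mf jf] := hf.
have iab : intg `]0 + x, (y - x) + x[ (fun s => `|f s|).
  rewrite add0r subrK; apply: (intgS_oo x0 yb (intg_norm (measurable_itv _) (sqi_intg hf))).
have j2 : intg `]0 + x, (y - x) + x[ (fun s => f s ^+ 2).
  by rewrite add0r subrK; exact: (intgS_oo x0 yb jf).
have [_] := Rint_shift_oo iab; rewrite add0r subrK => <-.
have [jsq e2] := Rint_shift_oo j2.
have ms : measurable_fun `]0, y - x[%classic (fun s => f (s + x)).
  have iff : intg `]0 + x, (y - x) + x[ f.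
    by rewrite add0r subrK; exact: (intgS_oo x0 yb (sqi_intg hf)).
  by have [/intg_meas] := Rint_shift_oo iff.
have hs : sqi (y - x) (fun s => f (s + x)) by split.
have yx0 : 0 <= y - x by rewrite subr_ge0.
apply: le_trans (L1_le_L2 yx0 hs) _.
rewrite ler_wpM2l ?sqrtr_ge0//; apply: L2norm_ler => //; first exact: L2norm_ge0.
rewrite e2 L2norm_sqr// add0r subrK; apply: Rint_mono_oo => //.
by move=> s; exact: sqr_ge0.
Qed.

End SquareIntegrable.

(** * Regularity and Green's formula on an edge *)

Section CausalSolutions.
Context {R : realType}.
Local Notation mu := (@lebesgue_measure R).
Implicit Types (U V : R -> R -> R) (f q A B : R -> R).
Implicit Types (x y z t r s a b c e k m L M K : R).

Definition ucont U := continuous (fun p : R * R => U p.1 p.2).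

Lemma ucont_comp U (f g : R -> R -> R) : ucont U -> ucont f -> ucont g ->
  ucont (fun y t => U (f y t) (g y t)).
Proof.
move=> cU cf cg p; have h := pair_cvg (nbhs_filter p) (cf p) (cg p).
exact: (cvg_comp _ _ h (cU (f p.1 p.2, g p.1 p.2))).
Qed.

Lemma ucont_fst : ucont (fun y t => y).
Proof. by move=> p; exact: (@cvg_fst _ _ (nbhs p.1) (nbhs p.2) _). Qed.

Lemma ucont_snd : ucont (fun y t => t).
Proof. by move=> p; exact: (@cvg_snd _ _ (nbhs p.1) (nbhs p.2) _). Qed.

Lemma ucont_swap U : ucont U -> ucont (fun t z => U z t).
Proof. by move=> cU; exact: (ucont_comp cU ucont_snd ucont_fst). Qed.

Lemma ucont_cst k : ucont (fun y t => k).
Proof. by move=> p; exact: cvg_cst. Qed.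

Lemma ucontD U V : ucont U -> ucont V -> ucont (fun y t => U y t + V y t).
Proof. by move=> cU cV p; apply: cvgD; [exact: cU|exact: cV]. Qed.

Lemma ucontB U V : ucont U -> ucont V -> ucont (fun y t => U y t - V y t).
Proof. by move=> cU cV p; apply: cvgB; [exact: cU|exact: cV]. Qed.

Lemma ucontM U V : ucont U -> ucont V -> ucont (fun y t => U y t * V y t).
Proof. by move=> cU cV p; apply: cvgM; [exact: cU|exact: cV]. Qed.

Lemma ucont_aff U k m c (g : R -> R -> R) : ucont U ->
  (forall z s, g z s = k * z + m * s + c) -> ucont (fun z s => U z (g z s)).
Proof.
move=> uU e; apply: (ucont_comp uU ucont_fst).
have -> : g = (fun z s => k * z + m * s + c) by apply/funext => z; apply/funext => s.
apply: (@ucontD (fun z s => k * z + m * s) (fun _ _ => c)); last exact: ucont_cst.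
apply: (@ucontD (fun z s => k * z) (fun z s => m * s)).
  exact: (ucontM (@ucont_cst k) ucont_fst).
exact: (ucontM (@ucont_cst m) ucont_snd).
Qed.

Lemma ucont_half (e : R) U V : ucont U -> ucont V ->
  ucont (fun z s => (U z s + e * V z s) / 2).
Proof.
move=> uU uV.
exact: (ucontM (ucontD uU (ucontM (@ucont_cst e) uV)) (@ucont_cst 2^-1)).
Qed.

Lemma ucont_f f U : continuous f -> ucont U -> ucont (fun y t => f (U y t)).
Proof. by move=> cf cU p; exact: (cvg_comp _ _ (cU p) (cf (U p.1 p.2))). Qed.

Lemma ucont_meas U : ucont U -> measurable_fun setT (fun p : R * R => U p.1 p.2).
Proof. exact: continuous_measurable2. Qed.

Lemma ucont_sec U z : ucont U -> continuous (U z).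
Proof.
move=> cU t.
have h : (fun s : R => (z, s)) @ nbhs t --> (z, t).
  by apply: pair_cvg; [exact: cvg_cst|exact: cvg_id].
exact: (cvg_comp _ _ h (cU (z, t))).
Qed.

Lemma ucont_intg U z a b : ucont U -> intg `]a, b[ (U z).
Proof. by move=> /(@ucont_sec U z); exact: continuous_intg. Qed.

Lemma continuous_bnd f a b : continuous f -> exists M, forall s, a <= s <= b -> `|f s| <= M.
Proof.
move=> cf; have [ab|ba] := leP a b; last first.
  by exists 0 => s /andP[h1 h2]; have := le_lt_trans (le_trans h1 h2) ba; rewrite ltxx.
have cn : {within `[a, b], continuous (fun s => `|f s|)}.
  apply: continuous_subspaceT => s.
  by apply: (cvg_comp _ _ (cf s)); exact: norm_continuous.
have [c _ hc] := EVT_max ab cn; exists (`|f c|) => s hs; exact: hc.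
Qed.

Lemma ucont_bnd U a b c d : ucont U ->
  exists2 M, 0 <= M & forall z s, a <= z <= b -> c <= s <= d -> `|U z s| <= M.
Proof.
move=> cU.
pose f (p : R * R) := `|U p.1 p.2|.
have cf : continuous f.
  by move=> p; apply: (cvg_comp _ _ (cU p)); exact: norm_continuous.
have K : compact (`[a, b] `*` `[c, d] : set (R * R)).
  by apply: compact_setX; exact: segment_compact.
have /compact_bounded [M [_ hM]] : compact (f @` (`[a, b] `*` `[c, d])).
  by apply: continuous_compact => //; exact: continuous_subspaceT.
exists (`|M| + 1); first by rewrite addr_ge0.
move=> z s hz hs.
have h : f (z, s) \in f @` (`[a, b] `*` `[c, d]).
  by rewrite inE; exists (z, s) => //; split; rewrite /= in_itv.
move: (hM (`|M| + 1)); rewrite ltr_pwDr// ?ler_norm// => /(_ isT (f (z, s))).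
rewrite -inE => /(_ h).
by rewrite /f/= normr_id.
Qed.

(** The tube lemma: compactness of [a, b] makes the neighbourhood of z0 independent of s. *)
Lemma ucont_unif U z0 a b e : ucont U -> 0 < e ->
  \forall z \near z0, forall s, a <= s <= b -> `|U z s - U z0 s| < e.
Proof.
move=> cU e0.
have K : compact `[a, b] by exact: segment_compact.
pose P z s := `|U z s - U z0 s| < e.
have nP : forall s, `[a, b]%classic s ->
    \forall s' \near s & z \near z0, P z s'.
  move=> s _.
  have cV : ucont (fun s z => U z s - U z0 s).
    apply: ucontB; first exact: ucont_swap.
    by apply: (ucont_comp cU); [exact: ucont_cst|exact: ucont_fst].
  have /cvgrPdist_lt /(_ e e0) := cV (s, z0).
  by apply: filterS => p /=; rewrite subrr sub0r normrN.
have := (compact_near_coveringP `[a, b]%classic).1 K R (nbhs z0) P _ nP.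
move=> /(_ (nbhs_filter z0)).
by apply: filterS => z hz s hs; apply: hz; rewrite /= in_itv.
Qed.

Definition tprim U z t := prim (U z) t.

Lemma tprim_lip U z t t' a b M : (forall a b, intg `]a, b[ (U z)) ->
  a <= t <= b -> a <= t' <= b -> (forall s, a <= s <= b -> `|U z s| <= M) -> 0 <= a ->
  `|tprim U z t - tprim U z t'| <= M * `|t - t'|.
Proof.
move=> hU; wlog tt' : t t' / t <= t'.
  move=> wl h1 h2 h3 h4; have [tt'|/ltW tt'] := leP t t'; first exact: wl.
  by rewrite distrC [`|t - _|]distrC; apply: wl.
move=> /andP[at_ tb] /andP[at' tb'] hM a0.
rewrite distrC /tprim (primB (hU 0 t') (le_trans a0 at_) tt' (lexx _)).
rewrite [`|t - t'|]distrC (ger0_norm (_ : 0 <= t' - t)) ?subr_ge0//.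
apply: (Rint_bnd tt' (hU t t')) => s /andP[s1 s2].
by apply: hM; rewrite (le_trans at_ (ltW s1)) (le_trans (ltW s2)).
Qed.

Lemma tprim_ucont U : ucont U -> ucont (tprim U).
Proof.
move=> cU [z0 t0]; apply/cvgrPdist_lt => e e0 /=.
have iU z a b : intg `]a, b[ (U z) by exact: ucont_intg.
pose b := `|t0| + 1.
have b0 : 0 < b by rewrite ltr_wpDl.
have e2 : 0 < e / 2 / b by rewrite !divr_gt0.
have := @ucont_unif U z0 0 b _ cU e2.
have [M M0 hM] := @ucont_bnd U z0 z0 0 b cU.
have M1 : 0 < M + 1 by rewrite ltr_wpDl.
move=> N; exists ([set z | forall s, 0 <= s <= b -> `|U z s - U z0 s| < e / 2 / b],
  ball t0 (Num.min 1 (e / 2 / (M + 1)))).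
  by split=> //; apply: nbhsx_ballx; rewrite lt_min ltr01/= !divr_gt0.
move=> [z t] /= [hz ht].
have ht1 : `|t0 - t| < 1 by move: ht; rewrite /ball/= lt_min => /andP[].
have ht2 : `|t0 - t| < e / 2 / (M + 1) by move: ht; rewrite /ball/= lt_min => /andP[].
(* Primitives vanish at negative times, so t0 and t may be replaced by their positive parts, which
   lie in [0, b]. *)
have max_prim x : tprim U z x = tprim U z (Num.max x 0) /\
    tprim U z0 x = tprim U z0 (Num.max x 0).
  by case: (leP x 0) => // x0; rewrite /tprim /prim !Rint_empty.
have [_ ->] := max_prim t0; have [-> _] := max_prim t.
set T0 := Num.max t0 0; set T1 := Num.max t 0.
have hb0 : 0 <= T0 <= b.
  by rewrite /T0 le_max lexx orbT ge_max (ltW b0) /b;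
    have := ler_norm t0; rewrite andbT => h; lra.
have hb1 : 0 <= T1 <= b.
  rewrite /T1 le_max lexx orbT ge_max (ltW b0) /b andbT/=.
  have := ler_norm t0; have := ler_norm (t - t0); rewrite distrC; lra.
have hT : `|T0 - T1| <= `|t0 - t| by exact: max_lip.
have -> : tprim U z0 T0 - tprim U z T1 =
  (tprim U z0 T0 - tprim U z0 T1) + (tprim U z0 T1 - tprim U z T1).
  by rewrite addrA subrK.
have -> : e = e / 2 + e / 2 by field.
apply: le_lt_trans (ler_normD _ _) _; apply: ltr_leD.
  apply: le_lt_trans (@tprim_lip U z0 T0 T1 0 b M _ _ _ _ _) _ => //.
    by move=> s hs; apply: hM => //; rewrite lexx.
  apply: (@le_lt_trans _ _ ((M + 1) * `|t0 - t|)).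
    by apply: ler_pM => //; rewrite lerDl.
  by rewrite mulrC -ltr_pdivlMr.
have /andP[T10 T1b] := hb1.
rewrite /tprim /prim -Rint_B; [|exact: measurable_itv|exact: iU|exact: iU].
apply: le_trans (@Rint_bnd _ _ _ _ (e / 2 / b) T10 _ _) _.
- by apply: intgB; [exact: measurable_itv|exact: iU|exact: iU].
- move=> s /andP[s0 sT]; rewrite distrC ltW// hz// (ltW s0)/=.
  exact: le_trans (ltW sT) T1b.
rewrite subr0; apply: (@le_trans _ _ (e / 2 / b * b)).
  by rewrite ler_wpM2l// ltW.
by rewrite divfK// gt_eqF.
Qed.

(** At rest up to time 0: on such functions the truncated [prim] is a genuine primitive on the whole
    line. *)
Definition cz f := (forall a b, intg `]a, b[ f) /\ forall s, s <= 0 -> f s = 0.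

Lemma cz_prim_diff f a b : cz f -> a <= b ->
  prim f b - prim f a = \int[mu]_(s in `]a, b[) f s.
Proof.
move=> [hf f0] ab; have [a0|/ltW a0] := leP 0 a; first exact: (primB (hf 0 b)).
have z c : c <= 0 -> \int[mu]_(s in `]a, c[) f s = 0.
  move=> c0; rewrite -(@Rint_zero R `]a, c[); apply: eq_Rint => s.
  by rewrite /= in_itv/= => /andP[_ sc]; rewrite f0// ltW// (lt_le_trans sc).
rewrite {2}/prim (Rint_empty _ a0) subr0.
have [b0|/ltW b0] := leP b 0; first by rewrite (z b b0) /prim Rint_empty.
by rewrite (Rint_split a0 b0)// z// add0r.
Qed.

Lemma cz_shift f c z y : cz f -> z <= y ->
  intg `]z, y[ (fun s => f (s + c)) /\
  \int[mu]_(s in `]z, y[) f (s + c) = prim f (y + c) - prim f (z + c).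
Proof.
move=> cf zy; have [h1 h2] := @Rint_shift_oo _ f z y c (cf.1 _ _).
by split=> //; rewrite h2 cz_prim_diff// lerD2r.
Qed.

Lemma cz_refl f c z y : cz f -> z <= y ->
  intg `]z, y[ (fun s => f (c - s)) /\
  \int[mu]_(s in `]z, y[) f (c - s) = prim f (c - z) - prim f (c - y).
Proof.
move=> cf zy; have [h1 h2] := @Rint_refl_oo _ f z y c (cf.1 _ _).
by split=> //; rewrite h2 cz_prim_diff// lerD2l lerN2.
Qed.

Lemma prim_vanish f t : (forall s, s <= t -> f s = 0) -> prim f t = 0.
Proof.
move=> f0; rewrite -(@Rint_zero R `]0, t[); apply: eq_Rint => s.
by rewrite /= in_itv/= => /andP[_ st]; rewrite f0// ltW.
Qed.

Definition vanish L f := forall s, s <= L -> f s = 0.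

Lemma vanish_prim L f : vanish L f -> vanish L (prim f).
Proof. by move=> vf s sL; apply: prim_vanish => r rs; apply: vf; exact: le_trans rs sL. Qed.

Lemma vanish_cz L f : 0 <= L -> (forall a b, intg `]a, b[ f) -> vanish L f -> cz f.
Proof. by move=> L0 hf vf; split=> // s s0; apply: vf; exact: le_trans L0. Qed.

(** Finite speed of propagation: the controls act at y = L from time 0 on, and depth z is at
    distance L - z from there. *)
Definition causal L U := forall z s, 0 <= z <= L -> s <= L - z -> U z s = 0.

Lemma causal_tprim L U : causal L U -> causal L (tprim U).
Proof.
by move=> cU z s hz hs; apply: prim_vanish => r rs; apply: cU hz _; exact: le_trans hs.
Qed.

Lemma causal_cz L U z : ucont U -> causal L U -> 0 <= z <= L -> cz (U z).
Proof.
move=> uU cU hz; split=> [a b|s s0]; first exact: ucont_intg.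
by apply: cU => //; apply: (le_trans s0); rewrite subr_ge0; case/andP: hz.
Qed.

Lemma avg_tprim L U z t r : ucont U -> causal L U -> 0 <= z <= L -> 0 <= r ->
  avg U z t r = (tprim U z (t + r) - tprim U z (t - r)) / 2.
Proof.
move=> uU cU hz r0; rewrite /avg /tprim cz_prim_diff//; last by lra.
exact: causal_cz cU hz.
Qed.

Section Edge.
Variables (q : R -> R) (L : R).
Hypothesis pq : potential q L.

(* For t >= 0 the potential term of a causal U is Sm (tprim U); its derivatives in y and
   in t are Sp U and Sm U. *)
Definition Sp U y t := \int[mu]_(z in `]0, y[)
  (q z * ((U z (t + (y - z)) + U z (t - (y - z))) / 2)).
Definition Sm U y t := \int[mu]_(z in `]0, y[)
  (q z * ((U z (t + (y - z)) - U z (t - (y - z))) / 2)).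

Definition edge_eq U A B := forall y t, 0 <= y <= L -> 0 <= t ->
  U y t = A (t + y) + B (t - y) + Sm (tprim U) y t.

Lemma Sm_avg U y t : ucont U -> causal L U -> 0 <= y <= L ->
  \int[mu]_(z in `]0, y[) (q z * avg U z t (y - z)) = Sm (tprim U) y t.
Proof.
move=> uU cU /andP[y0 yL]; apply: eq_Rint => z; rewrite /= in_itv/= => /andP[z0 zy].
rewrite (avg_tprim t uU cU)//; first by rewrite (ltW z0)/= (le_trans (ltW zy)).
by rewrite subr_ge0 ltW.
Qed.

Lemma ucont_p U y : ucont U -> ucont (fun z s => U z (s + (y - z))).
Proof. by move=> uU; apply: (@ucont_aff _ (-1) 1 y) => // z s; ring. Qed.

Lemma ucont_m U y : ucont U -> ucont (fun z s => U z (s - (y - z))).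
Proof. by move=> uU; apply: (@ucont_aff _ 1 1 (- y)) => // z s; ring. Qed.

(** One statement for both [Sp] (e = 1) and [Sm] (e = -1). *)
Lemma fubini_pm U y t e : `|e| <= 1 -> ucont U -> 0 <= y <= L -> 0 <= t ->
  [/\ forall s, 0 < s < t -> intg `]0, y[
        (fun z => q z * ((U z (s + (y - z)) + e * U z (s - (y - z))) / 2)),
     intg `]0, t[ (fun s => \int[mu]_(z in `]0, y[)
       (q z * ((U z (s + (y - z)) + e * U z (s - (y - z))) / 2))) &
  \int[mu]_(s in `]0, t[) \int[mu]_(z in `]0, y[)
       (q z * ((U z (s + (y - z)) + e * U z (s - (y - z))) / 2)) =
  \int[mu]_(z in `]0, y[) (q z * \int[mu]_(s in `]0, t[)
       ((U z (s + (y - z)) + e * U z (s - (y - z))) / 2))].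
Proof.
move=> he uU /andP[y0 yL] t0; have [L0 iq q0] := pq.
have [M M0 hM] := @ucont_bnd U 0 L (- L) (t + L) uU.
have mk : measurable_fun setT (fun p : R * R =>
    (U p.1 (p.2 + (y - p.1)) + e * U p.1 (p.2 - (y - p.1))) / 2).
  apply: (@ucont_meas (fun z s => (U z (s + (y - z)) + e * U z (s - (y - z))) / 2)).
  exact: (ucont_half (@ucont_p _ y uU) (@ucont_m _ y uU)).
have bk z s : 0 < z < y -> 0 < s < t ->
    `|(U z (s + (y - z)) + e * U z (s - (y - z))) / 2| <= M.
  move=> /andP[z0 zy] /andP[s0 st].
  rewrite normrM (ger0_norm (_ : 0 <= 2^-1))// ler_pdivrMr//.
  have hz : 0 <= z <= L by apply/andP; split; lra.
  have h1 : `|U z (s + (y - z))| <= M by apply: hM => //; apply/andP; split; lra.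
  have h2 : `|U z (s - (y - z))| <= M by apply: hM => //; apply/andP; split; lra.
  apply: le_trans (ler_normD _ _) _; rewrite normrM.
  have := ler_pM (normr_ge0 e) (normr_ge0 _) he h2; rewrite mul1r; lra.
by have [h1 h2 _ h4] := fubini_rect (intgT_oo 0 y iq) mk bk M0.
Qed.

(** The lower limits contribute nothing: y - z <= L - z, and there causality makes the primitive
    vanish. *)
Lemma int_pm U z y t e : ucont U -> causal L U -> 0 < z < y -> y <= L -> 0 <= t ->
  \int[mu]_(s in `]0, t[) ((U z (s + (y - z)) + e * U z (s - (y - z))) / 2) =
  (tprim U z (t + (y - z)) + e * tprim U z (t - (y - z))) / 2.
Proof.
move=> uU cU /andP[z0 zy] yL t0.
have hz : 0 <= z <= L by apply/andP; split; lra.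
have [i1 e1] := cz_shift (y - z) (causal_cz uU cU hz) t0.
have [i2 e2] := cz_shift (- (y - z)) (causal_cz uU cU hz) t0.
rewrite Rint_Zr; [|exact: measurable_itv|]; last first.
  by apply: intgD => //; exact: intgZ.
rewrite Rint_D//; last exact: intgZ.
rewrite Rint_Zl// e1 e2.
have cW := causal_tprim cU.
rewrite add0r (_ : prim (U z) (y - z) = 0); last by apply: cW => //; lra.
rewrite add0r (_ : prim (U z) (- (y - z)) = 0); last by apply: cW => //; lra.
by rewrite !subr0.
Qed.

Lemma Sp_prim U y t : ucont U -> causal L U -> 0 <= y <= L -> 0 <= t ->
  [/\ intg `]0, t[ (Sp U y) & Sp (tprim U) y t = prim (Sp U y) t].
Proof.
move=> uU cU hy t0; have h1 : `|1 : R| <= 1 by rewrite normr1.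
have [_ i1 FF] := fubini_pm h1 uU hy t0.
have E s : Sp U y s = \int[mu]_(z in `]0, y[)
   (q z * ((U z (s + (y - z)) + 1 * U z (s - (y - z))) / 2)).
  by apply: eq_Rint => z _; rewrite mul1r.
split; first by apply: eq_intg i1; [exact: measurable_itv|move=> s _; rewrite E].
rewrite /prim; under [RHS]eq_Rintegral do rewrite E.
rewrite FF; apply: eq_Rint => z; rewrite /= in_itv/= => hz.
by rewrite int_pm// ?mul1r//; case/andP: hy.
Qed.

Lemma Sm_prim U y t : ucont U -> causal L U -> 0 <= y <= L -> 0 <= t ->
  [/\ intg `]0, t[ (Sm U y) & Sm (tprim U) y t = prim (Sm U y) t].
Proof.
move=> uU cU hy t0; have h1 : `|-1 : R| <= 1 by rewrite normrN1.
have [_ i1 FF] := fubini_pm h1 uU hy t0.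
have E s : Sm U y s = \int[mu]_(z in `]0, y[)
   (q z * ((U z (s + (y - z)) + (-1) * U z (s - (y - z))) / 2)).
  by apply: eq_Rint => z _; rewrite mulN1r.
split; first by apply: eq_intg i1; [exact: measurable_itv|move=> s _; rewrite E].
rewrite /prim; under [RHS]eq_Rintegral do rewrite E.
rewrite FF; apply: eq_Rint => z; rewrite /= in_itv/= => hz.
by rewrite int_pm// ?mulN1r//; case/andP: hy.
Qed.

(** The values at time 0 vanish by causality, so d'Alembert's formula passes to time primitives.
    Each application gains one derivative. *)
Lemma edge_eq_prim U A B : ucont U -> causal L U ->
  (forall a b, intg `]a, b[ A) -> (forall a b, intg `]a, b[ B) ->
  vanish L A -> vanish L B ->
  edge_eq U A B -> edge_eq (tprim U) (prim A) (prim B).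
Proof.
move=> uU cU iA iB vA vB eU y t hy t0; have [L0 iq q0] := pq.
have cA := vanish_cz L0 iA vA; have cB := vanish_cz L0 iB vB.
have uW := tprim_ucont uU; have cW := causal_tprim cU.
have [iS ->] := Sm_prim uW cW hy t0.
have [i1 e1] := cz_shift y cA t0; have [i2 e2] := cz_shift (- y) cB t0.
have /andP[y0 yL] := hy.
have vy : 0 + y <= L by rewrite add0r.
have vy' : 0 - y <= L by lra.
rewrite (vanish_prim vA vy) subr0 in e1; rewrite (vanish_prim vB vy') subr0 in e2.
rewrite -e1 -e2 /prim -Rint_D; [|exact: measurable_itv|exact: i1|exact: i2].
rewrite -Rint_D; [|exact: measurable_itv|exact: intgD|exact: iS].
by apply: eq_Rint => s; rewrite /= in_itv/= => /andP[s0 _]; rewrite eU// ltW.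
Qed.

Lemma cone_itv z s y b t : 0 < z -> z < s -> s < y -> y <= b ->
  [/\ 0 <= z <= b, t - b <= t + (s - z) <= t + b & t - b <= t - (s - z) <= t + b].
Proof. by move=> z0 zs sy yb; split; apply/andP; split; lra. Qed.

(** With W = [tprim U], the conclusions say W_y = [Y] and W_yy = W_tt + q W, the first three terms
    of the last derivative being W_tt. They are stated for the primitive because A and B are merely
    integrable. *)
Lemma edge_reg U A B t : ucont U -> causal L U -> cz A -> cz B ->
  edge_eq (tprim U) (prim (prim A)) (prim (prim B)) ->
  (forall a b, intg `]a, b[ (prim A)) -> (forall a b, intg `]a, b[ (prim B)) ->
  0 <= t ->
  let Y y := prim A (t + y) - prim B (t - y) + Sp (tprim U) y t in
  AC_deriv L (fun y => tprim U y t) Y /\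
  AC_deriv L Y (fun y => A (t + y) + B (t - y) + Sm U y t + q y * tprim U y t).
Proof.
move=> uU cU cA cB eW ipA ipB t0 Y; have [L0 iq q0] := pq.
have uW := tprim_ucont uU; have cW := causal_tprim cU.
have czp f : cz f -> (forall a b, intg `]a, b[ (prim f)) -> cz (prim f).
  move=> cf hf; split=> // s s0; apply: prim_vanish => r rs.
  by apply: cf.2; exact: le_trans s0.
have cpA := czp _ cA ipA; have cpB := czp _ cB ipB.
have [M M0 hM] := @ucont_bnd (tprim U) 0 L (t - L) (t + L) uW.
have [N N0 hN] := @ucont_bnd U 0 L (t - L) (t + L) uU.
(* [k1] and [k2] are the y-derivatives of the kernels of [Sm (tprim (tprim U))] and [Sp (tprim U)].
   On the diagonal the first kernel is 0 and the second is [tprim U z t], which produces the term q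
   W. *)
pose k1 z s := (tprim U z (t + (s - z)) + tprim U z (t - (s - z))) / 2.
pose k2 z s := (U z (t + (s - z)) - U z (t - (s - z))) / 2.
have ups V : ucont V -> ucont (fun z s => V z (t + (s - z))).
  by move=> uV; apply: (@ucont_aff _ (-1) 1 t) => // z s; ring.
have ums V : ucont V -> ucont (fun z s => V z (t - (s - z))).
  by move=> uV; apply: (@ucont_aff _ 1 (-1) t) => // z s; ring.
have mk1 : measurable_fun setT (fun p : R * R => k1 p.1 p.2).
  have := ucont_meas (@ucont_half 1 _ _ (ups _ uW) (ums _ uW)).
  by apply: eq_measurable_fun => p _; rewrite mul1r.
have mk2 : measurable_fun setT (fun p : R * R => k2 p.1 p.2).
  have := ucont_meas (@ucont_half (-1) _ _ (ups _ uU) (ums _ uU)).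
  by apply: eq_measurable_fun => p _; rewrite mulN1r.
have bk1 y z s : y <= L -> 0 < z -> z < s -> s < y -> `|k1 z s| <= M.
  move=> yL z0 zs sy; rewrite /k1 normrM (ger0_norm (_ : 0 <= 2^-1))// ler_pdivrMr//.
  apply: le_trans (ler_normD _ _) _.
  have h1 : `|tprim U z (t + (s - z))| <= M by apply: hM; have [] := cone_itv t z0 zs sy yL.
  have h2 : `|tprim U z (t - (s - z))| <= M by apply: hM; have [] := cone_itv t z0 zs sy yL.
  by rewrite mulr_natr mulr2n lerD.
have bk2 y z s : y <= L -> 0 < z -> z < s -> s < y -> `|k2 z s| <= N.
  move=> yL z0 zs sy; rewrite /k2 normrM (ger0_norm (_ : 0 <= 2^-1))// ler_pdivrMr//.
  apply: le_trans (ler_normB _ _) _.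
  have h1 : `|U z (t + (s - z))| <= N by apply: hN; have [] := cone_itv t z0 zs sy yL.
  have h2 : `|U z (t - (s - z))| <= N by apply: hN; have [] := cone_itv t z0 zs sy yL.
  by rewrite mulr_natr mulr2n lerD.
have mk0 : measurable_fun setT (fun z => tprim U z t).
  by apply: continuous_measurable_fun; exact: (@ucont_sec _ t (ucont_swap uW)).
have bk0 y z : y <= L -> 0 < z < y -> `|tprim U z t| <= M.
  move=> yL /andP[z0 zy]; apply: hM; first by rewrite (ltW z0) (le_trans (ltW zy)).
  by rewrite gerBl lerDl L0.
have E1 z y : 0 < z -> z < y -> y <= L ->
    0 + \int[mu]_(s in `]z, y[) k1 z s =
    (tprim (tprim U) z (t + (y - z)) - tprim (tprim U) z (t - (y - z))) / 2.
  move=> z0 zy yL; have hz : 0 <= z <= L by rewrite (ltW z0) (le_trans (ltW zy)).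
  have cz1 := causal_cz uW cW hz.
  have [i1 e1] := cz_shift (t - z) cz1 (ltW zy).
  have [i2 e2] := cz_refl (t + z) cz1 (ltW zy).
  have S1 s : tprim U z (t + (s - z)) = tprim U z (s + (t - z)).
    by congr (tprim _ _ _); ring.
  have S2 s : tprim U z (t - (s - z)) = tprim U z (t + z - s).
    by congr (tprim _ _ _); ring.
  rewrite /k1; under eq_Rintegral do rewrite S1 S2.
  rewrite Rint_Zr; [|exact: measurable_itv|exact: intgD].
  rewrite Rint_D// e1 e2 add0r /tprim.
  rewrite (_ : y + (t - z) = t + (y - z)); last by ring.
  rewrite (_ : z + (t - z) = t); last by ring.
  rewrite (_ : t + z - z = t); last by ring.
  rewrite (_ : t + z - y = t - (y - z)); last by ring.
  move: (prim _ _) (prim _ t) (prim _ _) => a b c; ring.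
have E2 z y : 0 < z -> z < y -> y <= L ->
    tprim U z t + \int[mu]_(s in `]z, y[) k2 z s =
    (tprim U z (t + (y - z)) + tprim U z (t - (y - z))) / 2.
  move=> z0 zy yL; have hz : 0 <= z <= L by rewrite (ltW z0) (le_trans (ltW zy)).
  have cz1 := causal_cz uU cU hz.
  have [i1 e1] := cz_shift (t - z) cz1 (ltW zy).
  have [i2 e2] := cz_refl (t + z) cz1 (ltW zy).
  have S1 s : U z (t + (s - z)) = U z (s + (t - z)) by congr (U _ _); ring.
  have S2 s : U z (t - (s - z)) = U z (t + z - s) by congr (U _ _); ring.
  rewrite /k2; under eq_Rintegral do rewrite S1 S2.
  rewrite Rint_Zr; [|exact: measurable_itv|exact: intgB].
  rewrite Rint_B// e1 e2 /tprim.
  rewrite (_ : y + (t - z) = t + (y - z)); last by ring.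
  rewrite (_ : z + (t - z) = t); last by ring.
  rewrite (_ : t + z - z = t); last by ring.
  rewrite (_ : t + z - y = t - (y - z)); last by ring.
  set a := prim (U z) t; set b := prim (U z) (t + (y - z)).
  by set c := prim (U z) (t - (y - z)); move: a b c => a b c; field.
have L1 y : 0 <= y <= L -> intg `]0, y[ (fun s => Sp (tprim U) s t) /\
  Sm (tprim (tprim U)) y t = prim (fun s => Sp (tprim U) s t) y.
  move=> /andP[y0 yL].
  have [_ i2] := @leibniz R q (fun=> 0) k1 M y iq (measurable_cst _)
    (fun z _ => (eq_ind_r (fun x => x <= M) M0 (normr0 _))) mk1
    (fun z s h1 h2 h3 => bk1 y z s yL h1 h2 h3) M0 y0.
  move=> FF; split; first exact: i2.
  rewrite /prim -[RHS]add0r.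
  have Z : \int[mu]_(z in `]0, y[) (q z * 0) = 0.
    apply: (etrans _ (@Rint_zero R `]0, y[)).
    by apply: eq_Rint => z _; rewrite mulr0.
  rewrite -{1}Z -FF; apply: eq_Rint => z; rewrite /= in_itv/= => /andP[z0 zy].
  by rewrite E1.
have hMM : M <= Num.max M N by rewrite le_max lexx.
have hNN : N <= Num.max M N by rewrite le_max lexx orbT.
have L2 y : 0 <= y <= L -> [/\ intg `]0, y[ (fun z => q z * tprim U z t),
    intg `]0, y[ (fun s => Sm U s t) &
    Sp (tprim U) y t = prim (fun z => q z * tprim U z t) y + prim (fun s => Sm U s t) y].
  move=> /andP[y0 yL].
  have [i1 i2 FF] := @leibniz R q (fun z => tprim U z t) k2 (Num.max M N) y iq mk0
    (fun z h => le_trans (bk0 y z yL h) hMM) mk2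
    (fun z s h1 h2 h3 => le_trans (bk2 y z s yL h1 h2 h3) hNN)
    (le_trans M0 hMM) y0.
  split=> //; rewrite /prim -FF.
  apply: eq_Rint => z; rewrite /= in_itv/= => /andP[z0 zy].
  by rewrite E2.
have LL : 0 <= L <= L by rewrite L0 lexx.
have shA f y : cz f -> 0 <= y -> intg `]0, y[ (fun s => f (t + s)) /\
  prim f (t + y) = prim f t + prim (fun s => f (t + s)) y.
  move=> cf y0; have [i1 e1] := cz_shift t cf y0.
  have S s : f (s + t) = f (t + s) by rewrite addrC.
  split; first by apply: eq_intg i1; [exact: measurable_itv|move=> s _; exact: S].
  have -> : prim (fun s => f (t + s)) y = \int[mu]_(s in `]0, y[) f (s + t).
    by apply: eq_Rint => s _; rewrite addrC.
  rewrite e1 add0r [y + t]addrC.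
  by move: (prim f t) (prim f _) => a b; ring.
have shB f y : cz f -> 0 <= y -> intg `]0, y[ (fun s => f (t - s)) /\
  prim f (t - y) = prim f t - prim (fun s => f (t - s)) y.
  move=> cf y0; have [i1 e1] := cz_refl t cf y0.
  have E : prim (fun s => f (t - s)) y = prim f (t - 0) - prim f (t - y) := e1.
  split; first exact: i1.
  rewrite E subr0; move: (prim f t) (prim f _) => a b; ring.
split; apply/AC_derivP; split.
- have [iA _] := shA _ L cpA L0; have [iB _] := shB _ L cpB L0.
  apply: intgD; [exact: measurable_itv|exact: intgB|exact: (L1 L LL).1].
- move=> y hy; have /andP[y0 yL] := hy.
  have [iA eA] := shA _ y cpA y0; have [iB eB] := shB _ y cpB y0.
  have [iS eS] := L1 y hy.
  rewrite (eW y t hy t0) (eW 0 t)// ?lexx// addr0 subr0 eA eB eS.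
  have -> : Sm (tprim (tprim U)) 0 t = 0 by rewrite /Sm Rint_empty.
  have -> : prim Y y = prim (fun s => prim A (t + s)) y -
      prim (fun s => prim B (t - s)) y + prim (fun s => Sp (tprim U) s t) y.
    by rewrite {1}/prim Rint_D ?Rint_B//; exact: intgB.
  move: (prim _ y) (prim _ y) (prim _ y) (prim _ t) (prim _ t) => a b c d f.
  ring.
- have [iA _] := shA _ L cA L0; have [iB _] := shB _ L cB L0.
  have [iq1 iS _] := L2 L LL.
  apply: intgD; [exact: measurable_itv| |exact: iq1].
  apply: intgD; [exact: measurable_itv|exact: intgD|exact: iS].
- move=> y hy; have /andP[y0 yL] := hy.
  have [iA eA] := shA _ y cA y0; have [iB eB] := shB _ y cB y0.
  have [iq1 iS eS] := L2 y hy.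
  rewrite /Y addr0 subr0 eA eB eS.
  have -> : Sp (tprim U) 0 t = 0 by rewrite /Sp Rint_empty.
  have -> : prim (fun y => A (t + y) + B (t - y) + Sm U y t + q y * tprim U y t) y =
     prim (fun s => A (t + s)) y + prim (fun s => B (t - s)) y +
     prim (fun s => Sm U s t) y + prim (fun z => q z * tprim U z t) y.
    rewrite {1}/prim Rint_D//; last by apply: intgD => //; exact: intgD.
    by rewrite Rint_D//; [rewrite Rint_D|exact: intgD].
  move: (prim _ y) (prim _ y) (prim _ y) (prim _ y) (prim _ t) (prim _ t) => a b c d f g.
  ring.
Qed.

(** Two integrations by parts applied to W = [tprim U] through [edge_reg]; the left side is the
    pairing of W_tt with phi. *)
Lemma green_edge U A B t (phi phi' phi'' : R -> R) : ucont U -> causal L U ->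
  cz A -> cz B ->
  edge_eq (tprim U) (prim (prim A)) (prim (prim B)) ->
  (forall a b, intg `]a, b[ (prim A)) -> (forall a b, intg `]a, b[ (prim B)) ->
  0 <= t -> AC_deriv L phi phi' -> AC_deriv L phi' phi'' ->
  \int[mu]_(y in `]0, L[) ((A (t + y) + B (t - y) + Sm U y t) * phi y) =
  (prim A (t + L) - prim B (t - L) + Sp (tprim U) L t) * phi L
  - tprim U L t * phi' L - (prim A t - prim B t) * phi 0 + tprim U 0 t * phi' 0
  - \int[mu]_(y in `]0, L[) (tprim U y t * (- phi'' y + q y * phi y)).
Proof.
move=> uU cU cA cB eW ipA ipB t0 hphi hphi'; have [L0 iq q0] := pq.
have [hU hY] := edge_reg uU cU cA cB eW ipA ipB t0.
set Y := (fun y => prim A (t + y) - prim B (t - y) + Sp (tprim U) y t) in hU hY.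
set Y' := (fun y => _ + _ * _) in hY.
have P1 := AC_by_parts L0 hY hphi; have P2 := AC_by_parts L0 hU hphi'.
have [i1 i2 _] := P1; have [i3 i4 _] := P2.
have iqUp : intg `]0, L[ (fun y => q y * (tprim U y t * phi y)).
  have [M hM] := AC_bnd hU; have [N hN] := AC_bnd hphi.
  apply: (@intg_mulb _ _ _ _ (M * N)); first exact: measurable_itv.
  - exact: intgT_oo.
  - by apply: measurable_funM; [exact: (AC_meas L0 hU)|exact: (AC_meas L0 hphi)].
  move=> y; rewrite /= in_itv/= => /andP[y0 yL].
  have hy : 0 <= y <= L by rewrite !ltW.
  by rewrite normrM; apply: ler_pM => //; [exact: hM|exact: hN].
have mI : measurable `]0, L[%classic by exact: measurable_itv.
have -> : \int[mu]_(y in `]0, L[) (tprim U y t * (- phi'' y + q y * phi y)) =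
   \int[mu]_(y in `]0, L[) (q y * (tprim U y t * phi y)) -
   \int[mu]_(y in `]0, L[) (tprim U y t * phi'' y).
  rewrite -(Rint_B mI iqUp i4); apply: eq_Rint => y _; ring.
have -> : \int[mu]_(y in `]0, L[) ((A (t + y) + B (t - y) + Sm U y t) * phi y) =
   \int[mu]_(y in `]0, L[) (Y' y * phi y) -
   \int[mu]_(y in `]0, L[) (q y * (tprim U y t * phi y)).
  rewrite -(Rint_B mI i1 iqUp); apply: eq_Rint => y _; rewrite /Y'; ring.
case: P1 => _ _ ->; case: P2 => _ _ ->.
rewrite /Y addr0 subr0 (_ : Sp (tprim U) 0 t = 0); last by rewrite /Sp Rint_empty.
move: (Rintegral _ _ _) (Rintegral _ _ _) (Sp _ _ _) (tprim _ _ _) (tprim _ _ _) => a b c d f.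
move: (prim _ _) (prim _ _) (prim _ _) (prim _ _) => g h i j; ring.
Qed.

End Edge.

End CausalSolutions.

(** * Solutions on one edge with square-integrable boundary densities *)

Section Trajectory.
Context {R : realType}.
Local Notation mu := (@lebesgue_measure R).
Implicit Types (U V : R -> R -> R) (f q A B p : R -> R).
Implicit Types (x y z t r s a b c e k m L M K T H : R).

(** Vanishing up to L keeps the solution at rest at time 0; the upper end H makes the norm on (0, H)
    control shifts and primitives everywhere. Target functions on an edge are the case
    [density 0 L]. *)
Definition density L H p := sqi H p /\ forall t, ~~ (L < t < H) -> p t = 0.

Lemma density_ext L H p : 0 <= L -> density L H p ->
  p = (fun x => if 0 < x < H then p x else 0).
Proof.
move=> L0 [_ p0]; apply/funext => x; case: ifPn => // hx.
by apply: p0; apply: contra hx => /andP[h1 h2]; rewrite (le_lt_trans L0 h1).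
Qed.

Lemma density_intgT L H p : 0 <= L -> density L H p -> intg setT p.
Proof.
move=> L0 hp; rewrite (density_ext L0 hp); apply/intg_if.
by case: hp => /sqi_intg.
Qed.

Lemma density_sqrT L H p : 0 <= L -> density L H p ->
  intg setT (fun x => p x ^+ 2) /\
  \int[mu]_x p x ^+ 2 = \int[mu]_(x in `]0, H[) p x ^+ 2.
Proof.
move=> L0 hp; have e x : p x ^+ 2 = if 0 < x < H then p x ^+ 2 else 0.
  by rewrite {1}(density_ext L0 hp); case: ifP; rewrite // expr0n.
split; last by rewrite [RHS]Rint_if; apply: eq_Rint => x _; exact: e.
apply: (@eq_intg _ _ (fun x => if 0 < x < H then p x ^+ 2 else 0)) => //.
by apply/intg_if; case: hp => -[].
Qed.

Lemma density_cz L H p : 0 <= L -> density L H p -> cz p.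
Proof.
move=> L0 hp; split=> [a b|s s0]; first exact: intgT_oo (density_intgT L0 hp).
case: hp => _; apply; apply/negP => /andP[h1 h2].
by have := le_lt_trans (le_trans s0 L0) h1; rewrite ltxx.
Qed.

Lemma density_vanish L H p : density L H p -> vanish L p.
Proof.
move=> [_ p0] s sL; apply: p0; apply/negP => /andP[h1 h2].
by have := le_lt_trans sL h1; rewrite ltxx.
Qed.

Lemma density_lin L H k m p p' : density L H p -> density L H p' ->
  density L H (fun x => k * p x + m * p' x).
Proof.
move=> [hp p0] [hp' p0']; split; first exact: sqi_lin.
by move=> t ht; rewrite p0// p0'// !mulr0 addr0.
Qed.

Lemma density_holder L H p x y : 0 <= L -> 0 <= H -> density L H p ->
  `|prim p x - prim p y| <= Num.sqrt `|x - y| * L2norm H p.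
Proof.
move=> L0 H0 hp; wlog xy : x y / x <= y.
  move=> wl; have [xy|/ltW yx] := leP x y; first exact: wl.
  by rewrite distrC [`|x - y|]distrC; exact: wl.
have hc := density_cz L0 hp.
have cl t : prim p t = prim p (clamp H t).
  have [t0|/ltW t0] := leP t 0.
    by rewrite /clamp min_l ?(le_trans t0)// max_l// prim0 /prim Rint_empty.
  have [tH|/ltW Ht] := leP t H; first by rewrite clamp_id// t0 tH.
  rewrite /clamp min_r// max_r// /prim (Rint_split H0 Ht (hc.1 _ _)).
  have -> : \int[mu]_(s in `]H, t[) p s = 0; last by rewrite addr0.
  apply: (etrans _ (@Rint_zero R `]H, t[)); apply: eq_Rint => s.
  rewrite /= in_itv/= => /andP[sH _]; case: hp => _; apply.
  by apply/negP => /andP[_ h]; have := lt_trans h sH; rewrite ltxx.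
rewrite (cl x) (cl y) distrC.
have /andP[x0 xH] := clampP x H0; have /andP[y0 yH] := clampP y H0.
have cxy : clamp H x <= clamp H y.
  rewrite /clamp ge_max !le_max lexx/=; apply/orP; right.
  by rewrite le_min !ge_min xy lexx !orbT.
rewrite (primB (hc.1 0 H) x0 cxy yH).
have j := intgS_oo x0 yH (hc.1 0 H).
apply: le_trans (Rint_norm (measurable_itv _) j) _.
apply: le_trans (holder_half hp.1 x0 cxy yH) _.
rewrite ler_wpM2r ?L2norm_ge0// ler_wsqrtr// distrC.
by apply: le_trans (ler_norm _) _; exact: clamp_lip.
Qed.

Lemma density_bnd L H p x : 0 <= L -> 0 <= H -> density L H p ->
  `|prim p x| <= Num.sqrt H * L2norm H p.
Proof.
move=> L0 H0 hp; have hi := density_intgT L0 hp.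
apply: le_trans (L1_le_L2 H0 hp.1).
have [xH|/ltW Hx] := leP x H; first exact: prim_bnd (intgT_oo _ _ hi) _ _.
have -> : prim p x = prim p H.
  rewrite /prim (Rint_split H0 Hx (intgT_oo _ _ hi)).
  have -> : \int[mu]_(s in `]H, x[) p s = 0; last by rewrite addr0.
  apply: (etrans _ (@Rint_zero R `]H, x[)); apply: eq_Rint => s.
  rewrite /= in_itv/= => /andP[sH _]; case: hp => _; apply.
  by apply/negP => /andP[_ h]; have := lt_trans h sH; rewrite ltxx.
exact: prim_bnd (intgT_oo _ _ hi) _ (lexx _).
Qed.

Lemma density_continuous L H p : 0 <= L -> 0 <= H -> density L H p ->
  continuous (prim p).
Proof.
move=> L0 H0 hp x; apply/cvgrPdist_le => e e0.
have N1 : 0 < L2norm H p + 1 by rewrite ltr_wpDl// L2norm_ge0.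
exists ((e / (L2norm H p + 1)) ^+ 2); first by rewrite /= exprn_gt0// divr_gt0.
move=> y /= hy; apply: le_trans (density_holder _ _ L0 H0 hp) _.
apply: (@le_trans _ _ (e / (L2norm H p + 1) * (L2norm H p + 1))); last first.
  by rewrite divfK// gt_eqF.
apply: ler_pM; [exact: sqrtr_ge0|exact: L2norm_ge0| |by rewrite lerDl].
have k0 : 0 <= e / (L2norm H p + 1) by rewrite divr_ge0 ?ltW.
by rewrite -[leRHS](ger0_norm k0) -(sqrtr_sqr (e / _)) ler_wsqrtr// ltW.
Qed.

Lemma density_shift L H p c T : 0 <= L -> density L H p ->
  sqi T (fun s => p (s + c)) /\ L2norm T (fun s => p (s + c)) <= L2norm H p.
Proof.
move=> L0 hp; have hi := density_intgT L0 hp.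
have SS := density_sqrT L0 hp; have [hs _] := SS.
have [i1 _] := Rint_shift c hi.
have RS := Rint_shift c hs; have [i2 _] := RS.
have hq : sqi T (fun s => p (s + c)).
  split; last exact: intgT_oo.
  by apply: measurable_funTS; exact: intg_meas i1.
split=> //; apply: L2norm_ler => //; first exact: L2norm_ge0.
rewrite (L2norm_sqr hp.1); case: SS => _ <-; case: RS => _ <-.
apply: Rint_mono_set => //.
by move=> x; exact: sqr_ge0.
Qed.

Section EdgeTrajectory.
Variables (q : R -> R) (L H T : R).
Hypothesis pq : potential q L.
Hypothesis T0 : 0 <= T.

(** The right side of [green_edge] with U, A, B in place of their time primitives: formally, the
    second time derivative of the pairing of U with phi. *)
Definition bdry_rhs U A B (phi phi' psi : R -> R) s :=
  (A (s + L) - B (s - L) + Sp q U L s) * phi L - U L s * phi' L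
  - (A s - B s) * phi 0 + U 0 s * phi' 0
  - \int[mu]_(y in `]0, L[) (U y s * psi y).

(** Every term commutes with integration in time, because the terms at time 0 vanish. *)
Lemma bdry_rhs_prim U A B (phi phi' psi : R -> R) : ucont U -> causal L U ->
  cz A -> cz B -> vanish L A -> vanish L B -> intg `]0, L[ psi ->
  intg `]0, T[ (bdry_rhs U A B phi phi' psi) /\
  forall t, 0 <= t <= T -> bdry_rhs (tprim U) (prim A) (prim B) phi phi' psi t =
    prim (bdry_rhs U A B phi phi' psi) t.
Proof.
move=> uU cU cA cB vA vB ipsi; have [L0 iq q0] := pq.
have LL : 0 <= L <= L by rewrite L0 lexx.
pose X s := \int[mu]_(y in `]0, L[) (psi y * U y s).
have XE s : \int[mu]_(y in `]0, L[) (U y s * psi y) = X s.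
  by apply: eq_Rint => y _; rewrite mulrC.
have Xp t : 0 <= t -> intg `]0, t[ X /\
    \int[mu]_(y in `]0, L[) (tprim U y t * psi y) = prim X t.
  move=> t0.
  have [M M0 hM] := @ucont_bnd R U 0 L 0 t uU.
  have [|_ i2 _ FF] := fubini_rect ipsi (ucont_meas uU) (M := M) (t := t) _ M0.
    by move=> z s /andP[z0 zL] /andP[s0 st]; apply: hM; rewrite !ltW.
  split; first exact: i2.
  rewrite /prim FF; apply: eq_Rint => y _; by rewrite mulrC.
have key t : 0 <= t ->
    intg `]0, t[ (bdry_rhs U A B phi phi' psi) /\
    bdry_rhs (tprim U) (prim A) (prim B) phi phi' psi t =
    prim (bdry_rhs U A B phi phi' psi) t.
  move=> t0.
  have [iA eA] := cz_shift L cA t0; have [iB eB] := cz_shift (- L) cB t0.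
  have [iS eS] := Sp_prim pq uU cU LL t0.
  have [iX eX] := Xp t t0.
  have iL : intg `]0, t[ (U L) by exact: ucont_intg.
  have i0 : intg `]0, t[ (U 0) by exact: ucont_intg.
  have mI : measurable `]0, t[%classic by exact: measurable_itv.
  pose F s := phi L * (A (s + L)) + (- phi L) * (B (s - L)).
  pose G s := phi L * Sp q U L s + (- phi' L) * U L s.
  pose I s := (- phi 0) * A s + phi 0 * B s.
  pose J s := phi' 0 * U 0 s + (-1) * X s.
  have iF : intg `]0, t[ F by apply: intgD => //; exact: intgZ.
  have iG : intg `]0, t[ G by apply: intgD => //; exact: intgZ.
  have iI : intg `]0, t[ I.
    by apply: intgD => //; apply: intgZ => //; [exact: cA.1|exact: cB.1].
  have iJ : intg `]0, t[ J by apply: intgD => //; exact: intgZ.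
  have E s : bdry_rhs U A B phi phi' psi s = (F s + G s) + (I s + J s).
    rewrite /bdry_rhs XE /F /G /I /J.
    move: (X s) (Sp _ _ _ _) (U _ _) (U _ _) (A _) (A _) (B _) (B _) => *; ring.
  have iFG : intg `]0, t[ (fun s => F s + G s) by exact: intgD.
  have iIJ : intg `]0, t[ (fun s => I s + J s) by exact: intgD.
  split.
    by apply: eq_intg (intgD mI iFG iIJ) => // s _; rewrite E.
  have -> : prim (bdry_rhs U A B phi phi' psi) t =
      \int[mu]_(s in `]0, t[) ((F s + G s) + (I s + J s)).
    by apply: eq_Rint => s _; exact: E.
  rewrite Rint_D// (Rint_D mI iF iG) (Rint_D mI iI iJ).
  rewrite (Rint_lin _ _ mI iA iB) eA eB (Rint_lin _ _ mI iS iL).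
  rewrite (Rint_lin _ _ mI (cA.1 0 t) (cB.1 0 t)) (Rint_lin _ _ mI i0 iX).
  rewrite /bdry_rhs eS eX.
  have vL : 0 + L <= L by rewrite add0r.
  have vL' : 0 - L <= L by lra.
  have -> : prim A (0 + L) = 0 by exact: (vanish_prim vA).
  have -> : prim B (0 - L) = 0 by exact: (vanish_prim vB).
  have eL : \int[mu]_(x in `]0, t[) U L x = tprim U L t by [].
  have e0 : \int[mu]_(x in `]0, t[) U 0 x = tprim U 0 t by [].
  rewrite eL e0 -/(prim A t) -/(prim B t) -/(prim X t) -/(prim (Sp q U L) t).
  move: (prim X t) (prim (Sp q U L) t) (tprim U L t) (tprim U 0 t)
    (prim A t) (prim B t) (prim A _) (prim B _) => *; ring.
split; first exact: (key T T0).1.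
by move=> t /andP[t0 _]; exact: (key t t0).2.
Qed.

Variables p r : R -> R.
Hypothesis H0 : 0 <= H.
Hypothesis hp : density L H p.
Hypothesis hr : density L H r.

(* v = edge_v is the sideways solution whose boundary densities al, be have the
   derivatives p, r; edge_vt is v_t, and edge_tr is v_y at y = L. *)
Definition edge_data y t := prim p (t + clamp L y) + prim r (t - clamp L y).
Definition edge_v := wsol q L edge_data.
Definition edge_vt y t := p (t + y) + r (t - y) + Sm q edge_v y t.
Definition edge_tr t := p (t + L) - r (t - L) + Sp q edge_v L t.

Lemma clamp_continuous : continuous (clamp L).
Proof.
move=> x; apply/cvgrPdist_le => e e0; exists e => //= y hy.
by apply: le_trans (clamp_lip _ _ _) _; exact: ltW.
Qed.

Lemma edge_data_bnd y t :
  `|edge_data y t| <= Num.sqrt H * (L2norm H p + L2norm H r).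
Proof.
have [L0 _ _] := pq; rewrite mulrDr; apply: le_trans (ler_normD _ _) _.
by apply: lerD; [exact: density_bnd L0 H0 hp|exact: density_bnd L0 H0 hr].
Qed.

Lemma edge_data_bcont : bcont edge_data.
Proof.
have [L0 _ _] := pq; split; last by eexists; exact: edge_data_bnd.
have uc : ucont (fun y t => clamp L y).
  exact: ucont_f clamp_continuous ucont_fst.
apply: (@ucontD _ (fun y t => prim p (t + clamp L y)) (fun y t => prim r (t - clamp L y))).
  apply: ucont_f; first exact: density_continuous L0 H0 hp.
  exact: (ucontD ucont_snd uc).
apply: ucont_f; first exact: density_continuous L0 H0 hr.
exact: (ucontB ucont_snd uc).
Qed.

Lemma edge_v_bcont : bcont edge_v.
Proof. exact: (wsolP pq edge_data_bcont).1. Qed.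

Lemma edge_v_ucont : ucont edge_v.
Proof. exact: edge_v_bcont.1. Qed.

(** [cone_bound] with t0 = s and r = z: the triangle of (z, s) sees data only up to time s + z <= L,
    where both primitives are 0. *)
Lemma edge_v_causal : causal L edge_v.
Proof.
have [L0 _ _] := pq; have [C C0 hC] := cone_bound pq.
move=> z s hz hs; apply/eqP; rewrite -normr_le0.
have /andP[z0 zL] := hz.
have := hC _ _ _ (density_continuous L0 H0 hp) (density_continuous L0 H0 hr)
  edge_v_bcont (wsolP pq edge_data_bcont).2 s z hz z s z0.
rewrite subrr normr0 addr0 => /(_ (lexx _)).
have vp := vanish_prim (density_vanish hp); have vr := vanish_prim (density_vanish hr).
have -> : prim p (s + z) = 0 by apply: vp; lra.
have -> : prim r (s - z) = 0 by apply: vr; lra.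
have Z f : vanish L f -> \int[mu]_(x in `]s - z, s + z[) `|f x| = 0.
  move=> vf; apply: (etrans _ (@Rint_zero R `]s - z, s + z[)); apply: eq_Rint => x.
  by rewrite /= in_itv/= => /andP[h1 h2]; rewrite vf ?normr0//; lra.
by rewrite (Z _ vp) (Z _ vr) normr0 addr0 mulr0 addr0.
Qed.

Lemma edge_v_eq : edge_eq q L edge_v (prim p) (prim r).
Proof.
move=> y t hy t0; have := (wsolP pq edge_data_bcont).2 y t.
rewrite -/edge_v => ->; rewrite {1}/edge_data clamp_id//; congr (_ + _).
by rewrite (wave_int_oo t pq edge_v_bcont hy) (Sm_avg q t edge_v_ucont edge_v_causal hy).
Qed.

(** Green's formula is applied to the first time primitive of v for [m1] and to the second for the
    pairing with v; [bdry_rhs_prim] then takes one primitive out of each. *)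
Lemma edge_green (phi phi' phi'' : R -> R) : AC_deriv L phi phi' ->
  AC_deriv L phi' phi'' ->
  let psi y := - phi'' y + q y * phi y in
  let m1 t := \int[mu]_(y in `]0, L[) (edge_vt y t * phi y) in
  let m2 := bdry_rhs edge_v p r phi phi' psi in
  [/\ intg `]0, L[ psi, intg `]0, T[ m2, intg `]0, T[ m1,
      forall t, 0 <= t <= T -> m1 t = prim m2 t &
      forall t, 0 <= t <= T ->
        \int[mu]_(y in `]0, L[) (edge_v y t * phi y) = prim m1 t].
Proof.
move=> hphi hphi' psi m1 m2; have [L0 iq q0] := pq.
have cp := density_cz L0 hp; have cr := density_cz L0 hr.
have vp := density_vanish hp; have vr := density_vanish hr.
have contp := density_continuous L0 H0 hp; have contr := density_continuous L0 H0 hr.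
have iap a b : intg `]a, b[ (prim p) by exact: continuous_intg.
have iar a b : intg `]a, b[ (prim r) by exact: continuous_intg.
have vp1 := vanish_prim vp; have vr1 := vanish_prim vr.
have cp1 := vanish_cz L0 iap vp1; have cr1 := vanish_cz L0 iar vr1.
have uV := edge_v_ucont; have cV := edge_v_causal.
have uW := tprim_ucont uV; have cW := causal_tprim cV.
have eV := edge_v_eq.
have eW := edge_eq_prim pq uV cV iap iar vp1 vr1 eV.
have prim_cont f : (forall a b, intg `]a, b[ f) -> continuous f ->
    forall a b, intg `]a, b[ (prim f).
  move=> hf cf a b; have uf : ucont (fun _ : R => f) by exact: ucont_f cf ucont_snd.
  exact: (ucont_intg 0 a b (tprim_ucont uf)).
have iap2 := prim_cont _ iap contp; have iar2 := prim_cont _ iar contr.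
have vp2 := vanish_prim vp1; have vr2 := vanish_prim vr1.
have eX := edge_eq_prim pq uW cW iap2 iar2 vp2 vr2 eW.
have ipsi : intg `]0, L[ psi.
  have /AC_derivP[_ _] := hphi; have /AC_derivP[i2 _] := hphi'.
  have [N hN] := AC_bnd hphi.
  apply: intgD; [exact: measurable_itv|by apply: intgN; [exact: measurable_itv|]|].
  apply: (@intg_mulb _ _ _ _ N); [exact: measurable_itv|exact: intgT_oo|exact: AC_meas hphi|].
  by move=> y; rewrite /= in_itv/= => /andP[y0 yL]; apply: hN; rewrite !ltW.
have [im2 em2] := bdry_rhs_prim phi phi' uV cV cp cr vp vr ipsi.
have [im1 em1] := bdry_rhs_prim phi phi' uW cW cp1 cr1 vp1 vr1 ipsi.
have E1 t : 0 <= t -> m1 t = bdry_rhs (tprim edge_v) (prim p) (prim r) phi phi' psi t.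
  move=> t0; rewrite /m1 /edge_vt.
  exact: (green_edge pq uV cV cp cr eW iap iar t0 hphi hphi').
have E0 t : 0 <= t -> \int[mu]_(y in `]0, L[) (edge_v y t * phi y) =
    bdry_rhs (tprim (tprim edge_v)) (prim (prim p)) (prim (prim r)) phi phi' psi t.
  move=> t0; rewrite /bdry_rhs.
  rewrite -(green_edge pq uW cW cp1 cr1 eX iap2 iar2 t0 hphi hphi').
  apply: eq_Rint => y; rewrite /= in_itv/= => /andP[y0 yL].
  by rewrite eV// !ltW.
split=> //.
- apply: eq_intg im1; first exact: measurable_itv.
  by move=> t; rewrite /= in_itv/= => /andP[h _]; rewrite E1// ltW.
- by move=> t ht; rewrite E1; [exact: em2|case/andP: ht].
- move=> t ht; rewrite E0; last by case/andP: ht.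
  rewrite em1//; apply: eq_Rint => s; rewrite /= in_itv/= => /andP[h _].
  by rewrite E1// ltW.
Qed.

Lemma edge_v0 y : 0 <= y <= L -> edge_v y 0 = 0.
Proof. by move=> hy; apply: edge_v_causal => //; rewrite subr_ge0; case/andP: hy. Qed.

End EdgeTrajectory.

End Trajectory.

(** * Control of a pair of coupled edges *)

Section OneSidedDuhamel.
Context {R : realType}.
Local Notation mu := (@lebesgue_measure R).
Implicit Types (v U : R -> R -> R) (f q : R -> R).
Implicit Types (x y z t r s a b c e k m L M K T : R).

Lemma cz_of f : (forall b, 0 <= b -> intg `]0, b[ f) ->
  (forall s, s <= 0 -> f s = 0) -> cz f.
Proof.
move=> hf f0; split=> // a b; have h : 0 <= Num.max 0 b by rewrite le_max lexx.
apply: (@eq_intg _ _ (fun x => if 0 < x < Num.max 0 b then f x else 0)).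
- exact: measurable_itv.
- move=> x; rewrite /= in_itv/= => /andP[ax xb].
  case: ifPn => //; rewrite lt_max xb orbT andbT -leNgt => x0.
  by rewrite f0.
- by apply: intgT_oo; apply/intg_if; exact: hf.
Qed.

Variables (q : R -> R) (L T : R).
Hypothesis pq : potential q L.

Let Iq := \int[mu]_z `|q z|.

Lemma potential_mass_ge0 : 0 <= Iq. Proof. exact: Rintegral_ge0. Qed.

(* The derivative in y of the part of the Duhamel term of v(y, T) coming from
   times s with e (s - T) > 0; here e = 1 or e = -1. *)
Definition duh e v s := \int[mu]_(z in `]0, s[) (q z * (v z (T + e * (s - z)) / 2)).

Lemma duh_ucont e v : ucont v -> ucont (fun z s => v z (T + e * (s - z)) / 2).
Proof.
move=> uv; apply: (@ucontM _ (fun z s => v z (T + e * (s - z))) (fun _ _ => 2^-1)).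
  by apply: (@ucont_aff _ _ (- e) e T) => // z s; ring.
exact: ucont_cst.
Qed.

Lemma duh_intgz e v s : bcont v -> 0 <= s ->
  intg `]0, s[ (fun z => q z * (v z (T + e * (s - z)) / 2)).
Proof.
move=> [uv [M hM]] s0; have [L0 iq q0] := pq.
apply: (@intg_mulb _ _ _ _ M); [exact: measurable_itv|exact: intgT_oo| |].
  apply: measurable_funTS; apply: continuous_measurable_fun.
  exact: (@ucont_sec _ _ s (ucont_swap (@duh_ucont e v uv))).
move=> z _; rewrite normrM (ger0_norm (_ : 0 <= 2^-1))// ler_pdivrMr//.
by apply: le_trans (hM _ _) _; rewrite ler_peMr ?ler1n//; exact: le_trans (hM 0 0).
Qed.

Lemma duh_cz e v : bcont v -> cz (duh e v).
Proof.
move=> [uv [M hM]]; have [L0 iq q0] := pq.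
apply: cz_of => [b b0|s s0]; last by rewrite /duh Rint_empty.
have M0 : 0 <= M by exact: le_trans (hM 0 0).
have m0 : measurable_fun setT (fun _ : R => 0 : R) by exact: measurable_cst.
have [||_ i _] := @leibniz R q (fun=> 0) (fun z s => v z (T + e * (s - z)) / 2) M b iq
    m0 _ (ucont_meas (@duh_ucont e v uv)) _ M0 b0.
- by move=> z _; rewrite normr0.
- move=> z s _ _ _; rewrite normrM (ger0_norm (_ : 0 <= 2^-1))// ler_pdivrMr//.
  by apply: le_trans (hM _ _) _; rewrite ler_peMr ?ler1n.
- exact: i.
Qed.

Lemma duh_bnd e v M s : bcont v -> 0 <= M ->
  (forall z, 0 < z < s -> `|v z (T + e * (s - z))| <= M) -> `|duh e v s| <= Iq * M.
Proof.
move=> bv M0 hM; have [L0 iq q0] := pq.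
have [s0|/ltW s0] := leP s 0.
  by rewrite /duh Rint_empty// normr0 mulr_ge0// potential_mass_ge0.
have iqn := intg_norm measurableT iq.
apply: (@le_trans _ _ (\int[mu]_(z in `]0, s[) (`|q z| * M))).
  apply: Rint_norm_le; [exact: measurable_itv|exact: duh_intgz| |].
    apply: (@eq_intg _ _ (fun z => M * `|q z|)); first exact: measurable_itv.
      by move=> z _; rewrite mulrC.
    by apply: intgZ; [exact: measurable_itv|exact: intgT_oo].
  move=> z; rewrite /= in_itv/= => hz; rewrite normrM ler_wpM2l//.
  rewrite normrM (ger0_norm (_ : 0 <= 2^-1))// ler_pdivrMr//.
  by apply: le_trans (hM _ hz) _; rewrite ler_peMr ?ler1n.
rewrite Rint_Zr; [|exact: measurable_itv|exact: intgT_oo].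
rewrite ler_wpM2r//; apply: Rint_mono_set => //.
Qed.

Lemma duh_lin e k m u v s : bcont u -> bcont v ->
  duh e (fun y t => k * u y t + m * v y t) s = k * duh e u s + m * duh e v s.
Proof.
move=> bu bv; have [s0|/ltW s0] := leP s 0.
  by rewrite /duh !Rint_empty// !mulr0 addr0.
have iu := duh_intgz e bu s0; have iv := duh_intgz e bv s0.
rewrite /duh -(Rint_lin k m (measurable_itv _) iu iv); apply: eq_Rint => z _; ring.
Qed.

(** Split the section |s - T| < y - z at s = T and parametrise each half by the distance to T;
    Fubini on the triangle then puts the integration in y outside. *)
Lemma duh_pm v y : bcont v -> 0 <= y <= L ->
  wave_int q L v y T = prim (duh 1 v) y + prim (duh (-1) v) y.
Proof.
move=> bv hy; have [uv [M hM]] := bv; have [L0 iq q0] := pq.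
have /andP[y0 yL] := hy.
have M0 : 0 <= M by exact: le_trans (hM 0 0).
have m0 : measurable_fun setT (fun _ : R => 0 : R) by exact: measurable_cst.
rewrite (wave_int_oo T pq bv hy).
pose k z s := v z (T + 1 * (s - z)) / 2 + v z (T + -1 * (s - z)) / 2.
have uk : ucont k := ucontD (@duh_ucont 1 v uv) (@duh_ucont (-1) v uv).
have -> : \int[mu]_(z in `]0, y[) (q z * avg v z T (y - z)) =
    \int[mu]_(z in `]0, y[) (q z * (0 + \int[mu]_(s in `]z, y[) k z s)).
  apply: eq_Rint => z; rewrite /= in_itv/= => /andP[z0 zy]; congr (_ * _).
  rewrite add0r /avg.
  have cv := @ucont_sec _ v z uv.
  have zy' := ltW zy.
  rewrite (@Rint_split _ (T - (y - z)) T (T + (y - z)));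
    [|lra|lra|exact: continuous_intg].
  have [i1 e1] := @Rint_shift_oo _ (v z) z y (T - z) (continuous_intg _ _ cv).
  have [i2 e2] := @Rint_refl_oo _ (v z) z y (T + z) (continuous_intg _ _ cv).
  have S1 s : v z (T + 1 * (s - z)) = v z (s + (T - z)) by congr (v _ _); ring.
  have S2 s : v z (T + -1 * (s - z)) = v z (T + z - s) by congr (v _ _); ring.
  have -> : \int[mu]_(s in `]z, y[) k z s =
      \int[mu]_(s in `]z, y[) ((v z (s + (T - z)) + v z (T + z - s)) / 2).
    by apply: eq_Rint => s _; rewrite /k S1 S2 mulrDl.
  rewrite Rint_Zr; [|exact: measurable_itv|by apply: intgD => //; exact: measurable_itv].
  rewrite (Rint_D (measurable_itv _) i1 i2) e1 e2.
  rewrite (_ : y + (T - z) = T + (y - z)); last by ring.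
  rewrite (_ : z + (T - z) = T); last by ring.
  rewrite (_ : T + z - z = T); last by ring.
  rewrite (_ : T + z - y = T - (y - z)); last by ring.
  by rewrite [in RHS]addrC.
have [||_ i E] := @leibniz R q (fun=> 0) k M y iq
    m0 _ (ucont_meas uk) _ M0 y0.
- by move=> z _; rewrite normr0.
- move=> z s _ _ _; apply: le_trans (ler_normD _ _) _.
  rewrite !normrM (ger0_norm (_ : 0 <= 2^-1))// -mulrDl ler_pdivrMr//.
  by rewrite mulr_natr mulr2n lerD.
have z0 : \int[mu]_(z in `]0, y[) (q z * 0) = 0.
  by apply: (etrans _ (@Rint_zero R `]0, y[)); apply: eq_Rint => z _; rewrite mulr0.
rewrite E z0 add0r -(Rint_D (measurable_itv _) ((duh_cz 1 bv).1 0 y) ((duh_cz (-1) bv).1 0 y)).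
apply: eq_Rint => s; rewrite /= in_itv/= => /andP[s0 _].
rewrite /duh -(Rint_D (measurable_itv _) (duh_intgz 1 bv (ltW s0)) (duh_intgz (-1) bv (ltW s0))).
by apply: eq_Rint => z _; rewrite mulrDr.
Qed.

Lemma Sm_duh v s : bcont v -> 0 <= s -> Sm q v s T = duh 1 v s - duh (-1) v s.
Proof.
move=> bv s0.
rewrite /duh -(Rint_B (measurable_itv _) (duh_intgz 1 bv s0) (duh_intgz (-1) bv s0)).
apply: eq_Rint => z _; rewrite mul1r mulN1r -mulrBr; congr (_ * _); by field.
Qed.

End OneSidedDuhamel.

(** * The fixed-point equation for the data around time T *)

Section Control.
Context {R : realType}.
Local Notation mu := (@lebesgue_measure R).
Implicit Types (v U : R -> R -> R) (f g h : bool -> R -> R).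
Implicit Types (x y z t r s a b c k m M N K : R) (e : bool).

Variables (q : bool -> R -> R) (L T : R).
Hypothesis pq : forall e, potential (q e) L.

Let L0 : 0 <= L. Proof. by case: (pq true). Qed.

Definition bcpair f := forall e, bcont (fun _ => f e).

Lemma bcpair_cont f e : bcpair f -> continuous (f e).
Proof. by move=> bf; exact: (@bcont_sec _ (fun _ => f e) 0 (bf e)). Qed.

Lemma bcpair_lin k m f g : bcpair f -> bcpair g ->
  bcpair (fun e t => k * f e t + m * g e t).
Proof. by move=> bf bg e; exact: (bcont_lin k m (bf e) (bg e)). Qed.

(* e = true, false are the two halves of the ring, continued into one another
   across y = 0. *)
Definition side_data f e y t := f e (t + clamp L y) + f (~~ e) (t - clamp L y).

Lemma side_data_bnd f M : (forall e t, `|f e t| <= M) ->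
  forall e y t, `|side_data f e y t| <= 2 * M.
Proof.
by move=> hM e y t; rewrite mulr_natl mulr2n; apply: le_trans (ler_normD _ _) (lerD _ _).
Qed.

Lemma side_data_bcont f e : bcpair f -> bcont (side_data f e).
Proof.
move=> bf; have uc : ucont (fun y t => clamp L y).
  by apply: ucont_f ucont_fst; exact: clamp_continuous.
have [_ [M1 h1]] := bf e; have [_ [M2 h2]] := bf (~~ e).
split; last first.
  exists (M1 + M2) => y t; apply: le_trans (ler_normD _ _) (lerD _ _).
    exact: (h1 0).
  exact: (h2 0).
apply: (@ucontD _ (fun y t => f e (t + clamp L y)) (fun y t => f (~~ e) (t - clamp L y))).
  by apply: ucont_f (ucontD ucont_snd uc); exact: bcpair_cont.
by apply: ucont_f (ucontB ucont_snd uc); exact: bcpair_cont.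
Qed.

Definition side_sol f e := wsol (q e) L (side_data f e).

Lemma side_sol_bcont f e : bcpair f -> bcont (side_sol f e).
Proof. by move=> bf; exact: (wsolP (pq e) (side_data_bcont e bf)).1. Qed.

Lemma side_sol_eq f e y t : bcpair f ->
  side_sol f e y t = f e (t + clamp L y) + f (~~ e) (t - clamp L y) +
    wave_int (q e) L (side_sol f e) y t.
Proof. by move=> bf; exact: (wsolP (pq e) (side_data_bcont e bf)).2. Qed.

Lemma side_sol_lin k m f g e y t : bcpair f -> bcpair g ->
  side_sol (fun e t => k * f e t + m * g e t) e y t =
  k * side_sol f e y t + m * side_sol g e y t.
Proof.
move=> bf bg.
rewrite -(wsol_lin k m (pq e) (side_data_bcont e bf) (side_data_bcont e bg)).
congr (wsol _ _ _ _ _); apply/funext => y'; apply/funext => t'.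
rewrite /side_data; ring.
Qed.

Lemma side_sol_bnd : exists2 C, 0 <= C & forall f M, bcpair f ->
  (forall e t, `|f e t| <= M) -> forall e y t, `|side_sol f e y t| <= C * M.
Proof.
have [C1 C10 h1] := wsol_bnd (pq true); have [C2 C20 h2] := wsol_bnd (pq false).
exists (2 * C1 + 2 * C2); first by rewrite addr_ge0// mulr_ge0.
move=> f M bf hM e y t; have M0 : 0 <= M by exact: le_trans (hM true 0).
have hd := side_data_bnd hM.
case: e.
  apply: le_trans (h1 _ _ (side_data_bcont true bf) (hd true) y t) _.
  by rewrite mulrA [C1 * 2]mulrC ler_wpM2r// lerDl mulr_ge0.
apply: le_trans (h2 _ _ (side_data_bcont false bf) (hd false) y t) _.
by rewrite mulrA [C2 * 2]mulrC ler_wpM2r// lerDr mulr_ge0.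
Qed.

(** The localised form of [side_sol_bnd] that makes the fixed-point problem Volterra in |t - T|. In
    the constant, 2 comes from the two pointwise values and 4 L from two integrals over intervals of
    length at most 2 L. *)
Lemma side_sol_cone : exists2 C, 0 <= C & forall f, bcpair f ->
  forall N s, 0 <= s <= L -> (forall e x, `|x - T| <= s -> `|f e x| <= N) ->
  forall e z t, 0 <= z -> z + `|t - T| <= s -> `|side_sol f e z t| <= C * N.
Proof.
have [C1 C10 h1] := cone_bound (pq true); have [C2 C20 h2] := cone_bound (pq false).
exists (2 + 4 * L * (C1 + C2)).
  by rewrite addr_ge0// mulr_ge0 ?addr_ge0// mulr_ge0.
move=> f bf N s hs hN e z t z0 hz.
have N0 : 0 <= N by apply: le_trans (hN true T _); rewrite ?subrr ?normr0//; case/andP: hs.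
have [C [C0 CC hC]] : exists C, [/\ 0 <= C, C <= C1 + C2 &
    `|side_sol f e z t| <= `|f e (t + z)| + `|f (~~ e) (t - z)| +
     C * (\int[mu]_(x in `]T - s, T + s[) `|f e x| +
          \int[mu]_(x in `]T - s, T + s[) `|f (~~ e) x|)].
  have c e' := @bcpair_cont f e' bf.
  case: e => /=; [exists C1|exists C2]; split=> //; rewrite ?lerDl ?lerDr//.
    by apply: (h1 _ _ _ (c _) (c _) (side_sol_bcont _ bf) _ _ _ hs _ _ z0 hz) => y u;
      exact: side_sol_eq.
  by apply: (h2 _ _ _ (c _) (c _) (side_sol_bcont _ bf) _ _ _ hs _ _ z0 hz) => y u;
      exact: side_sol_eq.
apply: le_trans hC _.
have /andP[s0 sL] := hs.
have [ht1 ht2] := (ler_norm (t - T), ler_norm (T - t)); rewrite distrC in ht2.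
have I e' : \int[mu]_(x in `]T - s, T + s[) `|f e' x| <= N * (2 * s).
  have -> : 2 * s = T + s - (T - s) by ring.
  rewrite -Rint_cst; last by lra.
  apply: Rint_le; [exact: measurable_itv| |exact: intg_cst_oo|].
    by apply: continuous_intg => x; apply: (cvg_comp _ _ (@bcpair_cont f e' bf x));
      exact: norm_continuous.
  move=> x; rewrite /= in_itv/= => /andP[x1 x2]; apply: hN.
  by rewrite ler_norml; apply/andP; split; lra.
have a1 : `|f e (t + z)| <= N by apply: hN; rewrite ler_norml; apply/andP; split; lra.
have a2 : `|f (~~ e) (t - z)| <= N by apply: hN; rewrite ler_norml; apply/andP; split; lra.
apply: (@le_trans _ _ (N + N + (C1 + C2) * (N * (2 * L) + N * (2 * L)))).
  apply: lerD; first exact: lerD.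
  apply: ler_pM => //; first by rewrite addr_ge0// Rintegral_ge0.
  have NL : N * (2 * s) <= N * (2 * L) by rewrite ler_wpM2l// ler_wpM2l.
  by apply: lerD; apply: le_trans (I _) _.
by rewrite le_eqVlt; apply/orP; left; apply/eqP; ring.
Qed.

Let D s f e := duh (q e) T s (side_sol f e).

Lemma side_duh_lin s k m f g e y : bcpair f -> bcpair g ->
  prim (D s (fun e t => k * f e t + m * g e t) e) y =
  k * prim (D s f e) y + m * prim (D s g e) y.
Proof.
move=> bf bg; have cf := duh_cz T (pq e) s (side_sol_bcont e bf).
have cg := duh_cz T (pq e) s (side_sol_bcont e bg).
rewrite /prim -(Rint_lin k m (measurable_itv _) (cf.1 0 y) (cg.1 0 y)).
apply: eq_Rint => x _; rewrite /D -(duh_lin T (pq e)); try exact: side_sol_bcont.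
by rewrite /duh; apply: eq_Rint => z _; rewrite side_sol_lin.
Qed.

(* Volterra operator in the distance |t - T|: adding ctrl_op f to the
   data of the solution for q = 0 compensates the effect of q at time T. *)
Definition ctrl_op f e t :=
  - prim (D 1 f e) (clamp L (t - T)) - prim (D (-1) f (~~ e)) (clamp L (T - t)).

Lemma ctrl_op_lin k m f g e t : bcpair f -> bcpair g ->
  ctrl_op (fun e t => k * f e t + m * g e t) e t = k * ctrl_op f e t + m * ctrl_op g e t.
Proof.
move=> bf bg; rewrite /ctrl_op (side_duh_lin 1 k m e _ bf bg).
rewrite (side_duh_lin (-1) k m (~~ e) _ bf bg).
move: (prim _ _) (prim _ _) (prim _ _) (prim _ _) => *; ring.
Qed.

Lemma prim_clamp_cont (w : R -> R) c k : cz w -> (exists M, forall s, `|w s| <= M) -> `|k| <= 1 ->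
  bcont (fun _ t => prim w (clamp L (c + k * t))).
Proof.
move=> ch [M hM] k1; have M0 : 0 <= M by exact: le_trans (hM 0).
have cl y := clampP y L0.
split.
  have h y t y' t' : `|(fun _ t => prim w (clamp L (c + k * t))) y t -
      (fun _ t => prim w (clamp L (c + k * t))) y' t'| <= M * (`|y - y'| + `|t - t'|);
    last exact: (@lipschitz_cont2 _ (fun _ t => prim w (clamp L (c + k * t))) M h).
  have /andP[a1 _] := cl (c + k * t); have /andP[a2 _] := cl (c + k * t').
  apply: le_trans (Rint_lip ch.1 hM a1 a2) _; rewrite ler_wpM2l//.
  apply: le_trans (clamp_lip _ _ _) _.
  have -> : c + k * t - (c + k * t') = k * (t - t') by ring.
  rewrite normrM; apply: (@le_trans _ _ (1 * `|t - t'|)); first by rewrite ler_wpM2r.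
  by rewrite mul1r lerDr.
exists (M * L) => _ t; have /andP[a1 a2] := cl (c + k * t).
apply: le_trans (Rint_bnd a1 (ch.1 _ _) (fun x _ => hM x)) _.
by rewrite subr0 ler_wpM2l.
Qed.

Lemma ctrl_op_bcpair f : bcpair f -> bcpair (ctrl_op f).
Proof.
move=> bf e.
have bd s e' : exists M, forall x, `|D s f e' x| <= M.
  have [_ [M h]] := side_sol_bcont e' bf.
  exists ((\int[mu]_z `|q e' z|) * M) => x; apply: (duh_bnd (pq e')) => //.
    exact: side_sol_bcont.
  exact: le_trans (h 0 0).
have c1 := prim_clamp_cont (- T) (duh_cz T (pq e) 1 (side_sol_bcont e bf)) (bd 1 e)
  (_ : `|1| <= 1).
have c2 := prim_clamp_cont T (duh_cz T (pq (~~ e)) (-1) (side_sol_bcont (~~ e) bf))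
  (bd (-1) (~~ e)) (_ : `|-1| <= 1).
have := bcont_lin (-1) (-1) (c1 _) (c2 _); rewrite normrN !normr1 => /(_ (lexx _) (lexx _)).
suff -> : (fun _ : R => ctrl_op f e) = (fun _ t => -1 * prim (D 1 f e) (clamp L (- T + 1 * t)) +
  -1 * prim (D (-1) f (~~ e)) (clamp L (T + -1 * t))) by [].
apply/funext => _; apply/funext => t; rewrite /ctrl_op !mulN1r mul1r.
by rewrite [- T + t]addrC.
Qed.

(** At distance y from T, [ctrl_op] uses the data only at distances less than y, so the Volterra
    weight evaluated at |t - T| makes it a contraction by 1/2. *)
Lemma ctrl_fixpoint : exists2 C, 0 <= C & forall g M, bcpair g ->
  (forall e t, `|g e t| <= M) -> exists f, [/\ bcpair f,
    forall e t, f e t = g e t + ctrl_op f e t & forall e t, `|f e t| <= C * M].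
Proof.
have [C C0 hC] := side_sol_cone.
pose I e := \int[mu]_z `|q e z|.
have I0 e : 0 <= I e by exact: Rintegral_ge0.
(* [D s f e] at x is at most the L^1 norm of q times the bound of the solution on the triangle of
   size x, hence at most K times a bound for f at distance at most x. The Volterra kernel is thus
   the constant K. *)
pose K := (I true + I false) * C.
have K0 : 0 <= K by rewrite mulr_ge0// addr_ge0.
have KI e : I e * C <= K.
  by rewrite ler_wpM2r//; case: e; rewrite ?lerDl ?lerDr.
pose k z := if 0 < z < L then K else 0.
have ik : intg setT k by apply/intg_if; exact: intg_cst_oo.
have k0 z : 0 <= k z by rewrite /k; case: ifP.
have [w [Mw [hw wnd mw hkw]]] := volterra_weight L0 ik k0.
have w1 x : 1 <= w x by case/andP: (hw x).
have wM x : w x <= Mw by case/andP: (hw x).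
have w0 x : 0 <= w x by exact: le_trans (w1 x).
exists (2 * Mw); first by rewrite mulr_ge0// (le_trans (w0 0)).
move=> g M bg hg; have M0 : 0 <= M by exact: le_trans (hg true 0).
pose uc (F : bool * R -> R) e t := F (e, t).
pose Cl (F : bool * R -> R) := bcpair (uc F).
pose Op (F : bool * R -> R) (p : bool * R) := ctrl_op (uc F) p.1 p.2.
pose W (p : bool * R) := w (clamp L `|p.2 - T|).
have DW s F N : Cl F -> (forall p, `|F p| <= N * W p) -> (s = 1 \/ s = -1) ->
    forall e y, 0 <= y <= L -> `|prim (D s (uc F) e) y| <= N / 2 * w y.
  move=> cF hF hs e y hy.
  have N0 : 0 <= N.
    by have := le_trans (normr_ge0 _) (hF (true, 0)); rewrite pmulr_lge0//; exact: lt_le_trans ltr01 (w1 _).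
  have cD := duh_cz T (pq e) s (side_sol_bcont e cF).
  have /andP[y0 yL] := hy.
  apply: (@le_trans _ _ (N * prim (fun z => k z * w z) y)); last first.
    by rewrite mulrAC -mulrA ler_wpM2l// hkw.
  have ikw : intg setT (fun z => k z * w z).
    apply: (@intg_mulb _ _ _ _ Mw) => // x _; rewrite ger0_norm//.
  have iky : intg `]0, y[ (fun z => k z * w z) by exact: intgT_oo.
  rewrite /prim -Rint_Zl; [|exact: measurable_itv|exact: iky].
  apply: Rint_norm_le; [exact: measurable_itv|exact: cD.1| |].
    by apply: intgZ; [exact: measurable_itv|].
  move=> x; rewrite /= in_itv/= => /andP[x0 xy].
  have xL : x < L by exact: lt_le_trans yL.
  have hx : 0 <= x <= L by rewrite !ltW.
  rewrite /k x0 xL/=.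
  apply: (@le_trans _ _ (I e * (C * (N * w x)))); last first.
    by rewrite mulrA [leRHS]mulrCA ler_wpM2r// mulr_ge0.
  apply: (duh_bnd (pq e)); [exact: side_sol_bcont|by rewrite !mulr_ge0|].
  move=> z /andP[z0 zx]; apply: (hC _ cF _ x) => //; last 1 first.
  - have -> : T + s * (x - z) - T = s * (x - z) by ring.
    have zx' := ltW zx; rewrite normrM (_ : `|s| = 1).
      by rewrite mul1r ger0_norm ?subr_ge0// addrC subrK.
    by case: hs => ->; rewrite ?normrN normr1.
  - move=> e' t ht; apply: le_trans (hF (e', t)) _; rewrite ler_wpM2l//.
    by apply: wnd; rewrite /= clamp_id// normr_ge0 (le_trans ht)// ltW.
  - exact: ltW.
have [|||||||F [cF eF bF]] := @fixpoint_exists R (bool * R)%type W Cl Op _ _ _ _ _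
    (fun p => g p.1 p.2) M.
- by move=> a m f h cf ch; exact: (bcpair_lin a m cf ch).
- move=> a m f h cf ch [e t]; rewrite /Op.
  have -> : uc (fun p => a * f p + m * h p) = fun e t => a * uc f e t + m * uc h e t by [].
  exact: (ctrl_op_lin a m e t cf ch).
- by move=> f cf; exact: (ctrl_op_bcpair cf).
- move=> f N cf hf [e t]; rewrite /Op /ctrl_op /W/=.
  (* Before T only the backward term of [ctrl_op] is nonzero, after T only the forward one. *)
  have [tT|/ltW Tt] := leP t T.
    have -> : clamp L (t - T) = 0.
      by rewrite /clamp min_l ?(le_trans _ L0)// ?subr_le0// max_l// subr_le0.
    rewrite prim0 oppr0 sub0r normrN distrC (ger0_norm (_ : 0 <= T - t)) ?subr_ge0//.
    by apply: DW => //; [right|exact: clampP].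
  have -> : clamp L (T - t) = 0.
    by rewrite /clamp min_l ?(le_trans _ L0)// ?subr_le0// max_l// subr_le0.
  rewrite prim0 subr0 normrN (ger0_norm (_ : 0 <= t - T)) ?subr_ge0//.
  by apply: DW => //; [left|exact: clampP].
- move=> u f N cu huf e.
  apply: (@bcont_lim _ (fun n _ t => u n (e, t)) _ (`|N| * Mw)) => [n|n _ t]; first exact: cu.
  apply: le_trans (huf n (e, t)) _.
  rewrite [leRHS]mulrAC; apply: (@le_trans _ _ (`|N| / 2 ^+ n * W (e, t))).
    by apply: (ler_wpM2r (w0 _)); rewrite ler_wpM2r ?invr_ge0 ?exprn_ge0// ler_norm.
  by apply: ler_wpM2l; [rewrite divr_ge0 ?exprn_ge0|exact: wM].
- exact: bg.
- by move=> [e t]; apply: le_trans (hg e t) _; apply: ler_peMr; [exact: M0|exact: w1].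
exists (uc F); split=> //.
- by move=> e t; exact: (eF (e, t)).
- move=> e t; apply: le_trans (bF (e, t)) _.
  rewrite mulrAC; apply: (ler_wpM2r M0); apply: ler_wpM2l; first by [].
  exact: wM.
Qed.

End Control.

Section ControlDensities.
Context {R : realType}.
Local Notation mu := (@lebesgue_measure R).
Implicit Types (v U : R -> R -> R) (f g h phi psi : bool -> R -> R) (w p : R -> R).
Implicit Types (x y z t r s a b c k m M N K H L T : R) (e : bool).

Lemma density_refl L H p c T : 0 <= L -> density L H p ->
  sqi T (fun s => p (c - s)) /\ L2norm T (fun s => p (c - s)) <= L2norm H p.
Proof.
move=> L0 hp; have hi := density_intgT L0 hp.
have SS := density_sqrT L0 hp; have [hs _] := SS.
have [i1 _] := Rint_refl c hi.
have RS := Rint_refl c hs; have [i2 _] := RS.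
have hq : sqi T (fun s => p (c - s)).
  split; last exact: intgT_oo.
  by apply: measurable_funTS; exact: intg_meas i1.
split=> //; apply: L2norm_ler => //; first exact: L2norm_ge0.
rewrite (L2norm_sqr hp.1); case: SS => _ <-; case: RS => _ <-.
apply: Rint_mono_set => //.
by move=> x; exact: sqr_ge0.
Qed.

Definition cutoff L p y := if 0 < y < L then p y else 0.

Lemma cutoff_density L p : sqi L p -> density 0 L (cutoff L p).
Proof.
move=> hp; split; last by move=> t ht; rewrite /cutoff (negbTE ht).
by apply: eq_sqi hp => x hx; rewrite /cutoff hx.
Qed.

Lemma cutoff_norm L p : L2norm L (cutoff L p) = L2norm L p.
Proof. by apply: eq_L2norm => x hx; rewrite /cutoff hx. Qed.

Lemma prim_cutoff L p y : y <= L -> prim (cutoff L p) y = prim p y.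
Proof. by move=> yL; apply: eq_prim yL => t ht; rewrite /cutoff ht. Qed.

Lemma prim_neg p y : y <= 0 -> prim p y = 0.
Proof. by move=> y0; rewrite /prim Rint_empty. Qed.

Lemma prim_clamp p L y : 0 <= L -> y <= L -> prim p (clamp L y) = prim p y.
Proof.
move=> L0 yL; have [y0|/ltW y0] := leP y 0; last by rewrite clamp_id// y0.
by rewrite /clamp min_l ?(le_trans y0)// max_l// prim0 prim_neg.
Qed.

(** A density that lifts the data from 0 to a prescribed level in the free time window between L and
    T - L. *)
Definition plateau L T t : R := if L < t < T - L then 1 else 0.

Lemma plateau_density L T : 0 <= L -> density L (T - L) (plateau L T).
Proof.
move=> L0; split; last by move=> t ht; rewrite /plateau (negbTE ht).
apply: (@sqi_bnd _ _ _ 1); last first.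
  by move=> x _; rewrite /plateau; case: ifP; rewrite ?normr1 ?normr0.
apply: measurable_funTS; apply: intg_meas; apply/intg_if; exact: intg_cst_oo.
Qed.

Lemma plateau_late L T x : T - L <= x -> plateau L T x = 0.
Proof. by move=> h; rewrite /plateau [x < _]ltNge h andbF. Qed.

Lemma plateau_prim L T x : 0 <= L -> L <= T - L -> T - L <= x ->
  prim (plateau L T) x = T - 2 * L.
Proof.
move=> L0 LT Tx; rewrite /prim.
transitivity (\int[mu]_(t in `]L, T - L[) (1 : R)).
  rewrite [LHS]Rint_if [RHS]Rint_if; apply: eq_Rint => t _.
  rewrite /plateau; case: ifPn => // h; case: ifPn => // /andP[h1 h2].
  by move: h; rewrite (le_lt_trans L0 h1) (lt_le_trans h2 Tx).
by rewrite Rint_cst// mul1r; ring.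
Qed.

Variables (q : bool -> R -> R) (L T : R).
Hypothesis pq : forall e, potential (q e) L.
Hypothesis LT : 2 * L < T.

Let L0 : 0 <= L. Proof. by case: (pq true). Qed.

Lemma control_support t :
  [|| L < t < T - L, 0 < T - t < L | 0 < t - T < L] -> L < t < T + L.
Proof.
have L0' := L0; have LT' := LT.
by move=> /or3P[] /andP[h1 h2]; apply/andP; split; lra.
Qed.

(** The coefficient is the level to be reached at T - L, namely k plus the full mass of [gm],
    divided by T - 2 L, the mass of [plateau]. The term with [gm] then brings the primitive down to
    k at T. *)
Lemma prim_glue (gp gm : R -> R) k x : density 0 L gp -> density 0 L gm ->
  T - L <= x -> x <= T + L ->
  prim (fun t => (k + prim gm T) / (T - 2 * L) * plateau L T t - gm (T - t) + gp (t - T)) x =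
  k + prim gp (x - T) + prim gm (T - x).
Proof.
move=> dp dm x1 x2; have cp := density_cz (lexx _) dp; have cm := density_cz (lexx _) dm.
have L2 : L <= 2 * L by rewrite mulr_natl mulr2n lerDl.
have x0 : 0 <= x by apply: le_trans x1; rewrite subr_ge0 (le_trans L2)// ltW.
have [ip ep] := cz_shift (- T) cp x0.
have [im em] := cz_refl T cm x0.
have il : intg `]0, x[ (plateau L T).
  by apply: intgT_oo; exact: density_intgT L0 (plateau_density T L0).
have mI : measurable `]0, x[%classic by exact: measurable_itv.
pose c := (k + prim gm T) / (T - 2 * L).
have j1 : intg `]0, x[ (fun t => c * plateau L T t) by exact: intgZ.
rewrite /prim (Rint_D mI (intgB mI j1 im) ip) (Rint_B mI j1 im) (Rint_Zl c mI il).
have LT' := LT; rewrite ep em -/(prim (plateau L T) x) plateau_prim//; last by lra.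
have -> : prim gp (0 + - T) = 0 by rewrite prim_neg//; lra.
rewrite subr0 subr0 -/(prim gp (x - T)) -/(prim gm (T - x)) -/(prim gm T) /c.
have n0 : T - 2 * L != 0 by rewrite gt_eqF// subr_gt0.
move: (prim _ _) (prim _ _) (prim _ _) => *; field.
by rewrite n0.
Qed.

(** [g] is the boundary data that would reach the target for zero potential, as d'Alembert's formula
    at time T shows. *)
Lemma ctrl_data_exists (hp hm : bool -> R -> R) k m :
  (forall e, density 0 L (hp e)) -> (forall e, density 0 L (hm e)) ->
  (forall e, L2norm L (hp e) <= m) -> (forall e, L2norm L (hm e) <= m) -> `|k| <= m ->
  let g e t := k + prim (hp e) (clamp L (t - T)) + prim (hm (~~ e)) (clamp L (T - t)) in
  bcpair g /\ forall e t, `|g e t| <= (1 + 2 * Num.sqrt L) * m.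
Proof.
move=> dp dm np nm km g.
have bg e t : `|g e t| <= (1 + 2 * Num.sqrt L) * m.
  rewrite [leRHS](_ : _ = m + Num.sqrt L * m + Num.sqrt L * m); last by ring.
  apply: le_trans (ler_normD _ _) (lerD _ _).
    apply: le_trans (ler_normD _ _) (lerD km _).
    apply: le_trans (density_bnd _ (lexx _) L0 (dp e)) _.
    by rewrite ler_wpM2l ?sqrtr_ge0.
  apply: le_trans (density_bnd _ (lexx _) L0 (dm _)) _.
  by rewrite ler_wpM2l ?sqrtr_ge0.
split=> // e; split; last by exists ((1 + 2 * Num.sqrt L) * m) => _ t; exact: bg.
have c1 := density_continuous (lexx _) L0 (dp e).
have c2 := density_continuous (lexx _) L0 (dm (~~ e)).
have uc (w : R -> R -> R) : ucont w -> ucont (fun y t => clamp L (w y t)).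
  by move=> ug; apply: ucont_f ug; exact: clamp_continuous.
apply: (@ucontD _ (fun _ t => k + prim (hp e) (clamp L (t - T)))
  (fun _ t => prim (hm (~~ e)) (clamp L (T - t)))).
  apply: (@ucontD _ (fun _ _ => k) (fun _ t => prim (hp e) (clamp L (t - T)))).
    exact: ucont_cst.
  apply: (@ucont_f _ _ (fun _ t => clamp L (t - T)) c1); apply: (uc (fun _ t => t - T)).
  pose h1 := @ucontB R (fun _ t => t) (fun _ _ => T) (@ucont_snd R) (@ucont_cst R T); exact: h1.
apply: (@ucont_f _ _ (fun _ t => clamp L (T - t)) c2); apply: (uc (fun _ t => T - t)).
pose h2 := @ucontB R (fun _ _ => T) (fun _ t => t) (@ucont_cst R T) (@ucont_snd R); exact: h2.
Qed.

(* Two solutions whose data agree on [T - L, T + L] agree on the triangle of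
   dependence of the segment at time T. *)
Lemma side_sol_agree (f g : bool -> R -> R) : bcpair f -> bcpair g ->
  (forall e x, T - L <= x <= T + L -> f e x = g e x) ->
  forall e z t, 0 <= z -> z + `|t - T| <= L ->
  side_sol q L f e z t = side_sol q L g e z t.
Proof.
move=> bf bg fg e z t z0 hz; have [C C0 hC] := side_sol_cone T pq.
have LL : 0 <= L <= L by rewrite L0 lexx.
have := hC _ (bcpair_lin 1 (-1) bf bg) 0 L LL _ e z t z0 hz.
rewrite mulr0 (side_sol_lin pq 1 (-1) e z t bf bg) mul1r mulN1r.
have h e' x : `|x - T| <= L -> `|1 * f e' x + -1 * g e' x| <= 0.
  move=> hx; rewrite fg ?mul1r ?mulN1r ?subrr ?normr0//.
  by move: hx; rewrite ler_norml => /andP[h1 h2]; apply/andP; split; lra.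
by move=> /(_ h); rewrite normr_le0 subr_eq0 => /eqP.
Qed.

(** In the fixed point f = g + [ctrl_op f], the correction cancels exactly the Duhamel terms of
    [duh_pm] and [Sm_duh], so the state at T is that of g for zero potential. Outside [T - L, T + L]
    the data are replaced by data coming from densities supported after L; by [side_sol_agree] the
    state at T does not notice. *)
Lemma control_densities : exists2 C, 0 <= C & forall (hp hm : bool -> R -> R) k m,
  (forall e, density 0 L (hp e)) -> (forall e, density 0 L (hm e)) ->
  (forall e, L2norm L (hp e) <= m) -> (forall e, L2norm L (hm e) <= m) -> `|k| <= m ->
  exists d : bool -> R -> R, forall e,
  [/\ density L (T + L) (d e), L2norm (T + L) (d e) <= C * m,
   forall y, 0 <= y <= L ->
     edge_v (q e) L (d e) (d (~~ e)) y T = k + k + prim (hp e) y + prim (hm e) y &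
   forall y, 0 < y < L ->
     edge_vt (q e) L (d e) (d (~~ e)) y T = hp e y - hm e y].
Proof.
have [Cf Cf0 hCf] := ctrl_fixpoint T pq.
have [Cs Cs0 hCs] := side_sol_bnd pq.
pose I e := \int[mu]_z `|q e z|.
have I0 e : 0 <= I e by exact: Rintegral_ge0.
pose S := Num.sqrt L; have S0 : 0 <= S by exact: sqrtr_ge0.
pose I2 := I true + I false.
have I20 : 0 <= I2 by rewrite addr_ge0.
have Ie e : I e <= I2 by case: e; rewrite ?lerDl ?lerDr.
(* Per unit of m: [K1] bounds the Duhamel derivatives, [G1] the corrected target densities, [c1] the
   coefficient of the plateau. *)
pose K1 := I2 * (Cs * (Cf * (1 + 2 * S))).
have K10 : 0 <= K1 by rewrite !mulr_ge0// addr_ge0// mulr_ge0.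
pose G1 := 1 + K1 * S.
have G10 : 0 <= G1 by rewrite addr_ge0// mulr_ge0.
have TL : 0 < T - 2 * L by rewrite subr_gt0.
have L2 : L <= 2 * L by rewrite mulr_natl mulr2n lerDl.
have T0 : 0 < T by apply: le_lt_trans LT; rewrite mulr_ge0.
have TL0 : 0 <= T + L by rewrite addr_ge0// ltW.
pose c1 := (1 + S * G1) / (T - 2 * L).
have c10 : 0 <= c1 by rewrite divr_ge0 ?(ltW TL)// addr_ge0// mulr_ge0.
exists (c1 * Num.sqrt (T + L) + G1 + G1).
  by rewrite !addr_ge0// mulr_ge0// sqrtr_ge0.
move=> hp hm k m dp dm np nm km.
have m0 : 0 <= m by exact: le_trans km.
have [bg hg] := ctrl_data_exists dp dm np nm km.
set g := (g in bcpair g) in bg hg *.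
have [f [bf ef hf]] := hCf g _ bg hg.
have hs := hCs f _ bf hf.
pose D s e := duh (q e) T s (side_sol q L f e).
have cD s e : cz (D s e) by apply: duh_cz => //; exact: side_sol_bcont.
have bD s e x : `|D s e x| <= K1 * m.
  apply: le_trans (@duh_bnd _ _ L T (pq e) s _ (Cs * (Cf * ((1 + 2 * S) * m))) x _ _ _) _.
  - exact: side_sol_bcont.
  - by rewrite !mulr_ge0// addr_ge0// mulr_ge0.
  - by move=> z _; exact: hs.
  rewrite /K1 -!mulrA; apply: ler_wpM2r; first by rewrite !mulr_ge0// addr_ge0// mulr_ge0.
  exact: Ie.
have sD s e : sqi L (D s e).
  apply: (@sqi_bnd _ _ _ (K1 * m)); last by move=> x _; exact: bD.
  exact: intg_meas ((cD s e).1 0 L).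
have nD s e : L2norm L (D s e) <= K1 * m * S.
  apply: L2norm_bnd; [exact: L0|by rewrite mulr_ge0| |by move=> x _; exact: bD].
  exact: intg_meas ((cD s e).1 0 L).
(* Target density minus Duhamel derivative: up to sign, the time derivative of the summand of f that
   lives after T (s = 1) or before T (s = -1). *)
pose gl s (h : bool -> R -> R) e := cutoff L (fun y => h e y - D s e y).
have dgl s h e : (forall e, density 0 L (h e)) -> density 0 L (gl s h e).
  by move=> dh; apply: cutoff_density; apply: sqiB => //; exact: (dh e).1.
have ngl s (h : bool -> R -> R) e : (forall e, density 0 L (h e)) ->
    (forall e, L2norm L (h e) <= m) -> L2norm L (gl s h e) <= G1 * m.
  move=> dh nh; rewrite cutoff_norm.
  have -> : (fun y => h e y - D s e y) = (fun y => h e y + (-1) * D s e y).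
    by apply/funext => y; rewrite mulN1r.
  apply: le_trans (L2normD (dh e).1 (sqiZ (-1) (sD s e))) _.
  rewrite L2normZ// normrN normr1 mul1r /G1 mulrDl mul1r mulrAC.
  exact: lerD.
have Pgl s h e y : (forall e, density 0 L (h e)) -> y <= L ->
    prim (gl s h e) y = prim (h e) y - prim (D s e) y.
  move=> dh yL; rewrite prim_cutoff// -[RHS]/(prim (h e) y - prim (D s e) y).
  have ch := density_cz (lexx _) (dh e).
  by rewrite /prim -(Rint_B (measurable_itv _) (ch.1 0 y) ((cD s e).1 0 y)).
pose gp := gl 1 hp; pose gm := gl (-1) hm.
have dgp e : density 0 L (gp e) := dgl 1 hp e dp.
have dgm e : density 0 L (gm e) := dgl (-1) hm e dm.
have Pgp e y : y <= L -> prim (gp e) y = prim (hp e) y - prim (D 1 e) y.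
  by move=> yL; exact: (Pgl 1 hp e y dp yL).
have Pgm e y : y <= L -> prim (gm e) y = prim (hm e) y - prim (D (-1) e) y.
  by move=> yL; exact: (Pgl (-1) hm e y dm yL).
have ngp e : L2norm L (gp e) <= G1 * m := ngl 1 hp e dp np.
have ngm e : L2norm L (gm e) <= G1 * m := ngl (-1) hm e dm nm.
have gpE e y : 0 < y < L -> gp e y = hp e y - D 1 e y by move=> h; rewrite /gp /gl /cutoff h.
have gmE e y : 0 < y < L -> gm e y = hm e y - D (-1) e y by move=> h; rewrite /gm /gl /cutoff h.
clearbody gp gm.
pose c e := (k + prim (gm (~~ e)) T) / (T - 2 * L).
have hc e : `|c e| <= c1 * m.
  rewrite /c normrM normfV (gtr0_norm TL) /c1 mulrAC ler_wpM2r ?invr_ge0 ?(ltW TL)//.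
  apply: le_trans (ler_normD _ _) _; rewrite mulrDl mul1r; apply: lerD => //.
  apply: le_trans (density_bnd _ (lexx _) L0 (dgm _)) _.
  by rewrite -mulrA ler_wpM2l.
pose d e t := c e * plateau L T t - gm (~~ e) (T - t) + gp e (t - T).
have dd e : density L (T + L) (d e) /\ L2norm (T + L) (d e) <= (c1 * Num.sqrt (T + L) + G1 + G1) * m.
  have [s1 n1] := density_refl T (T + L) (lexx _) (dgm (~~ e)).
  have [s2 n2] := density_shift (- T) (T + L) (lexx _) (dgp e).
  have mp : measurable_fun `]0, (T + L)[ (plateau L T).
    by apply: measurable_funTS; exact: intg_meas (density_intgT L0 (plateau_density T L0)).
  have bp x : `|plateau L T x| <= 1 by rewrite /plateau; case: ifP; rewrite ?normr1 ?normr0.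
  have s0 : sqi (T + L) (plateau L T) by apply: (@sqi_bnd _ _ _ 1).
  have n0 : L2norm (T + L) (plateau L T) <= Num.sqrt (T + L).
    by rewrite -[leRHS]mul1r; apply: L2norm_bnd.
  have dE : d e = (fun t => c e * plateau L T t + -1 * gm (~~ e) (T - t) + gp e (t - T)).
    by apply/funext => t; rewrite mulN1r.
  split; last first.
    rewrite dE; apply: le_trans (L2normD _ s2) _; first by apply: sqiD; exact: sqiZ.
    rewrite mulrDl; apply: lerD; last by apply: le_trans n2 (ngp _).
    apply: le_trans (L2normD (sqiZ _ s0) (sqiZ _ s1)) _.
    rewrite mulrDl !L2normZ//; apply: lerD; last first.
      by rewrite normrN normr1 mul1r; apply: le_trans n1 (ngm _).
    by rewrite mulrAC; apply: ler_pM => //; exact: L2norm_ge0.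
  split; first by rewrite dE; apply: sqiD => //; apply: sqiD; exact: sqiZ.
  move=> t ht.
  have h1 : plateau L T t = 0.
    by rewrite /plateau; case: ifPn => // h; rewrite control_support ?h in ht.
  have h2 : gm (~~ e) (T - t) = 0.
    by apply: (dgm _).2; apply: contra ht => h; rewrite control_support ?h ?orbT.
  have h3 : gp e (t - T) = 0.
    by apply: (dgp _).2; apply: contra ht => h; rewrite control_support ?h ?orbT.
  by rewrite /d h1 h2 h3 mulr0 subr0 addr0.
exists d => e.
pose F e := prim (d e).
have bF : bcpair F.
  move=> e'; split; last first.
    exists (Num.sqrt (T + L) * L2norm (T + L) (d e')) => _ t.
    exact: (density_bnd _ L0 TL0 (dd e').1).
  apply: (@ucont_f R _ (fun _ t => t)); last exact: ucont_snd.
  exact: density_continuous L0 TL0 (dd e').1.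
have Fe e' x : T - L <= x -> x <= T + L -> F e' x = k + prim (gp e') (x - T) + prim (gm (~~ e')) (T - x).
  by move=> x1 x2; rewrite /F /d prim_glue.
have agree := side_sol_agree bF bf.
(* On this window f is itself k plus a primitive of [gp] after T and one of [gm] before T. *)
have Ff e' x : T - L <= x <= T + L -> F e' x = f e' x.
  move=> /andP[x1 x2]; rewrite Fe// ef /g /ctrl_op.
  have a1 : x - T <= L by rewrite lerBlDl.
  have a2 : T - x <= L by rewrite lerBlDl -lerBlDr.
  rewrite !prim_clamp// (Pgp e' _ a1) (Pgm _ _ a2).
  move: (prim _ _) (prim _ _) (prim _ _) (prim _ _) => *; ring.
have vE : edge_v (q e) L (d e) (d (~~ e)) = side_sol q L F e by [].
have [[dde nde] _] := (dd e, true).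
have dv s x : x <= L -> (s = 1 \/ s = -1) ->
    duh (q e) T s (edge_v (q e) L (d e) (d (~~ e))) x = D s e x.
  move=> xL hs1; apply: eq_Rint => z; rewrite /= in_itv/= => /andP[z0 zx].
  rewrite vE (agree Ff) ?(ltW z0)//.
  have -> : T + s * (x - z) - T = s * (x - z) by ring.
  have zx' := ltW zx; rewrite normrM (_ : `|s| = 1).
    by rewrite mul1r ger0_norm ?subr_ge0// addrC subrK.
  by case: hs1 => ->; rewrite ?normrN normr1.
have bv : bcont (edge_v (q e) L (d e) (d (~~ e))).
  by rewrite vE; exact: side_sol_bcont.
split=> //.
- move=> y hy; have /andP[y0 yL] := hy.
  rewrite {1}vE (side_sol_eq pq)// -vE (clamp_id hy) (duh_pm T (pq e) bv hy).
  have eP s : s = 1 \/ s = -1 -> prim (duh (q e) T s (edge_v (q e) L (d e) (d (~~ e)))) y = prim (D s e) y.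
    move=> hs1; apply: (@eq_prim _ _ _ L) => // t /andP[_ tL]; apply: dv => //; exact: ltW.
  rewrite (eP 1); last by left.
  rewrite (eP (-1)); last by right.
  have LyL : - L <= y by rewrite (le_trans _ y0)// oppr_le0.
  have yLL : - y <= L by rewrite (le_trans _ L0)// oppr_le0.
  rewrite !Fe ?lerD2l ?lerN2//.
  rewrite negbK.
  have -> : T + y - T = y by ring.
  have -> : T - (T + y) = - y by ring.
  have -> : T - y - T = - y by ring.
  have -> : T - (T - y) = y by ring.
  have y00 : - y <= 0 by rewrite oppr_le0.
  rewrite (prim_neg (gm (~~ e)) y00) (prim_neg (gp (~~ e)) y00) (Pgp e _ yL) (Pgm e _ yL).
  move: (prim _ _) (prim _ _) (prim _ _) (prim _ _) => *; ring.
- move=> y hy; have /andP[y0 yL] := hy.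
  rewrite /edge_vt (@Sm_duh _ _ L T (pq e))// ?ltW// !dv ?ltW//; try by [left|right].
  have y1 : T + y - T = y by ring.
  have y2 : T - (T + y) = - y by ring.
  have y3 : T - y - T = - y by ring.
  have y4 : T - (T - y) = y by ring.
  have ny : ~~ (0 < - y < L) by rewrite oppr_gt0 ltNge (ltW y0).
  have p1 : plateau L T (T + y) = 0.
    by apply: plateau_late; rewrite lerD2l (le_trans _ (ltW y0))// oppr_le0.
  have p2 : plateau L T (T - y) = 0.
    by apply: plateau_late; rewrite lerD2l lerN2 ltW.
  rewrite /d y1 y2 y3 y4 p1 p2 ((dgm (~~ e)).2 _ ny) ((dgp (~~ e)).2 _ ny) negbK.
  rewrite (gpE e y hy) (gmE e y hy).
  ring.
Qed.

End ControlDensities.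

(** * The wave equation on a square *)

Section DoublePrimitives.
Context {R : realType}.
Local Notation mu := (@lebesgue_measure R).
Implicit Types (U V X A B F G S : R -> R -> R) (f : R -> R).
Implicit Types (s t x y z c d e k h K M b T : R).

Definition sprim U s t := prim (U^~ t) s.

Lemma sprim_ucont U : ucont U -> ucont (sprim U).
Proof. by move=> uU; exact: (ucont_swap (tprim_ucont (ucont_swap uU))). Qed.

Lemma sprim_tprim U s t : ucont U -> 0 <= s -> 0 <= t ->
  sprim (tprim U) s t = tprim (sprim U) s t.
Proof.
move=> uU s0 t0; have [M M0 hM] := @ucont_bnd R U 0 s 0 t uU.
have [|_ _ _ E] := fubini_rect (intg_cst_oo 0 s 1) (ucont_meas uU) (M := M) (t := t) _ M0.
  by move=> z x /andP[z0 zs] /andP[x0 xt]; apply: hM; rewrite !ltW.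
rewrite /sprim /tprim /prim.
transitivity (\int[mu]_(z in `]0, s[) (1 * \int[mu]_(x in `]0, t[) U z x)).
  by apply: eq_Rint => z _; rewrite mul1r.
rewrite -E; apply: eq_Rint => x _; apply: eq_Rint => z _; by rewrite mul1r.
Qed.

(* Bisecting [x, y] n times improves the bound by a factor 2^n. *)
Lemma quadratic_const f a b K : 0 <= K ->
  (forall x y, a <= x <= b -> a <= y <= b -> `|f x - f y| <= K * `|x - y| ^+ 2) ->
  forall x y, a <= x <= b -> a <= y <= b -> f x = f y.
Proof.
move=> K0 hf x y hx hy; apply/eqP; rewrite -subr_eq0 -normr_le0.
apply: (@half_pow_le0 _ _ (K * `|x - y| ^+ 2)) => n.
elim: n x y hx hy => [|n IH] x y hx hy; first by rewrite expr0 divr1; exact: hf.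
have /andP[x0 xb] := hx; have /andP[y0 yb] := hy.
pose m := (x + y) / 2.
have hm : a <= m <= b.
  rewrite /m ler_pdivlMr// ler_pdivrMr//.
  by apply/andP; split; lra.
have -> : f x - f y = (f x - f m) + (f m - f y) by ring.
apply: le_trans (ler_normD _ _) _.
have e1 : `|x - m| = `|x - y| / 2.
  by rewrite (_ : x - m = (x - y) / 2) ?normrM ?(ger0_norm (_ : 0 <= 2^-1))// /m; field.
have e2 : `|m - y| = `|x - y| / 2.
  by rewrite (_ : m - y = (x - y) / 2) ?normrM ?(ger0_norm (_ : 0 <= 2^-1))// /m; field.
have h1 := IH x m hx hm; have h2 := IH m y hm hy.
rewrite e1 in h1; rewrite e2 in h2.
apply: le_trans (lerD h1 h2) _.
have n0 : (2 : R) ^+ n != 0 by rewrite expf_neq0.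
rewrite le_eqVlt; apply/orP; left; apply/eqP.
rewrite (_ : (2 : R) ^+ n.+1 = 2 * 2 ^+ n); last exact: exprS.
by field.
Qed.

Lemma prim_zero f b : continuous f -> 0 < b -> (forall t, 0 <= t <= b -> prim f t = 0) ->
  forall t, 0 <= t <= b -> f t = 0.
Proof.
move=> cf b0 hf t ht; have /andP[t0 tb] := ht.
apply/eqP; rewrite -normr_le0; apply/ler_addgt0Pl => e e0; rewrite addr0.
have /cvgrPdist_lt /(_ _ e0) [d /= d0 hd] := cf t.
pose c1 := Num.max 0 (t - d / 2); pose c2 := Num.min b (t + d / 2).
have d2 : 0 < d / 2 by rewrite divr_gt0.
have c1t : c1 <= t by rewrite /c1 ge_max t0/=; lra.
have c2t : t <= c2 by rewrite /c2 le_min tb/=; lra.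
have c12 : c1 < c2.
  rewrite /c1 /c2 gt_max !lt_min b0/=; apply/andP; split; last by apply/andP; split; lra.
  lra.
have c10 : 0 <= c1 by rewrite /c1 le_max lexx.
have c2b : c2 <= b by rewrite /c2 ge_min lexx.
have c1d : t - d / 2 <= c1 by rewrite /c1 le_max lexx orbT.
have c2d : c2 <= t + d / 2 by rewrite /c2 ge_min lexx orbT.
have E : \int[mu]_(x in `]c1, c2[) f x = 0.
  rewrite -(@primB _ f b c1 c2 (continuous_intg _ _ cf) c10 (ltW c12) c2b).
  rewrite (hf c1) ?(hf c2) ?subrr//; first by rewrite c2b (le_trans c10)// ltW.
  by rewrite c10 (le_trans (ltW c12)).
have J : \int[mu]_(x in `]c1, c2[) (f t - f x) = f t * (c2 - c1).
  rewrite Rint_B ?E ?subr0 ?Rint_cst ?ltW//; first exact: intg_cst_oo.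
  exact: continuous_intg.
have := @Rint_bnd _ c1 c2 (fun x => f t - f x) e (ltW c12).
rewrite J normrM (gtr0_norm (_ : 0 < c2 - c1)) ?subr_gt0//.
rewrite ler_pM2r ?subr_gt0//; apply.
  by apply: intgB; [exact: measurable_itv|exact: intg_cst_oo|exact: continuous_intg].
move=> x /andP[x1 x2]; apply/ltW; apply: hd => /=.
by rewrite ltr_norml; apply/andP; split; lra.
Qed.

Lemma min_max_itv x y z a b : a <= x <= b -> a <= y <= b ->
  Num.min x y <= z <= Num.max x y -> a <= z <= b.
Proof.
move=> /andP[ax xb] /andP[ay yb]; rewrite ge_min le_max => /andP[/orP[] h1 /orP[] h2];
  by apply/andP; split; lra.
Qed.

Section Square.
Variables (T : R).
Hypothesis T0 : 0 <= T.

Let sq s t := (0 <= s <= T) && (0 <= t <= T).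

Lemma Rint_near (f : R -> R) k e x y : continuous f -> 0 <= x -> 0 <= y ->
  (forall z, Num.min x y <= z <= Num.max x y -> `|f z - k| <= e) ->
  `|prim f y - prim f x - (y - x) * k| <= e * `|y - x|.
Proof.
move=> cf; wlog xy : x y / x <= y.
  move=> wl x0 y0 hk; have [xy|/ltW yx] := leP x y; first exact: wl.
  have -> : prim f y - prim f x - (y - x) * k = - (prim f x - prim f y - (x - y) * k).
    move: (prim _ _) (prim _ _) => *; ring.
  by rewrite normrN [`|y - x|]distrC; apply: wl; rewrite // minC maxC.
move=> x0 y0 hk.
rewrite (@primB _ f y x y (continuous_intg _ _ cf) x0 xy (lexx _)).
have -> : (y - x) * k = \int[mu]_(z in `]x, y[) k by rewrite Rint_cst// mulrC.
rewrite -(Rint_B (measurable_itv _) (continuous_intg _ _ cf) (intg_cst_oo x y k)).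
rewrite (ger0_norm (_ : 0 <= y - x)) ?subr_ge0//; apply: Rint_bnd => //.
  by apply: intgB; [exact: measurable_itv|exact: continuous_intg|exact: intg_cst_oo].
move=> z /andP[xz zy]; apply: hk; rewrite min_l// max_r//.
by rewrite !ltW.
Qed.

Lemma sprim_sec U t : ucont U -> continuous (U^~ t).
Proof. by move=> uU; exact: (@ucont_sec _ _ t (ucont_swap uU)). Qed.

Lemma mixed_lip X A B M : ucont A -> ucont B ->
  (forall s t, sq s t -> X s t = sprim A s t) ->
  (forall s t, sq s t -> X s t = tprim B s t) ->
  (forall s t, sq s t -> `|A s t| <= M) -> (forall s t, sq s t -> `|B s t| <= M) ->
  forall s t s' t', sq s t -> sq s' t' ->
  `|X s' t' - X s t| <= M * (`|s' - s| + `|t' - t|).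
Proof.
move=> uA uB XA XB hA hB s t s' t' /andP[hs ht] /andP[hs' ht'].
have /andP[s0 sT] := hs; have /andP[t0 tT] := ht.
have /andP[s0' sT'] := hs'; have /andP[t0' tT'] := ht'.
have -> : X s' t' - X s t = (X s' t' - X s t') + (X s t' - X s t).
  by rewrite addrA subrK.
apply: le_trans (ler_normD _ _) _; rewrite mulrDr; apply: lerD.
  rewrite !XA /sq ?hs ?hs' ?ht ?ht'//.
  have := @Rint_near (A^~ t') 0 M s s' (sprim_sec uA) s0 s0'.
  rewrite mulr0 subr0; apply=> z hz; rewrite subr0; apply: hA.
  by rewrite /sq ht' (min_max_itv hs hs').
rewrite !XB /sq ?hs ?hs' ?ht ?ht'//.
have := @Rint_near (B s) 0 M t t' (@ucont_sec _ _ s uB) t0 t0'.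
rewrite mulr0 subr0; apply=> z hz; rewrite subr0; apply: hB.
by rewrite /sq hs (min_max_itv ht ht').
Qed.

(** A first-order expansion with quadratic error, obtained along the path (s, t), (s, t'), (s', t').
    It takes the place of differentiability in two variables and feeds [quadratic_const]. *)
Lemma mixed_increment X A B M : ucont A -> ucont B ->
  (forall s t, sq s t -> X s t = sprim A s t) ->
  (forall s t, sq s t -> X s t = tprim B s t) ->
  (forall s t s' t', sq s t -> sq s' t' -> `|A s' t' - A s t| <= M * (`|s' - s| + `|t' - t|)) ->
  (forall s t s' t', sq s t -> sq s' t' -> `|B s' t' - B s t| <= M * (`|s' - s| + `|t' - t|)) ->
  0 <= M -> forall s t s' t', sq s t -> sq s' t' ->
  `|X s' t' - X s t - ((s' - s) * A s t + (t' - t) * B s t)| <= M * (`|s' - s| + `|t' - t|) ^+ 2.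
Proof.
move=> uA uB XA XB hA hB M0 s t s' t' st st'.
have /andP[hs ht] := st; have /andP[hs' ht'] := st'.
have /andP[s0 sT] := hs; have /andP[t0 tT] := ht.
have /andP[s0' sT'] := hs'; have /andP[t0' tT'] := ht'.
have h z x y : 0 <= x <= T -> 0 <= y <= T -> Num.min x y <= z <= Num.max x y ->
    (0 <= z <= T) /\ `|z - x| <= `|y - x|.
  move=> hx hy hz; split; first exact: min_max_itv hz.
  move: hz; have [xy|/ltW yx] := leP x y.
    by move=> /andP[h1 h2]; rewrite !ger0_norm ?subr_ge0//; lra.
  move=> /andP[h1 h2]; rewrite distrC [leRHS]distrC !ger0_norm ?subr_ge0//; lra.
have -> : X s' t' - X s t - ((s' - s) * A s t + (t' - t) * B s t) =
  (X s' t' - X s t' - (s' - s) * A s t) + (X s t' - X s t - (t' - t) * B s t) by ring.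
apply: le_trans (ler_normD _ _) _.
set D := `|s' - s| + `|t' - t|.
have -> : M * D ^+ 2 = (M * D) * `|s' - s| + (M * D) * `|t' - t| by rewrite /D; ring.
apply: lerD.
  rewrite !XA /sq ?hs ?hs' ?ht ?ht'//.
  apply: (@Rint_near (A^~ t') _ _ s s' (sprim_sec uA) s0 s0') => z hz.
  have [hz1 hz2] := h z s s' hs hs' hz.
  apply: le_trans (hA s t z t' st _) _; first by rewrite /sq hz1.
  by rewrite ler_wpM2l// lerD2r.
rewrite !XB /sq ?hs ?hs' ?ht ?ht'//.
apply: (@Rint_near (B s) _ _ t t' (@ucont_sec _ _ s uB) t0 t0') => z hz.
have [hz1 hz2] := h z t t' ht ht' hz.
apply: le_trans (hB s t s z st _) _; first by rewrite /sq hs.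
rewrite subrr normr0 add0r ler_wpM2l//; apply: le_trans hz2 _; by rewrite /D lerDr.
Qed.

Lemma sq_antidiag T1 s t x : 0 <= T1 -> s + t <= T + T1 -> sq s t ->
  T1 <= x <= t -> sq (s + t - x) x.
Proof.
move=> T10 sT /andP[/andP[s0 _] /andP[_ tT]] /andP[x1 x2].
by apply/andP; split; apply/andP; split; lra.
Qed.

Lemma sq_diag T1 s t x : 0 <= T1 -> t - T1 <= s -> sq s t ->
  T1 <= x <= t -> sq (s - t + x) x.
Proof.
move=> T10 ts /andP[/andP[_ sT] /andP[_ tT]] /andP[x1 x2].
by apply/andP; split; apply/andP; split; lra.
Qed.

Lemma sq_diag_bdry s t x : s <= t -> sq s t -> 0 <= x <= s -> sq x (t - s + x).
Proof.
move=> st /andP[/andP[s0 sT] /andP[_ tT]] /andP[x1 x2].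
by apply/andP; split; apply/andP; split; lra.
Qed.

(* P_s = Q_t = F and P_t = Q_s = S, so P + Q and P - Q are constant on the
   characteristics s + t = const and s - t = const. *)
Lemma characteristics F S P Q T1 M s t : 0 <= M -> 0 <= T1 <= T ->
  (forall s t s' t', sq s t -> sq s' t' ->
    `|P s' t' - P s t - ((s' - s) * F s t + (t' - t) * S s t)| <= M * (`|s' - s| + `|t' - t|) ^+ 2) ->
  (forall s t s' t', sq s t -> sq s' t' ->
    `|Q s' t' - Q s t - ((s' - s) * S s t + (t' - t) * F s t)| <= M * (`|s' - s| + `|t' - t|) ^+ 2) ->
  (forall x, 0 <= x <= T -> P x T1 = 0) -> (forall x, 0 <= x <= T -> Q x T1 = 0) ->
  (forall x, 0 <= x <= T -> P 0 x = 0) -> (forall x, 0 <= x <= T -> Q 0 x = 0) ->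
  sq s t -> T1 <= t -> s + t <= T + T1 -> Q s t = 0.
Proof.
move=> M0 /andP[T10 T1T] iP iQ zP zQ zP0 zQ0 st T1t sT.
have /andP[hs /andP[t0 tT]] := st; have /andP[s0 sT'] := hs.
have dist2 x y : (`|x - y| + `|x - y|) ^+ 2 = 4 * `|x - y| ^+ 2 by ring.
have sum0 : P s t + Q s t = 0.
  pose f x := P (s + t - x) x + Q (s + t - x) x.
  have hf x y : T1 <= x <= t -> T1 <= y <= t -> f x = f y.
    apply: (@quadratic_const f T1 t (8 * M)); first by rewrite mulr_ge0.
    move=> {}x {}y hx hy.
    have sx : sq (s + t - x) x := sq_antidiag T10 sT st hx.
    have sy : sq (s + t - y) y := sq_antidiag T10 sT st hy.
    have := iP _ _ _ _ sy sx; have := iQ _ _ _ _ sy sx.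
    have -> : s + t - x - (s + t - y) = y - x by ring.
    rewrite [`|y - x|]distrC dist2 => h1 h2.
    have -> : f x - f y =
      (P (s + t - x) x - P (s + t - y) y - ((y - x) * F (s + t - y) y + (x - y) * S (s + t - y) y)) +
      (Q (s + t - x) x - Q (s + t - y) y - ((y - x) * S (s + t - y) y + (x - y) * F (s + t - y) y)).
      by rewrite /f; ring.
    apply: le_trans (ler_normD _ _) _; apply: le_trans (lerD h2 h1) _.
    by rewrite le_eqVlt; apply/orP; left; apply/eqP; ring.
  have /(_ _ _)e := hf t T1; move: e; rewrite /f addrK T1t !lexx => /(_ isT isT) ->.
  have /andP[h _] : sq (s + t - T1) T1.
    by apply: (sq_antidiag T10 sT st); rewrite lexx T1t.
  by rewrite zP ?zQ ?addr0.
have diff0 : P s t - Q s t = 0.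
  (* Followed backwards, the characteristic s - t = const meets either the line t = T1 or the line s
     = 0; both carry zero data. *)
  have [sle|/ltW sge] := leP (t - T1) s.
    pose f x := P (s - t + x) x - Q (s - t + x) x.
    have hf x y : T1 <= x <= t -> T1 <= y <= t -> f x = f y.
      apply: (@quadratic_const f T1 t (8 * M)); first by rewrite mulr_ge0.
      move=> {}x {}y hx hy.
      have sx : sq (s - t + x) x := sq_diag T10 sle st hx.
      have sy : sq (s - t + y) y := sq_diag T10 sle st hy.
      have := iP _ _ _ _ sy sx; have := iQ _ _ _ _ sy sx.
      have -> : s - t + x - (s - t + y) = x - y by ring.
      rewrite dist2 => h1 h2.
      have -> : f x - f y =
        (P (s - t + x) x - P (s - t + y) y - ((x - y) * F (s - t + y) y + (x - y) * S (s - t + y) y)) -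
        (Q (s - t + x) x - Q (s - t + y) y - ((x - y) * S (s - t + y) y + (x - y) * F (s - t + y) y)).
        by rewrite /f; ring.
      apply: le_trans (ler_normB _ _) _; apply: le_trans (lerD h2 h1) _.
      by rewrite le_eqVlt; apply/orP; left; apply/eqP; ring.
    have /(_ _ _)e := hf t T1; move: e; rewrite /f subrK T1t !lexx => /(_ isT isT) ->.
    have /andP[h _] : sq (s - t + T1) T1.
      by apply: (sq_diag T10 sle st); rewrite lexx T1t.
    by rewrite zP ?zQ ?subr0.
  have s_le_t : s <= t by rewrite (le_trans sge)// gerBl.
  pose f x := P x (t - s + x) - Q x (t - s + x).
  have hf x y : 0 <= x <= s -> 0 <= y <= s -> f x = f y.
    apply: (@quadratic_const f 0 s (8 * M)); first by rewrite mulr_ge0.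
    move=> {}x {}y hx hy.
    have sx : sq x (t - s + x) := sq_diag_bdry s_le_t st hx.
    have sy : sq y (t - s + y) := sq_diag_bdry s_le_t st hy.
    have := iP _ _ _ _ sy sx; have := iQ _ _ _ _ sy sx.
    have -> : t - s + x - (t - s + y) = x - y by ring.
    rewrite dist2 => h1 h2.
    have -> : f x - f y =
      (P x (t - s + x) - P y (t - s + y) - ((x - y) * F y (t - s + y) + (x - y) * S y (t - s + y))) -
      (Q x (t - s + x) - Q y (t - s + y) - ((x - y) * S y (t - s + y) + (x - y) * F y (t - s + y))).
      by rewrite /f; ring.
    apply: le_trans (ler_normB _ _) _; apply: le_trans (lerD h2 h1) _.
    by rewrite le_eqVlt; apply/orP; left; apply/eqP; ring.
  have /(_ _ _)e := hf s 0; move: e; rewrite /f subrK s0 !lexx => /(_ isT isT) ->.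
  have z0 : 0 <= t - s + 0 <= T by apply/andP; split; lra.
  by rewrite zP0 ?zQ0 ?subr0.
move: sum0 diff0; move: (P s t) (Q s t) => p r; lra.
Qed.

(* F solves F_ss = F_tt in integrated form, so F_s + F_t and F_s - F_t are
   constant on the characteristics; the statement is about primitives. *)
Lemma wave_square_unique G T1 : ucont G -> 0 <= T1 <= T ->
  (forall s t, sq s t -> tprim (tprim G) s t = sprim (sprim G) s t) ->
  (forall s t, sq s t -> t <= T1 -> tprim (tprim G) s t = 0) ->
  forall s t, sq s t -> s + t <= T + T1 -> tprim (tprim (tprim G)) s t = 0.
Proof.
move=> uG hT1 GF G0 s t st sT.
have /andP[T10 T1T] := hT1.
(* F and S have bounded first derivatives [sprim G] and [tprim G], so they are Lipschitz, and P, Q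
   have derivatives F, S. The hypothesis on double primitives provides F_s = [sprim G] and Q_s = S;
   the rest is Fubini. *)
pose F := tprim (tprim G); pose S := sprim (tprim G).
pose P := sprim F; pose Q := tprim F.
have utG := tprim_ucont uG; have usG := sprim_ucont uG.
have uF : ucont F by exact: tprim_ucont.
have uS : ucont S by exact: sprim_ucont.
have sq0 x y : sq x y -> 0 <= x /\ 0 <= y by move=> /andP[/andP[? _] /andP[? _]].
have sqle x y x' y' : sq x y -> 0 <= x' <= x -> 0 <= y' <= y -> sq x' y'.
  move=> /andP[/andP[? xT] /andP[? yT]] /andP[? xx] /andP[? yy].
  by apply/andP; split; apply/andP; split=> //; [exact: le_trans xT|exact: le_trans yT].
have SE x y : sq x y -> S x y = tprim (sprim G) x y.
  by move=> /sq0[x0 y0]; exact: sprim_tprim uG x0 y0.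
have PE x y : sq x y -> P x y = tprim S x y.
  by move=> /sq0[x0 y0]; exact: sprim_tprim utG x0 y0.
have QE x y : sq x y -> Q x y = sprim S x y.
  move=> xy; have [x0 y0] := sq0 _ _ xy.
  transitivity (tprim (sprim (sprim G)) x y).
    apply: eq_Rint => z; rewrite /= in_itv/= => /andP[z0 zy]; apply: GF.
    by apply: (sqle x y); rewrite ?lexx ?x0// !ltW.
  rewrite -(sprim_tprim usG x0 y0).
  apply: eq_Rint => z; rewrite /= in_itv/= => /andP[z0 zx]; apply/esym; apply: SE.
  by apply: (sqle x y); rewrite ?lexx ?y0// !ltW.
have [M1 M10 hM1] := @ucont_bnd R (tprim G) 0 T 0 T utG.
have [M2 M20 hM2] := @ucont_bnd R (sprim G) 0 T 0 T usG.
pose M := M1 + M2.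
have M0 : 0 <= M by rewrite addr_ge0.
have b1 x y : sq x y -> `|tprim G x y| <= M.
  by move=> /andP[hx hy]; apply: le_trans (hM1 _ _ hx hy) _; rewrite lerDl.
have b2 x y : sq x y -> `|sprim G x y| <= M.
  by move=> /andP[hx hy]; apply: le_trans (hM2 _ _ hx hy) _; rewrite lerDr.
have lF := @mixed_lip F (sprim G) (tprim G) M usG utG GF (fun _ _ _ => erefl) b2 b1.
have lS := @mixed_lip S (tprim G) (sprim G) M utG usG (fun _ _ _ => erefl) SE b1 b2.
have iP := @mixed_increment P F S M uF uS (fun _ _ _ => erefl) PE lF lS M0.
have iQ := @mixed_increment Q S F M uS uF QE (fun _ _ _ => erefl) lS lF M0.
have zP x : 0 <= x <= T -> P x T1 = 0.
  move=> hx; have /andP[x0 xT] := hx.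
  apply: (etrans _ (@Rint_zero R `]0, x[)); apply: eq_Rint => z; rewrite /= in_itv/= => /andP[z0 zx].
  by apply: G0 => //; apply: (sqle x T1); rewrite /sq ?hx ?hT1// ?lexx ?T10// !ltW.
have zQ x : 0 <= x <= T -> Q x T1 = 0.
  move=> hx; have /andP[x0 xT] := hx.
  apply: (etrans _ (@Rint_zero R `]0, T1[)); apply: eq_Rint => z; rewrite /= in_itv/= => /andP[z0 zx].
  apply: G0; last exact: ltW.
  by apply: (sqle x T1); rewrite /sq ?hx ?hT1// ?lexx ?x0// !ltW.
have [tT1|/ltW T1t] := leP t T1.
  have /andP[hs /andP[t0 tT]] := st; have /andP[s0 sT'] := hs.
  apply: (etrans _ (@Rint_zero R `]0, t[)); apply: eq_Rint => z; rewrite /= in_itv/= => /andP[z0 zx].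
  apply: G0; last by rewrite ltW// (lt_le_trans zx).
  by apply: (sqle s t); rewrite ?lexx ?s0// !ltW.
have zP0 x : 0 <= x <= T -> P 0 x = 0 by move=> _; exact: prim0.
have zQ0 x : 0 <= x <= T -> Q 0 x = 0.
  move=> hx; apply: (etrans (QE _ _ _)); last exact: prim0.
  by rewrite /sq hx lexx T0.
refine (@characteristics F S P Q T1 M s t M0 hT1 iP iQ zP zQ zP0 zQ0 st T1t sT).
Qed.

End Square.
End DoublePrimitives.

(** * The resolvent of the operator *)

Section Form.
Context {R : realType}.
Local Notation mu := (@lebesgue_measure R).
Implicit Types (f g phi chi : R -> R) (x y z c k m K L M : R).

Lemma AC_sqi L f f' : 0 <= L -> AC_deriv L f f' -> sqi L f.
Proof.
move=> L0 hf; have [M hM] := AC_bnd hf.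
apply: (@sqi_bnd _ _ _ M (AC_meas L0 hf)) => x /andP[x0 xL].
by apply: hM; rewrite !ltW.
Qed.

(** phi^2 varies by at most the integral of 2 |phi phi'| <= K phi^2 + K^-1 phi'^2; averaging over
    the base point gives the term with L^-1. The free parameter K trades one norm against the
    other. *)
Lemma AC_sup_form L phi phi' K : 0 < L -> 0 < K -> AC_deriv L phi phi' -> sqi L phi' ->
  forall x, 0 <= x <= L -> phi x ^+ 2 <=
    (L^-1 + K) * (\int[mu]_(y in `]0, L[) phi y ^+ 2) +
    K^-1 * \int[mu]_(y in `]0, L[) phi' y ^+ 2.
Proof.
move=> L0 K0 hphi sphi' x hx; have L0' := ltW L0.
have sphi := AC_sqi L0' hphi; have [_ i1] := sphi; have [_ i2] := sphi'.
have mI : measurable `]0, L[%classic by exact: measurable_itv.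
pose g y := phi' y * phi y + phi y * phi' y.
have hg : AC_deriv L (fun y => phi y * phi y) g by exact: AC_mul.
have /AC_derivP[ig eg] := hg.
pose h y := K * phi y ^+ 2 + K^-1 * phi' y ^+ 2.
have ih : intg `]0, L[ h by apply: intgD => //; exact: intgZ.
have gh y : `|g y| <= h y.
  have -> : g y = 2 * (phi y * phi' y) by rewrite /g; ring.
  have Kn : K != 0 by rewrite gt_eqF.
  have p1 : 0 <= K^-1 * (K * phi y - phi' y) ^+ 2 by rewrite mulr_ge0 ?sqr_ge0// invr_ge0 ltW.
  have p2 : 0 <= K^-1 * (K * phi y + phi' y) ^+ 2 by rewrite mulr_ge0 ?sqr_ge0// invr_ge0 ltW.
  have e1 : K^-1 * (K * phi y - phi' y) ^+ 2 = h y - 2 * (phi y * phi' y) by rewrite /h; field.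
  have e2 : K^-1 * (K * phi y + phi' y) ^+ 2 = h y + 2 * (phi y * phi' y) by rewrite /h; field.
  by rewrite ler_norml; apply/andP; split; lra.
pose H := \int[mu]_(y in `]0, L[) h y.
have D u v : 0 <= u -> u <= v -> v <= L -> `|prim g v - prim g u| <= H.
  move=> u0 uv vL; rewrite (primB ig u0 uv vL).
  have j : intg `]u, v[ h := intgS_oo u0 vL ih.
  apply: le_trans (Rint_norm_le (measurable_itv _) (intgS_oo u0 vL ig) j (fun y _ => gh y)) _.
  by apply: Rint_mono_oo => // y; apply: le_trans (gh y).
have B y : 0 < y < L -> phi x ^+ 2 <= phi y ^+ 2 + H.
  move=> /andP[y0 yL]; have /andP[x0 xL] := hx.
  have hy : 0 <= y <= L by rewrite !ltW.
  rewrite -lerBlDl expr2 [X in _ - X]expr2 (eg x hx) (eg y hy).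
  have -> : forall u v w : R, u + v - (u + w) = v - w by move=> *; ring.
  apply: le_trans (ler_norm _) _.
  have [xy|/ltW yx] := leP x y; first by rewrite distrC; apply: D => //; exact: ltW.
  by apply: D => //; exact: ltW.
have E : phi x ^+ 2 * L <= \int[mu]_(y in `]0, L[) phi y ^+ 2 + H * L.
  have -> : phi x ^+ 2 * L = \int[mu]_(y in `]0, L[) (phi x ^+ 2) by rewrite Rint_cst// subr0.
  have -> : H * L = \int[mu]_(y in `]0, L[) H by rewrite Rint_cst// subr0.
  rewrite -(Rint_D mI i1 (intg_cst_oo 0 L H)).
  apply: Rint_le => //; [exact: intg_cst_oo|by apply: intgD => //; exact: intg_cst_oo].
have HE : H = K * \int[mu]_(y in `]0, L[) phi y ^+ 2 + K^-1 * \int[mu]_(y in `]0, L[) phi' y ^+ 2.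
  exact: Rint_lin.
move: E; rewrite HE; move: (\int[mu]_(y in _) _) (\int[mu]_(y in _) _) => I J E.
rewrite -(ler_pM2r L0); apply: le_trans E _.
have Ln : L != 0 by rewrite gt_eqF.
have Kn : K != 0 by rewrite gt_eqF.
by rewrite le_eqVlt; apply/orP; left; apply/eqP; field; rewrite Ln Kn.
Qed.

Lemma form_bound L q : 0 < L -> intg `]0, L[ q -> exists C, forall phi phi',
  AC_deriv L phi phi' -> sqi L phi' ->
  - (\int[mu]_(y in `]0, L[) (q y * phi y * phi y)) <=
  \int[mu]_(y in `]0, L[) phi' y ^+ 2 + C * \int[mu]_(y in `]0, L[) phi y ^+ 2.
Proof.
move=> L0 iq; have L0' := ltW L0.
have mI : measurable `]0, L[%classic by exact: measurable_itv.
have iqn := intg_norm mI iq.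
pose Q := \int[mu]_(y in `]0, L[) `|q y|.
have Q0 : 0 <= Q by exact: Rintegral_ge0.
have K0 : 0 < Q + 1 by rewrite ltr_wpDl.
exists (Q * (L^-1 + (Q + 1))) => phi phi' hphi sphi'.
have sup := AC_sup_form L0 K0 hphi sphi'.
set I := \int[mu]_(y in _) phi y ^+ 2 in sup *.
set J := \int[mu]_(y in _) phi' y ^+ 2 in sup *.
have J0 : 0 <= J by apply: Rintegral_ge0 => y _; exact: sqr_ge0.
pose N := (L^-1 + (Q + 1)) * I + (Q + 1)^-1 * J.
have [M hM] := AC_bnd hphi.
have mphi := AC_meas L0' hphi.
have i2 : intg `]0, L[ (fun y => q y * phi y * phi y).
  apply: (@intg_mulb _ _ _ _ M) => //.
    apply: (@intg_mulb _ _ _ _ M) => // y; rewrite /= in_itv/= => /andP[y0 yL].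
    by apply: hM; rewrite !ltW.
  by move=> y; rewrite /= in_itv/= => /andP[y0 yL]; apply: hM; rewrite !ltW.
apply: le_trans (ler_norm _) _; rewrite normrN.
apply: (@le_trans _ _ (\int[mu]_(y in `]0, L[) (N * `|q y|))).
  apply: Rint_norm_le => //; first exact: intgZ.
  move=> y; rewrite /= in_itv/= => /andP[y0 yL].
  rewrite -mulrA normrM [leRHS]mulrC ler_wpM2l// -expr2 ger0_norm ?sqr_ge0//.
  by apply: sup; rewrite !ltW.
rewrite Rint_Zl// -/Q /N mulrDl addrC; apply: lerD; last first.
  by rewrite le_eqVlt; apply/orP; left; apply/eqP; ring.
rewrite mulrAC -[leRHS]mul1r ler_wpM2r//.
by rewrite mulrC ler_pdivrMr// mul1r lerDl.
Qed.

(** With K = 2^n in [AC_sup_form], only 2^-n times the Dirichlet integral remains. *)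
Lemma form_zero L phi phi' : 0 < L -> AC_deriv L phi phi' -> sqi L phi' ->
  \int[mu]_(y in `]0, L[) phi y ^+ 2 = 0 -> forall x, 0 <= x <= L -> phi x = 0.
Proof.
move=> L0 hphi sphi' I0 x hx.
pose J := \int[mu]_(y in `]0, L[) phi' y ^+ 2.
have J0 : 0 <= J by apply: Rintegral_ge0 => y _; exact: sqr_ge0.
apply/eqP; rewrite -sqrf_eq0 eq_le sqr_ge0 andbT.
apply: (@half_pow_le0 _ _ J) => n.
have n0 : (0 : R) < 2 ^+ n by rewrite exprn_gt0.
have := AC_sup_form L0 n0 hphi sphi' hx.
by rewrite I0 mulr0 add0r mulrC.
Qed.

Lemma solve3 (A B C D : 'I_3 -> R) :
  (forall x y z, (forall k : 'I_3, x * A k + y * B k + z * C k = 0) -> [/\ x = 0, y = 0 & z = 0]) ->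
  exists x y z, forall k : 'I_3, x * A k + y * B k + z * C k = D k.
Proof.
move=> inj.
pose M : 'M[R]_3 := \matrix_(i, k) (if i == edge1 then A k else if i == edge2 then B k else C k).
have sum3' (F : 'I_3 -> R) : \sum_(i < 3) F i = F edge1 + F edge2 + F edge3.
  by rewrite !big_ord_recl big_ord0 addr0 addrA; congr (F _ + F _ + F _); exact: val_inj.
have mE (p : 'rV[R]_3) (k : 'I_3) : (p *m M) 0 k = p 0 edge1 * A k + p 0 edge2 * B k + p 0 edge3 * C k.
  by rewrite mxE sum3' !mxE.
have fM : row_free M.
  apply: inj_row_free => p pM.
  have [|h1 h2 h3] := inj (p 0 edge1) (p 0 edge2) (p 0 edge3).
    by move=> k; rewrite -mE pM mxE.
  apply/rowP => i; rewrite mxE.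
  case: i => [[|[|[|//]]] hi].
  - by rewrite -[RHS]h1; congr (p _ _); exact: val_inj.
  - by rewrite -[RHS]h2; congr (p _ _); exact: val_inj.
  - by rewrite -[RHS]h3; congr (p _ _); exact: val_inj.
have uM : M \in unitmx by rewrite -row_free_unit.
pose p := (\row_k D k) *m invmx M.
exists (p 0 edge1), (p 0 edge2), (p 0 edge3) => k.
by rewrite -mE /p mulmxKV// mxE.
Qed.

(** A stationary sideways solution. Its data do not depend on t, so uniqueness under time shifts
    makes the solution independent of t, and the wave integral becomes the double primitive of q
    phi. *)
Lemma ode_exists q L alpha beta g : potential q L -> sqi L g -> exists phi phi',
  [/\ AC_deriv L phi phi', AC_deriv L phi' (fun y => q y * phi y - g y),
      phi 0 = alpha & phi' 0 = beta].
Proof.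
move=> pq sg; have [L0 iq q0] := pq.
pose h := cutoff L g.
have dh : density 0 L h by exact: cutoff_density.
have ch : continuous (prim h) by exact: density_continuous (lexx _) L0 dh.
have ih2 a b : intg `]a, b[ (prim h) by exact: continuous_intg.
have uh : ucont (fun _ : R => prim (prim h)).
  by apply: (@tprim_ucont _ (fun _ => prim h)); exact: ucont_f ch ucont_snd.
have cl : ucont (fun y t => clamp L y) by apply: ucont_f ucont_fst; exact: clamp_continuous.
pose v0 y (t : R) := alpha + beta * clamp L y - prim (prim h) (clamp L y).
have uv0 : ucont v0.
  apply: (@ucontB _ (fun y t => alpha + beta * clamp L y) (fun y t => prim (prim h) (clamp L y))).
    apply: (@ucontD _ (fun _ _ => alpha) (fun y t => beta * clamp L y)); first exact: ucont_cst.
    by apply: (@ucontM _ (fun _ _ => beta) (fun y t => clamp L y)); [exact: ucont_cst|exact: cl].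
  by apply: (@ucont_f R _ _ (@ucont_sec _ _ 0 uh)); exact: cl.
have bv0 : bcont v0.
  split=> //; have [M M0 hM] := @ucont_bnd R v0 0 L 0 0 uv0.
  exists M => y t; have -> : v0 y t = v0 (clamp L y) 0 by rewrite /v0 (clamp_id (clampP _ L0)).
  by apply: hM; [exact: clampP|rewrite lexx].
have [bv ev] := wsolP pq bv0.
set v := wsol q L v0 in bv ev.
have vt y t : v y t = v y 0.
  pose v1 y s := v y (s + t).
  have bv1 : bcont v1.
    apply: (@bcont_comp _ v (fun y _ => y) (fun _ s => s + t) bv).
      exact: ucont_fst.
    pose h1 := @ucontD R (fun _ s => s) (fun _ _ => t) (@ucont_snd R) (@ucont_cst R t).
    exact: h1.
  have ev1 y' s : v1 y' s = v0 y' s + wave_int q L v1 y' s.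
    rewrite /v1 ev; congr (_ + _); apply: eq_Rint => z _; congr (_ * _).
    rewrite /avg; congr (_ / _).
    have [_ e] := @Rint_shift_oo _ (v z) (s - crad L y' z) (s + crad L y' z) t (bcont_intg _ _ _ bv).
    rewrite (_ : s + t - crad L y' z = s - crad L y' z + t); last by ring.
    rewrite (_ : s + t + crad L y' z = s + crad L y' z + t); last by ring.
    exact: esym e.
  by have := sideways_unique pq bv1 bv ev1 ev y 0; rewrite /v1 add0r.
pose phi y := v y 0.
have uphi : ucont (fun z s : R => phi z).
  by apply: (@ucont_f _ phi (fun z _ => z)); [exact: bcont_sec2 bv|exact: ucont_fst].
have [_ [M hM]] := bv.
have M0 : 0 <= M by exact: le_trans (hM 0 0).
have cphi : continuous phi by exact: bcont_sec2 bv.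
have iqp : intg setT (fun z => q z * phi z).
  apply: (@intg_mulb _ _ _ _ M) => //; last by move=> x _; exact: hM.
  exact: continuous_measurable_fun.
have m0 : measurable_fun setT (fun _ : R => 0 : R) by exact: measurable_cst.
have WE y : 0 <= y <= L -> wave_int q L v y 0 = prim (prim (fun z => q z * phi z)) y.
  move=> hy; have /andP[y0 yL] := hy; rewrite (wave_int_oo 0 pq bv hy).
  have [||_ i E] := @leibniz R q (fun=> 0) (fun z _ => phi z) M y iq m0 _ (ucont_meas uphi) _ M0 y0.
  - by move=> z _; rewrite normr0.
  - by move=> z s _ _ _; exact: hM.
  have z0 : \int[mu]_(z in `]0, y[) (q z * 0) = 0.
    by apply: (etrans _ (@Rint_zero R `]0, y[)); apply: eq_Rint => z _; rewrite mulr0.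
  move: E; rewrite z0 add0r => E; refine (etrans _ E); clear E.
  apply: eq_Rint => z; rewrite /= in_itv/= => /andP[z1 zy]; congr (_ * _).
  rewrite add0r (Rint_cst _ (ltW zy)) /avg.
  have -> : \int[mu]_(s in `]0 - (y - z), 0 + (y - z)[) v z s =
      \int[mu]_(s in `]0 - (y - z), 0 + (y - z)[) phi z.
    by apply: eq_Rint => s _; exact: vt.
  rewrite Rint_cst; last by lra.
  by field.
have iqp2 : intg `]0, L[ (prim (fun z => q z * phi z)).
  have hq := AC_prim (intgT_oo 0 L iqp).
  have [N hN] := AC_bnd hq.
  apply: (@intg_bnd _ _ _ _ N (AC_meas L0 hq)) => x /andP[x0 xL].
  by apply: hN; rewrite !ltW.
have A1 := AC_prim iqp2; have A2 := AC_prim (ih2 0 L).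
have A3 := AC_prim (intgT_oo 0 L iqp); have A4 := AC_prim (sqi_intg dh.1).
pose phi' y := beta - prim h y + prim (fun z => q z * phi z) y.
exists phi, phi'; split.
- have := AC_lin 1 1 (AC_lin 1 beta (AC_cst L alpha) (AC_id L)) (AC_lin 1 (-1) A1 A2).
  apply: AC_eq => // x hx; last by rewrite /phi'; move: (prim _ _) (prim _ _) => *; ring.
  rewrite /phi ev /v0 clamp_id// WE//.
  move: (prim _ _) (prim _ _) => *; ring.
- have := AC_lin 1 1 (AC_cst L beta) (AC_lin 1 (-1) A3 A4).
  apply: AC_eq => // x hx; first by rewrite /phi'; move: (prim _ _) (prim _ _) => *; ring.
  by rewrite /h /cutoff hx; ring.
- rewrite /phi ev WE ?lexx// /v0 clamp_id ?lexx// !prim0; ring.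
- rewrite /phi' !prim0; ring.
Qed.

End Form.

(** * Symmetry, coercivity and solvability on the lasso *)

Section Resolvent.
Context {R : realType}.
Local Notation mu := (@lebesgue_measure R).
Variables (a l : R) (q : lasso_fun R).
Hypotheses (a_gt0 : 0 < a) (l_gt0 : 0 < l).
Hypothesis q_L1 : forall j : 'I_3, in_Lp 1%E (edge_length a l j) (q j).
Implicit Types (phi dphi d2phi chi dchi d2chi g w : lasso_fun R) (x y c : R) (j : 'I_3).

Local Notation len := (edge_length a l).
Local Notation dom := (in_domain a l q).

Lemma sum_edges (F : 'I_3 -> R) : \sum_(j < 3) F j = F edge1 + F edge2 + F edge3.
Proof.
by rewrite !big_ord_recl big_ord0 addr0 addrA; congr (F _ + F _ + F _); exact: val_inj.
Qed.

Lemma edge_ind (P : 'I_3 -> Prop) : P edge1 -> P edge2 -> P edge3 -> forall j, P j.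
Proof.
move=> h1 h2 h3 [[|[|[|//]]] hj].
- by rewrite (_ : Ordinal hj = edge1)//; exact: val_inj.
- by rewrite (_ : Ordinal hj = edge2)//; exact: val_inj.
- by rewrite (_ : Ordinal hj = edge3)//; exact: val_inj.
Qed.

Lemma len_gt0 j : 0 < len j.
Proof. by rewrite /edge_length; case: ifP. Qed.

Lemma innerE phi chi : inner a l phi chi =
  \int[mu]_(x in `]0, l[) (phi edge1 x * chi edge1 x) +
  \int[mu]_(x in `]0, a[) (phi edge2 x * chi edge2 x) +
  \int[mu]_(x in `]0, a[) (phi edge3 x * chi edge3 x).
Proof. by rewrite /inner sum_edges. Qed.

Lemma in_L2P phi : in_L2 a l phi <-> forall j, sqi (len j) (phi j).
Proof. by split=> h j; apply/in_Lp2P; exact: h. Qed.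

Lemma inner_lin_l k m phi chi psi : in_L2 a l phi -> in_L2 a l chi -> in_L2 a l psi ->
  inner a l (fun j x => k * phi j x + m * chi j x) psi =
  k * inner a l phi psi + m * inner a l chi psi.
Proof.
move=> /in_L2P h1 /in_L2P h2 /in_L2P h3; rewrite /inner 2!mulr_sumr -big_split/=.
apply: eq_bigr => j _; have mI : measurable `]0, len j[%classic by exact: measurable_itv.
rewrite -(Rint_lin k m mI (sqi_mul (h1 j) (h3 j)) (sqi_mul (h2 j) (h3 j))).
by apply: eq_Rint => x _; ring.
Qed.

Lemma innerC phi chi : inner a l phi chi = inner a l chi phi.
Proof. by apply: eq_bigr => j _; apply: eq_Rint => x _; rewrite mulrC. Qed.

Lemma inner_lin_r k m phi chi psi : in_L2 a l phi -> in_L2 a l chi -> in_L2 a l psi ->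
  inner a l psi (fun j x => k * phi j x + m * chi j x) =
  k * inner a l psi phi + m * inner a l psi chi.
Proof.
by move=> h1 h2 h3; rewrite innerC inner_lin_l// [inner _ _ _ psi]innerC [inner _ _ _ psi]innerC.
Qed.

Lemma eq_inner phi chi phi' chi' :
  (forall j x, 0 < x < len j -> phi j x = phi' j x) ->
  (forall j x, 0 < x < len j -> chi j x = chi' j x) ->
  inner a l phi chi = inner a l phi' chi'.
Proof.
move=> h1 h2; apply: eq_bigr => j _; apply: eq_Rint => x; rewrite /= in_itv/= => hx.
by rewrite h1// h2.
Qed.

Lemma inner_ge0 phi : 0 <= inner a l phi phi.
Proof.
by apply: sumr_ge0 => j _; apply: Rintegral_ge0 => x _; rewrite -expr2 sqr_ge0.
Qed.

Lemma inner_amgm phi chi : in_L2 a l phi -> in_L2 a l chi ->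
  2 * inner a l phi chi <= inner a l phi phi + inner a l chi chi.
Proof.
move=> h1 h2.
have := inner_ge0 (fun j x => 1 * phi j x + (-1) * chi j x).
have h : in_L2 a l (fun j x => 1 * phi j x + -1 * chi j x).
  by apply/in_L2P => j; move/in_L2P: h1 => h1; move/in_L2P: h2 => h2; exact: sqi_lin.
rewrite inner_lin_l// !inner_lin_r// [inner a l chi phi]innerC.
lra.
Qed.

Lemma inner_zero phi : in_L2 a l phi -> inner a l phi phi = 0 ->
  forall j, \int[mu]_(x in `]0, len j[) phi j x ^+ 2 = 0.
Proof.
move=> _ /eqP; rewrite psumr_eq0; last first.
  by move=> j _; apply: Rintegral_ge0 => x _; rewrite -expr2 sqr_ge0.
move=> /allP h j; have /= /eqP e := h j (mem_index_enum j).
by rewrite -[RHS]e; apply: eq_Rint => x _; rewrite expr2.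
Qed.

Lemma dom_parts j phi dphi d2phi chi dchi :
  AC_deriv (len j) (phi j) (dphi j) -> AC_deriv (len j) (dphi j) (d2phi j) ->
  AC_deriv (len j) (chi j) (dchi j) ->
  [/\ intg `]0, len j[ (fun x => opA q phi d2phi j x * chi j x),
      intg `]0, len j[ (fun x => q j x * phi j x * chi j x) &
  \int[mu]_(x in `]0, len j[) (opA q phi d2phi j x * chi j x) =
  (dphi j 0 * chi j 0 - dphi j (len j) * chi j (len j)) +
  (\int[mu]_(x in `]0, len j[) (dphi j x * dchi j x) +
   \int[mu]_(x in `]0, len j[) (q j x * phi j x * chi j x))].
Proof.
move=> h1 h2 h3; have L0 := ltW (len_gt0 j).
have mI : measurable `]0, len j[%classic by exact: measurable_itv.
have [i1 i2 E] := AC_by_parts L0 h2 h3.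
have iq : intg `]0, len j[ (q j) by apply/in_Lp1P.
have [M hM] := AC_bnd h1; have [N hN] := AC_bnd h3.
have bnd f K : (forall x, 0 <= x <= len j -> `|f x| <= K) ->
    forall x, `]0, len j[%classic x -> `|f x| <= K :> R.
  by move=> hf x; rewrite /= in_itv/= => /andP[x0 xL]; apply: hf; rewrite !ltW.
have i3 : intg `]0, len j[ (fun x => q j x * phi j x * chi j x).
  apply: (@intg_mulb _ _ _ _ N mI _ (AC_meas L0 h3)); last exact: bnd.
  apply: (@intg_mulb _ _ _ _ M mI iq (AC_meas L0 h1)); exact: bnd.
have e x : opA q phi d2phi j x * chi j x =
    -1 * (d2phi j x * chi j x) + 1 * (q j x * phi j x * chi j x) by rewrite /opA; ring.
have -> : \int[mu]_(x in `]0, len j[) (opA q phi d2phi j x * chi j x) =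
    \int[mu]_(x in `]0, len j[) (-1 * (d2phi j x * chi j x) + 1 * (q j x * phi j x * chi j x)).
  by apply: eq_Rint => x _; exact: e.
rewrite (Rint_lin _ _ mI i1 i3) E; split=> //.
  apply: (@eq_intg _ _ (fun x => -1 * (d2phi j x * chi j x) + 1 * (q j x * phi j x * chi j x))) => //.
  by apply: intgD => //; exact: intgZ.
move: (\int[mu]_(x in _) _) (\int[mu]_(x in _) _) => *; ring.
Qed.

(** The vertex terms cancel: the flux conditions on phi meet the continuity of chi at both ends of
    the ring edges, and phi satisfies the Neumann condition at x = l. *)
Lemma dom_form phi dphi d2phi chi dchi d2chi : dom phi dphi d2phi -> dom chi dchi d2chi ->
  inner a l (opA q phi d2phi) chi =
  \sum_(j < 3) (\int[mu]_(x in `]0, len j[) (dphi j x * dchi j x) +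
    \int[mu]_(x in `]0, len j[) (q j x * phi j x * chi j x)).
Proof.
move=> [_ h1 _ [f1 f2 f3] [v1 v2 v3]] [_ h2 _ [g1 g2 g3] [w1 w2 w3]].
rewrite /inner.
have E j : \int[mu]_(x in `]0, len j[) (opA q phi d2phi j x * chi j x) =
  (dphi j 0 * chi j 0 - dphi j (len j) * chi j (len j)) +
  (\int[mu]_(x in `]0, len j[) (dphi j x * dchi j x) +
   \int[mu]_(x in `]0, len j[) (q j x * phi j x * chi j x)).
  by have [h11 h12] := h1 j; have [h21 _] := h2 j; have [_ _] := dom_parts h11 h12 h21.
rewrite (eq_bigr _ (fun j _ => E j)) big_split/= sum_edges.
move: v3; rewrite sum_edges /outward_start => v3.
move: f3; rewrite /outward_end /edge_length/= => f3.
rewrite f1 -g2 -w2 -w1.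
set S := \sum_(j < 3) _.
suff -> : dphi edge1 0 * chi edge1 0 - 0 * chi edge1 l +
 (dphi edge2 0 * chi edge1 0 - dphi edge2 a * chi edge2 a) +
 (dphi edge3 0 * chi edge1 0 - dphi edge3 a * chi edge2 a) = 0 by rewrite add0r.
have -> : dphi edge1 0 = - dphi edge2 0 - dphi edge3 0 by lra.
have -> : dphi edge3 a = - dphi edge2 a by lra.
ring.
Qed.

Lemma opA_sym phi dphi d2phi chi dchi d2chi : dom phi dphi d2phi -> dom chi dchi d2chi ->
  inner a l (opA q phi d2phi) chi = inner a l (opA q chi d2chi) phi.
Proof.
move=> h1 h2; rewrite (dom_form h1 h2) (dom_form h2 h1); apply: eq_bigr => j _.
by congr (_ + _); apply: eq_Rint => x _; ring.
Qed.

Lemma coercive : exists c, forall phi dphi d2phi, dom phi dphi d2phi ->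
  inner a l phi phi <= inner a l (opA q phi d2phi) phi + c * inner a l phi phi.
Proof.
have hC j : exists C, forall u u' : R -> R, AC_deriv (len j) u u' -> sqi (len j) u' ->
  - (\int[mu]_(y in `]0, len j[) (q j y * u y * u y)) <=
  \int[mu]_(y in `]0, len j[) u' y ^+ 2 + C * \int[mu]_(y in `]0, len j[) u y ^+ 2.
  by apply: form_bound; [exact: len_gt0|apply/in_Lp1P].
have [C1 h1] := hC edge1; have [C2 h2] := hC edge2; have [C3 h3] := hC edge3.
(* Edge j needs c >= C_j + 1; the 1 pays for the norm on the left side. *)
pose c := `|C1| + `|C2| + `|C3| + 1; exists c => phi dphi d2phi hphi.
have Cj j : exists2 C, C + 1 <= c & forall u u' : R -> R, AC_deriv (len j) u u' -> sqi (len j) u' ->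
  - (\int[mu]_(y in `]0, len j[) (q j y * u y * u y)) <=
  \int[mu]_(y in `]0, len j[) u' y ^+ 2 + C * \int[mu]_(y in `]0, len j[) u y ^+ 2.
  have n1 := normr_ge0 C1; have n2 := normr_ge0 C2; have n3 := normr_ge0 C3.
  move: j; apply: edge_ind.
  - by exists C1 => //; rewrite /c; have := ler_norm C1; lra.
  - by exists C2 => //; rewrite /c; have := ler_norm C2; lra.
  - by exists C3 => //; rewrite /c; have := ler_norm C3; lra.
rewrite (dom_form hphi hphi) /inner mulr_sumr -big_split/=.
apply: ler_sum => j _; have [C hc hCj] := Cj j.
have [_ hAC _ _ _] := hphi; have [hj1 hj2] := hAC j.
have := hCj _ _ hj1 (AC_sqi (ltW (len_gt0 j)) hj2).
have -> : \int[mu]_(x in `]0, len j[) (dphi j x * dphi j x) =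
    \int[mu]_(x in `]0, len j[) dphi j x ^+ 2 by apply: eq_Rint => x _; rewrite expr2.
have -> : \int[mu]_(x in `]0, len j[) (phi j x * phi j x) =
    \int[mu]_(x in `]0, len j[) phi j x ^+ 2 by apply: eq_Rint => x _; rewrite expr2.
have : 0 <= \int[mu]_(x in `]0, len j[) phi j x ^+ 2 by apply: Rintegral_ge0 => x _; exact: sqr_ge0.
move: (\int[mu]_(x in _) _) (\int[mu]_(x in _) _) (\int[mu]_(x in _) _) => I J K I0 h.
have : (C + 1) * K <= c * K by rewrite ler_wpM2r.
lra.
Qed.

Variable c : R.
Hypothesis coer : forall phi dphi d2phi, dom phi dphi d2phi ->
  inner a l phi phi <= inner a l (opA q phi d2phi) phi + c * inner a l phi phi.

Let qc j x := if 0 < x < len j then q j x + c else 0.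

Lemma potential_qc j : potential (qc j) (len j).
Proof.
split; first exact: ltW (len_gt0 j).
- apply/intg_if; apply: intgD; [exact: measurable_itv| |exact: intg_cst_oo].
  by apply/in_Lp1P.
- by move=> z hz; rewrite /qc (negbTE hz).
Qed.

Lemma ode_family (alpha beta : 'I_3 -> R) g : in_L2 a l g -> exists U U' : lasso_fun R,
  forall j, [/\ AC_deriv (len j) (U j) (U' j),
    AC_deriv (len j) (U' j) (fun x => qc j x * U j x - g j x), U j 0 = alpha j & U' j 0 = beta j].
Proof.
move=> /in_L2P hg.
have h j : exists p : (R -> R) * (R -> R), [/\ AC_deriv (len j) p.1 p.2,
    AC_deriv (len j) p.2 (fun x => qc j x * p.1 x - g j x), p.1 0 = alpha j & p.2 0 = beta j].
  by have [u [u' hu]] := ode_exists (alpha j) (beta j) (potential_qc j) (hg j); exists (u, u').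
have [f hf] := choice h.
by exists (fun j => (f j).1), (fun j => (f j).2).
Qed.

Lemma resolvent_zero phi dphi d2phi : dom phi dphi d2phi ->
  (forall j x, 0 < x < len j -> d2phi j x = qc j x * phi j x) ->
  forall j, phi j 0 = 0 /\ dphi j 0 = 0.
Proof.
move=> hd he j; have [L2 hAC _ _ _] := hd.
have z : inner a l phi phi = 0.
  apply/eqP; rewrite eq_le inner_ge0 andbT; apply: le_trans (coer hd) _.
  have -> : inner a l (opA q phi d2phi) phi = inner a l (fun j x => - c * phi j x + 0 * phi j x) phi.
    apply: eq_inner => // i x hx.
    by rewrite /opA he// /qc hx; ring.
  by rewrite inner_lin_l// mul0r addr0 mulNr addNr.
have [h1 h2] := hAC j; have L0 := len_gt0 j.
have zj := form_zero L0 h1 (AC_sqi (ltW L0) h2) (inner_zero L2 z j).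
have p0 : phi j 0 = 0 by apply: zj; rewrite lexx ltW.
split=> //.
have /AC_derivP[_ e1] := h1; have /AC_derivP[_ e2] := h2.
have dc x : 0 <= x <= len j -> dphi j x = dphi j 0.
  move=> hx; rewrite e2//; have /andP[x0 xL] := hx.
  have -> : prim (d2phi j) x = 0; last by rewrite addr0.
  apply: (etrans _ (@Rint_zero R `]0, x[)); apply: eq_Rint => y; rewrite /= in_itv/= => /andP[y0 yx].
  by rewrite he ?y0 ?(lt_le_trans yx)// zj ?mulr0// !ltW// (lt_le_trans yx).
have LL : 0 <= len j <= len j by rewrite lexx ltW.
have := e1 _ LL; rewrite zj// p0 add0r.
have -> : prim (dphi j) (len j) = dphi j 0 * (len j - 0).
  rewrite -Rint_cst ?ltW//; apply: eq_Rint => y; rewrite /= in_itv/= => /andP[y0 yx].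
  by apply: dc; rewrite !ltW.
by move=> /esym/eqP; rewrite subr0 mulf_eq0 (gt_eqF L0) orbF => /eqP.
Qed.

(** Shooting from the interior vertex: three parameters remain for the three conditions at the far
    ends, and coercivity makes this square linear system injective. *)
Lemma resolvent_exists g : in_L2 a l g -> exists phi dphi d2phi, dom phi dphi d2phi /\
  forall j x, 0 < x < len j -> opA q phi d2phi j x + c * phi j x = g j x.
Proof.
move=> hg; have sg := (in_L2P g).1 hg.
have h0 : in_L2 a l (fun _ _ => 0) by apply/in_L2P => j; exact: sqi_cst.
have [U [U' hU]] := ode_family (fun=> 1) (fun=> 0) h0.
have [V [V' hV]] := ode_family (fun=> 0) (fun=> 1) h0.
have [G [G' hG]] := ode_family (fun=> 0) (fun=> 0) hg.
(* A common value x and slopes with sum zero build in the conditions at the interior vertex. The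
   parameter e below switches the source off (0, for injectivity) or on (1, for the solution). *)
pose bb (y z : R) j := if j == edge1 then - y - z else if j == edge2 then y else z.
pose phi x y z e : lasso_fun R := fun j t => x * U j t + bb y z j * V j t + e * G j t.
pose dphi x y z e : lasso_fun R := fun j t => x * U' j t + bb y z j * V' j t + e * G' j t.
pose d2phi x y z e : lasso_fun R := fun j t => qc j t * phi x y z e j t - e * g j t.
have AC x y z e j : AC_deriv (len j) (phi x y z e j) (dphi x y z e j) /\
    AC_deriv (len j) (dphi x y z e j) (d2phi x y z e j).
  have [u1 u2 _ _] := hU j; have [v1 v2 _ _] := hV j; have [g1 g2 _ _] := hG j.
  have L0 := ltW (len_gt0 j); split.
    have := AC_lin 1 e (AC_lin x (bb y z j) u1 v1) g1.
    by apply: AC_eq => // t _; rewrite /phi /dphi mul1r.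
  have := AC_lin 1 e (AC_lin x (bb y z j) u2 v2) g2.
  apply: AC_eq => // t _; first by rewrite /dphi mul1r.
  rewrite /d2phi /phi; ring.
pose A (k : 'I_3) := nth 0 [:: U' edge1 l; U edge2 a - U edge3 a; U' edge2 a + U' edge3 a] k.
pose B (k : 'I_3) := nth 0 [:: - V' edge1 l; V edge2 a; V' edge2 a] k.
pose C (k : 'I_3) := nth 0 [:: - V' edge1 l; - V edge3 a; V' edge3 a] k.
pose D (k : 'I_3) := nth 0 [:: - G' edge1 l; - (G edge2 a - G edge3 a); - (G' edge2 a + G' edge3 a)] k.
have key x y z e : (forall k, x * A k + y * B k + z * C k = e * D k) ->
    dom (phi x y z e) (dphi x y z e) (d2phi x y z e).
  move=> h; have := h edge1; have := h edge2; have := h edge3; rewrite /A /B /C /D/= => k3 k2 k1.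
  have L2 : in_L2 a l (phi x y z e).
    by apply/in_L2P => j; exact: AC_sqi (ltW (len_gt0 j)) (AC x y z e j).1.
  split; [exact: L2|by move=> j; exact: AC| | |].
  - apply/in_L2P => j.
    apply: (@eq_sqi _ _ (fun t => e * g j t + - c * phi x y z e j t)).
      by move=> t ht; rewrite /opA /d2phi /qc ht; ring.
    by apply: sqi_lin => //; move/in_L2P: L2; exact.
  - rewrite /outward_end /phi /dphi /bb/= /edge_length/=; split.
    + by move: k1; clear; move=> k1; lra.
    + by move: k2; clear; move=> k2; lra.
    + by move: k3; clear; move=> k3; lra.
  - rewrite sum_edges /outward_start /phi /dphi /bb/=.
    have [_ _ u1 u1'] := hU edge1; have [_ _ v1 v1'] := hV edge1; have [_ _ g1 g1'] := hG edge1.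
    have [_ _ u2 u2'] := hU edge2; have [_ _ v2 v2'] := hV edge2; have [_ _ g2 g2'] := hG edge2.
    have [_ _ u3 u3'] := hU edge3; have [_ _ v3 v3'] := hV edge3; have [_ _ g3 g3'] := hG edge3.
    rewrite u1 u2 u3 v1 v2 v3 g1 g2 g3 u1' u2' u3' v1' v2' v3' g1' g2' g3'.
    by split; ring.
have phi0 x y z e j : phi x y z e j 0 = x /\ dphi x y z e j 0 = bb y z j.
  have [_ _ u1 u1'] := hU j; have [_ _ v1 v1'] := hV j; have [_ _ g1 g1'] := hG j.
  by rewrite /phi /dphi u1 v1 g1 u1' v1' g1'; split; ring.
have [|x [y [z h]]] := @solve3 R A B C D.
  move=> x y z h.
  have hd : dom (phi x y z 0) (dphi x y z 0) (d2phi x y z 0).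
    by apply: key => k; rewrite h mul0r.
  have hz j : x = 0 /\ bb y z j = 0.
    have he i t : 0 < t < len i -> d2phi x y z 0 i t = qc i t * phi x y z 0 i t.
      by move=> _; rewrite /d2phi mul0r subr0.
    have [e1 e2] := resolvent_zero hd he j; have [p1 p2] := phi0 x y z 0 j.
    by split; [exact: etrans (esym p1) e1|exact: etrans (esym p2) e2].
  by have [-> _] := hz edge1; have [_ e2] := hz edge2; have [_ e3] := hz edge3.
exists (phi x y z 1), (dphi x y z 1), (d2phi x y z 1); split.
  by apply: key => k; rewrite h mul1r.
by move=> j t ht; rewrite /opA /d2phi /qc ht; ring.
Qed.

End Resolvent.

(** * Uniqueness for the homogeneous problem *)

Section Uniqueness.
Context {R : realType}.
Local Notation mu := (@lebesgue_measure R).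
Variables (a l T : R) (q : lasso_fun R).
Hypotheses (a_gt0 : 0 < a) (l_gt0 : 0 < l) (T_gt0 : 0 < T).
Hypothesis q_L1 : forall j : 'I_3, in_Lp 1%E (edge_length a l j) (q j).
Implicit Types (phi dphi d2phi chi f g : lasso_fun R) (w : R -> lasso_fun R).
Implicit Types (x y c e s t M N : R) (j : 'I_3).

Local Notation len := (edge_length a l).
Local Notation dom := (in_domain a l q).
Local Notation ip := (inner a l).

Definition dif f g : lasso_fun R := fun j x => f j x - g j x.

Lemma difE f g : dif f g = fun j x => 1 * f j x + -1 * g j x.
Proof. by apply/funext => j; apply/funext => x; rewrite /dif mul1r mulN1r. Qed.

Lemma dif_L2 f g : in_L2 a l f -> in_L2 a l g -> in_L2 a l (dif f g).
Proof.
by move=> /in_L2P h1 /in_L2P h2; rewrite difE; apply/in_L2P => j; exact: sqi_lin.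
Qed.

Lemma inner_dif_l f g h : in_L2 a l f -> in_L2 a l g -> in_L2 a l h ->
  ip (dif f g) h = ip f h - ip g h.
Proof. by move=> h1 h2 h3; rewrite difE inner_lin_l// mul1r mulN1r. Qed.

Lemma inner_dif_r f g h : in_L2 a l f -> in_L2 a l g -> in_L2 a l h ->
  ip h (dif f g) = ip h f - ip h g.
Proof. by move=> h1 h2 h3; rewrite innerC inner_dif_l// innerC [ip g h]innerC. Qed.

Lemma HnormE f : in_L2 a l f -> Hnorm a l f = Num.sqrt (ip f f).
Proof.
move=> /in_L2P h; rewrite /Hnorm /inner; congr Num.sqrt; apply: eq_bigr => j _.
by rewrite (L2norm_sqr (h j)); apply: eq_Rint => x _; rewrite expr2.
Qed.

(** A form of Cauchy-Schwarz without square roots, from the nonnegativity of |f + e g|^2 and |f - e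
    g|^2. *)
Lemma inner_small f g e M : in_L2 a l f -> in_L2 a l g -> 0 < e ->
  ip f f <= e ^+ 2 -> ip g g <= M -> `|ip f g| <= e * (1 + M).
Proof.
move=> hf hg e0 f2 gM.
have M0 : 0 <= M by apply: le_trans gM; exact: inner_ge0.
have h k : 0 <= ip f f + 2 * k * ip f g + k ^+ 2 * ip g g.
  have := inner_ge0 a l (fun j x => 1 * f j x + k * g j x).
  have hfg : in_L2 a l (fun j x => 1 * f j x + k * g j x).
    by apply/in_L2P => j; move/in_L2P: hf => hf; move/in_L2P: hg => hg; exact: sqi_lin.
  rewrite inner_lin_l// !inner_lin_r// [ip g f]innerC.
  have -> : ip f f + 2 * k * ip f g + k ^+ 2 * ip g g =
    1 * (1 * ip f f + k * ip f g) + k * (1 * ip f g + k * ip g g) by ring.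
  by [].
have h1 := h e; have h2 := h (- e).
have gM' : e ^+ 2 * ip g g <= e ^+ 2 * M by rewrite ler_wpM2l// sqr_ge0.
have eM : 0 <= e ^+ 2 * M by rewrite mulr_ge0// sqr_ge0.
rewrite -(ler_pM2l e0) -[X in X * `|_|](gtr0_norm e0) -normrM.
have -> : e * (e * (1 + M)) = e ^+ 2 + e ^+ 2 * M by ring.
have h2' : 0 <= ip f f - 2 * (e * ip f g) + e ^+ 2 * ip g g.
  by apply: (le_trans h2); rewrite le_eqVlt; apply/orP; left; apply/eqP; ring.
have h1' : 0 <= ip f f + 2 * (e * ip f g) + e ^+ 2 * ip g g.
  by apply: (le_trans h1); rewrite le_eqVlt; apply/orP; left; apply/eqP; ring.
have e2 : 0 <= e ^+ 2 by exact: sqr_ge0.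
by rewrite ler_norml; apply/andP; split; lra.
Qed.

Lemma inner_null f g : in_L2 a l f -> in_L2 a l g -> ip f f = 0 -> ip f g = 0.
Proof.
move=> hf hg f0; apply/eqP; rewrite -normr_le0.
apply: (@half_pow_le0 _ _ (1 + ip g g)) => n; rewrite mulrC.
have p0 : (0 : R) < (2 ^+ n)^-1 by rewrite invr_gt0 exprn_gt0.
by apply: inner_small => //; rewrite f0 sqr_ge0.
Qed.

Section Trajectory.
Variable w : R -> lasso_fun R.
Hypothesis cw : continuous_in_H a l T w.

(** Freezing the trajectory outside [0, T] turns one-sided continuity at 0 and T into continuity on
    the whole line. *)
Let W t := w (clamp T t).

Lemma clamp_mem t : clamp T t \in `[0, T].
Proof. by rewrite in_itv/=; exact: clampP (ltW T_gt0). Qed.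

Lemma traj_L2 t : in_L2 a l (W t).
Proof. exact: cw.1 _ (clamp_mem t). Qed.

Lemma traj_cont t0 e : 0 < e -> \forall t \near t0, ip (dif (W t) (W t0)) (dif (W t) (W t0)) <= e ^+ 2.
Proof.
move=> e0; have := cw.2 _ (clamp_mem t0) => /cvgrPdist_le /(_ _ e0).
rewrite near_withinE => -[d /= d0 hd].
exists d => //= t ht.
have /= := hd (clamp T t) _ (clamp_mem t).
rewrite sub0r normrN => h.
have : Hnorm a l (dif (W t) (W t0)) <= e.
  apply: le_trans (h _); first by rewrite ler_norm.
  exact: le_lt_trans (clamp_lip _ _ _) ht.
have hL := dif_L2 (traj_L2 t) (traj_L2 t0).
rewrite (HnormE hL) => he.
rewrite -(sqr_sqrtr (inner_ge0 a l (dif (W t) (W t0)))).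
by rewrite lerXn2r// ?nnegrE ?sqrtr_ge0// ltW.
Qed.

Let n t := ip (W t) (W t).

Lemma traj_norm_cont : continuous n.
Proof.
move=> t0; apply/cvgrPdist_le => e e0.
(* If |W t - W t0| <= k <= 1, then n t - n t0 is at most k^2 + 2 k (1 + n t0) <= k N in absolute
   value. *)
pose N := 3 + 2 * n t0.
have N0 : 0 < N by rewrite ltr_wpDr// mulr_ge0// inner_ge0.
pose k := Num.min 1 (e / N).
have k0 : 0 < k by rewrite lt_min ltr01 divr_gt0.
apply: filterS (traj_cont t0 k0) => t ht.
have hd := dif_L2 (traj_L2 t) (traj_L2 t0).
have := inner_small hd (traj_L2 t0) k0 ht (lexx _).
rewrite inner_dif_l ?inner_dif_r//; try exact: traj_L2.
have ht' := ht; rewrite inner_dif_l ?inner_dif_r// in ht'; try exact: traj_L2.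
have ge := inner_ge0 a l (dif (W t) (W t0)).
rewrite inner_dif_l ?inner_dif_r// in ge; try exact: traj_L2.
rewrite [ip (W t0) (W t)]innerC -/(n t) -/(n t0) in ht' ge *.
move: ht' ge; move: (ip (W t) (W t0)) => x h1 h2.
rewrite ler_norml => /andP[h3 h4].
have k1 : k ^+ 2 <= k.
  by rewrite expr2 ler_piMr ?(ltW k0)// ge_min lexx.
have kN : k * N <= e by rewrite -ler_pdivlMr// ge_min lexx orbT.
have kN' : 3 * k + 2 * (k * n t0) <= e by apply: le_trans kN; rewrite le_eqVlt; apply/orP; left; apply/eqP; rewrite /N; ring.
have e4 : k * (1 + n t0) = k + k * n t0 by ring.
rewrite e4 in h3 h4.
have q1 : 0 <= k * n t0 by rewrite mulr_ge0 ?(ltW k0)// inner_ge0.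
by rewrite ler_norml; apply/andP; split; lra.
Qed.

Lemma traj_bound : exists2 M, 0 <= M & forall t, n t <= M.
Proof.
have [M hM] := continuous_bnd 0 T traj_norm_cont.
have n0 t : n t <= M.
  have -> : n t = n (clamp T t) by rewrite /n /W (clamp_id (clampP t (ltW T_gt0))).
  by apply: le_trans (ler_norm _) (hM _ _); exact: clampP (ltW T_gt0).
by exists M => //; apply: le_trans (n0 0); exact: inner_ge0.
Qed.

(* For K s = W s and K s = (A + c)^-1 (W s). *)
Lemma pairing_ucont (K : R -> lasso_fun R) M : (forall s, in_L2 a l (K s)) ->
  (forall s, ip (K s) (K s) <= M) -> (forall s t, ip (W t) (K s) = ip (W s) (K t)) ->
  ucont (fun s t => ip (W t) (K s)).
Proof.
move=> hK KM sym [s0 t0]; apply/cvgrPdist_le => /= e e0.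
have M0 : 0 <= M by apply: le_trans (KM 0); exact: inner_ge0.
pose k := e / (2 * (1 + M)).
have k0 : 0 < k by rewrite divr_gt0// mulr_gt0// ltr_wpDr.
exists ([set s | ip (dif (W s) (W s0)) (dif (W s) (W s0)) <= k ^+ 2],
  [set t | ip (dif (W t) (W t0)) (dif (W t) (W t0)) <= k ^+ 2]).
  by split; exact: traj_cont.
move=> [s t] /= [hs ht].
have -> : ip (W t0) (K s0) - ip (W t) (K s) =
   - (ip (dif (W t) (W t0)) (K s) + ip (dif (W s) (W s0)) (K t0)).
  rewrite !inner_dif_l//; try exact: traj_L2.
  rewrite (sym s t0) (sym s0 t0); ring.
rewrite normrN; apply: le_trans (ler_normD _ _) _.
have h1 := inner_small (dif_L2 (traj_L2 t) (traj_L2 t0)) (hK s) k0 ht (KM s).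
have h2 := inner_small (dif_L2 (traj_L2 s) (traj_L2 s0)) (hK t0) k0 hs (KM t0).
apply: le_trans (lerD h1 h2) _.
rewrite le_eqVlt; apply/orP; left; apply/eqP; rewrite /k; field.
by rewrite gt_eqF// ltr_wpDr.
Qed.

End Trajectory.

Variable w : R -> lasso_fun R.
Hypothesis cw : continuous_in_H a l T w.
Hypothesis hw : forall phi dphi d2phi, dom phi dphi d2phi -> exists m1 m2 : R -> R,
  [/\ H2_derivs T (fun t => ip (w t) phi) m1 m2, ip (w 0) phi = 0, m1 0 = 0 &
   {ae mu, forall t, t \in `]0, T[ -> m2 t + ip (w t) (opA q phi d2phi) = 0}].

Lemma homogeneous_zero : forall t, 0 <= t <= T -> ip (w t) (w t) = 0.
Proof.
have T0 := ltW T_gt0.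
pose W t := w (clamp T t).
have WL t : in_L2 a l (W t) by exact: traj_L2.
have [c coer] := coercive a_gt0 l_gt0 q_L1.
have hres s : exists p : lasso_fun R * lasso_fun R * lasso_fun R, dom p.1.1 p.1.2 p.2 /\
    forall j x, 0 < x < len j -> opA q p.1.1 p.2 j x + c * p.1.1 j x = W s j x.
  by have [f [f1 [f2 h]]] := resolvent_exists a_gt0 l_gt0 q_L1 coer (WL s); exists (f, f1, f2).
have [pk hk] := choice hres; clear hres.
pose K s := (pk s).1.1; pose K1 s := (pk s).1.2; pose K2 s := (pk s).2.
have dK s : dom (K s) (K1 s) (K2 s) by have [] := hk s.
have eK s j x : 0 < x < len j -> opA q (K s) (K2 s) j x + c * K s j x = W s j x by have [_] := hk s; exact.
have KL s : in_L2 a l (K s) by case: (dK s).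
have AL s : in_L2 a l (opA q (K s) (K2 s)) by case: (dK s).
have WE s g : in_L2 a l g -> ip (W s) g = ip (opA q (K s) (K2 s)) g + c * ip (K s) g.
  move=> hg; have := inner_lin_l 1 c (AL s) (KL s) hg; rewrite mul1r => <-.
  by apply: eq_inner => // j x hx; rewrite -eK// mul1r.
have symF s t' : ip (W t') (K s) = ip (W s) (K t').
  by rewrite !WE// (opA_sym a_gt0 l_gt0 q_L1 (dK t') (dK s)) [ip (K s) (K t')]innerC.
have [M M0 hM] := traj_bound cw.
have KM s : ip (K s) (K s) <= M.
  apply: le_trans (hM s); have := coer _ _ _ (dK s); rewrite -(WE s _ (KL s)) => h.
  have := inner_amgm (WL s) (KL s); rewrite -/(W s); lra.
have uF := pairing_ucont cw KL KM symF.
have uQ : ucont (fun s t => ip (W t) (W s)).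
  by apply: (pairing_ucont cw WL hM) => s t'; exact: innerC.
pose F s t := ip (W t) (K s); pose Q s t := ip (W t) (W s).
(* Testing with K(s) gives F_tt = - <W t, A K(s)>, and A K(s) = W s - c K(s); hence F_tt = G. *)
pose G s t := c * F s t - Q s t.
have uG : ucont G.
  apply: (@ucontB _ (fun s t => c * F s t) Q) => //.
  by apply: (@ucontM _ (fun _ _ => c) F) => //; exact: ucont_cst.
have symG s t' : G s t' = G t' s by rewrite /G /F /Q symF [ip (W t') (W s)]innerC.
have FG s t' : 0 <= t' <= T -> F s t' = tprim (tprim G) s t'.
  move=> ht'; have /andP[t0' tT'] := ht'.
  have [m1 [m2 [[h1 h2 _] z0 z1 hae]]] := hw (dK s).
  have /AC_derivP[i1 e1] := h1; have /AC_derivP[i2 e2] := h2.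
  rewrite /F /W clamp_id// (e1 _ ht') z0 add0r.
  apply: eq_Rint => x; rewrite /= in_itv/= => /andP[x0 xt].
  have xT : x <= T by rewrite ltW// (lt_le_trans xt).
  rewrite e2 ?xT ?ltW// z1 add0r.
  apply: ae_eq_Rint; [exact: measurable_itv| | |].
  - exact: intg_meas (intgS_oo (lexx _) xT i2).
  - exact: intg_meas (ucont_intg _ _ _ uG).
  apply: (@filterS _ _ (ae_filter_ringOfSetsType mu)) hae => y hy.
  rewrite /= in_itv/= => /andP[y0 yx].
  have yT : y < T by exact: lt_le_trans xT.
  have := hy; rewrite in_itv/= y0 yT => /(_ isT) => /eqP.
  rewrite addr_eq0 => /eqP ->.
  have -> : w y = W y by rewrite /W clamp_id// !ltW.
  have e : ip (W y) (W s) = ip (W y) (opA q (K s) (K2 s)) + c * ip (W y) (K s).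
    have := inner_lin_r 1 c (AL s) (KL s) (WL y); rewrite mul1r => <-.
    by apply: eq_inner => // j z hz; rewrite -eK// mul1r.
  by rewrite /G /F /Q e; ring.
have GS s t' : 0 <= s <= T -> 0 <= t' <= T -> tprim (tprim G) s t' = sprim (sprim G) s t'.
  move=> hs ht'; rewrite -FG//.
  have -> : sprim (sprim G) s t' = tprim (tprim G) t' s.
    apply: eq_Rint => x _; apply: eq_Rint => y _; exact: symG.
  by rewrite -FG// /F symF.
pose P T1 := forall s t, 0 <= s <= T -> 0 <= t <= T -> t <= T1 -> F s t = 0.
have P0 : P 0.
  move=> s x hs /andP[x0 _] x0'; have -> : x = 0 by apply/le_anti; rewrite x0 x0'.
  have [m1 [m2 [_ z0 _ _]]] := hw (dK s).
  by rewrite /F /W clamp_id ?lexx ?T0.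
have nz T1 s : 0 <= T1 <= T -> P T1 -> 0 <= s <= T -> s <= (T + T1) / 2 -> ip (W s) (W s) = 0.
  move=> hT1 PT hs sT1; have /andP[T10 T1T] := hT1; have /andP[s0 sT] := hs.
  (* The triple time primitive of G vanishes up to b; three differentiations give F = G = 0 there.
     The bound s <= (T + T1) / 2 puts the diagonal point t = s in this range, and there G = - <W s,
     W s>. *)
  pose b := Num.min T (T + T1 - s).
  have sb : s <= b by rewrite /b le_min sT/=; lra.
  have b0 : 0 < b by rewrite /b lt_min T_gt0/=; have T_gt0' := T_gt0; lra.
  have bT : b <= T by rewrite /b ge_min lexx.
  have R0 x : 0 <= x <= b -> tprim (tprim (tprim G)) s x = 0.
    move=> /andP[x0 xb]; apply: (@wave_square_unique _ T T0 G T1 uG hT1).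
    - by move=> y z /andP[hy hz]; exact: GS.
    - by move=> y z /andP[hy hz] zT; rewrite -FG//; exact: PT.
    - by rewrite hs x0 (le_trans xb).
    - have : x <= T + T1 - s by rewrite (le_trans xb)// ge_min lexx orbT.
      by lra.
  have utG := tprim_ucont uG; have uttG := tprim_ucont utG.
  have F0 := prim_zero (@ucont_sec _ _ s uttG) b0 R0.
  have H0 := prim_zero (@ucont_sec _ _ s utG) b0 F0.
  have G0 := prim_zero (@ucont_sec _ _ s uG) b0 H0.
  have hsb : 0 <= s <= b by rewrite s0.
  have := G0 _ hsb; rewrite /G FG// F0// mulr0 sub0r => /eqP.
  by rewrite oppr_eq0 => /eqP.
have PS T1 : 0 <= T1 <= T -> P T1 -> P ((T + T1) / 2).
  move=> hT1 PT s x hs hx xT1; rewrite /F; apply: inner_null => //.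
  exact: nz PT hx xT1.
pose Tn k := T - T / 2 ^+ k.
have Tn_le k : 0 <= Tn k <= T.
  have h1 : (1 : R) <= 2 ^+ k by apply: exprn_ege1; rewrite ler1n.
  have h2 : (0 : R) < 2 ^+ k by exact: lt_le_trans h1.
  rewrite /Tn subr_ge0 ler_pdivrMr// ler_peMr//= gerBl divr_ge0// ltW//.
have PTn k : P (Tn k).
  elim: k => [|k IH]; first by rewrite /Tn expr0 divr1 subrr.
  have -> : Tn k.+1 = (T + Tn k) / 2.
    have n0 : (2 : R) ^+ k != 0 by rewrite expf_neq0.
    by rewrite /Tn (_ : (2 : R) ^+ k.+1 = 2 * 2 ^+ k); [field|exact: exprS].
  exact: PS.
move=> t ht; have /andP[t0 tT] := ht.
rewrite -[w t]/(w t) (_ : w t = W t); last by rewrite /W clamp_id.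
have [[k tk]|ge_t] := pselect (exists k, t <= Tn k).
  apply: (nz (Tn k)) => //.
  have /andP[_ hk2] := Tn_le k; lra.
have lt_t k : Tn k < t by rewrite ltNge; apply/negP => h; apply: ge_t; exists k.
have eT : t = T.
  apply/le_anti; rewrite tT/= -subr_le0; apply: (@half_pow_le0 _ _ T) => k.
  by have := lt_t k; rewrite /Tn; move: (T / 2 ^+ k) => x; lra.
(* The times T - T / 2^k never reach T; continuity of the norm covers the endpoint. *)
rewrite eT; apply/eqP; rewrite -normr_le0; apply/ler_addgt0Pl => e e0; rewrite addr0.
have /cvgrPdist_le /(_ _ e0) [d /= d0 hd] := @traj_norm_cont w cw T.
have [k hk2] : exists k, T / 2 ^+ k < d.
  apply: contrapT => h; have : d <= 0; last by rewrite leNgt d0.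
  apply: (@half_pow_le0 _ _ T) => k; rewrite leNgt; apply/negP => hk2; apply: h.
  by exists k.
have T2 : 0 <= T / 2 ^+ k by rewrite divr_ge0// exprn_ge0.
have hball : `|T - Tn k| < d.
  by rewrite /Tn (_ : T - (T - T / 2 ^+ k) = T / 2 ^+ k) ?ger0_norm//; ring.
have z : ip (W (Tn k)) (W (Tn k)) = 0.
  apply: (nz (Tn k)) => //; have /andP[_ hk3] := Tn_le k; lra.
have := hd (Tn k) hball; rewrite /= -/(W T) -/(W (Tn k)) z subr0; by [].
Qed.

End Uniqueness.

(** * Traces and dynamics on the lasso *)

Section AlmostEverywhere.
Context {R : realType}.
Local Notation mu := (@lebesgue_measure R).
Implicit Types (f g h m : R -> R) (b x y z : R).

Lemma ae_of_sqr_zero b f : sqi b f -> \int[mu]_(x in `]0, b[) f x ^+ 2 = 0 ->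
  {ae mu, forall x, x \in `]0, b[ -> f x = 0}.
Proof.
move=> [mf [hi]] h0.
have mI : measurable `]0, b[%classic by exact: measurable_itv.
have fin := @integrable_fin_num _ _ _ mu _ mI _ hi.
have e0 : (\int[mu]_(x in `]0%R, b[) (f x ^+ 2)%:E = 0)%E.
  by rewrite -(fineK fin) -RintegralE h0.
have := (@ae_eq_integral_abs _ _ _ mu _ mI (EFin \o (fun x => f x ^+ 2)) (measurable_int mu hi)).1.
have h1 : (\int[mu]_(x in `]0%R, b[) `|(f x ^+ 2)%:E| = 0)%E.
  rewrite -[RHS]e0; apply: eq_integral => x _ /=.
  by rewrite ger0_norm ?sqr_ge0.
move=> /(_ h1); apply: (@filterS _ _ (ae_filter_ringOfSetsType mu)) => x hx xI.
have /= /eqP := hx xI; rewrite eqe sqrf_eq0 => /eqP; exact.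
Qed.

(** The difference of the two versions, extended by 0, has zero primitive, and Lebesgue's
    differentiation theorem makes it zero almost everywhere. *)
Lemma ae_deriv_unique b m g g' : AC_deriv b m g -> AC_deriv b m g' ->
  {ae mu, forall x, 0 < x < b -> g x = g' x}.
Proof.
move=> /AC_derivP[ig eg] /AC_derivP[ig' eg'].
pose d x := g x - g' x.
have mI : measurable `]0, b[%classic by exact: measurable_itv.
have id : intg `]0, b[ d by exact: intgB.
pose h x := if 0 < x < b then d x else 0.
have ih : intg setT h by apply/intg_if.
have F0 x : \int[mu]_(t in `]-oo, x]) h t = 0.
  have mx : measurable `]-oo, x]%classic by exact: measurable_itv.
  have e : \int[mu]_(t in `]-oo, x]) h t = \int[mu]_(t in `]0, Num.min x b]) h t.
    apply: Rint_subset.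
      by move=> t /=; rewrite !in_itv/= => /andP[_]; rewrite le_min => /andP[].
    move=> t; rewrite /= !in_itv/= => tx /negP; rewrite le_min tx/= /h.
    by case: ifPn => // /andP[t0 tb]; rewrite t0 (ltW tb).
  rewrite {}e.
  have j c : intg `]0, c[ h by exact: intgT_oo.
  have [x0|x0] := leP (Num.min x b) 0.
    rewrite (_ : `]0, Num.min x b]%classic = set0) ?Rintegral_set0//.
    by apply: set_itv_ge; rewrite bnd_simp -leNgt.
  have := j (Num.min x b) => -[jj].
  rewrite -(@Rintegral_itv_bndo_bndc _ _ _ _ jj).
  have xb : Num.min x b <= b by rewrite ge_min lexx orbT.
  have -> : \int[mu]_(t in `]0, (Num.min x b)[) h t = \int[mu]_(t in `]0, (Num.min x b)[) d t.
    apply: eq_Rint => t; rewrite /= in_itv/= => /andP[t0 tx]; rewrite /h t0/=.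
    by rewrite (lt_le_trans tx xb).
  have k1 := intgS_oo (lexx _) xb ig; have k2 := intgS_oo (lexx _) xb ig'.
  rewrite (Rint_B (measurable_itv _) k1 k2) -/(prim g _) -/(prim g' _).
  have hx : 0 <= Num.min x b <= b by rewrite xb (ltW x0).
  have := eg _ hx; rewrite (eg' _ hx) => /addrI ->; exact: subrr.
have loc : locally_integrable [set: R] h.
  by apply: open_integrable_locally; [exact: openT|case: ih].
have iy y : mu.-integrable `]-oo, y] (EFin \o h).
  by have [] : intg `]-oo, y] h by exact: intgS ih.
have := @FTC1Ny R h iy loc; apply: (@filterS _ _ (ae_filter_ringOfSetsType mu)) => x [_].
have -> : (fun x => \int[mu]_(t in [set` `]-oo, x]]) h t) = cst 0.
  by apply/funext => y; exact: F0.
rewrite derive1E derive_cst => hx0 hxb; apply/eqP; rewrite -subr_eq0; apply/eqP.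
by have := esym hx0; rewrite /h hxb.
Qed.

Lemma ae_sqi b g g' : sqi b g -> intg `]0, b[ g' ->
  {ae mu, forall x, 0 < x < b -> g x = g' x} -> sqi b g' /\ L2norm b g' = L2norm b g.
Proof.
move=> [mg [hg]] ig' hae; have mg' := intg_meas ig'.
have mI : measurable `]0, b[%classic by exact: measurable_itv.
have m2 : measurable_fun `]0, b[%classic (fun x => g x ^+ 2) by exact: measurable_funX.
have m2' : measurable_fun `]0, b[%classic (fun x => g' x ^+ 2) by exact: measurable_funX.
have ae2 : {ae mu, forall x, `]0, b[%classic x -> g x ^+ 2 = g' x ^+ 2}.
  apply: (@filterS _ _ (ae_filter_ringOfSetsType mu)) hae => x hx.
  by rewrite /= in_itv/= => /hx ->.
have s' : sqi b g'.
  split=> //; split; apply/integrableP; split; first exact/measurable_EFinP.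
  have /integrableP[_] := hg; apply: le_lt_trans; rewrite le_eqVlt; apply/orP; left; apply/eqP.
  apply: ge0_ae_eq_integral => //.
  - by apply/measurable_EFinP; apply: measurableT_comp => //.
  - by apply/measurable_EFinP; apply: measurableT_comp => //.
  - by apply: (@filterS _ _ (ae_filter_ringOfSetsType mu)) ae2 => x hx Dx /=; rewrite hx.
split=> //; have sg : sqi b g by split.
rewrite (L2norm_sqrt s') (L2norm_sqrt sg); congr Num.sqrt.
apply: ae_eq_Rint => //.
by apply: (@filterS _ _ (ae_filter_ringOfSetsType mu)) ae2 => x hx Dx; rewrite hx.
Qed.

(** [weak_deriv] is picked among integrable derivatives only; almost everywhere uniqueness transfers
    square integrability and the norm to the version picked. *)
Lemma weak_derivP b m : in_H1 b m ->
  [/\ AC_deriv b m (weak_deriv b m), sqi b (weak_deriv b m) &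
   forall g, AC_deriv b m g -> sqi b g -> L2norm b (weak_deriv b m) = L2norm b g].
Proof.
move=> [g hg /in_Lp2P sg].
have hw : AC_deriv b m (weak_deriv b m) by rewrite /weak_deriv; case: xgetP => [x _ //|/(_ g)].
have key k : AC_deriv b m k -> sqi b k ->
    sqi b (weak_deriv b m) /\ L2norm b (weak_deriv b m) = L2norm b k.
  move=> hk sk; apply: ae_sqi => //; first by case/AC_derivP: hw.
  exact: ae_deriv_unique hk hw.
split=> //; first exact: (key g hg sg).1.
by move=> k hk sk; exact: (key k hk sk).2.
Qed.

End AlmostEverywhere.

Section Reflection.
Context {R : realType}.
Local Notation mu := (@lebesgue_measure R).
Implicit Types (f g : R -> R) (L c x y : R).

Lemma Rint_reflect L f : intg `]0, L[ f ->
  intg `]0, L[ (fun x => f (L - x)) /\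
  \int[mu]_(x in `]0, L[) f (L - x) = \int[mu]_(x in `]0, L[) f x.
Proof.
move=> hf; have := @Rint_refl_oo _ f 0 L L; rewrite subrr subr0; exact.
Qed.

Lemma sqi_reflect L f : sqi L f ->
  sqi L (fun x => f (L - x)) /\ L2norm L (fun x => f (L - x)) = L2norm L f.
Proof.
move=> sf; have [i1 _] := Rint_reflect (sqi_intg sf).
have [_ i2] := sf; have H2 := Rint_reflect i2.
have s' : sqi L (fun x => f (L - x)).
  by split; [exact: intg_meas i1|case: H2].
split=> //; rewrite (L2norm_sqrt s') (L2norm_sqrt sf); congr Num.sqrt.
by case: H2.
Qed.

Lemma AC_shift b c L f f' : 0 <= c -> 0 <= L -> c + L <= b -> AC_deriv b f f' ->
  AC_deriv L (fun y => f (c + y)) (fun y => f' (c + y)).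
Proof.
move=> c0 L0 cb /AC_derivP[i e]; apply/AC_derivP.
have sh y : 0 <= y <= L -> intg `]0, y[ (fun s => f' (c + s)) /\
    \int[mu]_(s in `]0, y[) f' (c + s) = \int[mu]_(s in `]c, c + y[) f' s.
  move=> /andP[y0 yL]; have j : intg `]0 + c, y + c[ f'.
    by apply: intgS_oo i; rewrite ?add0r// addrC; apply: le_trans cb; rewrite lerD2l.
  have [j1 j2] := Rint_shift_oo j; rewrite add0r [y + c]addrC in j2.
  split.
    by apply: eq_intg j1; [exact: measurable_itv|move=> s _; rewrite addrC].
  by rewrite -j2; apply: eq_Rint => s _; rewrite addrC.
split; first by apply: (sh L _).1; rewrite L0 lexx.
move=> y hy; have /andP[y0 yL] := hy.
rewrite addr0 /prim (sh y hy).2.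
have cyb : c + y <= b by apply: le_trans cb; rewrite lerD2l.
have ccy : c <= c + y by rewrite lerDl.
rewrite -(primB i c0 ccy cyb) (e (c + y)) ?(addr_ge0 c0 y0)// (e c) ?c0 ?(le_trans ccy)//.
move: (prim _ _) (prim _ _) => *; ring.
Qed.

Lemma AC_reflect b c L f f' : 0 <= L -> L <= c -> c <= b -> AC_deriv b f f' ->
  AC_deriv L (fun y => f (c - y)) (fun y => - f' (c - y)).
Proof.
move=> L0 Lc cb /AC_derivP[i e]; apply/AC_derivP.
have sh y : 0 <= y <= L -> intg `]0, y[ (fun s => f' (c - s)) /\
    \int[mu]_(s in `]0, y[) f' (c - s) = \int[mu]_(s in `]c - y, c[) f' s.
  move=> /andP[y0 yL]; have := @Rint_refl_oo _ f' 0 y c; rewrite subr0; apply.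
  by apply: intgS_oo i => //; rewrite subr_ge0 (le_trans yL).
split.
  by apply: intgN; [exact: measurable_itv|apply: (sh L _).1; rewrite L0 lexx].
move=> y hy; have /andP[y0 yL] := hy.
have cy0 : 0 <= c - y by rewrite subr_ge0 (le_trans yL).
have cyc : c - y <= c by rewrite gerBl.
have c0 : 0 <= c by exact: le_trans Lc.
rewrite subr0.
have -> : prim (fun s => - f' (c - s)) y = - (prim f' c - prim f' (c - y)).
  rewrite (primB i cy0 cyc cb) -(sh y hy).2 -mulN1r -Rint_Zl; first by
    apply: eq_Rint => s _; rewrite mulN1r.
    exact: measurable_itv.
  exact: (sh y hy).1.
rewrite (e (c - y)) ?cy0 ?(le_trans cyc)// (e c) ?c0//.
move: (prim _ _) (prim _ _) => *; ring.
Qed.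

End Reflection.

(** * Traces of an edge solution at the interior vertex *)

Section EdgeTraces.
Context {R : realType}.
Local Notation mu := (@lebesgue_measure R).
Implicit Types (p r : R -> R) (x y t s C : R).
Variables (q : R -> R) (L T : R).
Hypothesis pq : potential q L.
Hypothesis T0 : 0 <= T.

Lemma Sp_duh v s t : bcont v -> 0 <= s -> Sp q v s t = duh q t 1 v s + duh q t (-1) v s.
Proof.
move=> bv s0.
rewrite /duh -(Rint_D (measurable_itv _) (duh_intgz t pq 1 bv s0) (duh_intgz t pq (-1) bv s0)).
apply: eq_Rint => z _; rewrite mul1r mulN1r -mulrDr; congr (_ * _); by field.
Qed.

Lemma S_bnd v M : bcont v -> (forall y t, `|v y t| <= M) -> forall y t, 0 <= y ->
  `|Sp q v y t| <= 2 * (\int[mu]_z `|q z|) * M /\ `|Sm q v y t| <= 2 * (\int[mu]_z `|q z|) * M.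
Proof.
move=> bv hM y t y0; have M0 : 0 <= M by exact: le_trans (hM 0 0).
have h e := @duh_bnd _ q L t pq e v M y bv M0 (fun z _ => hM _ _).
have -> : forall Iq : R, 2 * Iq * M = Iq * M + Iq * M by move=> *; ring.
rewrite (Sp_duh t bv y0) (Sm_duh t pq bv y0); split.
  exact: le_trans (ler_normD _ _) (lerD (h _) (h _)).
exact: le_trans (ler_normB _ _) (lerD (h _) (h _)).
Qed.

Lemma edge_v_bound : exists2 C, 0 <= C & forall p r, density L (T + L) p -> density L (T + L) r ->
  forall y t, `|edge_v q L p r y t| <= C * (L2norm (T + L) p + L2norm (T + L) r).
Proof.
have [L0 _ _] := pq; have H0 : 0 <= T + L by rewrite addr_ge0.
have [C C0 hC] := wsol_bnd pq; exists (C * Num.sqrt (T + L)).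
  by rewrite mulr_ge0// sqrtr_ge0.
move=> p r hp hr y t; rewrite -mulrA; apply: hC.
  exact: (edge_data_bcont pq H0 hp hr).
exact: (edge_data_bnd pq H0 hp hr).
Qed.

(** At y = L, both v_t and v_y are shifted densities plus a bounded potential term. This gain over
    the energy regularity is what places the controls in L^2 and H^1. *)
Lemma edge_traces : exists2 C, 0 <= C & forall p r, density L (T + L) p -> density L (T + L) r ->
  let N := L2norm (T + L) p + L2norm (T + L) r in let v := edge_v q L p r in
  [/\ sqi T (edge_vt q L p r L) /\ L2norm T (edge_vt q L p r L) <= C * N,
      sqi T (edge_tr q L p r) /\ L2norm T (edge_tr q L p r) <= C * N,
      sqi T (v L) /\ L2norm T (v L) <= C * N,
      AC_deriv T (v L) (edge_vt q L p r L) &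
      forall y, 0 <= y <= L -> v y 0 = 0].
Proof.
have [L0 iq q0] := pq; have H0 : 0 <= T + L by rewrite addr_ge0.
have [C C0 hC] := edge_v_bound.
pose Iq := \int[mu]_z `|q z|.
have Iq0 : 0 <= Iq by exact: Rintegral_ge0.
(* The summands bound the potential term, the shifted densities, and the trace of v itself. *)
pose K := 2 * Iq * C * Num.sqrt T + 1 + C * Num.sqrt T.
have ST0 : 0 <= Num.sqrt T by exact: sqrtr_ge0.
exists K; first by rewrite !addr_ge0// ?mulr_ge0.
move=> p r hp hr N v.
have N0 : 0 <= N by rewrite addr_ge0// L2norm_ge0.
have vB := hC p r hp hr.
have bv : bcont v := edge_v_bcont pq H0 hp hr.
have uv := bv.1; have cv : causal L v := edge_v_causal pq H0 hp hr.
have LL : 0 <= L <= L by rewrite L0 lexx.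
have SB t := S_bnd bv vB t L0.
have [sp np] := density_shift L T L0 hp.
have [sr nr] := density_shift (- L) T L0 hr.
have [iSp eSp] := Sp_prim pq uv cv LL T0.
have [iSm eSm] := Sm_prim pq uv cv LL T0.
have CN0 : 0 <= C * N by rewrite mulr_ge0.
have fin (e : R) (F : R -> R) : `|e| <= 1 -> intg `]0, T[ F -> (forall t, `|F t| <= 2 * Iq * (C * N)) ->
    sqi T (fun t => p (t + L) + e * r (t - L) + F t) /\
    L2norm T (fun t => p (t + L) + e * r (t - L) + F t) <= K * N.
  move=> e1 iF bF.
  have sF : sqi T F by apply: (@sqi_bnd _ _ _ (2 * Iq * (C * N)) (intg_meas iF)).
  have nF : L2norm T F <= 2 * Iq * (C * N) * Num.sqrt T.
    by apply: L2norm_bnd => //; [rewrite !mulr_ge0|exact: intg_meas iF].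
  have s1 := sqiD sp (sqiZ e sr).
  split; first exact: sqiD.
  apply: le_trans (L2normD s1 sF) _.
  have h1 : L2norm T (fun t => p (t + L) + e * r (t - L)) <= N.
    apply: le_trans (L2normD sp (sqiZ e sr)) (lerD np _).
    rewrite L2normZ//; apply: le_trans nr; rewrite -[leRHS]mul1r.
    by rewrite ler_wpM2r// L2norm_ge0.
  apply: le_trans (lerD h1 nF) _.
  have -> : K * N = N + 2 * Iq * (C * N) * Num.sqrt T + C * N * Num.sqrt T by rewrite /K; ring.
  by rewrite lerDl mulr_ge0.
have vE t : 0 <= t -> v L t = prim (edge_vt q L p r L) t.
  move=> t0.
  have cp := density_cz L0 hp; have cr := density_cz L0 hr.
  have [ip ep] := cz_shift L cp t0; have [ir er] := cz_shift (- L) cr t0.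
  have [iSt eSt] := Sm_prim pq uv cv LL t0.
  rewrite /v (edge_v_eq pq H0 hp hr LL t0) -/v eSt.
  have mI : measurable `]0, t[%classic by exact: measurable_itv.
  rewrite /edge_vt /prim (Rint_D mI (intgD mI ip ir) iSt) (Rint_D mI ip ir) ep er.
  have -> : prim p (0 + L) = 0.
    by apply: (vanish_prim (density_vanish hp)); rewrite add0r.
  have -> : prim r (0 - L) = 0.
    by apply: (vanish_prim (density_vanish hr)); rewrite sub0r; apply: (le_trans _ L0); rewrite oppr_le0.
  by rewrite !subr0 -/(prim p (t + L)) -/(prim r (t - L)).
have n1 : `|1 : R| <= 1 by rewrite normr1.
have n2 : `|-1 : R| <= 1 by rewrite normrN normr1.
have [sA nA] := fin 1 _ n1 iSm (fun t => (SB t).2).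
have [sB nB] := fin (-1) _ n2 iSp (fun t => (SB t).1).
have EA : edge_vt q L p r L = (fun t => p (t + L) + 1 * r (t - L) + Sm q v L t).
  by apply/funext => t; rewrite /edge_vt mul1r.
have EB : edge_tr q L p r = (fun t => p (t + L) + -1 * r (t - L) + Sp q v L t).
  by apply/funext => t; rewrite /edge_tr mulN1r.
have svt : sqi T (edge_vt q L p r L) by rewrite EA.
have cvL : continuous (v L) by exact: bcont_sec.
split.
- by split=> //; rewrite EA.
- by rewrite EB.
- split; first exact: continuous_sqi.
  apply: (@le_trans _ _ (C * N * Num.sqrt T)).
    apply: (L2norm_bnd T0 CN0); last by move=> x _; exact: vB.
    by apply: measurable_funTS; exact: continuous_measurable_fun.
  have -> : K * N = (N + 2 * Iq * (C * N) * Num.sqrt T) + C * N * Num.sqrt T by rewrite /K; ring.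
  by rewrite lerDr addr_ge0// !mulr_ge0.
- apply/AC_derivP; split; first exact: sqi_intg.
  have v0 : v L 0 = 0 by rewrite vE// prim0.
  by move=> t /andP[t0 _]; rewrite vE// vE// prim0 add0r.
- by move=> y hy; exact: (edge_v0 pq H0 hp hr).
Qed.

End EdgeTraces.

Section EdgeDynamics.
Context {R : realType}.
Local Notation mu := (@lebesgue_measure R).
Implicit Types (p r phi psi : R -> R) (x y t s C : R).
Variables (q : R -> R) (L T : R).
Hypothesis iq : intg `]0, L[ q.
Hypothesis L_gt0 : 0 < L.
Hypothesis T0 : 0 <= T.

(** The potential in the coordinate measured from the far end of the edge. *)
Definition flip x := cutoff L (fun y => q (L - y)) x.

Lemma flip_potential : potential flip L.
Proof.
split; [exact: ltW|by apply/intg_if; exact: (Rint_reflect iq).1|].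
by move=> z hz; rewrite /flip /cutoff (negbTE hz).
Qed.

Section Density.
Variables p r : R -> R.
Hypothesis hp : density L (T + L) p.
Hypothesis hr : density L (T + L) r.

Let v := edge_v flip L p r.
Let L0 : 0 <= L := ltW L_gt0.
Let H0 : 0 <= T + L := addr_ge0 T0 L0.

Lemma bdry_rhs_sqi phi phi' psi : intg `]0, L[ psi -> sqi T (bdry_rhs flip L v p r phi phi' psi).
Proof.
move=> ipsi; have pq := flip_potential.
have bv : bcont v := edge_v_bcont pq H0 hp hr.
have uv := bv.1; have [_ [M hM]] := bv.
have M0 : 0 <= M by exact: le_trans (hM 0 0).
have [C C0 hC] := edge_traces pq T0.
have [_ [str _] _ _ _] := hC p r hp hr.
have sp : sqi T p by apply: sqi_sub hp.1; rewrite lerDl.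
have sr : sqi T r by apply: sqi_sub hr.1; rewrite lerDl.
have sL : sqi T (v L) by apply: continuous_sqi; exact: bcont_sec.
have s0 : sqi T (v 0) by apply: continuous_sqi; exact: bcont_sec.
have sX : sqi T (fun s => \int[mu]_(y in `]0, L[) (psi y * v y s)).
  have [|i1 i2 _ _] := fubini_rect ipsi (ucont_meas uv) (M := M) (t := T) _ M0.
    by move=> z s _ _; exact: hM.
  apply: (@sqi_bnd _ _ _ (M * \int[mu]_(y in `]0, L[) `|psi y|) (intg_meas i2)) => s hs.
  have mI : measurable `]0, L[%classic by exact: measurable_itv.
  rewrite -Rint_Zl//; last exact: intg_norm.
  apply: Rint_norm_le => //; [exact: i1|by apply: intgZ => //; exact: intg_norm|].
  by move=> y _; rewrite normrM mulrC ler_wpM2r.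
have S1 := sqi_lin (phi L) (- phi' L) str sL.
have S2 := sqi_lin (- phi 0) (phi 0) sp sr.
have S3 := sqi_lin (phi' 0) (-1) s0 sX.
apply: eq_sqi (sqiD (sqiD S1 S2) S3) => s _.
rewrite /bdry_rhs /edge_tr -/v.
have -> : \int[mu]_(y in `]0, L[) (v y s * psi y) = \int[mu]_(y in `]0, L[) (psi y * v y s).
  by apply: eq_Rint => y _; rewrite mulrC.
move: (\int[mu]_(y in _) _) (Sp _ _ _ _) (v _ _) (v _ _) => *; ring.
Qed.

Lemma edge_dynamics phi phi' phi'' psi : AC_deriv L phi phi' -> AC_deriv L phi' phi'' ->
  sqi L psi -> (forall y, 0 < y < L -> edge_vt flip L p r y T = psi y) ->
  exists m1 m2 : R -> R,
  [/\ AC_deriv T (fun t => \int[mu]_(x in `]0, L[) (v (L - x) t * phi x)) m1,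
      AC_deriv T m1 m2 /\ sqi T m2,
      \int[mu]_(x in `]0, L[) (v (L - x) 0 * phi x) = 0 /\ m1 0 = 0,
      forall t, 0 < t < T ->
        m2 t + \int[mu]_(x in `]0, L[) (v (L - x) t * (- phi'' x + q x * phi x)) =
        edge_tr flip L p r t * phi 0 + v L t * phi' 0 - (p t - r t) * phi L - v 0 t * phi' L &
      m1 T = \int[mu]_(x in `]0, L[) (psi (L - x) * phi x)].
Proof.
move=> h1 h2 spsi vpsi; have pq := flip_potential.
have mI : measurable `]0, L[%classic by exact: measurable_itv.
have LL : L <= L by [].
have k1 := AC_reflect L0 LL LL h1.
have k2 : AC_deriv L (fun y => - phi' (L - y)) (fun y => phi'' (L - y)).
  have := AC_lin (-1) 0 (AC_reflect L0 LL LL h2) (AC_cst L 0).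
  by apply: AC_eq => // x _; rewrite mul0r addr0 mulN1r ?opprK.
have [ipsi im2 im1 e1 e0] := edge_green pq T0 H0 hp hr k1 k2.
set m1 := (fun t => \int[mu]_(y in `]0, L[) (edge_vt flip L p r y t * phi (L - y))) in e1 e0 im1.
set pp := (fun y => - phi'' (L - y) + flip y * phi (L - y)) in ipsi im2 e1.
set m2 := bdry_rhs flip L (edge_v flip L p r) p r _ _ pp in im2 e1.
have bv : bcont v := edge_v_bcont pq H0 hp hr.
have [_ [M hM]] := bv.
have refl t (f : R -> R) : intg `]0, L[ f ->
    \int[mu]_(x in `]0, L[) (v (L - x) t * f x) = \int[mu]_(y in `]0, L[) (v y t * f (L - y)).
  move=> hf; pose g x := v (L - x) t * f x.
  have mg : intg `]0, L[ g.
    apply: (@eq_intg _ _ (fun x => f x * v (L - x) t)) => //; first by move=> x _; rewrite mulrC.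
    apply: (@intg_mulb _ _ _ _ M mI hf); last by move=> x _; exact: hM.
    apply: measurable_funTS; apply: continuous_measurable_fun => x.
    apply: (@cvg_comp _ _ _ (fun x => L - x) (v^~ t) _ _ _ _ (@bcont_sec2 _ v t bv (L - x))).
    by apply: cvgB; [exact: cvg_cst|exact: cvg_id].
  have [_ <-] := Rint_reflect mg.
  by apply: eq_Rint => y _; rewrite /g opprB addrCA subrr addr0.
have iphi : intg `]0, L[ phi by apply: sqi_intg; exact: AC_sqi h1.
have e0' t : 0 <= t <= T -> \int[mu]_(x in `]0, L[) (v (L - x) t * phi x) = prim m1 t.
  by move=> ht; rewrite (refl _ _ iphi); exact: e0.
have e1' t : 0 <= t <= T -> m1 t = prim m2 t := e1 t.
have T0' : 0 <= (0 : R) <= T by rewrite lexx.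
exists m1, m2; split.
- apply/AC_derivP; split => // t ht.
  by rewrite e0' // (e0' 0 T0') prim0 add0r.
- split; last exact: bdry_rhs_sqi.
  apply/AC_derivP; split=> // t ht.
  by rewrite e1'// (e1' 0 T0') prim0 add0r.
- by rewrite (e0' 0 T0') (e1' 0 T0') !prim0.
- move=> t ht.
  have iq' : intg `]0, L[ (fun x => - phi'' x + q x * phi x).
    have /AC_derivP[i2 _] := h2; have [N hN] := AC_bnd h1.
    apply: intgD => //; first exact: intgN.
    apply: (@intg_mulb _ _ _ _ N) => //; first exact: AC_meas h1.
    by move=> x; rewrite /= in_itv/= => /andP[x0 xL]; apply: hN; rewrite !ltW.
  rewrite (refl _ _ iq').
  have -> : \int[mu]_(y in `]0, L[) (v y t * (- phi'' (L - y) + q (L - y) * phi (L - y))) =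
      \int[mu]_(y in `]0, L[) (v y t * pp y).
    apply: eq_Rint => y; rewrite /= in_itv/= => hy.
    by rewrite /pp /flip /cutoff hy.
  rewrite /m2 /bdry_rhs -/v -/(edge_tr flip L p r t) !subrr !subr0.
  move: (\int[mu]_(y in _) _) (edge_tr _ _ _ _ _) (v _ _) (v _ _) => *; ring.
- rewrite /m1.
  have i3 : intg `]0, L[ (fun x => psi (L - x) * phi x).
    by apply: sqi_mul; [exact: (sqi_reflect spsi).1|exact: AC_sqi h1].
  have [_ <-] := Rint_reflect i3.
  apply: eq_Rint => y; rewrite /= in_itv/= => hy.
  by rewrite vpsi// opprB addrCA subrr addr0.
Qed.

End Density.
End EdgeDynamics.

(** * The trajectory on the lasso and the controls read off from it *)

Section LassoTrajectory.
Context {R : realType}.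
Local Notation mu := (@lebesgue_measure R).
Variables (a l T : R) (q : lasso_fun R).
Hypotheses (a_gt0 : 0 < a) (l_gt0 : 0 < l) (T_gt0 : 0 < T).
Hypothesis q_L1 : forall j : 'I_3, in_Lp 1%E (edge_length a l j) (q j).
Implicit Types (phi dphi psi f g : lasso_fun R) (x y t s e : R) (j : 'I_3).

Local Notation len := (edge_length a l).
Local Notation dom := (in_domain a l q).

Definition lasso_pot j := flip (q j) (len j).

Let T0 : 0 <= T := ltW T_gt0.
Let len0 j : 0 <= len j := ltW (len_gt0 a_gt0 l_gt0 j).
Let iq j : intg `]0, len j[ (q j). Proof. exact/in_Lp1P. Qed.

Lemma lasso_potP j : potential (lasso_pot j) (len j).
Proof. exact: flip_potential (iq j) (len_gt0 a_gt0 l_gt0 j). Qed.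

Section Densities.
Variables p r : 'I_3 -> R -> R.
Hypothesis hp : forall j, density (len j) (T + len j) (p j).
Hypothesis hr : forall j, density (len j) (T + len j) (r j).

Definition lasso_v j := edge_v (lasso_pot j) (len j) (p j) (r j).
Definition lasso_u t : lasso_fun R := fun j x => lasso_v j (len j - x) t.
Definition lasso_tr j := edge_tr (lasso_pot j) (len j) (p j) (r j).

Let H0 j : 0 <= T + len j := addr_ge0 T0 (len0 j).

Lemma lasso_v_bcont j : bcont (lasso_v j).
Proof. have h : bcont (lasso_v j) := edge_v_bcont (lasso_potP j) (H0 j) (hp j) (hr j). by []. Qed.

Lemma lasso_u_L2 t : in_L2 a l (lasso_u t).
Proof.
apply/in_L2P => j.
apply: (sqi_reflect (continuous_sqi (len j) (@bcont_sec2 _ _ t (lasso_v_bcont j)))).1.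
Qed.

Lemma lasso_v_near t e : 0 < e -> \forall s \near t, forall j y, 0 <= y <= len j ->
  `|lasso_v j y s - lasso_v j y t| < e.
Proof.
move=> e0.
have near_j j : \forall s \near t, forall y, 0 <= y <= len j ->
    `|lasso_v j y s - lasso_v j y t| < e.
  apply: (@ucont_unif _ (fun s y => lasso_v j y s) t 0 (len j)) => //.
  exact: ucont_swap (lasso_v_bcont j).1.
apply: filterS3 (near_j edge1) (near_j edge2) (near_j edge3) => s h1 h2 h3.
exact: edge_ind.
Qed.

Lemma lasso_u_continuous : continuous_in_H a l T lasso_u.
Proof.
split=> [t _|t _]; first exact: lasso_u_L2.
apply/cvgrPdist_le => e e0.
(* K^2 exceeds the total length l + 2 a, so a uniform error e / K has norm at most e. *)
pose K := 3 * (1 + a + l).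
have al0 : 0 < a + l by exact: addr_gt0.
have K1 : 0 < 1 + a + l by rewrite -addrA addr_gt0.
have K0 : 0 < K by rewrite mulr_gt0.
have eK : 0 < e / K by rewrite divr_gt0.
have [d /= d0 hd] := lasso_v_near t eK; exists d => //= s ht _.
rewrite sub0r normrN.
have hs := hd s ht.
pose D := dif (lasso_u s) (lasso_u t).
have DL : in_L2 a l D by apply: dif_L2; exact: lasso_u_L2.
rewrite -/D ger0_norm ?sqrtr_ge0//.
have eK0 : 0 <= e / K by rewrite ltW// divr_gt0.
have Dj j : L2norm (len j) (D j) ^+ 2 <= (e / K) ^+ 2 * len j.
  move/in_L2P: DL => DL; rewrite (L2norm_sqr (DL j)).
  have -> : (e / K) ^+ 2 * len j = \int[mu]_(x in `]0, len j[) (e / K) ^+ 2.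
    by rewrite Rint_cst// subr0.
  apply: Rint_le; [exact: measurable_itv|by have [] := DL j|exact: intg_cst_oo|].
  move=> x; rewrite /= in_itv/= => /andP[x0 xL].
  rewrite -[leLHS]real_normK ?num_real// lerXn2r ?nnegrE// /D /dif /lasso_u.
  apply/ltW/hs; rewrite subr_ge0 (ltW xL)/= gerBl; exact: ltW.
rewrite -(ger0_norm (ltW e0)) -(sqrtr_sqr e) ler_wsqrtr//.
apply: le_trans (ler_sum _ (fun j _ => Dj j)) _.
rewrite -mulr_sumr sum_edges /edge_length/=.
have -> : e ^+ 2 = (e / K) ^+ 2 * K ^+ 2.
  by rewrite -exprMn divfK// gt_eqF.
apply: ler_wpM2l; first exact: sqr_ge0.
have a0 := a_gt0; have l0 := l_gt0.
have aa : 0 <= a * a by rewrite mulr_ge0 ?ltW.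
have ll : 0 <= l * l by rewrite mulr_ge0 ?ltW.
have la : 0 <= a * l by rewrite mulr_ge0 ?ltW.
have -> : K ^+ 2 = 9 * (1 + 2 * a + 2 * l + a * a + l * l + 2 * (a * l)) by rewrite /K; ring.
lra.
Qed.

Hypotheses (sym1 : p edge1 = r edge1) (sym2 : p edge2 = r edge3) (sym3 : p edge3 = r edge2).

Lemma lasso_v_far : lasso_v edge2 0 = lasso_v edge3 0.
Proof.
have h j t : lasso_v j 0 t = prim (p j) t + prim (r j) t.
  have [_ e] := wsolP (lasso_potP j) (edge_data_bcont (lasso_potP j) (H0 j) (hp j) (hr j)).
  have z : 0 <= (0 : R) <= len j by rewrite lexx len0.
  rewrite /lasso_v /edge_v e (wave_int_oo t (lasso_potP j) (lasso_v_bcont j) z) Rint_empty// addr0.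
  by rewrite /edge_data clamp_id// addr0 subr0.
by apply/funext => t; rewrite !h sym2 sym3 addrC.
Qed.

(** [lasso_tr] is the derivative in y = len - x, hence minus the outward derivative at x = 0. *)
Definition ctrl1 t := - (lasso_tr edge1 t + lasso_tr edge2 t + lasso_tr edge3 t).
Definition ctrl2 t := lasso_v edge2 a t - lasso_v edge1 l t.
Definition ctrl3 t := lasso_v edge3 a t - lasso_v edge1 l t.

(** The far-end terms cancel: on e1 by p = r and the Neumann condition, on the ring because
    exchanging p and r gives equal values of v and opposite fluxes. At the interior vertex,
    eliminating [dphi edge1 0] leaves the differences of traces that form the controls. *)
Lemma lasso_dynamics psi phi dphi d2phi : in_L2 a l psi ->
  (forall j y, 0 < y < len j -> edge_vt (lasso_pot j) (len j) (p j) (r j) y T = psi j (len j - y)) ->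
  dom phi dphi d2phi -> exists m1 m2 : R -> R,
  [/\ H2_derivs T (fun t => inner a l (lasso_u t) phi) m1 m2,
      inner a l (lasso_u 0) phi = 0, m1 0 = 0,
      forall t, 0 < t < T -> m2 t + inner a l (lasso_u t) (opA q phi d2phi) =
        - ctrl1 t * phi edge1 0 + ctrl2 t * outward_start dphi edge2
                                + ctrl3 t * outward_start dphi edge3 &
      m1 T = inner a l psi phi].
Proof.
move=> hpsi hvt [_ hAC _ [b1 b2 b3] [c1 c2 c3]].
have e1 : dphi edge1 0 = - dphi edge2 0 - dphi edge3 0.
  by move: c3; rewrite sum_edges /outward_start; lra.
have e2 : dphi edge3 a = - dphi edge2 a.
  by move: b3; rewrite /outward_end /edge_length/=; lra.
have dyn j : exists m1 m2 : R -> R,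
  [/\ AC_deriv T (fun t => \int[mu]_(x in `]0, len j[) (lasso_u t j x * phi j x)) m1,
      AC_deriv T m1 m2 /\ sqi T m2,
      \int[mu]_(x in `]0, len j[) (lasso_u 0 j x * phi j x) = 0 /\ m1 0 = 0,
      forall t, 0 < t < T ->
        m2 t + \int[mu]_(x in `]0, len j[) (lasso_u t j x * opA q phi d2phi j x) =
        lasso_tr j t * phi j 0 + lasso_v j (len j) t * dphi j 0
        - (p j t - r j t) * phi j (len j) - lasso_v j 0 t * dphi j (len j) &
      m1 T = \int[mu]_(x in `]0, len j[) (psi j x * phi j x)].
  have [h1 h2] := hAC j; move/in_L2P: hpsi => hpsi.
  have [m1 [m2 [k1 k2 k3 k4 k5]]] := edge_dynamics (iq j) (len_gt0 a_gt0 l_gt0 j) T0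
    (hp j) (hr j) h1 h2 (sqi_reflect (hpsi j)).1 (hvt j).
  exists m1, m2; split=> //; rewrite k5; apply: eq_Rint => x _.
  by rewrite opprB addrCA subrr addr0.
have [m1 [n1 [A1 B1 C1 D1 E1]]] := dyn edge1.
have [m2 [n2 [A2 B2 C2 D2 E2]]] := dyn edge2.
have [m3 [n3 [A3 B3 C3 D3 E3]]] := dyn edge3; clear dyn.
exists (fun t => 1 * (1 * m1 t + 1 * m2 t) + 1 * m3 t),
  (fun t => 1 * (1 * n1 t + 1 * n2 t) + 1 * n3 t).
split.
- split.
  + have := AC_lin 1 1 (AC_lin 1 1 A1 A2) A3.
    apply: AC_eq => // t _; rewrite innerE.
    by rewrite /edge_length/= !mul1r.
  + exact: AC_lin 1 1 (AC_lin 1 1 B1.1 B2.1) B3.1.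
  + apply/in_Lp2P; exact: sqi_lin (sqi_lin 1 1 B1.2 B2.2) B3.2.
- rewrite innerE; move: C1 C2 C3 => [C1 _] [C2 _] [C3 _].
  by move: C1 C2 C3; rewrite /edge_length/= => -> -> ->; rewrite !addr0.
- move: C1 C2 C3 => [_ ->] [_ ->] [_ ->]; ring.
- move=> t ht; have := D1 t ht; have := D2 t ht; have := D3 t ht.
  rewrite innerE /edge_length/= b1 sym1 lasso_v_far sym2 sym3 -b2 -c2 -c1 => d3 d2 d1.
  rewrite /ctrl1 /ctrl2 /ctrl3 /outward_start.
  rewrite e1 in d1; rewrite e2 in d3; clear D1 D2 D3 A1 A2 A3 E1 E2 E3 hvt.
  move: d1 d2 d3; move: (\int[mu]_(x in _) _) (\int[mu]_(x in _) _) (\int[mu]_(x in _) _) => I3 I2 I1 d1 d2 d3.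
  have -> : forall u1 u2 u3 : R, 1 * (1 * u1 + 1 * u2) + 1 * u3 + (I1 + I2 + I3) =
     (u1 + I1) + (u2 + I2) + (u3 + I3) by move=> *; ring.
  rewrite d1 d2 d3.
  move: (lasso_tr _ _) (lasso_tr _ _) (lasso_tr _ _) (lasso_v _ _ _) (lasso_v _ _ _) (lasso_v _ _ _) (lasso_v _ _ _) (lasso_v _ _ _) (r _ _) (r _ _) (r _ _) => *; ring.
- by rewrite E1 E2 E3 innerE /edge_length/= !mul1r.
Qed.

End Densities.
End LassoTrajectory.

(** * Assembly *)

Section EdgeControl.
Context {R : realType}.
Local Notation mu := (@lebesgue_measure R).
Implicit Types (x y t k m c C N b L T : R).

Lemma sobolev L (phi phi' : R -> R) : 0 < L -> AC_deriv L phi phi' -> sqi L phi' ->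
  forall x, 0 <= x <= L -> `|phi x| <= (L^-1 + 1) * (L2norm L phi + L2norm L phi').
Proof.
move=> L0 h1 s1 x hx; have := AC_sup_form L0 ltr01 h1 s1 hx.
have s0 := AC_sqi (ltW L0) h1.
rewrite -(L2norm_sqr s0) -(L2norm_sqr s1) invr1 mul1r => h.
have n0 := @L2norm_ge0 R L phi; have n1 := @L2norm_ge0 R L phi'.
move: h n0 n1; move: (L2norm L phi) (L2norm L phi') => u v h u0 v0.
have c1 : 1 <= L^-1 + 1 by rewrite lerDr invr_ge0 ltW.
move: c1 h; move: (L^-1 + 1) => c c1 h.
have c0 : 0 <= c by exact: le_trans c1.
rewrite -(@ler_pXn2r _ 2) ?nnegrE ?mulr_ge0 ?addr_ge0// real_normK ?num_real//.
apply: le_trans h _.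
have -> : (c * (u + v)) ^+ 2 = c * (c * (u ^+ 2 + v ^+ 2 + 2 * (u * v))) by ring.
have uv : 0 <= u * v by exact: mulr_ge0.
have u2 := sqr_ge0 u; have v2 := sqr_ge0 v.
set X := u ^+ 2 + v ^+ 2 + 2 * (u * v).
have X0 : 0 <= X by rewrite /X; lra.
have cX : X <= c * X by rewrite ler_peMl.
have h1' : c * X <= c * (c * X) by rewrite ler_wpM2l.
apply: le_trans h1'.
have -> : c * X = c * u ^+ 2 + c * v ^+ 2 + 2 * (c * (u * v)) by rewrite /X; ring.
have cv : v ^+ 2 <= c * v ^+ 2 by rewrite ler_peMl.
have cuv : 0 <= c * (u * v) by rewrite mulr_ge0.
lra.
Qed.

Lemma sqi_shift_sub b c L (g : R -> R) : 0 <= c -> c + L <= b -> sqi b g ->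
  sqi L (fun y => g (c + y)) /\ L2norm L (fun y => g (c + y)) <= L2norm b g.
Proof.
move=> c0 cb sg; have [mg ig] := sg; have ig1 := sqi_intg sg.
have sub (f : R -> R) : intg `]0, b[ f -> intg `]0 + c, L + c[ f.
  by apply: intgS_oo; rewrite ?add0r// addrC.
have [j1 _] := Rint_shift_oo (sub _ ig1).
have J2 := Rint_shift_oo (sub _ ig).
have cE (f : R -> R) : (fun y => f (c + y)) = (fun y => f (y + c)).
  by apply/funext => y; rewrite addrC.
rewrite (cE g).
have s : sqi L (fun y => g (y + c)) by split; [exact: intg_meas j1|case: J2].
split=> //; apply: L2norm_ler => //; first exact: L2norm_ge0.
rewrite (L2norm_sqr sg); case: J2 => _ ->.
by apply: Rint_mono_oo; rewrite ?add0r// ?[L + c]addrC// => x; exact: sqr_ge0.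
Qed.

(** The travelling components (phi' + psi) / 2 and (phi' - psi) / 2 serve as [hp] and [hm], and k is
    half the common value at the midpoint. *)
Lemma control_pair (q : bool -> R -> R) L T : (forall e, potential (q e) L) -> 2 * L < T ->
  exists2 C, 0 <= C & forall (phi phi' psi : bool -> R -> R) N,
  (forall e, AC_deriv L (phi e) (phi' e)) ->
  (forall e, sqi L (phi' e) /\ L2norm L (phi' e) <= N) ->
  (forall e, sqi L (psi e) /\ L2norm L (psi e) <= N) ->
  phi true 0 = phi false 0 -> `|phi true 0| <= N ->
  exists d : bool -> R -> R, forall e,
  [/\ density L (T + L) (d e), L2norm (T + L) (d e) <= C * N,
   forall y, 0 <= y <= L -> edge_v (q e) L (d e) (d (~~ e)) y T = phi e y &
   forall y, 0 < y < L -> edge_vt (q e) L (d e) (d (~~ e)) y T = psi e y].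
Proof.
move=> pq LT; have [C C0 hC] := control_densities pq LT; exists C => // phi phi' psi N hphi s1 s2 e0 nphi.
have N0 : 0 <= N by exact: le_trans nphi.
have half k e : `|k| = 2^-1 -> sqi L (fun y => 2^-1 * phi' e y + k * psi e y) /\
    L2norm L (fun y => 2^-1 * phi' e y + k * psi e y) <= N.
  move=> hk; have [a1 a2] := s1 e; have [b1 b2] := s2 e.
  split; first exact: sqi_lin.
  apply: le_trans (L2normD (sqiZ 2^-1 a1) (sqiZ k b1)) _.
  by rewrite !L2normZ// hk ger0_norm//; lra.
have k1 : `|2^-1 : R| = 2^-1 by rewrite ger0_norm.
have k2 : `|- 2^-1 : R| = 2^-1 by rewrite normrN ger0_norm.
pose hp e := cutoff L (fun y => 2^-1 * phi' e y + 2^-1 * psi e y).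
pose hm e := cutoff L (fun y => 2^-1 * phi' e y + - 2^-1 * psi e y).
have [|||||d hd] := hC hp hm (phi true 0 / 2) N.
- by move=> e; apply: cutoff_density; exact: (half _ e k1).1.
- by move=> e; apply: cutoff_density; exact: (half _ e k2).1.
- by move=> e; rewrite cutoff_norm; exact: (half _ e k1).2.
- by move=> e; rewrite cutoff_norm; exact: (half _ e k2).2.
- by rewrite normrM k1; apply: le_trans nphi; rewrite ler_pdivrMr// ler_peMr// ler1n.
exists d => e; have [d1 d2 d3 d4] := hd e; split=> //.
- move=> y hy; rewrite d3//; have /andP[y0 yL] := hy.
  have mI : measurable `]0, y[%classic by exact: measurable_itv.
  have i1 := sqi_intg (sqi_sub yL (s1 e).1); have i2 := sqi_intg (sqi_sub yL (s2 e).1).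
  rewrite /hp /hm !prim_cutoff// /prim (Rint_lin _ _ mI i1 i2) (Rint_lin _ _ mI i1 i2).
  have /AC_derivP[_ E] := hphi e; rewrite (E _ hy).
  have -> : phi e 0 = phi true 0 by case: e {d1 d2 d3 d4 i1 i2 E}.
  rewrite -/(prim (phi' e) y) -/(prim (psi e) y).
  move: (prim _ _) (prim _ _) => u v; by field.
- by move=> y hy; rewrite d4// /hp /hm /cutoff hy; field.
Qed.

Section Average.
Variables (q : R -> R) (L H : R).
Hypothesis pq : potential q L.
Hypothesis H0 : 0 <= H.
Variables p r : R -> R.
Hypotheses (hp : density L H p) (hr : density L H r).

Let mean x := 2^-1 * p x + 2^-1 * r x.

Lemma mean_density : density L H mean.
Proof. exact: density_lin. Qed.

Lemma edge_v_mean y t : edge_v q L mean mean y t = 2^-1 * edge_v q L p r y t + 2^-1 * edge_v q L r p y t.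
Proof.
have [L0 _ _] := pq.
have cp := density_cz L0 hp; have cr := density_cz L0 hr.
have pm x : prim mean x = 2^-1 * prim p x + 2^-1 * prim r x.
  exact: (Rint_lin _ _ (measurable_itv _) (cp.1 0 x) (cr.1 0 x)).
rewrite /edge_v -(wsol_lin _ _ pq (edge_data_bcont pq H0 hp hr) (edge_data_bcont pq H0 hr hp)).
congr (wsol _ _ _ _ _); apply/funext => y'; apply/funext => t'.
rewrite /edge_data !pm; move: (prim _ _) (prim _ _) (prim _ _) (prim _ _) => *; ring.
Qed.

Lemma edge_vt_mean y t : 0 <= y -> edge_vt q L mean mean y t =
  2^-1 * edge_vt q L p r y t + 2^-1 * edge_vt q L r p y t.
Proof.
move=> y0.
have b0 := edge_v_bcont pq H0 mean_density mean_density.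
have b1 := edge_v_bcont pq H0 hp hr; have b2 := edge_v_bcont pq H0 hr hp.
rewrite /edge_vt (Sm_duh t pq b0 y0) (Sm_duh t pq b1 y0) (Sm_duh t pq b2 y0).
have E e : duh q t e (edge_v q L mean mean) y =
   2^-1 * duh q t e (edge_v q L p r) y + 2^-1 * duh q t e (edge_v q L r p) y.
  rewrite -(duh_lin t pq e 2^-1 2^-1 y b1 b2); apply: eq_Rint => z _.
  by rewrite edge_v_mean.
rewrite !E /mean.
move: (duh _ _ _ _ _) (duh _ _ _ _ _) (duh _ _ _ _ _) (duh _ _ _ _ _) => *; ring.
Qed.

End Average.

Lemma control_single (q : R -> R) L T : potential q L -> 2 * L < T ->
  exists2 C, 0 <= C & forall (phi phi' psi : R -> R) N,
  AC_deriv L phi phi' -> sqi L phi' /\ L2norm L phi' <= N ->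
  sqi L psi /\ L2norm L psi <= N -> `|phi 0| <= N ->
  exists d : R -> R,
  [/\ density L (T + L) d, L2norm (T + L) d <= C * N,
   forall y, 0 <= y <= L -> edge_v q L d d y T = phi y &
   forall y, 0 < y < L -> edge_vt q L d d y T = psi y].
Proof.
move=> pq LT; have [L0 _ _] := pq.
have T0 : 0 <= T by apply: le_trans (ltW LT); rewrite mulr_ge0.
have H0 : 0 <= T + L by exact: addr_ge0.
have [C C0 hC] := @control_pair (fun=> q) L T (fun=> pq) LT; exists C => // phi phi' psi N h1 h2 h3 h4.
have [d hd] := hC (fun=> phi) (fun=> phi') (fun=> psi) N (fun=> h1) (fun=> h2) (fun=> h3) erefl h4.
have [a1 a2 a3 a4] := hd true; have [b1 b2 b3 b4] := hd false.
exists (fun x => 2^-1 * d true x + 2^-1 * d false x); split.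
- exact: mean_density.
- apply: le_trans (L2normD (sqiZ _ a1.1) (sqiZ _ b1.1)) _.
  by rewrite !L2normZ ?ger0_norm//; [lra|exact: b1.1|exact: a1.1].
- move=> y hy; rewrite (edge_v_mean pq H0 a1 b1) (a3 y hy) (b3 y hy); by field.
- move=> y hy; have y0 : 0 <= y by case/andP: hy => /ltW.
  by rewrite (edge_vt_mean pq H0 a1 b1 _ y0) (a4 y hy) (b4 y hy); field.
Qed.

End EdgeControl.

(** * Two generalized solutions with the same controls coincide *)

Section SolutionUniqueness.
Context {R : realType}.
Local Notation mu := (@lebesgue_measure R).
Variables (a l T : R) (q : lasso_fun R).
Hypotheses (a_gt0 : 0 < a) (l_gt0 : 0 < l) (T_gt0 : 0 < T).
Hypothesis q_L1 : forall j : 'I_3, in_Lp 1%E (edge_length a l j) (q j).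
Implicit Types (f g : lasso_fun R).

Lemma Hnorm_dif f g : in_L2 a l f -> in_L2 a l g ->
  Hnorm a l (dif f g) <= 2 * (Hnorm a l f + Hnorm a l g).
Proof.
move=> hf hg; rewrite (HnormE (dif_L2 hf hg)) (HnormE hf) (HnormE hg).
have F0 := inner_ge0 a l f; have G0 := inner_ge0 a l g.
have sf := sqrtr_ge0 (inner a l f f); have sg := sqrtr_ge0 (inner a l g g).
have sfg : 0 <= Num.sqrt (inner a l f f) * Num.sqrt (inner a l g g) by exact: mulr_ge0.
rewrite -[leRHS]ger0_norm ?mulr_ge0 ?addr_ge0// -sqrtr_sqr ler_wsqrtr//.
have -> : (2 * (Num.sqrt (inner a l f f) + Num.sqrt (inner a l g g))) ^+ 2 =
  4 * (Num.sqrt (inner a l f f) ^+ 2 + Num.sqrt (inner a l g g) ^+ 2 +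
    2 * (Num.sqrt (inner a l f f) * Num.sqrt (inner a l g g))) by ring.
rewrite !sqr_sqrtr// inner_dif_l ?inner_dif_r//; last exact: dif_L2.
have := inner_ge0 a l (fun j x => 1 * f j x + 1 * g j x).
have h : in_L2 a l (fun j x => 1 * f j x + 1 * g j x).
  by apply/in_L2P => j; move/in_L2P: hf => hf; move/in_L2P: hg => hg; exact: sqi_lin.
rewrite inner_lin_l// !inner_lin_r// [inner a l g f]innerC.
lra.
Qed.

Variables (f1 f2 f3 : R -> R) (u w : R -> lasso_fun R).
Hypotheses (hu : is_solution a l q T f1 f2 f3 u) (hw : is_solution a l q T f1 f2 f3 w).

Lemma solution_unique t : 0 <= t <= T -> inner a l (dif (u t) (w t)) (dif (u t) (w t)) = 0.
Proof.
have [[uL uc] ue] := hu; have [[wL wc] we] := hw.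
have mem s : 0 <= s <= T -> s \in `[0, T] by rewrite in_itv.
apply: (@homogeneous_zero _ a l T q a_gt0 l_gt0 T_gt0 q_L1 (fun t => dif (u t) (w t))).
- split=> [s hs|s hs]; first by apply: dif_L2; [exact: uL|exact: wL].
  apply/cvgrPdist_le => e e0.
  have e4 : 0 < e / 4 by rewrite divr_gt0.
  have /cvgrPdist_le /(_ _ e4) := uc s hs; rewrite near_withinE => -[d1 /= d10 h1].
  have /cvgrPdist_le /(_ _ e4) := wc s hs; rewrite near_withinE => -[d2 /= d20 h2].
  exists (Num.min d1 d2); first by rewrite /= lt_min d10.
  move=> r /=; rewrite lt_min => /andP[r1 r2] hr.
  have := h1 r r1 hr; have := h2 r r2 hr.
  rewrite !sub0r !normrN !ger0_norm ?sqrtr_ge0// => k2 k1.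
  have E : (fun j x => dif (u r) (w r) j x - dif (u s) (w s) j x) =
      dif (dif (u r) (u s)) (dif (w r) (w s)).
    apply/funext => j; apply/funext => x; rewrite /dif; ring.
  rewrite E; apply: le_trans (Hnorm_dif _ _) _.
  + by apply: dif_L2; exact: uL.
  + by apply: dif_L2; exact: wL.
  + by move: k1 k2; rewrite /dif; lra.
- move=> phi dphi d2phi hphi.
  have [m1 [m2 [[A1 A2 A3] B1 B2 B3]]] := ue _ _ _ hphi.
  have [n1 [n2 [[C1 C2 C3] D1 D2 D3]]] := we _ _ _ hphi.
  have [pL _ pA _ _] := hphi.
  have T0 := ltW T_gt0.
  have m0 : (0 : R) \in `[0, T] by rewrite in_itv/= lexx.
  exists (fun t => 1 * m1 t + -1 * n1 t), (fun t => 1 * m2 t + -1 * n2 t); split.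
  + split.
    * apply: AC_eq (AC_lin 1 (-1) A1 C1) => // s hs.
      by rewrite inner_dif_l ?mul1r ?mulN1r//; [exact/uL/mem|exact/wL/mem].
    * exact: AC_lin.
    * by apply/in_Lp2P; apply: sqi_lin; exact/in_Lp2P.
  + by rewrite inner_dif_l ?B1 ?D1 ?subrr//; [exact: uL|exact: wL].
  + by rewrite B2 D2; ring.
  + apply: (@filterS2 _ _ (ae_filter_ringOfSetsType mu) _ _ _ _ B3 D3) => s hb hd hs.
    have hs' : s \in `[0, T] by move: hs; rewrite !in_itv/= => /andP[/ltW -> /ltW ->].
    rewrite inner_dif_l//; [|exact: uL|exact: wL].
    move: (hb hs) (hd hs); move: (inner _ _ _ _) (inner _ _ _ _) => x y; lra.
Qed.

End SolutionUniqueness.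

Section InitialData.
Context {R : realType}.
Local Notation mu := (@lebesgue_measure R).
Variables (a l : R).
Hypotheses (a_gt0 : 0 < a) (l_gt0 : 0 < l).
Implicit Types (phi psi f : lasso_fun R) (x y N : R) (j : 'I_3).

Local Notation len := (edge_length a l).

Lemma L2norm_le_Hnorm f j : L2norm (len j) (f j) <= Hnorm a l f.
Proof.
rewrite /Hnorm -[leLHS]ger0_norm ?L2norm_ge0// -sqrtr_sqr ler_wsqrtr//.
rewrite (bigD1 j)//= lerDl; apply: sumr_ge0 => i _; exact: sqr_ge0.
Qed.

Lemma Hnorm_ge0 f : 0 <= Hnorm a l f. Proof. exact: sqrtr_ge0. Qed.

Lemma calH1norm_ge phi :
  [/\ Hnorm a l phi <= calH1norm a l phi,
      L2norm l (weak_deriv l (phi edge1)) <= calH1norm a l phi &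
      L2norm (2 * a) (weak_deriv (2 * a) (ring_part a phi)) <= calH1norm a l phi].
Proof.
rewrite /calH1norm; set x := L2norm l _; set y := L2norm (2 * a) _; set z := Hnorm a l phi.
have [x2 y2 z2] := And3 (sqr_ge0 x) (sqr_ge0 y) (sqr_ge0 z).
split.
- rewrite -[leLHS]ger0_norm ?Hnorm_ge0// -sqrtr_sqr ler_wsqrtr//; lra.
- rewrite -[leLHS]ger0_norm ?L2norm_ge0// -sqrtr_sqr ler_wsqrtr//; lra.
- rewrite -[leLHS]ger0_norm ?L2norm_ge0// -sqrtr_sqr ler_wsqrtr//; lra.
Qed.

Lemma sqi_neg b (f : R -> R) : sqi b f -> sqi b (fun x => - f x) /\ L2norm b (fun x => - f x) = L2norm b f.
Proof.
move=> sf; have e : (fun x => - f x) = (fun x => -1 * f x) by apply/funext => x; rewrite mulN1r.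
by rewrite e; split; [exact: sqiZ|rewrite L2normZ// normrN normr1 mul1r].
Qed.

(* The two halves of the ring are read from its midpoint: the half e = true
   is edge 2 and the half e = false is edge 3. *)
Definition half_ring phi (e : bool) y := ring_part a phi (if e then a - y else a + y).
Definition half_dring (g : R -> R) (e : bool) y := if e then - g (a - y) else g (a + y).

Lemma half_ringE phi e x : 0 < x < a ->
  half_ring phi e (a - x) = phi (if e then edge2 else edge3) x.
Proof.
move=> /andP[x0 xa]; case: e; rewrite /half_ring /ring_part.
  by rewrite opprB addrCA subrr addr0 xa.
rewrite ifF; first by congr (phi _ _); ring.
by apply/negbTE; rewrite -leNgt; lra.
Qed.

Lemma half_ring_AC phi g e : AC_deriv (2 * a) (ring_part a phi) g -> sqi (2 * a) g ->
  [/\ AC_deriv a (half_ring phi e) (half_dring g e), sqi a (half_dring g e) &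
      L2norm a (half_dring g e) <= L2norm (2 * a) g].
Proof.
move=> hg sg; have a0 := ltW a_gt0; have aa : a <= 2 * a by lra.
case: e.
- have s1 : sqi a g by exact: sqi_sub sg.
  have [s2 n2] := sqi_reflect s1; have [s3 n3] := sqi_neg s2.
  split=> //; first exact: (AC_reflect a0 (lexx a) aa hg).
  rewrite n3 n2; have z0 : 0 + a <= 2 * a by rewrite add0r.
  have [_] := sqi_shift_sub (lexx 0) z0 sg; apply: le_trans.
  by rewrite le_eqVlt; apply/orP; left; apply/eqP; apply: eq_L2norm => x _; rewrite add0r.
- have a2 : a + a <= 2 * a by lra.
  have [s1 n1] := sqi_shift_sub a0 a2 sg.
  by split=> //; exact: (AC_shift a0 a0 a2 hg).
Qed.

(** For the second and third controls, which are differences of traces: they vanish at 0 by rest,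
    and at T because the target is continuous at the interior vertex. *)
Lemma dif_in_H1_0 T (A B A' B' : R -> R) M K : AC_deriv T A A' -> AC_deriv T B B' ->
  sqi T A' /\ L2norm T A' <= M -> sqi T B' /\ L2norm T B' <= K ->
  sqi T A /\ L2norm T A <= M -> sqi T B /\ L2norm T B <= K ->
  A 0 = 0 -> B 0 = 0 -> A T = B T -> 0 <= T ->
  in_H1_0 T (fun t => A t - B t) /\ H1norm T (fun t => A t - B t) <= 2 * (M + K).
Proof.
move=> hA hB [sA' nA'] [sB' nB'] [sA nA] [sB nB] A0 B0 AB T0.
have nrm (f g : R -> R) : sqi T f -> sqi T g -> L2norm T f <= M -> L2norm T g <= K ->
    sqi T (fun t => 1 * f t + -1 * g t) /\ L2norm T (fun t => 1 * f t + -1 * g t) <= M + K.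
  move=> sf sg fM gK; split; first exact: sqi_lin.
  apply: le_trans (L2normD (sqiZ 1 sf) (sqiZ (-1) sg)) _.
  by rewrite !L2normZ// normrN !normr1 !mul1r lerD.
have [s1 n1] := nrm _ _ sA' sB' nA' nB'; have [s0 n0] := nrm _ _ sA sB nA nB.
have e : (fun t => A t - B t) = (fun t => 1 * A t + -1 * B t).
  by apply/funext => t; rewrite mul1r mulN1r.
have hd : AC_deriv T (fun t => 1 * A t + -1 * B t) (fun t => 1 * A' t + -1 * B' t).
  exact: AC_lin.
have hH : in_H1 T (fun t => 1 * A t + -1 * B t).
  by exists (fun t => 1 * A' t + -1 * B' t) => //; apply/in_Lp2P.
split; first by split; [rewrite e|rewrite A0 B0 subrr|rewrite AB subrr].
rewrite e /H1norm; have [_ _ W] := weak_derivP hH; rewrite (W _ hd s1); clear W.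
move: n0 n1; have := @L2norm_ge0 R T (fun t => 1 * A t + -1 * B t).
have := @L2norm_ge0 R T (fun t => 1 * A' t + -1 * B' t).
move: (L2norm T _) (L2norm T _) => x y x0 y0 yM xM.
have MK : 0 <= M + K by exact: le_trans yM.
rewrite -[leRHS]ger0_norm ?mulr_ge0// -sqrtr_sqr ler_wsqrtr//.
have h1 : x ^+ 2 <= (M + K) ^+ 2 by rewrite lerXn2r ?nnegrE.
have h2 : y ^+ 2 <= (M + K) ^+ 2 by rewrite lerXn2r ?nnegrE.
have h3 := sqr_ge0 (M + K).
have -> : (2 * (M + K)) ^+ 2 = 4 * (M + K) ^+ 2 by ring.
lra.
Qed.

End InitialData.

Lemma weighted_sum_le5 (R : realType) (x y z : R) : 0 <= x -> 0 <= y -> 0 <= z ->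
  x + y + z + 2 * (y + x) + 2 * (z + x) <= 5 * (x + y + z).
Proof. by move=> x0 y0 z0; lra. Qed.

Theorem theorem2 (R : realType) (a l T : R) (q : lasso_fun R)
  (a_gt0 : 0 < a) (l_gt0 : 0 < l)
  (q_L1 : forall j : 'I_3, in_Lp 1%E (edge_length a l j) (q j))
  (T_gt : 2 * Num.max a l < T) :
  exists C : R, forall phi1 phi2 : lasso_fun R,
    in_calH1_0 a l phi1 -> in_L2 a l phi2 ->
    exists f1 f2 f3 : R -> R,
      [/\ [/\ in_Lp 2%:E T f1, in_H1_0 T f2 & in_H1_0 T f3],
          exists u : R -> lasso_fun R, is_solution a l q T f1 f2 f3 u,
          forall u : R -> lasso_fun R, is_solution a l q T f1 f2 f3 u ->
            H_eq a l (u T) phi1 /\ final_velocity a l q T u phi2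
        & L2norm T f1 + H1norm T f2 + H1norm T f3
            <= C * (calH1norm a l phi1 + Hnorm a l phi2)].
Proof.
have aT : 2 * a < T by apply: le_lt_trans T_gt; rewrite ler_wpM2l// le_max lexx.
have lT : 2 * l < T by apply: le_lt_trans T_gt; rewrite ler_wpM2l// le_max lexx orbT.
have T0 : 0 < T by apply: lt_trans aT; rewrite mulr_gt0.
have T0' := ltW T0.
pose pot := lasso_pot a l q; pose len := edge_length a l.
have ppot j : potential (pot j) (len j) := lasso_potP a_gt0 l_gt0 q_L1 j.
have len0 j : 0 < len j := len_gt0 a_gt0 l_gt0 j.
have [C1 C10 hC1] := control_single (ppot edge1) lT.
have ppot2 (e : bool) : potential (pot (if e then edge2 else edge3)) a.
  by case: e; [exact: (ppot edge2)|exact: (ppot edge3)].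
have [C2 C20 hC2] := control_pair ppot2 aT.
have [D1 D10 hD1] := edge_traces (ppot edge1) T0'.
have [D2 D20 hD2] := edge_traces (ppot edge2) T0'.
have [D3 D30 hD3] := edge_traces (ppot edge3) T0'.
(* N = K X must dominate the norms of the targets (the term 1) and their values at x = l and at the
   midpoint of the ring, which [sobolev] bounds with constants l^-1 + 1 and a^-1 + 1 times a sum of
   two norms. *)
pose K := 1 + 2 * (l^-1 + 1) + 2 * (a^-1 + 1).
pose E := 2 * (D1 * C1 + D2 * C2 + D3 * C2).
(* Below, M1 + M2 + M3 = E N. The factor 5 is due to M1, which occurs once in the bound for the
   first control and twice in each of the other two. *)
exists (5 * E * K) => phi1 phi2 [[phi1_L2 phi1_H1 ring_H1] v12 v23] phi2_L2.
pose X := calH1norm a l phi1 + Hnorm a l phi2; pose N := K * X.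
have [nH n1 nr] := calH1norm_ge a l phi1.
have H20 := Hnorm_ge0 a l phi2; have H10 := Hnorm_ge0 a l phi1.
have X0 : 0 <= X by rewrite addr_ge0// (le_trans H10).
have X1 : calH1norm a l phi1 <= X by rewrite lerDl.
have X2 : Hnorm a l phi2 <= X by rewrite lerDr// (le_trans H10).
have il : 0 < l^-1 by rewrite invr_gt0.
have ia : 0 < a^-1 by rewrite invr_gt0.
have K1 : 1 <= K by rewrite /K; lra.
have XN : X <= N by rewrite ler_peMl.
have KX c x y : 0 < c -> 2 * (c + 1) <= K -> 0 <= x -> x <= X -> y <= X -> (c + 1) * (x + y) <= N.
  move=> c0 cK x0 xX yX; apply: (@le_trans _ _ ((c + 1) * (X + X))).
    by rewrite ler_wpM2l// ?lerD// addr_ge0// ltW.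
  have -> : (c + 1) * (X + X) = (2 * (c + 1)) * X by ring.
  by rewrite ler_wpM2r.
have [w1 s1 _] := weak_derivP phi1_H1; have [wr sr _] := weak_derivP ring_H1.
set g1 := weak_deriv l (phi1 edge1) in w1 s1 n1.
set gr := weak_deriv (2 * a) (ring_part a phi1) in wr sr nr.
have L2_1 := (in_L2P a l phi1).1 phi1_L2; have L2_2 := (in_L2P a l phi2).1 phi2_L2.
have psi_ok j : sqi (len j) (fun y => phi2 j (len j - y)) /\ L2norm (len j) (fun y => phi2 j (len j - y)) <= N.
  have [b1 ->] := sqi_reflect (L2_2 j); split=> //.
  by apply: le_trans XN; apply: le_trans X2; exact: L2norm_le_Hnorm.
have [d1 [d1a d1b d1c d1d]] : exists d : R -> R,
  [/\ density l (T + l) d, L2norm (T + l) d <= C1 * N,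
   forall y, 0 <= y <= l -> edge_v (pot edge1) l d d y T = phi1 edge1 (l - y) &
   forall y, 0 < y < l -> edge_vt (pot edge1) l d d y T = phi2 edge1 (l - y)].
  have ll : l <= l by [].
  have A := AC_reflect (ltW l_gt0) ll ll w1.
  have [b1 b2] := sqi_reflect s1; have [b3 b4] := sqi_neg b1.
  have nn : L2norm l (fun y => - g1 (l - y)) <= X by rewrite b4 b2 (le_trans n1).
  apply: (hC1 (fun y => phi1 edge1 (l - y)) (fun y => - g1 (l - y)) (fun y => phi2 edge1 (l - y)) N A).
  - by split=> //; exact: le_trans XN.
  - exact: (psi_ok edge1).
  - have z0 : 0 <= (0 : R) <= l by rewrite lexx ltW.
    apply: le_trans (sobolev l_gt0 A b3 z0) _.
    apply: KX => //; [by rewrite /K; lra|exact: L2norm_ge0|].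
    rewrite (sqi_reflect (L2_1 edge1)).2; apply: le_trans X1; apply: le_trans nH.
    exact: (@L2norm_le_Hnorm _ a l phi1 edge1).
pose dr e := half_dring a gr e.
have hr e := half_ring_AC a_gt0 e wr sr.
have [d2 hd2] : exists d : bool -> R -> R, forall e,
  [/\ density a (T + a) (d e), L2norm (T + a) (d e) <= C2 * N,
   forall y, 0 <= y <= a -> edge_v (pot (if e then edge2 else edge3)) a (d e) (d (~~ e)) y T = half_ring a phi1 e y &
   forall y, 0 < y < a -> edge_vt (pot (if e then edge2 else edge3)) a (d e) (d (~~ e)) y T =
     phi2 (if e then edge2 else edge3) (a - y)].
  apply: (hC2 (half_ring a phi1) dr (fun e y => phi2 (if e then edge2 else edge3) (a - y)) N).
  - by move=> e; have [] := hr e.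
  - move=> e; have [_ b1 b2] := hr e; split=> //.
    by apply: le_trans XN; apply: le_trans X1; exact: le_trans nr.
  - by case; [exact: (psi_ok edge2)|exact: (psi_ok edge3)].
  - by rewrite /half_ring subr0 addr0.
  - have z0 : 0 <= (0 : R) <= a by rewrite lexx ltW.
    have [A b1 b2] := hr true.
    apply: le_trans (sobolev a_gt0 A b1 z0) _.
    apply: KX => //; [by rewrite /K; lra|exact: L2norm_ge0| |].
      have -> : L2norm a (half_ring a phi1 true) = L2norm a (phi1 edge2).
        rewrite -(sqi_reflect (L2_1 edge2)).2; apply: eq_L2norm => y /andP[y0 ya].
        have hy : 0 < a - y < a by rewrite subr_gt0 ya gtrBl y0.
        by have := half_ringE phi1 true hy; rewrite opprB addrCA subrr addr0.
      apply: le_trans X1; apply: le_trans nH; exact: (@L2norm_le_Hnorm _ a l phi1 edge2).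
    by apply: le_trans X1; apply: le_trans nr.
pose p (j : 'I_3) := if j == edge1 then d1 else if j == edge2 then d2 true else d2 false.
pose r (j : 'I_3) := if j == edge1 then d1 else if j == edge2 then d2 false else d2 true.
have [dt1 dt2 dt3 dt4] := hd2 true; have [df1 df2 df3 df4] := hd2 false.
have hp : forall j, density (len j) (T + len j) (p j) by exact: edge_ind.
have hq : forall j, density (len j) (T + len j) (r j) by exact: edge_ind.
pose u := lasso_u a l q p r.
pose f1 := ctrl1 a l q p r; pose f2 := ctrl2 a l q p r; pose f3 := ctrl3 a l q p r.
have uT j x : 0 < x < len j -> u T j x = phi1 j x.
  move: j; apply: edge_ind => hx; have /andP[x0 xL] := hx; rewrite /u /lasso_u.
  - have hy : 0 <= l - x <= l by rewrite subr_ge0 (ltW xL) gerBl ltW.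
    by have := d1c _ hy; rewrite opprB addrCA subrr addr0.
  - have hy : 0 <= a - x <= a by rewrite subr_ge0 (ltW xL) gerBl ltW.
    by have := dt3 _ hy; rewrite half_ringE.
  - have hy : 0 <= a - x <= a by rewrite subr_ge0 (ltW xL) gerBl ltW.
    by have := df3 _ hy; rewrite half_ringE.
have uvt : forall j y, 0 < y < len j -> edge_vt (pot j) (len j) (p j) (r j) y T = phi2 j (len j - y).
  by apply: edge_ind => y hy; [exact: d1d|exact: dt4|exact: df4].
have dyn := lasso_dynamics a_gt0 l_gt0 T0 q_L1 hp hq erefl erefl erefl phi2_L2 uvt.
have solu : is_solution a l q T f1 f2 f3 u.
  split; first exact: lasso_u_continuous a_gt0 l_gt0 T0 q_L1 _ _ hp hq.
  move=> phi dphi d2phi hphi; have [m1 [m2 [k1 k2 k3 k4 k5]]] := dyn _ _ _ hphi.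
  exists m1, m2; split=> //; apply: aeW => t; rewrite in_itv/=; exact: k4.
have [[t11 t12] [t21 t22] [t31 t32] t4 t5] := hD1 _ _ (hp edge1) (hq edge1).
have [[e11 e12] [e21 e22] [e31 e32] e4 e5] := hD2 _ _ (hp edge2) (hq edge2).
have [[c11 c12] [c21 c22] [c31 c32] c4 c5] := hD3 _ _ (hp edge3) (hq edge3).
pose M1 := D1 * (2 * (C1 * N)); pose M2 := D2 * (2 * (C2 * N)); pose M3 := D3 * (2 * (C2 * N)).
have tw (x : R) : 2 * x = x + x by ring.
have B1 : D1 * (L2norm (T + len edge1) (p edge1) + L2norm (T + len edge1) (r edge1)) <= M1.
  by rewrite /M1 ler_wpM2l// tw; exact: (lerD d1b d1b).
have B2 : D2 * (L2norm (T + len edge2) (p edge2) + L2norm (T + len edge2) (r edge2)) <= M2.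
  by rewrite /M2 ler_wpM2l// tw; exact: (lerD dt2 df2).
have B3 : D3 * (L2norm (T + len edge3) (p edge3) + L2norm (T + len edge3) (r edge3)) <= M3.
  by rewrite /M3 ler_wpM2l// tw; exact: (lerD df2 dt2).
have ll : 0 <= l <= l by rewrite lexx ltW.
have aa : 0 <= a <= a by rewrite lexx ltW.
have v1T : lasso_v a l q p r edge1 l T = phi1 edge1 0.
  by have := d1c l ll; rewrite subrr.
have v2T : lasso_v a l q p r edge2 a T = ring_part a phi1 0.
  by have := dt3 a aa; rewrite /half_ring subrr.
have v3T : lasso_v a l q p r edge3 a T = ring_part a phi1 (2 * a).
  by have := df3 a aa; rewrite /half_ring (_ : a + a = 2 * a); last ring.
have [H2 N2] : in_H1_0 T f2 /\ H1norm T f2 <= 2 * (M2 + M1).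
  apply: (dif_in_H1_0 e4 t4 (conj e11 (le_trans e12 B2)) (conj t11 (le_trans t12 B1))
    (conj e31 (le_trans e32 B2)) (conj t31 (le_trans t32 B1))) => //.
  - exact: (e5 a aa).
  - exact: (t5 l ll).
  - by apply: etrans v2T _; rewrite -v12; exact: esym v1T.
have [H3 N3] : in_H1_0 T f3 /\ H1norm T f3 <= 2 * (M3 + M1).
  apply: (dif_in_H1_0 c4 t4 (conj c11 (le_trans c12 B3)) (conj t11 (le_trans t12 B1))
    (conj c31 (le_trans c32 B3)) (conj t31 (le_trans t32 B1))) => //.
  - exact: (c5 a aa).
  - exact: (t5 l ll).
  - by apply: etrans v3T _; rewrite -v23 -v12; exact: esym v1T.
have s12 := sqiD t21 e21; have [s1' n1'] := sqi_neg (sqiD s12 c21).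
have N1 : L2norm T f1 <= M1 + M2 + M3.
  rewrite [L2norm T f1]n1'; apply: le_trans (L2normD s12 c21) _.
  apply: lerD; last exact: le_trans c22 B3.
  by apply: le_trans (L2normD t21 e21) (lerD _ _); [exact: le_trans t22 B1|exact: le_trans e22 B2].
exists f1, f2, f3; split.
- by split=> //; apply/in_Lp2P; exact: s1'.
- by exists u.
(* Any solution w agrees with u in H at every time, so its final state and its pairings with D are
   those of u. *)
- move=> w solw.
  have z t : 0 <= t <= T -> inner a l (dif (w t) (u t)) (dif (w t) (u t)) = 0.
    exact: (solution_unique a_gt0 l_gt0 T0 q_L1 solw solu).
  have wL t : 0 <= t <= T -> in_L2 a l (w t).
    by move=> ht; have [[h _] _] := solw; apply: h; rewrite in_itv.
  have uL t : in_L2 a l (u t) := lasso_u_L2 a_gt0 l_gt0 T0 q_L1 hp hq t.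
  have TT : 0 <= T <= T by rewrite lexx ltW.
  split.
  + move=> j; have dL := dif_L2 (wL _ TT) (uL T).
    have := ae_of_sqr_zero ((in_L2P a l _).1 dL j) (inner_zero dL (z _ TT) j).
    apply: (@filterS _ _ (ae_filter_ringOfSetsType _)) => x hx xI.
    have := hx xI; rewrite /dif uT; last by move: xI; rewrite in_itv.
    by move/eqP; rewrite subr_eq0 => /eqP.
  + move=> phi dphi d2phi hphi; have [m1 [m2 [[k1 k1' k1''] _ _ _ k5]]] := dyn _ _ _ hphi.
    exists m1, m2; split=> //; split=> //; apply: AC_eq k1 => // t ht.
    have [phiL _ _ _ _] := hphi.
    have := inner_null (dif_L2 (wL t ht) (uL t)) phiL (z t ht).
    rewrite inner_dif_l//; last exact: wL.
    by move/eqP; rewrite subr_eq0 => /eqP.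
- apply: le_trans (lerD (lerD N1 N2) N3) _.
  have -> : 5 * E * K * (calH1norm a l phi1 + Hnorm a l phi2) = 5 * (M1 + M2 + M3).
    by rewrite /E /M1 /M2 /M3 /N /X; ring.
  have N0 : 0 <= N by exact: le_trans XN.
  have pos (x y : R) : 0 <= x -> 0 <= y -> 0 <= x * (2 * (y * N)).
    by move=> x0 y0; apply: mulr_ge0 => //; apply: mulr_ge0 => //; exact: mulr_ge0.
  by apply: weighted_sum_le5; exact: pos.
Qed.
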